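(* Let $q\geq 1$ be an integer, let $f:\mathbb{Z}_{\geq 0}\to\mathbb{C}$ be a periodic function of period $q$ which is not identically zero, and let $0<\alpha\leq 1$ be a real number. For $s=\sigma+it$ with $\sigma>1$ put \[ F(s,f,\alpha)=\sum_{n=0}^{\infty}\frac{f(n)}{(n+\alpha)^{s}}. \] Suppose that either $\alpha\notin\{1,\tfrac12\}$, or $\alpha\in\{1,\tfrac12\}$ and $F(s,f,\alpha)$ is not of the form $\alpha^{-s}P(s)L(s,\chi)$, where $P(s)$ is a Dirichlet polynomial and $L(s,\chi)$ is the Dirichlet $L$-function associated to a Dirichlet character $\chi$. Then $F(s,f,\alpha)$ has infinitely many zeros in the half-plane $\sigma>1$.
   Context: The series defining $F(s,f,\alpha)$ converges absolutely for $\sigma>1$. A Dirichlet polynomial is a finite sum $P(s)=\sum_{n\in\mathcal{N}}a(n)n^{-s}$, where $\mathcal{N}$ is a non-empty finite set of positive integers and $a(n)\neq 0$ for $n\in\mathcal{N}$. For a Dirichlet character $\chi$ modulo $k$, $L(s,\chi)=\sum_{m\geq1}\chi(m)m^{-s}$. *)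

(* Defs.v *)
From HB Require Import structures.
From mathcomp Require Import all_boot all_order all_algebra finmap complex.
From mathcomp Require Import all_classical all_reals all_analysis.

Set Implicit Arguments.
Unset Strict Implicit.
Unset Printing Implicit Defensive.

Import Order.TTheory GRing.Theory Num.Theory numFieldNormedType.Exports.
Local Open Scope classical_set_scope.
Local Open Scope ring_scope.
Local Open Scope complex_scope.

Section Defs.
Variable R : realType.
Implicit Types (f chi : nat -> R[i]) (s z : R[i]) (alpha x : R).

Definition cexp z : R[i] :=
  (expR (complex.Re z))%:C * (cos (complex.Im z) +i* sin (complex.Im z)).

(* [x ^ s] for a positive real base, with the real determination of [ln x];
   meaningless for [x <= 0]. *)
Definition cpow x s : R[i] := cexp (s * (ln x)%:C).

(* The sum over [n >= 0] of [u n]. The alias [R[i]^o] is what carries the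
   topology given by the complex modulus. *)
Definition csum (u : nat -> R[i]) : R[i] :=
  limn (series (u : nat -> R[i]^o)).

Definition periodic_hurwitz f alpha s : R[i] :=
  csum (fun n => f n / cpow (n%:R + alpha) s).

(* [chi] is given by its values on the natural numbers, which determine it
   since it is periodic modulo [k]. *)
Definition dirichlet_character (k : nat) chi : Prop :=
  [/\ (0 < k)%N,
      chi 1%N = 1,
      forall m n : nat, chi (m * n)%N = chi m * chi n,
      forall n : nat, chi (n + k)%N = chi n
    & forall n : nat, (chi n != 0) = coprime n k].

(* The sum starts at [m = 1]. *)
Definition dirichlet_L chi s : R[i] :=
  csum (fun m => chi m.+1 * cpow m.+1%:R (- s)).

Definition dirichlet_polynomial (P : R[i] -> R[i]) : Prop :=
  exists (N : {fset nat}) (a : nat -> R[i]),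
    [/\ N != fset0,
        forall n, n \in N -> (0 < n)%N,
        forall n, n \in N -> a n != 0
      & forall s, P s = \sum_(n <- N) a n * cpow n%:R (- s)].

Definition of_PL_form f alpha : Prop :=
  exists (P : R[i] -> R[i]) (k : nat) (chi : nat -> R[i]),
    [/\ dirichlet_polynomial P,
        dirichlet_character k chi
      & forall s, 1 < complex.Re s ->
          periodic_hurwitz f alpha s =
          cpow alpha (- s) * P s * dirichlet_L chi s].

End Defs.

(* Main.v *)
(** Write [mu m = m + alpha] and let [n0] be the first index with [f n0 <> 0].
    Twist the terms of [F] by [prod_j z_j ^ (v_j m)], where [|z_j| <= 1], the
    exponents [v_j] are additive along multiplicative relations between the
    numbers [mu m], and [v_j n0 = 0]. A zero of a twisted series in [Re s > 1]
    yields zeros of [F] with arbitrarily large imaginary part: the zero can be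
    moved until all [|z_j| = 1], then Kronecker's theorem approximates the twist
    by vertical translations, and Hurwitz's theorem applies.

    If [alpha] is transcendental there are no relations and every term can be
    twisted separately. If [alpha] is algebraic irrational with minimal
    polynomial [P], then for a positive proportion of the [n] the number [P (-n)]
    has a prime factor larger than a constant times [n ln n], and the valuations
    at these primes are sufficiently independent exponents.

    If [alpha = a / b], then [F] is [b ^ s] times a Dirichlet series whose
    coefficients [g] are periodic modulo [k = b q]. Let [c] be prime to [k] with
    [sum 1/p] divergent over the primes [p = c] modulo [k]. When [g (c n)] is not
    a multiple of [g n], twisting these primes produces an exponential sum with
    at least two frequencies, hence a zero. Otherwise the remaining primes are so
    sparse that [g (c n) = chi c * g n] for every [c] prime to [k]. Taking [c = -1]
    gives [b %| 2 a], so that [alpha] is [1] or [1/2], and in these two cases [F] is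
    a Dirichlet polynomial times the L-function of the primitive character
    inducing [chi]. *)
Require Import Defs.
From HB Require Import structures.
From mathcomp Require Import all_boot all_order all_algebra finmap complex.
From mathcomp Require Import all_classical all_reals all_analysis.
From mathcomp Require Import ring lra zify.
From mathcomp Require cyclic.
Import Order.TTheory GRing.Theory Num.Theory numFieldNormedType.Exports.
Set Implicit Arguments.
Unset Strict Implicit.
Unset Printing Implicit Defensive.
Local Open Scope classical_set_scope.
Local Open Scope ring_scope.
Local Open Scope complex_scope.

(* [lra] and [nra] reify the whole context, which is slow in long proofs. Only the
   order relations and the equations are left to them here, and the section
   variables recognized by [keep], which they do not allow to be cleared. *)
Ltac slim keep := repeat match goal with
  | x := _ |- _ => tryif keep x then fail else clearbody x
  | H : ?T |- _ => lazymatch T with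
      | is_true (@Order.le _ _ _ _) => fail
      | is_true (@Order.lt _ _ _ _) => fail
      | _ /\ _ => fail
      | @eq nat _ _ => tryif keep H then fail else clear H
      | @eq (complex _) _ _ => tryif keep H then fail else clear H
      | @eq _ _ _ => fail
      | _ => lazymatch type of T with Prop => tryif keep H then fail else clear H end
      end
  end.
Ltac lra_keeping keep := first [solve [slim keep; lra] | lra].
Ltac nra_keeping keep := first [solve [slim keep; nra] | nra].
Ltac slra := lra_keeping ltac:(fun _ => fail).
Ltac snra := nra_keeping ltac:(fun _ => fail).

(** The exponents vanish at [n0] so that no twist alters the first nonzero term: the zeros of all
    twists then lie to the left of one vertical line, and compactness provides extremal ones.
    Additivity makes a twist with all [|z_j| = 1] extend to a character of the group generated by
    the [mu m], the kind of twist that vertical translations approximate. In the irrational cases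
    the aligned terms must outweigh all others at a real part [sg] close to [1]. Terms of lower
    degree are small in mean square. Those of higher degree lie in progressions modulo large primes
    [p], each of mass about [1 / (p * (sg - 1))], and the factor [ln n] in the size of [p]
    compensates for [1 / (sg - 1)]. Such primes exist because the smaller ones cannot account for
    all of [ln |Q x|]: bounding the number of roots modulo [p] by the degree would just fail to show
    it, and counting lattice points in a box improves the leading constant from [1] to [3/4]. In the
    rational case one variable [xi] twists all chosen primes of a class; the finite Euler products
    are then close to exponentials of [xi], one frequency for each eigenvalue of the dilation by
    [c]. *)

Section ComplexModulus.
Variable R : realType.
Implicit Types (z w : R[i]) (x y : R).

(** The norm of [R[i]] takes its values in [R[i]]; this real-valued copy lets moduli be compared,
    summed and bounded in [R]. *)
Definition cabs z : R := complex.Re `|z|.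

Lemma cabsE z : `|z| = (cabs z)%:C.
Proof. by rewrite /cabs normc_def. Qed.

Lemma cabs_ge0 z : 0 <= cabs z.
Proof. by rewrite -ler0c -cabsE. Qed.

Lemma cabs0 : cabs 0 = 0.
Proof. by rewrite /cabs normr0. Qed.

Lemma cabs1 : cabs 1 = 1.
Proof. by rewrite /cabs normr1. Qed.

Lemma cabsN z : cabs (- z) = cabs z.
Proof. by rewrite /cabs normrN. Qed.

Lemma cabsM z w : cabs (z * w) = cabs z * cabs w.
Proof. by apply: complexI; rewrite rmorphM /= -!cabsE normrM. Qed.

Lemma cabsX z n : cabs (z ^+ n) = cabs z ^+ n.
Proof. by elim: n => [|n IH]; rewrite ?expr0 ?cabs1// !exprS cabsM IH. Qed.

Lemma cabsV z : cabs z^-1 = (cabs z)^-1.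
Proof. by apply: complexI; rewrite fmorphV /= -!cabsE normfV. Qed.

Lemma cabsR x : cabs x%:C = `|x|.
Proof. by rewrite /cabs normc_def /= expr0n addr0 sqrtr_sqr. Qed.

Lemma cabs_nat n : cabs (n%:R : R[i]) = n%:R.
Proof. by rewrite -(rmorph_nat (real_complex R)) cabsR ger0_norm. Qed.

Lemma cabsJ z : cabs z^* = cabs z.
Proof. by rewrite /cabs normcJ. Qed.

Lemma cabs_eq0 z : (cabs z == 0) = (z == 0).
Proof.
by rewrite -(inj_eq (@complexI R)) -cabsE normr_eq0.
Qed.

Lemma cabs_gt0 z : (0 < cabs z) = (z != 0).
Proof. by rewrite lt_def cabs_ge0 andbT cabs_eq0. Qed.

Lemma cabsD z w : cabs (z + w) <= cabs z + cabs w.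
Proof. by rewrite -lecR rmorphD /= -!cabsE ler_normD. Qed.

Lemma cabsB z w : cabs (z - w) = cabs (w - z).
Proof. by rewrite -cabsN opprB. Qed.

Lemma cabs_subl z w : cabs z - cabs w <= cabs (z - w).
Proof. by rewrite lerBlDr; apply: le_trans (cabsD _ _); rewrite subrK. Qed.

Lemma cabs_dist z w u : cabs (z - w) <= cabs (z - u) + cabs (u - w).
Proof. by apply: le_trans (cabsD _ _); rewrite addrA subrK. Qed.

Lemma cabs_sum (I : Type) (r : seq I) (P : pred I) (F : I -> R[i]) :
  cabs (\sum_(i <- r | P i) F i) <= \sum_(i <- r | P i) cabs (F i).
Proof.
elim/big_rec2: _ => [|i y z _ yz]; first by rewrite cabs0.
by apply: le_trans (cabsD _ _) _; rewrite lerD2l.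
Qed.

Lemma cabs_prod (I : Type) (r : seq I) (P : pred I) (F : I -> R[i]) :
  cabs (\prod_(i <- r | P i) F i) = \prod_(i <- r | P i) cabs (F i).
Proof.
by elim/big_rec2: _ => [|i y z _ <-]; rewrite ?cabs1 ?cabsM.
Qed.

Lemma sqr_cabs z : cabs z ^+ 2 = complex.Re z ^+ 2 + complex.Im z ^+ 2.
Proof.
by rewrite /cabs normc_def /= sqr_sqrtr// addr_ge0// sqr_ge0.
Qed.

Lemma sqr_cabsJ z : (cabs z ^+ 2)%:C = z * z^*.
Proof. by rewrite rmorphXn /= -cabsE sqr_normc. Qed.

Lemma Re_le_cabs z : complex.Re z <= cabs z.
Proof.
have [|/ltW h] := lerP (complex.Re z) 0; first by move/le_trans; apply; exact: cabs_ge0.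
rewrite -(ler_pXn2r (n := 2))// ?nnegrE ?cabs_ge0//.
by rewrite sqr_cabs lerDl sqr_ge0.
Qed.

Lemma absRe_le_cabs z : `|complex.Re z| <= cabs z.
Proof.
by rewrite ler_norml Re_le_cabs andbT lerNl; have := Re_le_cabs (- z); case: z => a b /=; rewrite cabsN.
Qed.

Lemma absIm_le_cabs z : `|complex.Im z| <= cabs z.
Proof.
have := absRe_le_cabs (z * 'i%C); rewrite cabsM.
have -> : cabs ('i%C : R[i]) = 1.
  by rewrite /cabs normc_def /= expr0n expr1n add0r sqrtr1.
by rewrite mulr1; case: z => a b /=; rewrite mulr0 mulr1 sub0r normrN.
Qed.

Lemma cabs_le_ReIm z : cabs z <= `|complex.Re z| + `|complex.Im z|.
Proof.
rewrite -(ler_pXn2r (n := 2))// ?nnegrE ?cabs_ge0 ?addr_ge0//.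
rewrite sqr_cabs sqrrD !real_normK ?num_real//.
by rewrite lerD2r lerDl mulrn_wge0// mulr_ge0.
Qed.

Lemma ReD z w : complex.Re (z + w) = complex.Re z + complex.Re w.
Proof. by case: z; case: w. Qed.

Lemma ImD z w : complex.Im (z + w) = complex.Im z + complex.Im w.
Proof. by case: z; case: w. Qed.

Lemma ReN z : complex.Re (- z) = - complex.Re z.
Proof. by case: z. Qed.

Lemma ImN z : complex.Im (- z) = - complex.Im z.
Proof. by case: z. Qed.

Lemma ReB z w : complex.Re (z - w) = complex.Re z - complex.Re w.
Proof. by rewrite ReD ReN. Qed.

Lemma ImB z w : complex.Im (z - w) = complex.Im z - complex.Im w.
Proof. by rewrite ImD ImN. Qed.

Lemma Re_sum (I : Type) (r : seq I) (P : pred I) (F : I -> R[i]) :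
  complex.Re (\sum_(i <- r | P i) F i) = \sum_(i <- r | P i) complex.Re (F i).
Proof. by elim/big_rec2: _ => // i y z _ <-; rewrite ReD. Qed.

Lemma Im_sum (I : Type) (r : seq I) (P : pred I) (F : I -> R[i]) :
  complex.Im (\sum_(i <- r | P i) F i) = \sum_(i <- r | P i) complex.Im (F i).
Proof. by elim/big_rec2: _ => // i y z _ <-; rewrite ImD. Qed.

Lemma Re_realM x z : complex.Re (x%:C * z) = x * complex.Re z.
Proof. by case: z => a b /=; rewrite mul0r subr0. Qed.

Lemma Im_realM x z : complex.Im (x%:C * z) = x * complex.Im z.
Proof. by case: z => a b /=; rewrite mul0r addr0. Qed.

Lemma eq_of_cabs z w : (forall e, 0 < e -> cabs (z - w) <= e) -> z = w.
Proof.
move=> h; apply/eqP; rewrite -subr_eq0 -cabs_eq0 eq_le cabs_ge0 andbT.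
by apply/ler_addgt0Pr => e /h; rewrite add0r.
Qed.

End ComplexModulus.

Section ComplexExp.
Variable R : realType.
Implicit Types (z w s : R[i]) (x y t : R).

Lemma cexp0 : cexp (0 : R[i]) = 1.
Proof. by rewrite /cexp /= expR0 cos0 sin0 mul1r. Qed.

Lemma cexpD z w : cexp (z + w) = cexp z * cexp w.
Proof.
case: z w => a b [c d]; rewrite /cexp /= expRD cosD sinD rmorphM /=.
rewrite mulrACA; congr (_ * _).
by apply/eqP; rewrite eq_complex /=; apply/andP; split; apply/eqP; ring.
Qed.

Lemma cexpN z : cexp (- z) = (cexp z)^-1.
Proof.
have h : cexp (- z) * cexp z = 1 by rewrite -cexpD addNr cexp0.
have nz : cexp z != 0.
  by apply: contra_eq_neq h => ->; rewrite mulr0 eq_sym oner_eq0.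
by apply: (mulIf nz); rewrite h mulVf.
Qed.

Lemma cabs_cexp z : cabs (cexp z) = expR (complex.Re z).
Proof.
rewrite /cexp cabsM cabsR ger0_norm ?expR_ge0//.
suff -> : cabs (cos (complex.Im z) +i* sin (complex.Im z)) = 1 by rewrite mulr1.
by rewrite /cabs normc_def /= cos2Dsin2 sqrtr1.
Qed.

Lemma cexp_neq0 z : cexp z != 0.
Proof. by rewrite -cabs_gt0 cabs_cexp expR_gt0. Qed.

Lemma cpowD x z w : cpow x (z + w) = cpow x z * cpow x w.
Proof. by rewrite /cpow mulrDl cexpD. Qed.

Lemma cpowN x z : cpow x (- z) = (cpow x z)^-1.
Proof. by rewrite /cpow mulNr cexpN. Qed.

Lemma cpow_neq0 x z : cpow x z != 0.
Proof. exact: cexp_neq0. Qed.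

Lemma cpowM x y z : 0 < x -> 0 < y -> cpow (x * y) z = cpow x z * cpow y z.
Proof. by move=> x0 y0; rewrite /cpow lnM ?posrE// rmorphD mulrDr cexpD. Qed.

Lemma cpow1 z : cpow 1 z = 1.
Proof. by rewrite /cpow ln1 mulr0 cexp0. Qed.

Lemma cabs_cpow x z : cabs (cpow x z) = expR (complex.Re z * ln x).
Proof. by rewrite /cpow cabs_cexp mulrC Re_realM mulrC. Qed.

Lemma cabs_cpow_powR x z : 0 < x -> cabs (cpow x z) = x `^ complex.Re z.
Proof. by move=> x0; rewrite cabs_cpow /powR gt_eqF. Qed.

Definition cis t : R[i] := cexp (0 +i* t).

Lemma cabs_cis t : cabs (cis t) = 1.
Proof. by rewrite cabs_cexp /= expR0. Qed.

Lemma cisD x y : cis (x + y) = cis x * cis y.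
Proof. by rewrite /cis -cexpD; congr cexp; apply/eqP; rewrite eq_complex /= addr0 !eqxx. Qed.

Lemma cis0 : cis 0 = 1.
Proof. exact: cexp0. Qed.

Lemma cisJ t : (cis t)^* = cis (- t).
Proof.
by rewrite /cis /cexp /= expR0 cosN sinN; apply/eqP; rewrite eq_complex /= !(mul1r, mul0r, subr0, addr0) !eqxx.
Qed.

Lemma cis_neq0 t : cis t != 0.
Proof. exact: cexp_neq0. Qed.

Lemma cisN t : cis (- t) = (cis t)^-1.
Proof. by rewrite /cis -cexpN; congr cexp; apply/eqP; rewrite eq_complex /= oppr0 !eqxx. Qed.

Lemma cisMn t n : cis (t *+ n) = cis t ^+ n.
Proof. by elim: n => [|n IH]; rewrite ?cis0// mulrS cisD IH exprS. Qed.

Lemma cis_sum (I : Type) (r : seq I) (P : pred I) (F : I -> R) :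
  cis (\sum_(i <- r | P i) F i) = \prod_(i <- r | P i) cis (F i).
Proof. by elim/big_rec2: _ => [|i y z _ <-]; rewrite ?cis0 ?cisD. Qed.

Lemma cis_eq1 t : cis t = 1 -> `|t| <= 1 -> t = 0.
Proof.
rewrite /cis /cexp /= expR0 mul1r => -[c1 s0] t1.
have cs : `|t| < pi :> R by apply: le_lt_trans t1 _; have := pi_ge2 R; lra.
have : cos `|t| = cos 0 by rewrite cos0 cos_norm.
move/(cos_inj); rewrite !in_itv /= normr_ge0 lexx pi_ge0 ltW//.
by move=> /(_ isT isT)/eqP; rewrite normr_eq0 => /eqP.
Qed.

Lemma cpow_cis x t : cpow x (0 +i* t) = cis (t * ln x).
Proof.
by rewrite /cpow /cis; congr cexp; apply/eqP; rewrite eq_complex /= !mulr0 subr0 mul0r add0r mulrC !eqxx.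
Qed.

End ComplexExp.

(** * Absolutely convergent complex series and sums of powers *)

Section BoundedSums.
Variable R : realType.
Implicit Types (b : nat -> R) (B e l : R).

Lemma sum_nat_shift (V : nmodType) (F : nat -> V) m n :
  \sum_(i < m + n) F i = \sum_(i < m) F i + \sum_(i < n) F (m + i)%N.
Proof. by rewrite big_split_ord. Qed.

Lemma bounded_sum_tail b B : (forall i, 0 <= b i) ->
  (forall n, \sum_(i < n) b i <= B) ->
  forall e, 0 < e -> exists N, forall m n, (N <= m)%N ->
    \sum_(i < n) b (m + i)%N <= e.
Proof.
move=> b0 bB e e0.
pose S := [set x | exists n, x = \sum_(i < n) b i].
have hS : has_sup S.
  split; first by exists (\sum_(i < 0) b i), 0%N.
  by exists B => _ [n ->].
have [_ [N ->] hN] := sup_adherent e0 hS.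
exists N => m n Nm.
have le : \sum_(i < m + n) b i <= sup S by apply: sup_upper_bound => //; exists (m + n)%N.
have mono : \sum_(i < N) b i <= \sum_(i < m) b i.
  by rewrite -(subnKC Nm) sum_nat_shift lerDl sumr_ge0.
by rewrite sum_nat_shift in le; lra.
Qed.

Lemma bounded_sum_cvg b B : (forall n, \sum_(i < n) `|b i| <= B) ->
  exists l, forall e, 0 < e -> exists N, forall n, (N <= n)%N ->
    `|l - \sum_(i < n) b i| <= e.
Proof.
move=> bB.
have cn : cvgn [normed (series b)].
  apply: nondecreasing_is_cvgn.
    by apply: nondecreasing_series => i _ _; rewrite normr_ge0.
  by exists B => _ [n _ <-]; rewrite /normed_series_of /= /series /= big_mkord; exact: bB.
have cb := normed_cvg cn.
exists (limn (series b)) => e e0.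
have /cvgrPdist_le /(_ e e0) [N _ hN] := cb.
by exists N => n Nn; have := hN n Nn; rewrite /series /= big_mkord.
Qed.

End BoundedSums.

Section ComplexSums.
Variable R : realType.
Implicit Types (u v : nat -> R[i]) (z w l : R[i]) (b : nat -> R) (B e : R).

Definition is_csum u l := forall e : R, 0 < e -> exists N, forall n, (N <= n)%N ->
  cabs (l - \sum_(i < n) u i) <= e.

Lemma is_csum_unique u l : is_csum u l -> csum u = l.
Proof.
move=> h; rewrite /csum.
have c : (series (u : nat -> R[i]^o)) @ \oo --> (l : R[i]^o).
  apply/cvgrPdist_le => e; rewrite ltcE /= => /andP[/eqP ie e0].
  have [N hN] := h _ e0.
  exists N => // n /= Nn; rewrite cabsE lecE /= ie eqxx /=.
  by rewrite /series /= big_mkord; exact: hN.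
exact: (cvg_lim (@norm_hausdorff _ R[i]^o) c).
Qed.

Definition csummable u := exists B : R, forall n, \sum_(i < n) cabs (u i) <= B.

Lemma csummable_csum u : csummable u -> is_csum u (csum u).
Proof.
move=> [B uB].
have bRe n : \sum_(i < n) `|complex.Re (u i)| <= B.
  by apply: le_trans (uB n); apply: ler_sum => i _; exact: absRe_le_cabs.
have bIm n : \sum_(i < n) `|complex.Im (u i)| <= B.
  by apply: le_trans (uB n); apply: ler_sum => i _; exact: absIm_le_cabs.
have [a ha] := @bounded_sum_cvg R (fun i => complex.Re (u i)) _ bRe.
have [c hc] := @bounded_sum_cvg R (fun i => complex.Im (u i)) _ bIm.
have h : is_csum u (a +i* c).
  move=> e e0; have e2 : 0 < e / 2 by rewrite divr_gt0.
  have [N1 h1] := ha _ e2; have [N2 h2] := hc _ e2.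
  exists (maxn N1 N2) => n; rewrite geq_max => /andP[n1 n2].
  apply: le_trans (cabs_le_ReIm _) _; rewrite ReB ImB /= Re_sum Im_sum.
  by have := h1 _ n1; have := h2 _ n2; lra.
by rewrite (is_csum_unique h).
Qed.

Lemma csummable_dom u b B : (forall i, cabs (u i) <= b i) ->
  (forall n, \sum_(i < n) b i <= B) -> csummable u.
Proof.
move=> ub bB; exists B => n; apply: le_trans (bB n); exact: ler_sum.
Qed.

Lemma eq_csum u v : (forall i, u i = v i) -> csum u = csum v.
Proof. by move=> uv; congr csum; apply/funext. Qed.

Lemma csumD u v : csummable u -> csummable v ->
  csum (fun i => u i + v i) = csum u + csum v.
Proof.
move=> /csummable_csum su /csummable_csum sv; apply: is_csum_unique => e e0.
have e2 : 0 < e / 2 by rewrite divr_gt0.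
have [N1 h1] := su _ e2; have [N2 h2] := sv _ e2.
exists (maxn N1 N2) => n; rewrite geq_max => /andP[n1 n2].
rewrite big_split /= opprD addrACA.
by apply: le_trans (cabsD _ _) _; have := h1 _ n1; have := h2 _ n2; lra.
Qed.

Lemma csumZ z u : csummable u -> csum (fun i => z * u i) = z * csum u.
Proof.
move=> /csummable_csum su; apply: is_csum_unique => e e0.
have z0 := cabs_ge0 z.
have e2 : 0 < e / (1 + cabs z) by rewrite divr_gt0//; lra.
have [N1 h1] := su _ e2; exists N1 => n /h1 h.
rewrite -mulr_sumr -mulrBr cabsM.
apply: le_trans (ler_wpM2l z0 h) _.
rewrite mulrA ler_pdivrMr; last lra.
by rewrite mulrC ler_wpM2l ?ltW//; lra.
Qed.

Lemma csumN u : csummable u -> csum (fun i => - u i) = - csum u.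
Proof.
by move=> su; rewrite -mulN1r -csumZ//; apply: eq_csum => i; rewrite mulN1r.
Qed.

Lemma csummableD u v : csummable u -> csummable v ->
  csummable (fun i => u i + v i).
Proof.
move=> [B uB] [C vC]; exists (B + C) => n.
apply: le_trans (lerD (uB n) (vC n)); rewrite -big_split /=.
by apply: ler_sum => i _; exact: cabsD.
Qed.

Lemma csummableZ z u : csummable u -> csummable (fun i => z * u i).
Proof.
move=> [B uB]; exists (cabs z * B) => n.
under eq_bigr do rewrite cabsM.
by rewrite -mulr_sumr ler_wpM2l// cabs_ge0.
Qed.

Lemma csummableN u : csummable u -> csummable (fun i => - u i).
Proof. by move=> [B uB]; exists B => n; under eq_bigr do rewrite cabsN. Qed.

Lemma csumB u v : csummable u -> csummable v ->
  csum (fun i => u i - v i) = csum u - csum v.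
Proof. by move=> su sv; rewrite csumD// ?csumN//; exact: csummableN. Qed.

Lemma csummable0 : csummable (fun=> 0 : R[i]).
Proof. by exists 0 => n; rewrite big1// => i _; rewrite cabs0. Qed.

Lemma csum0 : csum (fun=> 0 : R[i]) = 0.
Proof.
apply: is_csum_unique => e e0; exists 0%N => n _.
by rewrite big1// subr0 cabs0 ltW.
Qed.

Lemma csummable_sum (I : Type) (r : seq I) (P : pred I) (F : I -> nat -> R[i]) :
  (forall i, P i -> csummable (F i)) ->
  csummable (fun n => \sum_(i <- r | P i) F i n).
Proof.
move=> h; elim: r => [|i r IH].
  by under eq_fun do rewrite big_nil; exact: csummable0.
under eq_fun do rewrite big_cons.
by case: (boolP (P i)) => // /h hi; exact: csummableD.
Qed.

Lemma csum_sum (I : Type) (r : seq I) (P : pred I) (F : I -> nat -> R[i]) :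
  (forall i, P i -> csummable (F i)) ->
  csum (fun n => \sum_(i <- r | P i) F i n) = \sum_(i <- r | P i) csum (F i).
Proof.
move=> h; elim: r => [|i r IH].
  by under eq_fun do rewrite big_nil; rewrite big_nil csum0.
under eq_fun do rewrite big_cons.
rewrite big_cons; case: (boolP (P i)) => // Pi.
by rewrite csumD ?IH//; [exact: h | exact: csummable_sum].
Qed.

Lemma cabs_csum_sub u N e : csummable u ->
  (forall n, \sum_(i < n) cabs (u (N + i)%N) <= e) ->
  cabs (csum u - \sum_(i < N) u i) <= e.
Proof.
move=> /csummable_csum su h; apply/ler_addgt0Pr => d d0.
have [M hM] := su _ d0.
have := hM (N + M)%N (leq_addl _ _); rewrite sum_nat_shift => h1.
have -> : csum u - \sum_(i < N) u i =
  (csum u - (\sum_(i < N) u i + \sum_(i < M) u (N + i)%N)) +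
  \sum_(i < M) u (N + i)%N by ring.
apply: le_trans (cabsD _ _) _; rewrite addrC; apply: lerD => //.
exact: le_trans (cabs_sum _ _ _) (h M).
Qed.

Lemma cabs_csum u B : (forall n, \sum_(i < n) cabs (u i) <= B) ->
  cabs (csum u) <= B.
Proof.
move=> h; have su : csummable u by exists B.
by have := @cabs_csum_sub u 0 B su h; rewrite big_ord0 subr0.
Qed.

(** The cut-off depends on the majorant alone, so it serves for all twists of a series at once. *)
Lemma cabs_csum_tail b B : (forall i, 0 <= b i) ->
  (forall n, \sum_(i < n) b i <= B) ->
  forall e, 0 < e -> exists N, forall u, (forall i, cabs (u i) <= b i) ->
  forall m, (N <= m)%N -> cabs (csum u - \sum_(i < m) u i) <= e.
Proof.
move=> b0 bB e e0; have [N hN] := bounded_sum_tail b0 bB e0.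
exists N => u ub m Nm; apply: cabs_csum_sub; first exact: csummable_dom bB.
by move=> n; apply: le_trans (hN m n Nm); apply: ler_sum.
Qed.

Lemma csum_mul u p : (0 < p)%N -> csummable u ->
  csum (fun m => if (p %| m)%N then u (m %/ p)%N else 0) = csum u.
Proof.
move=> p0 su; have hu := csummable_csum su.
apply: is_csum_unique => e e0; have [N hN] := hu _ e0.
exists (N * p)%N => n Nn.
(* The first [n] terms of the spread series contain the [u i] with [i * p < n], and the number of
   these is the ceiling of [n / p]. *)
suff -> : \sum_(i < n) (if (p %| i)%N then u (i %/ p)%N else 0) =
    \sum_(i < (n + p.-1) %/ p) u i.
  by apply: hN; rewrite leq_divRL//; apply: leq_trans Nn _; rewrite leq_addr.
elim: n {Nn} => [|n IH].
  by rewrite big_ord0 add0n divn_small ?prednK// big_ord0.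
rewrite big_ord_recr /= IH.
have [/dvdnP[k ->]|nd] := boolP (p %| n)%N.
  rewrite mulnK//.
  have -> : ((k * p + p.-1) %/ p = k)%N by rewrite divnMDl// divn_small ?prednK// addn0.
  have -> : (((k * p).+1 + p.-1) %/ p = k.+1)%N.
    by rewrite addSnnS prednK// divnDr// mulnK// divnn p0 addn1.
  by rewrite big_ord_recr.
rewrite addr0; congr (\sum_(i < _) u i).
rewrite addSnnS prednK// (divnDr _ (dvdnn p)) divnn p0 addn1.
have r0 : (0 < n %% p)%N by rewrite lt0n.
rewrite {1}(divn_eq n p) -addnA divnMDl//.
have -> : ((n %% p + p.-1) %/ p = 1)%N.
  have rp : (n %% p < p)%N by rewrite ltn_mod.
  by apply/eqP; rewrite eqn_leq -ltnS ltn_divLR// leq_divRL//; lia.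
by rewrite addn1.
Qed.

End ComplexSums.

Section PowerSums.
Variable R : realType.
Implicit Types (a s x : R).

(** Comparison with the integral of [x ^ (- s)] over [[l, l + 1]]. It comes from [1 + x <= exp x],
    used once to bound [ln (1 - 1 / (l + 1))] and once for the power of exponent [1 - s]. *)
Lemma powR_telescope s (l : nat) : 1 < s -> (0 < l)%N ->
  (l.+1%:R : R) `^ (- s) <=
  (s - 1)^-1 * (l%:R `^ (1 - s) - l.+1%:R `^ (1 - s)).
Proof.
move=> s1 l0; have s0 : 0 < s - 1 by lra.
rewrite mulrC ler_pdivlMr//.
have l0' : 0 < l%:R :> R by rewrite ltr0n.
have x0 : 0 < l.+1%:R :> R by rewrite ltr0n.
have y0 : 0 < 1 - (l.+1%:R)^-1 :> R.
  by rewrite subr_gt0 invf_lt1// ltr1n.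
have lE : l%:R = l.+1%:R * (1 - (l.+1%:R)^-1) :> R.
  by rewrite mulrBr mulr1 mulfV ?gt_eqF// -natr1 addrK.
rewrite {1}lE powRM ?(ltW x0) ?(ltW y0)//.
have E : l.+1%:R `^ (- s) = (l.+1%:R `^ (1 - s)) * (l.+1%:R)^-1 :> R.
  rewrite -[(l.+1%:R)^-1]powR_inv1 ?(ltW x0)// -powRD; last first.
    by apply/implyP => _; rewrite gt_eqF.
  by congr (_ `^ _); ring.
rewrite E -mulrA -[X in _ <= _ - X]mulr1 -mulrBr ler_wpM2l ?powR_ge0//.
rewrite /powR gt_eqF//.
have h1 : ln (1 - (l.+1%:R)^-1) <= - (l.+1%:R)^-1 :> R.
  by rewrite -ler_expR lnK// ?posrE//; apply: expR_ge1Dx.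
have h2 : 1 + (1 - s) * ln (1 - (l.+1%:R)^-1) <= expR ((1 - s) * ln (1 - (l.+1%:R)^-1)) :> R.
  exact: expR_ge1Dx.
move: h1 h2; set y := (l.+1%:R)^-1; set L := ln _ => h1 h2.
have h3 : 0 <= (s - 1) * (- y - L) by rewrite mulr_ge0 ?subr_ge0// ltW.
by move: h2 h3; set E' := expR _ => h2 h3; lra.
Qed.

Lemma sum_powR_le s n : 1 < s ->
  \sum_(i < n) (i.+1%:R : R) `^ (- s) <= 1 + (s - 1)^-1.
Proof.
move=> s1; have s0 : 0 < s - 1 by lra.
case: n => [|n]; first by rewrite big_ord0 addr_ge0// invr_ge0 ltW.
have h : \sum_(i < n.+1) (i.+1%:R : R) `^ (- s) <=
    1 + (s - 1)^-1 * (1 - n.+1%:R `^ (1 - s)).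
  elim: n => [|n IH]; first by rewrite big_ord1 !powR1 subrr mulr0 addr0.
  rewrite big_ord_recr /=; have := powR_telescope s1 (ltn0Sn n).
  by rewrite mulrBr => h; apply: le_trans (lerD IH h) _; rewrite mulrBr mulr1; lra.
apply: le_trans h _; rewrite lerD2l ger_pMr ?invr_gt0// gerBl powR_ge0//.
Qed.

Lemma powR_antitone a b s : 0 < a -> a <= b -> 0 <= s -> b `^ (- s) <= a `^ (- s).
Proof.
move=> a0 ab s0; have b0 : 0 < b by exact: lt_le_trans ab.
rewrite /powR !gt_eqF// ler_expR !mulNr lerN2 ler_wpM2l// ler_ln ?posrE//.
Qed.

Lemma sum_shift_powR_le a s n : 0 < a -> 1 < s ->
  \sum_(i < n) (i%:R + a) `^ (- s) <= a `^ (- s) + 1 + (s - 1)^-1.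
Proof.
move=> a0 s1; case: n => [|n].
  by rewrite big_ord0 !addr_ge0 ?powR_ge0// invr_ge0; lra.
rewrite big_ord_recl /= add0r -addrA lerD2l.
apply: le_trans (sum_powR_le n s1); apply: ler_sum => i _.
by apply: powR_antitone; rewrite ?ltr0n// /bump /= ?add1n; lra.
Qed.

End PowerSums.

(** * Compactness and extrema for pairs of complex numbers *)

Section Compactness.
Variable R : realType.
Implicit Types (p q : R[i] * R[i]) (K : R[i] * R[i] -> Prop).
Implicit Types (g : R[i] * R[i] -> R) (d e M : R).

Lemma small_factor (b1 b2 b3 A1 A2 A3 : R) : 0 < b1 -> 0 < b2 -> 0 < b3 ->
  0 <= A1 -> 0 <= A2 -> 0 <= A3 ->
  exists e, [/\ 0 < e, e <= 1, e * A1 < b1, e * A2 < b2 & e * A3 < b3].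
Proof.
move=> b10 b20 b30 A10 A20 A30.
have h (b A : R) : 0 < b -> 0 <= A -> 0 < b / (A + b) /\
    forall e, 0 < e -> e <= b / (A + b) / 2 -> e * A < b.
  move=> b0 A0; have Ab : 0 < A + b by lra.
  split; first by rewrite divr_gt0.
  move=> e e0; rewrite ler_pdivlMr// ler_pdivlMr// => h; nra.
have [p1 h1] := h _ _ b10 A10; have [p2 h2] := h _ _ b20 A20.
have [p3 h3] := h _ _ b30 A30.
set x1 := b1 / _ in p1 h1; set x2 := b2 / _ in p2 h2; set x3 := b3 / _ in p3 h3.
exists (Num.min 1 (Num.min (x1 / 2) (Num.min (x2 / 2) (x3 / 2)))).
have e0 : 0 < Num.min 1 (Num.min (x1 / 2) (Num.min (x2 / 2) (x3 / 2))).
  by rewrite !lt_min ltr01 /=; apply/and3P; split; rewrite divr_gt0.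
by split => //; [rewrite ge_min lexx | apply: h1 | apply: h2 | apply: h3];
  rewrite // !ge_min lexx ?orbT.
Qed.

(** Pairs, because the extremal arguments run over a variable [s] and a twisting variable [z]
    together; a one-variable problem sets the second entry to [0]. *)
Definition pnear d p q := cabs (p.1 - q.1) <= d /\ cabs (p.2 - q.2) <= d.

Lemma bolzano_weierstrass (u : nat -> R[i] * R[i]) M :
  (forall n, cabs (u n).1 <= M /\ cabs (u n).2 <= M) ->
  exists p, forall d N, 0 < d -> exists2 n, (N <= n)%N & pnear d p (u n).
Proof.
move=> uM.
pose T : Type := ((R * R) * (R * R))%type.
pose I : set R := [set` `[- M, M]].
pose A : set T := (I `*` I) `*` (I `*` I).
have cI : compact I by exact: segment_compact.
have cA : compact A by do !apply: compact_setX.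
pose v n : T := ((complex.Re (u n).1, complex.Im (u n).1),
                 (complex.Re (u n).2, complex.Im (u n).2)).
have vA n : A (v n).
  have [h1 h2] := uM n; rewrite /A /I /v /= !in_itv /= -!ler_norml.
  by do !split; apply: le_trans (absRe_le_cabs _) _ || apply: le_trans (absIm_le_cabs _) _.
have [p [Ap cp]] := cA (v @ \oo) _ (ex_intro2 _ _ 0%N Logic.I (fun n _ => vA n)).
exists (p.1.1 +i* p.1.2, p.2.1 +i* p.2.2) => d N d0.
have d2 : 0 < d / 2 by rewrite divr_gt0.
have [_ [[n /= Nn <-] bn]] := cp (v @` [set n | (N <= n)%N]) (ball p (d / 2)) (ex_intro2 _ _ N Logic.I (fun n h => ex_intro2 _ _ n h erefl)) (nbhsx_ballx _ _ d2).
exists n => //.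
move: bn => /= [[/= b1 b2] [/= b3 b4]].
by split; apply: le_trans (cabs_le_ReIm _) _; rewrite ReB ImB /=;
  move: b1 b2 b3 b4; rewrite /ball /=; lra.
Qed.

Definition pcontinuous K g := forall p, K p -> forall e, 0 < e ->
  exists2 d, 0 < d & forall q, K q -> pnear d p q -> `|g p - g q| <= e.

Definition pclosed K := forall p, (forall d, 0 < d -> exists2 q, K q & pnear d p q) -> K p.

Lemma compact_argmax K g M : (exists p, K p) ->
  (forall p, K p -> cabs p.1 <= M /\ cabs p.2 <= M) -> pclosed K ->
  pcontinuous K g -> exists2 p, K p & forall q, K q -> g q <= g p.
Proof.
move=> [p0 Kp0] KM Kcl gc.
(* A solvable sequence of conditions yields a point of [K] whose value under [g] is approached by
   solutions with arbitrarily large index. It serves first with [n%:R < g p], to bound [g], then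
   with values within [1 / (n + 1)] of the supremum. *)
have seq (P : nat -> R[i] * R[i] -> Prop) : (forall n, exists p, K p /\ P n p) ->
    exists2 p, K p & forall e N, 0 < e ->
      exists n q, [/\ (N <= n)%N, P n q & `|g p - g q| <= e].
  move=> /choice[u hu]; have [n|p hp] := @bolzano_weierstrass u M.
    by apply: KM; case: (hu n).
  have Kp : K p.
    apply: Kcl => d d0; have [n _ pn] := hp d 0%N d0.
    by exists (u n) => //; case: (hu n).
  exists p => // e N e0; have [d d0 hd] := gc p Kp e e0.
  have [n Nn pn] := hp d N d0; exists n, (u n); split => //; case: (hu n) => //.
  by move=> Kn _; apply: hd.
pose S := [set x | exists2 p, K p & x = g p].
have S0 : S !=set0 by exists (g p0), p0.
have [ubS|nub] := pselect (has_ubound S); last first.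
  have [n|p Kp hp] := seq (fun n p => n%:R < g p).
    apply: contrapT => h; apply: nub; exists n%:R => _ [p Kp ->].
    by rewrite leNgt; apply/negP => np; apply: h; exists p.
  have [|n [q [Nn nq /ler_normlP[h1 h2]]]] := hp 1 (Num.truncn `|g p + 1|).+1 => //.
  have := truncnS_gt (`|g p + 1|); have := ler_norm (g p + 1).
  by move: Nn; rewrite -(ler_nat R); lra.
have hS : has_sup S by split.
have [n|p Kp hp] := seq (fun n p => sup S - n.+1%:R^-1 < g p).
  have [|_ [p Kp ->] h] := @sup_adherent R S (n.+1%:R^-1) _ hS; first by rewrite invr_gt0.
  by exists p.
exists p => // q Kq; apply: le_trans (_ : sup S <= _).
  by apply: sup_upper_bound => //; exists q.
apply/ler_addgt0Pr => e e0; have e2 : 0 < e / 2 by rewrite divr_gt0.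
have [n [r [Nn nr /ler_normlP[h1 h2]]]] := hp (e / 2) (Num.truncn (e / 2)^-1).+1 e2.
have h3 : (e / 2)^-1 <= n.+1%:R.
  have := truncnS_gt ((e / 2)^-1); move: Nn; rewrite -(ler_nat R) -(natr1 n); lra.
have : n.+1%:R^-1 <= e / 2 by rewrite -[leRHS]invrK lef_pV2 ?posrE ?invr_gt0.
by move: nr; move: (n.+1%:R^-1) => i nr hi; lra.
Qed.

Lemma compact_lexi_argmax K g1 g2 M : (exists p, K p) ->
  (forall p, K p -> cabs p.1 <= M /\ cabs p.2 <= M) -> pclosed K ->
  pcontinuous K g1 -> pcontinuous K g2 ->
  exists2 p, K p & forall q, K q -> g1 q <= g1 p /\ (g1 q = g1 p -> g2 q <= g2 p).
Proof.
move=> K0 KM Kcl c1 c2; have [p1 Kp1 h1] := compact_argmax K0 KM Kcl c1.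
pose K' p := K p /\ g1 p = g1 p1.
have [| | | |p [Kp pE] hp] := @compact_argmax K' g2 M.
- by exists p1.
- by move=> p [/KM].
- move=> p hp; have Kp : K p.
    by apply: Kcl => d /hp[q [Kq _] pq]; exists q.
  split=> //; apply/eqP; rewrite -subr_eq0 -normr_eq0 eq_le normr_ge0 andbT.
  apply/ler_addgt0Pr => e e0; rewrite add0r; have [d d0 hd] := c1 p Kp e e0.
  by have [q [Kq <-] pq] := hp d d0; exact: hd.
- move=> p [Kp _] e e0; have [d d0 hd] := c2 p Kp e e0.
  by exists d => // q [Kq _]; exact: hd.
- exists p => // q Kq; rewrite pE; split; first exact: h1.
  by move=> qE; apply: hp.
Qed.

End Compactness.

(** * Analytic functions described by their Taylor remainders *)

Section Analytic.
Variable R : realType.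
Implicit Types (g : R[i] -> R[i]) (w x y z : R[i]) (c : nat -> R[i]) (rho B d e r : R).

(** Analyticity as an expansion whose remainders decay geometrically on a whole disc. The case
    [k = 0] bounds [g] there by [B], and a series of such functions is again one when the constants
    [B] are summable. *)
Definition taylor g w rho B c := forall k x, cabs x <= rho ->
  cabs (g (w + x) - \sum_(j < k) c j * x ^+ j) <= B * (cabs x / rho) ^+ k.

Definition ana g w := exists rho B c, 0 < rho /\ taylor g w rho B c.

Lemma taylor_ge0 g w rho B c : 0 < rho -> taylor g w rho B c -> 0 <= B.
Proof.
move=> r0 /(_ 0%N 0); rewrite cabs0 expr0 mulr1 => /(_ (ltW r0)).
exact: le_trans (cabs_ge0 _).
Qed.

(** The remainders of orders [j] and [j + 1] at the boundary point [rho] differ by [c j * rho ^ j],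
    whence the factor [2]. *)
Lemma taylor_coef g w rho B c j : 0 < rho -> taylor g w rho B c ->
  cabs (c j) <= 2 * B / rho ^+ j.
Proof.
move=> r0 h; rewrite ler_pdivlMr ?exprn_gt0//.
have rr : cabs (rho%:C : R[i]) = rho by rewrite cabsR ger0_norm// ltW.
have h1 := h j rho%:C; have h2 := h j.+1 rho%:C.
rewrite rr lexx divff ?gt_eqF// expr1n mulr1 in h1.
rewrite rr lexx divff ?gt_eqF// expr1n mulr1 big_ord_recr /= in h2.
have -> : cabs (c j) * rho ^+ j = cabs (c j * rho%:C ^+ j).
  by rewrite cabsM cabsX rr.
set S := \sum_(_ < _) _ in h1 h2.
have -> : c j * rho%:C ^+ j =
   (g (w + rho%:C) - S) - (g (w + rho%:C) - (S + c j * rho%:C ^+ j)) by ring.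
apply: le_trans (cabsD _ _) _; rewrite cabsN.
by have := h1 isT; have := h2 isT; lra.
Qed.

Lemma taylor0 g w rho B c : 0 < rho -> taylor g w rho B c -> c 0%N = g w.
Proof.
move=> r0 /(_ 1%N 0); rewrite cabs0 (ltW r0) mul0r expr1 mulr0 big_ord1 expr0 mulr1 addr0.
move=> /(_ isT) h; apply/esym/eqP; rewrite -subr_eq0 -cabs_eq0 eq_le h; exact: cabs_ge0.
Qed.

(** Either some coefficient beyond the constant one is nonzero, and the first of them gives the
    leading term, or on the half disc the remainder bounds tend to [0]. *)
Lemma ana_local g w : ana g w ->
  (exists2 d, 0 < d & forall x, cabs x <= d -> g (w + x) = g w) \/
  (exists k a (C d : R), [/\ 0 < d, a != 0, 0 <= C & forall x, cabs x <= d ->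
     cabs (g (w + x) - g w - a * x ^+ k.+1) <= C * cabs x ^+ k.+2]).
Proof.
move=> [rho [B [c [r0 h]]]]; have B0 := taylor_ge0 r0 h.
have c0 := taylor0 r0 h.
have [ex|nex] := pselect (exists k, c k.+1 != 0).
  right; case: (ex_minnP ex) => k ck mk.
  exists k, (c k.+1), (B / rho ^+ k.+2), rho; split => //.
    by rewrite divr_ge0// exprn_ge0// ltW.
  move=> x xr; have := h k.+2 x xr.
  rewrite big_ord_recr /= big_ord_recl /= big1 => [|i _].
    by rewrite expr0 mulr1 addr0 c0 opprD addrA expr_div_n mulrA [X in _ <= X]mulrAC.
  suff -> : c (bump 0 i) = 0 by rewrite mul0r.
  by apply/eqP; apply: contraTT (ltn_ord i); rewrite /bump /= add1n -leqNgt => /mk.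
left; exists (rho / 2); first by rewrite divr_gt0.
move=> x xr; apply: eq_of_cabs => e e0.
have xr' : cabs x <= rho by lra.
have hk k : cabs (g (w + x) - g w) <= B * 2^-1 ^+ k.+1.
  have := h k.+1 x xr'; rewrite big_ord_recl /= big1 => [|i _]; last first.
    suff -> : c (bump 0 i) = 0 by rewrite mul0r.
    by apply/eqP; apply: contrapT => hi; apply: nex; exists i; apply/negP.
  rewrite expr0 mulr1 addr0 c0 => /le_trans; apply.
  rewrite ler_wpM2l// lerXn2r ?nnegrE//; first by rewrite divr_ge0 ?cabs_ge0// ltW.
  by rewrite ler_pdivrMr//; lra.
apply: le_trans (hk (Num.truncn (B / e)).+1) _.
have := truncnS_gt (B / e); set n := Num.truncn _ => hn.
have n2 : (n.+1%:R : R) <= 2 ^+ n.+2.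
  by rewrite -natrX ler_nat ltnW// ltnW// ltn_expl.
rewrite exprVn ler_pdivrMr ?exprn_gt0//.
have : B / e <= 2 ^+ n.+2 by apply: le_trans n2; exact: ltW.
by rewrite ler_pdivrMr// mulrC.
Qed.

(** With [a * y ^ (k + 1) = - g w], moving by [t y] multiplies [g w] by [1 - t ^ (k + 1)] up to an
    error of order [t ^ (k + 2)]. *)
Lemma ana_descent g w k a (C d : R) : 0 < d -> a != 0 -> 0 <= C -> g w != 0 ->
  (forall x, cabs x <= d -> cabs (g (w + x) - g w - a * x ^+ k.+1) <= C * cabs x ^+ k.+2) ->
  forall e, 0 < e -> exists2 x, cabs x <= e & cabs (g (w + x)) < cabs (g w).
Proof.
move=> d0 a0 C0 gw0 h e e0.
pose y := k.+1.-root (- g w / a); have yk : y ^+ k.+1 = - g w / a by rewrite rootCK.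
have y0 := cabs_ge0 y; have gw : 0 < cabs (g w) by rewrite cabs_gt0.
have [t [t0 t1 td te tC]] := small_factor d0 e0 gw y0 y0 (mulr_ge0 C0 (exprn_ge0 k.+2 y0)).
have cx : cabs (t%:C * y) = t * cabs y by rewrite cabsM cabsR ger0_norm// ltW.
exists (t%:C * y); first by rewrite cx ltW.
have := h (t%:C * y); rewrite cx => /(_ (ltW td)) hh.
have E : a * (t%:C * y) ^+ k.+1 = - (t ^+ k.+1)%:C * g w.
  by rewrite exprMn yk rmorphXn; field.
rewrite E in hh.
have -> : g (w + t%:C * y) = (g (w + t%:C * y) - g w - - (t ^+ k.+1)%:C * g w) +
   (1 - t ^+ k.+1)%:C * g w by rewrite rmorphB /=; ring.
apply: le_lt_trans (cabsD _ _) _; rewrite cabsM cabsR.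
have tk0 : 0 < t ^+ k.+1 by rewrite exprn_gt0.
have tk1 : t ^+ k.+1 <= 1 by rewrite exprn_ile1// ltW.
rewrite ger0_norm; last lra.
apply: le_lt_trans (lerD hh (lexx _)) _.
rewrite exprMn (exprS t k.+1).
have : t ^+ k.+1 * (t * (C * cabs y ^+ k.+2)) < t ^+ k.+1 * cabs (g w) by rewrite ltr_pM2l.
by lra.
Qed.

Lemma ana_continuous g w : ana g w -> forall e, 0 < e ->
  exists2 d, 0 < d & forall x, cabs x <= d -> cabs (g (w + x) - g w) <= e.
Proof.
move=> [rho [B [c [r0 h]]]] e e0; have B0 := taylor_ge0 r0 h; have c0 := taylor0 r0 h.
have [t [t0 t1 tB _ _]] := small_factor e0 e0 e0 B0 B0 B0.
exists (t * rho); first by rewrite mulr_gt0.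
move=> x xt; have xr : cabs x <= rho by apply: le_trans xt _; rewrite ger_pMl.
have := h 1%N x xr; rewrite big_ord1 expr0 mulr1 c0 expr1 => /le_trans; apply.
apply: le_trans (_ : B * t <= e); last by rewrite mulrC ltW.
by rewrite ler_wpM2l// ler_pdivrMr.
Qed.

Lemma ana_pcontinuous g (P : R[i] -> Prop) : (forall y, P y -> ana g y) ->
  pcontinuous (fun p => P p.1) (fun p => cabs (g p.1)).
Proof.
move=> h p /h /ana_continuous hp e e0; have [d d0 hd] := hp e e0.
exists d => // q _ [h1 _]; have := hd (q.1 - p.1); rewrite cabsB => /(_ h1).
have -> : p.1 + (q.1 - p.1) = q.1 by ring.
move=> h2; rewrite ler_norml; have := cabs_subl (g q.1) (g p.1).
by have := cabs_subl (g p.1) (g q.1); rewrite cabsB => h3 h4; apply/andP; split; lra.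
Qed.

(* Argand's proof of the fundamental theorem of algebra: at an interior minimum
   of the modulus a nonconstant analytic function vanishes. Taking the minimum
   farthest from the center rules out local constancy. *)
Lemma min_principle g w r : 0 < r -> (forall y, cabs (y - w) <= r -> ana g y) ->
  (forall y, cabs (y - w) = r -> cabs (g w) < cabs (g y)) ->
  exists2 y, cabs (y - w) < r & g y = 0.
Proof.
move=> r0 ga gm.
pose K (p : R[i] * R[i]) := cabs (p.1 - w) <= r /\ p.2 = 0.
have Kin y : cabs (y - w) <= r -> K (y, 0) by [].
have [||||| [y0 y2] [/= yr _] hy] := @compact_lexi_argmax R K (fun p => - cabs (g p.1))
   (fun p => cabs (p.1 - w)) (r + cabs w).
- by exists (w, 0); apply: Kin; rewrite subrr cabs0 ltW.
- move=> p [p1 ->]; rewrite cabs0; split; last by have := cabs_ge0 w; lra.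
  by have := cabs_subl p.1 (- w); have := cabsD (p.1 - w) w; rewrite subrK; lra.
- move=> p hp; split.
    apply/ler_addgt0Pr => e e0; have [q [q1 _] [pq _]] := hp e e0.
    by apply: le_trans (cabs_dist _ _ q.1) _; lra.
  apply: eq_of_cabs => e e0; by have [q [_ q0] [_]] := hp e e0; rewrite q0.
- move=> p [p1 _] e e0; have [d d0 hd] := ana_pcontinuous (P := fun y => cabs (y - w) <= r) ga p1 e0.
  by exists d => // q [q1 _] pq; rewrite -opprD normrN; exact: hd.
- move=> p _ e e0; exists e => // q _ [pq _].
  have := cabs_dist p.1 w q.1; have := cabs_dist q.1 w p.1; rewrite [cabs (q.1 - p.1)]cabsB.
  by rewrite ler_norml => h1 h2; apply/andP; split; lra.
have yr' : cabs (y0 - w) < r.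
  rewrite lt_neqAle yr andbT; apply/eqP => /gm.
  have [h _] := hy (w, 0) (Kin w ltac:(by rewrite subrr cabs0 ltW)).
  by move: h => /=; lra.
exists y0 => //; apply/eqP; apply: contrapT => /negP gy0.
have inK x : cabs x <= r - cabs (y0 - w) -> K (y0 + x, 0).
  move=> xr; apply: Kin; have -> : y0 + x - w = (y0 - w) + x by ring.
  by apply: le_trans (cabsD _ _) _; lra.
have rr : 0 < r - cabs (y0 - w) by lra.
have [[d d0 hd]|[k [a [C [d [d0 a0 C0 hd]]]]]] := ana_local (ga _ yr).
  pose t := Num.min d (r - cabs (y0 - w)); have t0 : 0 < t by rewrite lt_min d0.
  pose x := (if 0 <= complex.Re (y0 - w) then t else - t)%:C : R[i].
  have cx : cabs x = t by rewrite cabsR; case: ifP => _; rewrite ?normrN gtr0_norm.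
  have [_ h] := hy (y0 + x, 0) (inK x ltac:(by rewrite cx ge_min lexx orbT)).
  have /= := h; rewrite hd ?cx ?ge_min ?lexx// => /(_ erefl).
  rewrite leNgt => /negP; apply.
  rewrite -(ltr_pXn2r (n := 2))// ?nnegrE ?cabs_ge0//.
  have -> : y0 + x - w = (y0 - w) + x by ring.
  have xI : complex.Im x = 0 by [].
  have xR : complex.Re x = if 0 <= complex.Re (y0 - w) then t else - t by [].
  rewrite !sqr_cabs [complex.Re (_ + x)]ReD [complex.Im (_ + x)]ImD xI addr0 ltrD2r xR.
  by case: ifP => [v0|/negbT]; rewrite -?ltNge; nra.
have [x xe gx] := ana_descent d0 a0 C0 gy0 hd rr.
by have [/=] := hy (y0 + x, 0) (inK x xe); lra.
Qed.

(* A quantitative form of Hurwitz's theorem on zeros of nearby functions. *)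
Lemma zero_perturb g w r m (g' : R[i] -> R[i]) : 0 < r ->
  (forall y, cabs (y - w) <= r -> ana g' y) -> cabs (g w) <= m ->
  (forall y, cabs (y - w) = r -> 3 * m < cabs (g y)) ->
  (forall y, cabs (y - w) <= r -> cabs (g' y - g y) <= m) ->
  exists2 y, cabs (y - w) < r & g' y = 0.
Proof.
(* On the circle [|g'| > 2 m], while [|g'| <= 2 m] at the center. *)
move=> r0 ga gw gm hm; apply: min_principle => // y yr.
have h1 := hm y ltac:(by rewrite yr); have h2 := gm y yr.
have h3 := hm w ltac:(by rewrite subrr cabs0 ltW).
have := cabs_subl (g y) (g' y); rewrite cabsB => h4.
have := cabsD (g' w - g w) (g w); rewrite subrK => h5.
lra.
Qed.

Lemma isolated_zero g w : ana g w -> g w = 0 ->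
  (exists2 d, 0 < d & forall x, cabs x <= d -> g (w + x) = 0) \/
  (forall e, 0 < e -> exists r m, [/\ 0 < r, r <= e, 0 < m &
     forall x, cabs x = r -> m <= cabs (g (w + x))]).
Proof.
move=> ga gw; have [[d d0 hd]|[k [a [C [d [d0 a0 C0 hd]]]]]] := ana_local ga.
  by left; exists d => // x /hd ->.
right => e e0; have a1 : 0 < cabs a / 2 by rewrite divr_gt0// cabs_gt0.
have [t [t0 t1 td te tC]] := small_factor d0 e0 a1 ler01 ler01 C0.
rewrite !mulr1 in td te.
exists t, (cabs a / 2 * t ^+ k.+1); split => //; first exact: ltW.
  by rewrite mulr_gt0// exprn_gt0.
move=> x xt; have := hd x ltac:(by rewrite xt ltW).
rewrite gw subr0 xt => h; have := cabs_subl (a * x ^+ k.+1) (g (w + x)).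
rewrite cabsB cabsM cabsX xt => h2.
have tk0 : 0 < t ^+ k.+1 by rewrite exprn_gt0.
have : t ^+ k.+1 * (t * C) <= t ^+ k.+1 * (cabs a / 2) by rewrite ler_pM2l// ltW.
rewrite (exprS t k.+1) in h; lra.
Qed.

End Analytic.

Section RealDerivatives.
Variable R : realType.
Implicit Types (a b c p q t : R).

Lemma is_derive_cast (f : R -> R) (x df df' : R) :
  is_derive x 1 f df -> df = df' -> is_derive x 1 f df'.
Proof. by move=> h <-. Qed.

Lemma is_derive_monomial n c t :
  is_derive t 1 (fun t => t ^+ n * c) (n%:R * t ^+ n.-1 * c).
Proof.
have -> : (fun t => t ^+ n * c) = c *: ((fun t : R => t) ^+ n).
  by rewrite exprfctE; apply/funext => x; rewrite mulrC.
apply: is_derive_cast (is_deriveZ c (is_deriveX n (is_derive_id t 1))) _.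
by rewrite /GRing.scale /= mulr1; ring.
Qed.

Lemma is_derive_scale a t : is_derive t 1 (fun t => t * a) a.
Proof.
by have := is_derive_monomial 1 a t; rewrite expr0 !mul1r; under eq_fun do rewrite expr1.
Qed.

Lemma is_derive_exp_cos_sin a b p q t :
  is_derive t 1 (fun t => expR (t * a) * (p * cos (t * b) - q * sin (t * b)))
   (expR (t * a) * (a * (p * cos (t * b) - q * sin (t * b)) -
     b * (p * sin (t * b) + q * cos (t * b)))).
Proof.
have d1 := @is_derive1_comp R expR (fun t => t * a) t _ _ (is_derive_expR (t * a)) (is_derive_scale a t).
have d2 := @is_derive1_comp R (@cos R) (fun t => t * b) t _ _ (is_derive_cos (t * b)) (is_derive_scale b t).
have d3 := @is_derive1_comp R (@sin R) (fun t => t * b) t _ _ (is_derive_sin (t * b)) (is_derive_scale b t).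
apply: is_derive_cast (is_deriveM d1 (is_deriveB (is_deriveZ p d2) (is_deriveZ q d3))) _.
have -> : (p \*: (@cos R \o *%R^~ b) - q \*: (@sin R \o *%R^~ b)) t =
  p * cos (t * b) - q * sin (t * b) by [].
by rewrite /GRing.scale /=; ring.
Qed.

End RealDerivatives.

Section TaylorSeries.
Variable R : realType.
Implicit Types (g : R[i] -> R[i]) (w x y z s : R[i]) (rho B : R).

Lemma csum_taylor (u : nat -> R[i] -> R[i]) w rho (b : nat -> R) (c : nat -> nat -> R[i]) B :
  0 < rho -> (forall m, taylor (u m) w rho (b m) (c m)) ->
  (forall n, \sum_(m < n) b m <= B) ->
  taylor (fun x => csum (fun m => u m x)) w rho B (fun j => csum (fun m => c m j)).
Proof.
move=> r0 h bB k x xr.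
have su : csummable (fun m => u m (w + x)).
  apply: csummable_dom bB => m; have := h m 0%N x xr.
  by rewrite big_ord0 subr0 expr0 mulr1.
have sc j : csummable (fun m => c m j).
  apply: (@csummable_dom _ _ (fun m => 2 / rho ^+ j * b m) (2 / rho ^+ j * B)).
    by move=> m; have := taylor_coef j r0 (h m); rewrite mulrAC.
  by move=> n; rewrite -mulr_sumr ler_wpM2l// divr_ge0// exprn_ge0// ltW.
have scx j : csummable (fun m => c m j * x ^+ j).
  by under eq_fun do rewrite mulrC; exact: csummableZ.
have -> : \sum_(j < k) csum (fun m => c m j) * x ^+ j =
    csum (fun m => \sum_(j < k) c m j * x ^+ j).
  rewrite csum_sum//; apply: eq_bigr => j _; rewrite mulrC -csumZ//.
  by apply: eq_csum => m; rewrite mulrC.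
rewrite -csumB//; last by apply: csummable_sum => j _.
apply: cabs_csum => n.
apply: le_trans (_ : \sum_(m < n) b m * (cabs x / rho) ^+ k <= _).
  by apply: ler_sum => m _; exact: h.
by rewrite -mulr_suml ler_wpM2r// exprn_ge0// divr_ge0 ?cabs_ge0// ltW.
Qed.

Lemma taylorZ g w rho B c a : taylor g w rho B c ->
  taylor (fun x => a * g x) w rho (cabs a * B) (fun j => a * c j).
Proof.
move=> h k x xr; under eq_bigr do rewrite -mulrA.
by rewrite -mulr_sumr -mulrBr cabsM -mulrA ler_wpM2l ?cabs_ge0//; exact: h.
Qed.

(** The bound [1] is independent of [h]: binomial coefficients are nonnegative, so a remainder is at
    most [(|x| / rho) ^ k] times part of the expansion of [(|w| + rho) ^ h <= 1]. *)
Lemma taylor_exp h w rho : 0 < rho -> cabs w + rho <= 1 ->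
  taylor (fun z => z ^+ h) w rho 1 (fun j => 'C(h, j)%:R * w ^+ (h - j)).
Proof.
move=> r0 wr k x xr.
have c0 := cabs_ge0 w; have x0 := cabs_ge0 x.
pose F (T : comNzRingType) (a b : T) j := 'C(h, j)%:R * a ^+ (h - j) * b ^+ j.
have FE (T : comNzRingType) (a b : T) : (a + b) ^+ h = \sum_(j < k + h.+1) F T a b j.
  rewrite addnC sum_nat_shift [X in _ = _ + X]big1 ?addr0; last first.
    by move=> i _; rewrite /F bin_small ?mul0r// addSn ltnS leq_addr.
  by rewrite exprDn; apply: eq_bigr => i _; rewrite /F -mulr_natl mulrA.
rewrite FE sum_nat_shift addrAC subrr add0r.
apply: le_trans (cabs_sum _ _ _) _.
apply: le_trans (_ : \sum_(i < h.+1) F R (cabs w) rho (k + i)%N * (cabs x / rho) ^+ k <= _).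
  apply: ler_sum => i _; rewrite /F !cabsM !cabsX cabs_nat -!mulrA.
  rewrite ler_wpM2l// ler_wpM2l ?exprn_ge0//.
  have -> : rho ^+ (k + i) * (cabs x / rho) ^+ k = cabs x ^+ k * rho ^+ i.
    by rewrite exprD expr_div_n; field; rewrite expf_neq0 ?gt_eqF.
  by rewrite exprD ler_wpM2l ?exprn_ge0// lerXn2r ?nnegrE ?(ltW r0).
rewrite -mulr_suml mul1r ler_piMl ?exprn_ge0 ?divr_ge0 ?(ltW r0)//.
have := FE R (cabs w) rho; rewrite sum_nat_shift.
have h1 : 0 <= \sum_(i < k) F R (cabs w) rho i.
  by apply: sumr_ge0 => i _; rewrite /F !mulr_ge0 ?exprn_ge0 ?(ltW r0).
have h2 : (cabs w + rho) ^+ h <= 1 by apply: exprn_ile1; lra.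
lra.
Qed.

Lemma ana_csum_exp (a : nat -> R[i]) (h : nat -> nat) w : csummable a ->
  cabs w < 1 -> ana (fun z => csum (fun m => a m * z ^+ h m)) w.
Proof.
move=> [B aB] w1; pose rho := 1 - cabs w; have r0 : 0 < rho by rewrite subr_gt0.
exists rho, B, (fun j => csum (fun m => a m * ('C(h m, j)%:R * w ^+ (h m - j)))); split=> //.
apply: (csum_taylor (b := fun m => cabs (a m) * 1)) => // [m|n].
  by apply: taylorZ; apply: taylor_exp => //; rewrite addrC subrK.
by under eq_bigr do rewrite mulr1.
Qed.

Lemma cabs_le_of_Re z (b : R) : (forall u, cabs u = 1 -> complex.Re (u * z) <= b) -> 0 <= b ->
  cabs z <= b.
Proof.
move=> h b0; have [->|z0] := eqVneq z 0; first by rewrite cabs0.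
have cz : 0 < cabs z by rewrite cabs_gt0.
have := h (z^* / (cabs z)%:C).
rewrite cabsM cabsJ cabsV cabsR gtr0_norm// mulfV ?gt_eqF// => /(_ erefl).
have -> : z^* / (cabs z)%:C * z = (cabs z)%:C.
  by rewrite mulrAC [z^* * z]mulrC -sqr_cabsJ expr2 rmorphM /= mulfK// -cabs_eq0 cabsR normr_eq0 gt_eqF.
by [].
Qed.

(** Induction on [k]: along the segment [t y] the derivative of the remainder of order [k + 1] is
    [y] times that of order [k]. A rotation by [u] reduces moduli to real parts, and the mean value
    theorem gives [H 1 >= H 0 = 0]. *)
Lemma cexp_taylor k y :
  cabs (cexp y - \sum_(j < k) y ^+ j / (j`!)%:R) <= cabs y ^+ k / (k`!)%:R * expR (cabs y).
Proof.
elim: k y => [|k IH] y.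
  by rewrite big_ord0 subr0 expr0 fact0 divr1 mul1r cabs_cexp ler_expR Re_le_cabs.
have y0 := cabs_ge0 y.
apply: cabs_le_of_Re => [u u1|]; last first.
  by rewrite mulr_ge0 ?expR_ge0// divr_ge0 ?exprn_ge0.
pose E j (t : R) := cexp (t%:C * y) - \sum_(i < j) (t%:C * y) ^+ i / (i`!)%:R.
pose H (t : R) := t ^+ k.+1 * (cabs y ^+ k.+1 / (k.+1`!)%:R * expR (cabs y)) -
   complex.Re (u * E k.+1 t).
pose dH (t : R) := k.+1%:R * t ^+ k * (cabs y ^+ k.+1 / (k.+1`!)%:R * expR (cabs y)) -
   complex.Re (u * y * E k t).
have HE : H = (fun t => t ^+ k.+1 * (cabs y ^+ k.+1 / (k.+1`!)%:R * expR (cabs y)) -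
   (expR (t * complex.Re y) * (complex.Re u * cos (t * complex.Im y) - complex.Im u * sin (t * complex.Im y)) -
   \sum_(i < k.+1) t ^+ i * complex.Re (u * y ^+ i / (i`!)%:R))).
  apply/funext => t; rewrite /H /E; congr (_ - _).
  rewrite mulrBr ReB; congr (_ - _).
    by rewrite /cexp Re_realM Im_realM mulrCA Re_realM; congr (_ * _); case: (u).
  rewrite mulr_sumr Re_sum; apply: eq_bigr => i _.
  by rewrite -Re_realM; congr complex.Re; rewrite exprMn rmorphXn /=; ring.
have der (t : R) : is_derive t 1 H (dH t).
  rewrite HE.
  have d3 : is_derive t 1 (fun t => \sum_(i < k.+1) t ^+ i * complex.Re (u * y ^+ i / (i`!)%:R))
     (complex.Re (u * y * \sum_(i < k) (t%:C * y) ^+ i / (i`!)%:R)).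
    have -> : (fun t => \sum_(i < k.+1) t ^+ i * complex.Re (u * y ^+ i / (i`!)%:R)) =
      \sum_(i < k.+1) (fun t => t ^+ i * complex.Re (u * y ^+ i / (i`!)%:R)).
      by apply/funext => z; rewrite fct_sumE.
    apply: is_derive_cast (is_derive_sum (fun i : 'I_k.+1 => is_derive_monomial i (complex.Re (u * y ^+ i / (i`!)%:R)) t)) _.
    rewrite big_ord_recl /= !mul0r add0r mulr_sumr Re_sum.
    apply: eq_bigr => i _; rewrite /bump /= add1n -Re_realM; congr complex.Re.
    rewrite factS natrM exprMn exprS rmorphM rmorphXn /= rmorph_nat; field.
    by rewrite nat1r !pnatr_eq0 -!lt0n fact_gt0.
  apply: is_derive_cast (is_deriveB (is_derive_monomial k.+1 (cabs y ^+ k.+1 / (k.+1`!)%:R * expR (cabs y)) t)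
     (is_deriveB (is_derive_exp_cos_sin (complex.Re y) (complex.Im y) (complex.Re u) (complex.Im u) t) d3)) _.
  rewrite /dH /E [u * y * (_ - _)]mulrBr ReB; congr (_ - (_ - _)).
  rewrite /cexp Re_realM Im_realM mulrCA Re_realM.
  by case: (u) => p q; case: (y) => a b /=; ring.
have dH0 (t : R) : 0 <= t <= 1 -> 0 <= dH t.
  move=> /andP[t0 t1]; rewrite subr_ge0.
  apply: le_trans (Re_le_cabs _) _; rewrite !cabsM u1 mul1r.
  apply: le_trans (ler_wpM2l y0 (IH (t%:C * y))) _.
  rewrite cabsM cabsR ger0_norm// factS natrM.
  have -> : k.+1%:R * t ^+ k * (cabs y ^+ k.+1 / (k.+1%:R * k`!%:R) * expR (cabs y)) =
     cabs y * ((t * cabs y) ^+ k / k`!%:R * expR (cabs y)).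
    by rewrite exprMn exprS; field; rewrite nat1r !pnatr_eq0 -!lt0n fact_gt0.
  rewrite ler_wpM2l// ler_wpM2l// ?divr_ge0 ?exprn_ge0 ?mulr_ge0//.
  by rewrite ler_expR ler_piMl.
have [|c c01 hc] := @MVT R H dH 0 1 ltr01 (fun t _ => der t).
  by apply: derivable_within_continuous => t _; case: (der t).
have : 0 <= H 1 - H 0.
  rewrite hc subr0 mulr1; apply: dH0; move: c01; rewrite in_itv /=; lra.
have -> : H 0 = 0.
  rewrite /H /E exprS mul0r mul0r mul0r cexp0 big_ord_recl /= expr0 fact0 divr1 big1 ?addr0 ?subrr ?mulr0//; first by rewrite /= subr0.
  by move=> i _; rewrite /bump /= add1n exprS !mul0r.
by rewrite /H /E expr1n !mul1r !subr0 subr_ge0.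
Qed.

(** One factor [exp (rho * |ln mu|)] bounds [(rho * |ln mu|) ^ k / k!], the other the exponential in
    [cexp_taylor]. *)
Lemma taylor_cpow (mu : R) w rho : 0 < rho ->
  taylor (fun s => cpow mu (- s)) w rho (expR (- complex.Re w * ln mu) * expR (2 * rho * `|ln mu|))
   (fun j => cpow mu (- w) * ((- ln mu)%:C ^+ j / (j`!)%:R)).
Proof.
move=> r0 k x xr; rewrite opprD cpowD.
under eq_bigr do rewrite -mulrA.
rewrite -mulr_sumr -mulrBr cabsM cabs_cpow ReN -mulrA ler_wpM2l ?expR_ge0//.
have := cexp_taylor k (- x * (ln mu)%:C).
have -> : \sum_(j < k) (- x * (ln mu)%:C) ^+ j / j`!%:R =
   \sum_(i < k) (- ln mu)%:C ^+ i / i`!%:R * x ^+ i.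
  by apply: eq_bigr => i _; rewrite rmorphN mulNr -mulrN mulrC exprMn; ring.
rewrite /cpow => /le_trans; apply.
rewrite cabsM cabsN cabsR; set l := `|ln mu|.
have l0 : 0 <= l by rewrite normr_ge0.
have x0 := cabs_ge0 x.
have e1 : expR (cabs x * l) <= expR (rho * l) by rewrite ler_expR ler_wpM2r.
have e2 : (cabs x * l) ^+ k / k`!%:R <= (cabs x / rho) ^+ k * expR (rho * l).
  have -> : (cabs x * l) ^+ k / k`!%:R = (cabs x / rho) ^+ k * ((rho * l) ^+ k / k`!%:R).
    by rewrite !exprMn exprVn; field; rewrite pnatr_eq0 -lt0n fact_gt0 expf_neq0 ?gt_eqF.
  rewrite ler_wpM2l ?exprn_ge0 ?divr_ge0 ?(ltW r0)//.
  have rl : 0 <= rho * l by rewrite mulr_ge0// ltW.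
  case: {e1 xr x x0} k => [|k]; first by rewrite expr0 fact0 divr1 -expR0 ler_expR.
  by have := expR_ge1Dxn k rl; lra.
have -> : 2 * rho * l = rho * l + rho * l by ring.
rewrite expRD [leRHS]mulrC mulrA; by apply: ler_pM => //; rewrite ?expR_ge0 ?divr_ge0 ?exprn_ge0 ?mulr_ge0.
Qed.

End TaylorSeries.

(** * Generalized Dirichlet series and their extremal zeros *)

Section DirichletSums.
Variables (R : realType) (alpha : R).
Hypothesis alpha_gt0 : 0 < alpha.
Implicit Types (a c : nat -> R[i]) (s w x z : R[i]) (C e sg t : R) (h : nat -> nat).

Definition mu (m : nat) : R := m%:R + alpha.

Lemma mu_gt0 m : 0 < mu m.
Proof. by rewrite /mu ltr_wpDl. Qed.

Lemma mu_lt m n : (m < n)%N -> mu m < mu n.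
Proof. by move=> mn; rewrite /mu ltrD2r ltr_nat. Qed.

Lemma mu_inj : injective mu.
Proof. by move=> m n /addIr /eqP; rewrite eqr_nat => /eqP. Qed.

Lemma mu_ge1 m : 1 <= mu m.+1.
Proof. by rewrite /mu -natr1; have := ler0n R m; have := alpha_gt0; lra. Qed.

Definition dterm a s m : R[i] := a m * cpow (mu m) (- s).
Definition dsum a s : R[i] := csum (dterm a s).

Lemma cabs_cpow_mu m s : cabs (cpow (mu m) (- s)) = mu m `^ (- complex.Re s).
Proof. by rewrite cabs_cpow_powR ?mu_gt0// ReN. Qed.

Definition mu_bound sg := alpha `^ (- sg) + 1 + (sg - 1)^-1.

Lemma sum_mu_le sg n : 1 < sg -> \sum_(m < n) mu m `^ (- sg) <= mu_bound sg.
Proof. exact: sum_shift_powR_le. Qed.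

Lemma mu_bound_ge0 sg : 1 < sg -> 0 <= mu_bound sg.
Proof. by move=> s1; rewrite !addr_ge0 ?powR_ge0// invr_ge0 subr_ge0 ltW. Qed.

Lemma dterm_summable a C s : (forall m, cabs (a m) <= C) -> 1 < complex.Re s ->
  csummable (dterm a s).
Proof.
move=> aC s1; have C0 : 0 <= C by apply: le_trans (cabs_ge0 _) (aC 0%N).
apply: (@csummable_dom _ _ (fun m => C * mu m `^ (- complex.Re s)) (C * mu_bound (complex.Re s))).
  by move=> m; rewrite cabsM cabs_cpow_mu ler_wpM2r ?powR_ge0.
by move=> n; rewrite -mulr_sumr ler_wpM2l// sum_mu_le.
Qed.

Lemma taylor_cpow_mu w : 1 < complex.Re w -> exists rho (b : nat -> R) B,
  [/\ 0 < rho, forall n, \sum_(m < n) b m <= B, forall m, 0 <= b m & forall m,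
   taylor (fun s => cpow (mu m) (- s)) w rho (b m)
     (fun j => cpow (mu m) (- w) * ((- ln (mu m))%:C ^+ j / (j`!)%:R))].
Proof.
(* With this radius [b m] is [mu m ^ (- (Re w - 2 rho))] for [m >= 1], still with an exponent beyond
   [1]. The first index is set apart because [mu 0] may be below [1]. *)
move=> w1; pose rho := (complex.Re w - 1) / 4; have r0 : 0 < rho by rewrite divr_gt0// subr_gt0.
pose b m := expR (- complex.Re w * ln (mu m)) * expR (2 * rho * `|ln (mu m)|).
have sg1 : 1 < complex.Re w - 2 * rho by rewrite /rho; lra.
exists rho, b, (b 0%N + mu_bound (complex.Re w - 2 * rho)); split => //; last first.
- by move=> m; exact: taylor_cpow.
- by move=> m; rewrite mulr_ge0 ?expR_ge0.
have b0 : 0 <= b 0%N by rewrite mulr_ge0 ?expR_ge0.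
case=> [|n]; first by rewrite big_ord0 addr_ge0// mu_bound_ge0.
rewrite big_ord_recl lerD2l; apply: le_trans (sum_mu_le n.+1 sg1).
rewrite [leRHS]big_ord_recl; apply: ler_wpDl; first exact: powR_ge0.
apply: ler_sum => i _; rewrite /b -expRD /powR gt_eqF ?mu_gt0// ler_expR.
have := mu_ge1 i; rewrite -[in mu _]/(bump 0 i); set y := mu _ => y1.
by rewrite ger0_norm ?ln_ge0//; lra.
Qed.

Lemma ana_dsum a C w : (forall m, cabs (a m) <= C) -> 1 < complex.Re w -> ana (dsum a) w.
Proof.
move=> aC w1; have C0 : 0 <= C by apply: le_trans (cabs_ge0 _) (aC 0%N).
have [rho [b [B [r0 bB b0 h]]]] := taylor_cpow_mu w1.
exists rho, (C * B); eexists; split => //.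
apply: (csum_taylor (b := fun m => cabs (a m) * b m)) => // [m|n].
  by apply: taylorZ; exact: h.
apply: le_trans (ler_wpM2l C0 (bB n)); rewrite mulr_sumr.
by apply: ler_sum => i _; rewrite ler_wpM2r.
Qed.

(** The radius [d] depends on [C] and [s] but not on the coefficients, hence is common to all
    twists. *)
Lemma dsum_unif_continuous C s e : 0 <= C -> 1 < complex.Re s -> 0 < e ->
  exists2 d, 0 < d & forall a, (forall m, cabs (a m) <= C) -> forall x, cabs x <= d ->
   1 < complex.Re (s + x) /\ cabs (dsum a (s + x) - dsum a s) <= e.
Proof.
move=> C0 s1 e0; have [rho [b [B [r0 bB b0 h]]]] := taylor_cpow_mu s1.
have B0 : 0 <= B by apply: le_trans (bB 0%N); rewrite big_ord0.
have s10 : 0 < complex.Re s - 1 by rewrite subr_gt0.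
have [t [t0 t1 te ts _]] := small_factor e0 s10 e0 (mulr_ge0 C0 B0) (ltW r0) (ltW r0).
exists (t * rho); first by rewrite mulr_gt0.
move=> a aC x xt.
have sx1 : 1 < complex.Re (s + x).
  by rewrite ReD; have := absRe_le_cabs x; rewrite ler_norml; lra.
split=> //; rewrite /dsum -csumB; [|exact: dterm_summable aC _..].
have xr : cabs x <= rho by apply: le_trans xt _; rewrite ger_pMl.
apply: cabs_csum => n.
apply: le_trans (_ : \sum_(m < n) C * (b m * t) <= _).
  apply: ler_sum => m _; rewrite /dterm -mulrBr cabsM; apply: ler_pM; rewrite ?cabs_ge0//.
  have := h m 1%N x xr; rewrite big_ord1 /= !expr0 fact0 divr1 !mulr1 expr1.
  move=> /le_trans; apply; rewrite ler_wpM2l//.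
  by rewrite ler_pdivrMr.
rewrite -mulr_sumr -mulr_suml; apply: le_trans (ltW te).
by rewrite [_ * t]mulrC mulrCA ler_wpM2l ?(ltW t0)// ler_wpM2l.
Qed.

Lemma cabs_exp_sub z w n : cabs z <= 1 -> cabs w <= 1 ->
  cabs (z ^+ n - w ^+ n) <= n%:R * cabs (z - w).
Proof.
move=> z1 w1; elim: n => [|n IH]; first by rewrite subrr cabs0 mul0r.
have -> : z ^+ n.+1 - w ^+ n.+1 = z * (z ^+ n - w ^+ n) + (z - w) * w ^+ n.
  by rewrite !exprS; ring.
apply: le_trans (cabsD _ _) _; rewrite !cabsM cabsX -natr1 mulrDl mul1r.
apply: lerD; last by rewrite ler_piMr ?cabs_ge0// exprn_ile1 ?cabs_ge0.
by apply: le_trans IH; rewrite ler_piMl ?cabs_ge0.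
Qed.

Lemma csum_exp_continuous a h e : csummable a -> 0 < e ->
  exists2 d, 0 < d & forall z w, cabs z <= 1 -> cabs w <= 1 -> cabs (z - w) <= d ->
   cabs (csum (fun m => a m * z ^+ h m) - csum (fun m => a m * w ^+ h m)) <= e.
Proof.
move=> [B aB] e0; have e3 : 0 < e / 3 by rewrite divr_gt0.
have [N hN] := cabs_csum_tail (fun i => cabs_ge0 (a i)) aB e3.
pose D := \sum_(m < N) cabs (a m) * (h m)%:R.
have D0 : 0 <= D by apply: sumr_ge0 => i _; rewrite mulr_ge0 ?cabs_ge0.
have [t [t0 t1 te _ _]] := small_factor e3 e3 e3 D0 D0 D0.
exists t => // z w z1 w1 zw.
have dom y : cabs y <= 1 -> forall m, cabs (a m * y ^+ h m) <= cabs (a m).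
  by move=> y1 m; rewrite cabsM cabsX ler_piMr ?cabs_ge0// exprn_ile1 ?cabs_ge0.
have h1 := hN _ (dom z z1) N (leqnn _); have h2 := hN _ (dom w w1) N (leqnn _).
have h3 : cabs (\sum_(i < N) a i * z ^+ h i - \sum_(i < N) a i * w ^+ h i) <= t * D.
  rewrite -sumrB /D mulr_sumr; apply: le_trans (cabs_sum _ _ _) _.
  apply: ler_sum => i _; rewrite -mulrBr cabsM mulrCA ler_wpM2l ?cabs_ge0//.
  by apply: le_trans (cabs_exp_sub _ z1 w1) _; rewrite mulrC ler_wpM2r.
move: h1 h2 h3; set A := csum _; set A' := \sum_(i < N) _; set E := csum _; set E' := \sum_(i < N) _.
move=> h1 h2 h3.
have -> : A - E = (A - A') + (A' - E') - (E - E') by ring.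
apply: le_trans (cabsD _ _) _; rewrite cabsN.
by have := cabsD (A - A') (A' - E'); lra.
Qed.

(** Far to the right the term [n0] dominates all later ones. As [sg] is uniform in [a], it bounds
    the real parts of the zeros of all twists, which supplies the compactness in
    [zero_on_circle]. *)
Lemma dsum_neq0 C d (n0 : nat) : 0 <= C -> 0 < d -> exists sg, forall a,
  (forall m, cabs (a m) <= C) -> (forall m, (m < n0)%N -> a m = 0) -> d <= cabs (a n0) ->
  forall s, sg <= complex.Re s -> dsum a s != 0.
Proof.
move=> C0 d0; pose K := mu_bound 2; have K0 : 0 <= K by apply: mu_bound_ge0; lra.
pose x := ln (mu n0.+1) - ln (mu n0).
have x0 : 0 < x by rewrite subr_gt0 ltr_ln ?posrE ?mu_gt0// mu_lt.
pose D := C * K * mu n0.+1 `^ 2 / d.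
have D0 : 0 <= D by rewrite !mulr_ge0 ?powR_ge0// invr_ge0 ltW.
exists (2 + D / x) => a aC a0 an0 s sg.
have Dx : 0 <= D / x by rewrite divr_ge0// ltW.
have s2 : 2 <= complex.Re s by lra.
have s1 : 1 < complex.Re s by lra.
have sa := dterm_summable aC s1.
pose sr := complex.Re s.
have tail : cabs (dsum a s - \sum_(i < n0.+1) dterm a s i) <= C * K * mu n0.+1 `^ (2 - sr).
  apply: cabs_csum_sub => // n.
  apply: le_trans (_ : \sum_(i < n) C * mu n0.+1 `^ (2 - sr) * mu (n0.+1 + i)%N `^ (- 2) <= _).
    apply: ler_sum => i _; rewrite /dterm cabsM cabs_cpow_mu -mulrA; apply: ler_pM; rewrite ?cabs_ge0 ?powR_ge0//.
    rewrite (_ : 2 - sr = - (sr - 2)); last by ring.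
    have -> : - complex.Re s = - (sr - 2) + - 2 by rewrite /sr; ring.
    rewrite powRD; last by apply/implyP => _; rewrite gt_eqF ?mu_gt0.
    rewrite ler_wpM2r ?powR_ge0//.
    apply: powR_antitone; rewrite ?mu_gt0 ?subr_ge0// /mu lerD2r ler_nat leq_addr//.
  rewrite -mulr_sumr -mulrA [leRHS]mulrAC -!mulrA ler_wpM2l// ler_wpM2l ?powR_ge0//.
  apply: le_trans (sum_mu_le (n0.+1 + n) _); last lra.
  by rewrite (sum_nat_shift (fun m => mu m `^ (- 2))); apply: ler_wpDl => //; apply: sumr_ge0 => i _; exact: powR_ge0.
rewrite big_ord_recr /= big1 ?add0r in tail; last by move=> i _; rewrite /dterm a0// mul0r.
apply/eqP => E; rewrite E sub0r cabsN /dterm cabsM cabs_cpow_mu -/sr in tail.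
have : d * mu n0 `^ (- sr) <= C * K * mu n0.+1 `^ (2 - sr).
  by apply: le_trans tail; rewrite ler_wpM2r ?powR_ge0.
apply/negP; rewrite -ltNge.
have -> : mu n0.+1 `^ (2 - sr) = mu n0.+1 `^ 2 * mu n0.+1 `^ (- sr).
  by rewrite -powRD//; apply/implyP => _; rewrite gt_eqF ?mu_gt0.
have -> : mu n0 `^ (- sr) = mu n0.+1 `^ (- sr) * expR (sr * x).
  by rewrite /powR !gt_eqF ?mu_gt0// -expRD; congr expR; rewrite /x; ring.
have -> : C * K * (mu n0.+1 `^ 2 * mu n0.+1 `^ (- sr)) = d * (mu n0.+1 `^ (- sr) * D).
  by rewrite /D; field; rewrite gt_eqF.
rewrite ltr_pM2l// ltr_pM2l ?powR_gt0 ?mu_gt0//.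
apply: lt_le_trans (expR_ge1Dx _).
have : D <= sr * x by rewrite -ler_pdivrMr//; rewrite /sr; lra.
lra.
Qed.

(* Among the zeros [(s, z)] with [Im s] fixed take one with [Re s] maximal, and
   then [|z|] maximal. If [|z| < 1], Hurwitz's theorem in the variable [z] moves
   the zero to a larger [Re s]. *)

Lemma zero_on_circle c h C (n0 : nat) s0 z0 : (forall m, cabs (c m) <= C) ->
  (forall m, (m < n0)%N -> c m = 0) -> c n0 != 0 -> h n0 = 0%N ->
  1 < complex.Re s0 -> cabs z0 <= 1 -> dsum (fun m => c m * z0 ^+ h m) s0 = 0 ->
  exists s z, [/\ 1 < complex.Re s, cabs z = 1, dsum (fun m => c m * z ^+ h m) s = 0 &
    forall t, 0 < t -> dsum (fun m => c m * z ^+ h m) (s + t%:C) != 0].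
Proof.
move=> cC c0 cn0 hn0 s01 z01 Z0.
have C0 : 0 <= C by apply: le_trans (cabs_ge0 _) (cC 0%N).
have dom z : cabs z <= 1 -> forall m, cabs (c m * z ^+ h m) <= C.
  move=> z1 m; apply: le_trans (cC m); rewrite cabsM cabsX ler_piMr ?cabs_ge0//.
  by rewrite exprn_ile1 ?cabs_ge0.
have [sg1 nz] := @dsum_neq0 C (cabs (c n0)) n0 C0 ltac:(by rewrite cabs_gt0).
have nz' z s : cabs z <= 1 -> dsum (fun m => c m * z ^+ h m) s = 0 -> complex.Re s < sg1.
  move=> z1 E; rewrite ltNge; apply/negP => /(nz (fun m => c m * z ^+ h m)); rewrite E eqxx.
  move=> H; apply: notF; apply: H.
  - exact: dom.
  - by move=> m /c0 ->; rewrite mul0r.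
  - by rewrite hn0 expr0 mulr1.
pose t0 := complex.Im s0; pose sg0 := complex.Re s0.
pose K (p : R[i] * R[i]) := [/\ complex.Im p.1 = t0, sg0 <= complex.Re p.1, complex.Re p.1 <= sg1,
   cabs p.2 <= 1 & dsum (fun m => c m * p.2 ^+ h m) p.1 = 0].
have dsE z s : dsum (fun m => c m * z ^+ h m) s = csum (fun m => dterm c s m * z ^+ h m).
  by apply: eq_csum => m; rewrite /dterm mulrAC.
have [||||| [s z] [/= sI s0' s1' z1 Zs] hp] := @compact_lexi_argmax R K (fun p => complex.Re p.1)
   (fun p => cabs p.2) (1 + `|sg0| + `|sg1| + `|t0|).
- by exists (s0, z0); split => //=; apply: ltW; exact: nz' Z0.
- move=> p [pI p0 p1 p2 _]; split.
    apply: le_trans (cabs_le_ReIm _) _; rewrite pI lerD2r.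
    rewrite ler_norml; have := ler_norm sg1; have := ler_norm (- sg0); rewrite normrN.
    by have := normr_ge0 sg1; have := normr_ge0 sg0; slra.
  by have := normr_ge0 sg1; have := normr_ge0 sg0; have := normr_ge0 t0; slra.
- move=> p hp.
  have p2 : cabs p.2 <= 1.
    apply/ler_addgt0Pr => e e0; have [q [_ _ _ q2 _] [_ pq]] := hp e e0.
    by have := cabs_subl p.2 q.2; slra.
  have re e : 0 < e -> exists q, [/\ K q, `|complex.Re p.1 - complex.Re q.1| <= e &
       `|complex.Im p.1 - complex.Im q.1| <= e].
    move=> e0; have [q Kq [pq _]] := hp e e0; exists q; rewrite -ReB -ImB; split => //.
      exact: le_trans (absRe_le_cabs _) pq.
    exact: le_trans (absIm_le_cabs _) pq.
  have p0 : sg0 <= complex.Re p.1.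
    by apply/ler_addgt0Pr => e /re[q [[_ q0 _ _ _] /ler_normlP[h1 h2] _]]; slra.
  have p1 : complex.Re p.1 <= sg1.
    by apply/ler_addgt0Pr => e /re[q [[_ _ q1 _ _] /ler_normlP[h1 h2] _]]; slra.
  have p11 : 1 < complex.Re p.1 by apply: lt_le_trans p0.
  split=> //.
    apply/eqP; rewrite -subr_eq0 -normr_eq0 eq_le normr_ge0 andbT.
    by apply/ler_addgt0Pr => e /re[q [[-> _ _ _ _] _ hq]]; rewrite add0r.
  (* Vanishing passes to the limit in two moves: [z] at the fixed point [p.1], then [s] uniformly in
     the twist. *)
  apply: eq_of_cabs => e e0; rewrite subr0.
  have e2 : 0 < e / 2 by rewrite divr_gt0.
  have [d d0 hd] := dsum_unif_continuous C0 p11 e2.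
  have [d' d'0 hd'] := @csum_exp_continuous (dterm c p.1) h (e / 2) (dterm_summable cC p11) e2.
  have [q [_ _ _ q2 Zq] [pq1 pq2]] := hp (Num.min d d') ltac:(by rewrite lt_min d0).
  rewrite le_min in pq1; rewrite le_min in pq2; case/andP: pq1 => pq1 _; case/andP: pq2 => _ pq2.
  have := hd' p.2 q.2 p2 q2 pq2; rewrite -!dsE => h1.
  have [_] := hd _ (dom _ q2) (q.1 - p.1) ltac:(by rewrite cabsB).
  have -> : p.1 + (q.1 - p.1) = q.1 by ring.
  rewrite Zq sub0r cabsN => h2.
  rewrite -[X in cabs X](subrK (dsum (fun m => c m * q.2 ^+ h m) p.1)).
  by apply: le_trans (cabsD _ _) _; slra.
- move=> p _ e e0; exists e => // q _ [pq _]; rewrite -ReB.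
  exact: le_trans (absRe_le_cabs _) pq.
- move=> p _ e e0; exists e => // q _ [_ pq].
  have := cabs_subl p.2 q.2; have := cabs_subl q.2 p.2; rewrite [cabs (q.2 - _)]cabsB.
  by rewrite ler_norml => h1 h2; apply/andP; split; slra.
have s1 : 1 < complex.Re s by apply: lt_le_trans s0'.
exists s, z; split => //; last first.
  move=> t t0'; apply/eqP => Zt; have [|+ _] := hp (s + t%:C, z); last first.
    by rewrite [_.1]/= ReD gerDl leNgt => /negP; apply.
  split => //; [by rewrite ImD addr0 | by apply: le_trans s0' _; rewrite ReD lerDl; exact: ltW |].
  by apply: ltW; apply: nz' Zt.
apply/eqP; rewrite eq_le z1 leNgt; apply/negP => zlt.
have az : ana (fun z => dsum (fun m => c m * z ^+ h m) s) z.
  have -> : (fun z => dsum (fun m => c m * z ^+ h m) s) =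
     (fun z => csum (fun m => dterm c s m * z ^+ h m)) by apply/funext => y; exact: dsE.
  by apply: ana_csum_exp => //; exact: dterm_summable cC s1.
(* If the series vanishes identically in the variable [z] near the zero, moving [z] radially
   outwards keeps the zero and contradicts the maximality of [|z|]. Otherwise a small circle
   separates the zero and Hurwitz's theorem applies. *)
have [[d d0 hd]|iso] := isolated_zero az Zs.
  pose r := Num.min d (1 - cabs z); have r0 : 0 < r by rewrite lt_min d0 subr_gt0.
  pose x : R[i] := if z == 0 then r%:C else (r / cabs z)%:C * z.
  have xr : cabs x = r.
    rewrite /x; case: eqVneq => [_|z0']; first by rewrite cabsR gtr0_norm.
    have cz : 0 < cabs z by rewrite cabs_gt0.
    by rewrite cabsM cabsR gtr0_norm ?divr_gt0// divfK// gt_eqF.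
  have zx : cabs (z + x) = cabs z + r.
    rewrite /x; case: eqVneq => [->|z0']; first by rewrite cabs0 !add0r cabsR gtr0_norm.
    have cz : 0 < cabs z by rewrite cabs_gt0.
    have -> : z + (r / cabs z)%:C * z = (1 + r / cabs z)%:C * z by rewrite rmorphD /=; ring.
    rewrite cabsM cabsR gtr0_norm; last by rewrite addr_gt0// divr_gt0.
    by rewrite mulrDl mul1r divfK// gt_eqF.
  have rz : r <= 1 - cabs z by rewrite ge_min lexx orbT.
  have [|_ /= /(_ erefl)] := hp (s, z + x); last by rewrite zx; slra.
  split; [exact: sI | exact: s0' | exact: s1' | by rewrite [_.2]/= zx; slra |].
  by apply: hd; rewrite xr ge_min lexx.
have [r [m [r0 re m0 hm]]] := iso ((1 - cabs z) / 2) ltac:(by rewrite divr_gt0// subr_gt0).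
have m4 : 0 < m / 4 by rewrite divr_gt0.
have [d d0 hd] := dsum_unif_continuous C0 s1 m4.
have dC : cabs (d%:C : R[i]) = d by rewrite cabsR gtr0_norm.
have sd1 : 1 < complex.Re (s + d%:C) by rewrite ReD /=; slra.
have inD y : cabs (y - z) <= r -> cabs y < 1.
  by move=> yr; have := cabs_subl y z; slra.
have [|||| y yr Zy] := @zero_perturb R (fun z => dsum (fun m => c m * z ^+ h m) s) z r (m / 4)
   (fun z => dsum (fun m => c m * z ^+ h m) (s + d%:C)) r0.
- move=> y /inD y1.
  have -> : (fun z => dsum (fun m => c m * z ^+ h m) (s + d%:C)) =
     (fun z => csum (fun m => dterm c (s + d%:C) m * z ^+ h m)) by apply/funext => u; exact: dsE.
  by apply: ana_csum_exp => //; exact: dterm_summable cC sd1.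
- by rewrite Zs cabs0 ltW.
- by move=> y yr; have := hm (y - z) yr; rewrite addrC subrK; slra.
- by move=> y /inD y1; have [_] := hd _ (dom y (ltW y1)) d%:C ltac:(by rewrite dC).
have y1 : cabs y < 1 by apply: inD; exact: ltW.
have [|/=] := hp (s + d%:C, y).
  split; [by rewrite ImD addr0 | by apply: le_trans s0' _; rewrite ReD lerDl; exact: ltW | | exact: ltW | exact: Zy].
  by apply: ltW; apply: nz' Zy; exact: ltW.
by rewrite ReD /=; slra.
Qed.

End DirichletSums.

(** * Mean values, Kronecker's theorem and the passage from twists to translates *)

Section MeanValues.
Variable R : realType.
Implicit Types (t T e l : R).

Lemma cis_mean_bound l : l != 0 -> `|l| <= 1 ->
  exists2 K : R, 0 <= K & forall n, cabs (\sum_(j < n) cis (l *+ j)) <= K.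
Proof.
move=> l0 l1; have x1 : cis l != 1.
  by apply/eqP => /cis_eq1 /(_ l1) lE; rewrite lE eqxx in l0.
have d0 : 0 < cabs (cis l - 1) by rewrite cabs_gt0 subr_eq0.
exists (2 / cabs (cis l - 1)) => [|n]; first by rewrite divr_ge0 ?cabs_ge0.
rewrite ler_pdivlMr// -cabsM mulrC.
under eq_bigr do rewrite cisMn.
rewrite -subrX1; apply: le_trans (cabsD _ _) _.
by rewrite cabsN cabs1 cabsX cabs_cis expr1n.
Qed.

(* Average over a long arithmetic progression of [t]'s with small step: the mean
   of [cis (t * L)] tends to [0] unless [L = 0]. *)
Lemma mean_value (I : finType) (c : I -> R[i]) (L : I -> R) T e : 0 < e ->
  exists2 t, T <= t & complex.Re (\sum_(i | L i == 0) c i) - e <=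
    complex.Re (\sum_i c i * cis (t * L i)).
Proof.
(* The step is so small that [|d * L i| <= 1], hence [cis (d * L i) = 1] only when [L i = 0]. *)
move=> e0; pose d := (1 + \sum_i `|L i|)^-1.
have S0 : 0 <= \sum_i `|L i| by apply: sumr_ge0.
have d0 : 0 < d by rewrite invr_gt0; lra.
have dL i : `|d * L i| <= 1.
  rewrite normrM gtr0_norm// mulrC ler_pdivrMr ?mul1r; last lra.
  by rewrite (bigD1 i) //= addrCA lerDl addr_ge0// sumr_ge0.
have hK i : exists K, 0 <= K /\ (L i != 0 -> forall n, cabs (\sum_(j < n) cis ((d * L i) *+ j)) <= K).
  have [->|Li] := eqVneq (L i) 0; first by exists 0.
  have [|K K0 hK] := @cis_mean_bound (d * L i) _ (dL i); first by rewrite mulf_neq0// gt_eqF.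
  by exists K.
have [K HK] := choice hK.
pose S := \sum_i cabs (c i) * K i.
have S0' : 0 <= S by apply: sumr_ge0 => i _; rewrite mulr_ge0 ?cabs_ge0//; case: (HK i).
have [n] : exists n : nat, S < e * n.+1%:R.
  exists (Num.truncn (S / e)); have := truncnS_gt (S / e).
  by rewrite ltr_pdivrMr// mulrC.
move=> hn; set A := complex.Re (\sum_(i | L i == 0) c i).
apply: contrapT => H.
have lt (j : nat) : complex.Re (\sum_i c i * cis ((T + d *+ j) * L i)) < A - e.
  rewrite ltNge; apply/negP => h; apply: H; exists (T + d *+ j) => //.
  by rewrite lerDl mulrn_wge0// ltW.
have : \sum_(j < n.+1) complex.Re (\sum_i c i * cis ((T + d *+ j) * L i)) < \sum_(j < n.+1) (A - e).
  by apply: ltr_sum => //; apply/hasP; exists ord0; rewrite // mem_index_enum.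
rewrite sumr_const card_ord -Re_sum exchange_big /=.
rewrite (bigID (fun i => L i == 0)) /= ReD.
have -> : \sum_(i | L i == 0) \sum_(j < n.+1) c i * cis ((T + d *+ j) * L i) =
    (\sum_(i | L i == 0) c i) *+ n.+1.
  rewrite -sumrMnl; apply: eq_bigr => i /eqP Li.
  under eq_bigr do rewrite Li mulr0 cis0 mulr1.
  by rewrite sumr_const card_ord.
have -> : complex.Re ((\sum_(i | L i == 0) c i) *+ n.+1) = A *+ n.+1.
  by rewrite /A; elim: n.+1 => [//|m IH]; rewrite !mulrS ReD IH.
have : cabs (\sum_(i | L i != 0) \sum_(j < n.+1) c i * cis ((T + d *+ j) * L i)) <= S.
  apply: le_trans (cabs_sum _ _ _) _; rewrite big_mkcond /=.
  apply: ler_sum => i _; have [K0 hi] := HK i.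
  case: ifP => Li; last by rewrite mulr_ge0 ?cabs_ge0.
  have -> : \sum_(j < n.+1) c i * cis ((T + d *+ j) * L i) =
     c i * cis (T * L i) * \sum_(j < n.+1) cis ((d * L i) *+ j).
    rewrite mulr_sumr; apply: eq_bigr => j _; rewrite -mulrA -cisD mulrDl.
    by rewrite mulrnAl.
  rewrite 2!cabsM cabs_cis mulr1 ler_wpM2l ?cabs_ge0//.
  exact: hi.
set Q := \sum_(i | L i != 0) _ => Qs.
have := absRe_le_cabs Q; rewrite ler_norml => /andP[h1 _].
rewrite mulrnBl -(mulr_natr e); move: hn h1 Qs.
by move: (e * n.+1%:R) (A *+ n.+1) (complex.Re Q) (cabs Q) => *; lra.
Qed.

End MeanValues.

Section Kronecker.
Variables (R : realType) (alpha : R).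
Hypothesis alpha_gt0 : 0 < alpha.
Local Notation mu := (mu alpha).

(** Lists stand for multisets of indices. For nonzero [phi] the condition says that [mu m |-> phi m]
    extends to a character of the multiplicative group generated by the [mu m]. *)
Definition respects_relations (phi : nat -> R[i]) := forall s s' : seq nat,
  \prod_(m <- s) mu m = \prod_(m <- s') mu m ->
  \prod_(m <- s) phi m = \prod_(m <- s') phi m.

Definition additive_on_relations (v : nat -> nat) := forall s s' : seq nat,
  \prod_(m <- s) mu m = \prod_(m <- s') mu m ->
  (\sum_(m <- s) v m = \sum_(m <- s') v m)%N.

Lemma ln_prod (I : Type) (s : seq I) (F : I -> R) : (forall i, 0 < F i) ->
  ln (\prod_(i <- s) F i) = \sum_(i <- s) ln (F i).
Proof.
move=> F0; elim: s => [|i s IH]; first by rewrite !big_nil ln1.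
by rewrite !big_cons lnM ?IH// posrE// prodr_gt0.
Qed.

Lemma prod_flatten_nseq (T : comPzSemiRingType) N (k : 'I_N -> nat) (F : nat -> T) :
  \prod_(m <- flatten [seq nseq (k i) (val i) | i <- enum 'I_N]) F m = \prod_(i < N) F i ^+ k i.
Proof.
rewrite big_flatten /= big_map big_enum /=; apply: eq_bigr => i _.
by rewrite big_nseq; elim: (k i) => [//|n IH] /=; rewrite IH exprS.
Qed.

(** Cauchy-Schwarz against the constant sequence: the squares of the deviations of the binomial
    coefficients from their mean [2 ^ p / (p + 1)] have a nonnegative sum. *)
Lemma sum_sqr_binomial_ge p : (4 ^+ p : R) / p.+1%:R <= \sum_(j < p.+1) ('C(p, j)%:R ^+ 2 : R).
Proof.
have E : \sum_(j < p.+1) ('C(p, j)%:R : R) = 2 ^+ p.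
  have := exprDn (1 : R) 1 p; rewrite -[1 + 1]/(2 : R) => ->.
  by apply: eq_bigr => j _; rewrite !expr1n mulr1.
rewrite ler_pdivrMr ?ltr0n//.
have -> : (4 : R) ^+ p = 2 ^+ p * 2 ^+ p by rewrite -exprMn; congr (_ ^+ _); ring.
rewrite -{1}E -{1}E.
set N : R := p.+1%:R; set A : R := 2 ^+ p in E *.
have N0 : 0 < N by rewrite ltr0n.
have : 0 <= \sum_(j < p.+1) ('C(p, j)%:R - A / N) ^+ 2 :> R by apply: sumr_ge0 => i _; exact: sqr_ge0.
have -> : \sum_(j < p.+1) ('C(p, j)%:R - A / N) ^+ 2 =
   \sum_(j < p.+1) 'C(p, j)%:R ^+ 2 - 2 * (A / N) * A + (A / N) ^+ 2 * N :> R.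
  under eq_bigr do rewrite sqrrB.
  rewrite big_split sumrB /= sumr_const card_ord -[_ *+ p.+1]mulr_natr.
  congr (_ - _ + _).
  under eq_bigr do rewrite -mulrnAr.
  by rewrite -mulr_suml E -mulr_natl; ring.
have -> : 2 * (A / N) * A = 2 * (A ^+ 2 / N) by field; rewrite gt_eqF.
have -> : (A / N) ^+ 2 * N = A ^+ 2 / N by field; rewrite gt_eqF.
rewrite E; set S := \sum_(j < p.+1) _ => h.
have : A ^+ 2 / N <= S by move: h; move: (A ^+ 2 / N) => q; lra.
by rewrite ler_pdivrMr// expr2.
Qed.

Lemma exp_beats_power (x : R) N : 0 <= x -> x < 1 -> exists p : nat, x ^+ p * p.+1%:R ^+ N < 1.
Proof.
rewrite le_eqVlt => /predU1P[<- _|x0 x1]; first by exists 1%N; rewrite expr1 mul0r.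
pose l := - ln x; have l0 : 0 < l by rewrite oppr_gt0 ln_lt0// x0.
have xE : x = expR (- l) by rewrite opprK lnK.
pose C := N.+1`!%:R / l ^+ N.+1 * expR l.
have f0 : 0 < N.+1`!%:R :> R by rewrite ltr0n fact_gt0.
have C0 : 0 <= C by rewrite mulr_ge0 ?expR_ge0// divr_ge0 ?exprn_ge0 ?ltW.
exists (Num.truncn C); have := truncnS_gt C; set p := Num.truncn C => hp.
have p0 : 0 < p.+1%:R :> R by rewrite ltr0n.
have lp : 0 <= l * p.+1%:R by rewrite mulr_ge0// ltW.
have h : (l * p.+1%:R) ^+ N.+1 / N.+1`!%:R <= expR (l * p.+1%:R).
  by have := expR_ge1Dxn N lp; lra.
have xp : x ^+ p = expR l / expR (l * p.+1%:R).
  by rewrite xE -expRM_natl -expRN -expRD; congr expR; rewrite -natr1; ring.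
rewrite xp; have E0 : 0 < expR (l * p.+1%:R) by exact: expR_gt0.
rewrite mulrAC ltr_pdivrMr// mul1r.
apply: lt_le_trans h; rewrite ltr_pdivlMr// exprMn [p.+1%:R ^+ N.+1]exprS.
have -> : expR l * p.+1%:R ^+ N * N.+1`!%:R = l ^+ N.+1 * (C * p.+1%:R ^+ N).
  by rewrite /C; field; rewrite expf_neq0// gt_eqF.
by rewrite ltr_pM2l ?exprn_gt0// ltr_pM2r ?exprn_gt0.
Qed.

(* Bohr's proof: if no [t] works, then [|prod (1 + y_m)^p|^2] is too small on
   average, [y_m = conj (phi m) mu_m^{-it}]; the relations satisfied by [phi] make all
   resonant terms of its mean value nonnegative. *)
Lemma kronecker phi N T e : (forall m, cabs (phi m) = 1) -> respects_relations phi ->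
  0 < e -> exists2 t, T <= t & forall m, (m < N)%N -> cabs (cis (- t * ln (mu m)) - phi m) <= e.
Proof.
move=> phi1 phir e0; apply: contrapT => H.
have bad t : T <= t -> exists2 m : 'I_N, true & e < cabs (cis (- t * ln (mu m)) - phi m).
  move=> Tt; apply: contrapT => h; apply: H; exists t => // m mN.
  by rewrite leNgt; apply/negP => he; apply: h; exists (Ordinal mN).
have phiJ m : phi m * (phi m)^* = 1 by rewrite -sqr_cabsJ phi1 expr1n.
pose y t m := (phi m)^* * cis (- t * ln (mu m)).
have y1 t m : cabs (y t m) = 1 by rewrite cabsM cabsJ phi1 cabs_cis mulr1.
have ysub t m : cabs (1 - y t m) = cabs (cis (- t * ln (mu m)) - phi m).
  rewrite -[LHS]mul1r -{1}(phi1 m) -cabsM mulrBr mulr1 /y mulrA phiJ mul1r.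
  by rewrite cabsB.
have para t m : cabs (1 + y t m) ^+ 2 = 4 - cabs (1 - y t m) ^+ 2.
  have := y1 t m; move/(congr1 (fun x => x ^+ 2)); rewrite !sqr_cabs.
  by case: (y t m) => a b /=; rewrite expr1n; lra.
(* A deviation above [e] at one index forces [|1 + y| ^ 2 <= 4 x] there, against the trivial bound
   [4]. Then [p] is taken so large that the gain [x ^ p] beats the loss [(p + 1) ^ N] of the lower
   bound for the mean square. *)
pose x := Num.max 0 (1 - e ^+ 2 / 4).
have x0 : 0 <= x by rewrite le_max lexx.
have x1 : x < 1 by rewrite gt_max ltr01 /= gtrBl divr_gt0// exprn_gt0.
have [p hp] := exp_beats_power N x0 x1.
pose F := {ffun 'I_N -> 'I_p.+1}.
pose cf (k : F) : R[i] := \prod_(m < N) ('C(p, k m)%:R * (phi m)^* ^+ k m).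
pose la (k : F) : R := - \sum_(m < N) ln (mu m) *+ k m.
pose V t := \prod_(m < N) (1 + y t m) ^+ p.
have VE t : V t = \sum_(k : F) cf k * cis (t * la k).
  rewrite /V.
  under eq_bigr => m _ do rewrite exprDn.
  rewrite bigA_distr_bigA /=; apply: eq_bigr => k _.
  rewrite /la mulrN -mulNr mulr_sumr cis_sum -big_split /=; apply: eq_bigr => m _.
  by rewrite expr1n mul1r -mulr_natl /y exprMn -cisMn mulrnAr mulrA.
have Vub t : T <= t -> cabs (V t) ^+ 2 <= 4 ^+ (p * N) * x ^+ p.
  move=> /bad[m0 _ hm0]; rewrite /V cabs_prod -prodrXl.
  have le4 m : cabs (1 + y t m) ^+ 2 <= 4 by rewrite para gerBl sqr_ge0.
  rewrite (bigD1 m0) //= exprM mulrC.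
  have -> : (4 ^+ p) ^+ N * x ^+ p = (\prod_(m < N | m != m0) 4 ^+ p) * (4 * x) ^+ p :> R.
    have -> : (4 ^+ p) ^+ N = \prod_(m < N) 4 ^+ p :> R by rewrite prodr_const card_ord.
    by rewrite (bigD1 m0) //= exprMn; ring.
  apply: ler_pM.
  - by apply: prodr_ge0 => i _; rewrite sqr_ge0.
  - by rewrite sqr_ge0.
  - apply: ler_prod => i _; rewrite sqr_ge0 /= cabsX exprAC.
    by rewrite lerXn2r// ?nnegrE ?sqr_ge0.
  - rewrite cabsX exprAC lerXn2r// ?nnegrE ?sqr_ge0 ?mulr_ge0//.
    rewrite para ysub; apply: le_trans (_ : 4 * (1 - e ^+ 2 / 4) <= _); last first.
      by rewrite ler_pM2l// le_max lexx orbT.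
    have : e ^+ 2 <= cabs (cis (- t * ln (mu m0)) - phi m0) ^+ 2.
      by rewrite lerXn2r ?nnegrE ?(ltW e0) ?cabs_ge0 ?(ltW hm0).
    lra.
have q0 : 0 < 4 ^+ (p * N) :> R by rewrite exprn_gt0.
pose lo : R := 4 ^+ (p * N) / p.+1%:R ^+ N.
have pN0 : 0 < p.+1%:R ^+ N :> R by rewrite exprn_gt0// ltr0n.
have lohi : 4 ^+ (p * N) * x ^+ p < lo.
  by rewrite /lo ltr_pdivlMr// -mulrA -[X in _ < X]mulr1 ltr_pM2l.
pose e' := (lo - 4 ^+ (p * N) * x ^+ p) / 2.
have e'0 : 0 < e' by rewrite divr_gt0// subr_gt0.
have JM (a b : R[i]) : ((a * b)^*)%R = (a^* * b^*)%R by exact: rmorphM.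
have [t Tt] := @mean_value R (F * F)%type (fun kk => cf kk.1 * (cf kk.2)^*) (fun kk => la kk.1 - la kk.2) T _ e'0.
have -> : \sum_(kk : F * F) cf kk.1 * (cf kk.2)^* * cis (t * (la kk.1 - la kk.2)) = (cabs (V t) ^+ 2)%:C.
  rewrite sqr_cabsJ VE rmorph_sum /= big_distrlr /= pair_bigA /=; apply: eq_bigr => -[k k'] _ /=.
  rewrite [X in _ = _ * X](_ : _ = (cf k')^* * cis (- (t * la k'))); last by rewrite -cisJ; exact: JM.
  by rewrite mulrBr cisD mulrN; ring.
have -> : complex.Re (cabs (V t) ^+ 2)%:C = cabs (V t) ^+ 2 by [].
have := Vub t Tt.
suff : lo <= complex.Re (\sum_(kk : F * F | la kk.1 - la kk.2 == 0) cf kk.1 * (cf kk.2)^*).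
  by rewrite /e'; lra.
pose bn (k : F) : R := \prod_(m < N) 'C(p, k m)%:R.
have bn0 k : 0 <= bn k by apply: prodr_ge0.
have res (k k' : F) : la k - la k' == 0 -> cf k * (cf k')^* = (bn k * bn k')%:C.
  rewrite subr_eq0 => /eqP /oppr_inj E.
  have pE (k1 : F) : \sum_(m < N) ln (mu m) *+ k1 m =
      ln (\prod_(m <- flatten [seq nseq (k1 i) (val i) | i <- enum 'I_N]) mu m).
    rewrite prod_flatten_nseq ln_prod; last by move=> i; rewrite exprn_gt0// mu_gt0.
    by apply: eq_bigr => i _; rewrite lnXn// mu_gt0.
  have := E; rewrite !pE => /ln_inj.
  rewrite !posrE !prodr_gt0; [|by move=> *; exact: mu_gt0..] => /(_ isT isT) /phir.
  rewrite !prod_flatten_nseq => pp.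
  rewrite /cf !big_split /= rmorphM /= !rmorph_prod /= rmorphM /= !rmorph_prod /=.
  have J : (\prod_(i < N) (phi i)^* ^+ k i) * (\prod_(i < N) ((phi i)^* ^+ k' i)^*) = 1.
    have -> : \prod_(i < N) ((phi i)^* ^+ k' i)^* = \prod_(i < N) phi i ^+ k' i.
      by apply: eq_bigr => i _; rewrite rmorphXn /=; congr (_ ^+ _); exact: conjcK.
    rewrite -pp -big_split /= big1// => i _.
    by rewrite -exprMn mulrC phiJ expr1n.
  have b1 (k1 : F) : \prod_(i < N) ('C(p, k1 i)%:R : R)%:C = \prod_(i < N) 'C(p, k1 i)%:R.
    by apply: eq_bigr => i _; rewrite rmorph_nat.
  rewrite !b1.
  have -> : \prod_(i < N) ('C(p, k' i)%:R : R[i])^* = \prod_(i < N) 'C(p, k' i)%:R.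
    by apply: eq_bigr => i _; exact: conjc_nat.
  by rewrite mulrACA J mulr1.
rewrite -(pair_big_dep xpredT (fun k k' => la k - la k' == 0) (fun k k' => cf k * (cf k')^*)) /=.
rewrite Re_sum; apply: le_trans (_ : \sum_(k : F) bn k ^+ 2 <= _); last first.
  apply: ler_sum => k _; rewrite Re_sum (bigD1 k) ?subrr//=.
  rewrite res ?subrr// -expr2 /=; apply: ler_wpDr => //; apply: sumr_ge0 => k' /andP[kk _].
  by rewrite res// mulr_ge0.
have -> : \sum_(k : F) bn k ^+ 2 = \prod_(m < N) \sum_(j < p.+1) ('C(p, j)%:R ^+ 2 : R).
  by rewrite bigA_distr_bigA; apply: eq_bigr => k _; rewrite -prodrXl.
have -> : lo = \prod_(m < N) (4 ^+ p / p.+1%:R).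
  by rewrite prodr_const card_ord expr_div_n -exprM.
apply: ler_prod => m _; rewrite sum_sqr_binomial_ge andbT.
by rewrite divr_ge0// exprn_ge0.
Qed.

Lemma ana_shift (g : R[i] -> R[i]) (u w : R[i]) : ana g (w + u) -> ana (fun s => g (s + u)) w.
Proof.
move=> [rho [B [c [r0 h]]]]; exists rho, B, c; split => // k x xr.
by rewrite addrAC; exact: h.
Qed.


(** By [kronecker], a translate of [dsum alpha f] by some [i t] is uniformly close to the twisted
    series near [s]. The absence of zeros to the right of [s] on its horizontal line makes [s] an
    isolated zero, so a perturbation keeps a zero nearby. *)
Lemma zeros_of_twist f phi C s : (forall m, cabs (f m) <= C) -> (forall m, cabs (phi m) = 1) ->
  respects_relations phi -> 1 < complex.Re s -> dsum alpha (fun m => f m * phi m) s = 0 ->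
  (forall t : R, 0 < t -> dsum alpha (fun m => f m * phi m) (s + t%:C) != 0) ->
  forall T : R, exists s', [/\ 1 < complex.Re s', T <= complex.Im s' & dsum alpha f s' = 0].
Proof.
move=> fC phi1 phir s1 Zs nZ T.
have C0 : 0 <= C by apply: le_trans (cabs_ge0 _) (fC 0%N).
have fpC m : cabs (f m * phi m) <= C by rewrite cabsM phi1 mulr1.
have [[d d0 hd]|iso] := isolated_zero (ana_dsum alpha_gt0 fpC s1) Zs.
  have := nZ d d0; rewrite hd ?eqxx//.
  by rewrite cabsR gtr0_norm.
have [r [m [r0 rs m0 hm]]] := iso ((complex.Re s - 1) / 2) ltac:(by rewrite divr_gt0// subr_gt0).
have sr1 : 1 < complex.Re s - r by slra.
have m8 : 0 < m / 8 by rewrite divr_gt0.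
pose b n := 2 * C * mu n `^ (- (complex.Re s - r)).
have b0 n : 0 <= b n by rewrite !mulr_ge0 ?powR_ge0.
have bB n : \sum_(i < n) b i <= 2 * C * mu_bound alpha (complex.Re s - r).
  by rewrite -mulr_sumr ler_wpM2l ?mulr_ge0// sum_mu_le.
have [N' hN'] := bounded_sum_tail b0 bB m8.
(* The tail beyond [N] costs [m / 8], and the head, where Kronecker's theorem applies, another
   [m / 8]. The successor keeps the index [0], where [mu] may be below [1], out of the tail. *)
pose N := N'.+1; have hN n : \sum_(i < n) b (N + i)%N <= m / 8 by apply: hN'; rewrite leqnSn.
pose D := \sum_(i < N) C * (mu i `^ (- (complex.Re s - r)) + mu i `^ (- (complex.Re s + r))).
have D0 : 0 <= D by apply: sumr_ge0 => i _; rewrite mulr_ge0// addr_ge0 ?powR_ge0.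
have [e [e0 e1 eD _ _]] := small_factor m8 m8 m8 D0 D0 D0.
have [t Tt ht] := kronecker N (T + r - complex.Im s) phi1 phir e0.
pose u : R[i] := 0 +i* t.
have uE n y : cpow (mu n) (- (y + u)) = cis (- t * ln (mu n)) * cpow (mu n) (- y).
  rewrite opprD cpowD mulrC; congr (_ * _).
  have -> : - u = 0 +i* (- t) by apply/eqP; rewrite eq_complex /= oppr0 !eqxx.
  by rewrite cpow_cis.
have Rey y : cabs (y - s) <= r -> complex.Re s - r <= complex.Re y /\ complex.Re y <= complex.Re s + r.
  move=> ys; have := le_trans (absRe_le_cabs _) ys; rewrite ReB ler_norml => /andP[h1 h2]; slra.
have Reu y : complex.Re (y + u) = complex.Re y by rewrite ReD addr0.
have [|||| y yr Zy] := @zero_perturb R (dsum alpha (fun m => f m * phi m)) s r (m / 4)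
   (fun y => dsum alpha f (y + u)) r0.
- move=> y /Rey[y1 _]; apply: ana_shift; apply: ana_dsum fC _ => //.
  by rewrite Reu; slra.
- by rewrite Zs cabs0 divr_ge0// ltW.
- move=> y yr; have := hm (y - s) yr.
  have -> : s + (y - s) = y by rewrite addrC subrK.
  by slra.
- move=> y /Rey[y1 y2].
  have y11 : 1 < complex.Re y by slra.
  rewrite /dsum -csumB; [|by apply: dterm_summable fC _ => //; rewrite Reu|exact: dterm_summable fpC _].
  have dE n : dterm alpha f (y + u) n - dterm alpha (fun m => f m * phi m) y n =
     f n * (cis (- t * ln (mu n)) - phi n) * cpow (mu n) (- y).
    by rewrite /dterm uE; ring.
  under eq_csum do rewrite dE.
  set U := fun n => _.
  have U2 n : cabs (U n) <= 2 * C * mu n `^ (- complex.Re y).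
    rewrite /U 2!cabsM cabs_cpow_mu// ler_wpM2r ?powR_ge0// mulrC ler_pM ?cabs_ge0//.
    by apply: le_trans (cabsD _ _) _; rewrite cabsN cabs_cis phi1.
  have sU : csummable U.
    apply: (csummable_dom (b := fun n => 2 * C * mu n `^ (- complex.Re y))
      (B := 2 * C * mu_bound alpha (complex.Re y)) U2) => n; rewrite -mulr_sumr.
    by apply: ler_wpM2l; [rewrite mulr_ge0 | exact: sum_mu_le].
  have tl : cabs (csum U - \sum_(i < N) U i) <= m / 8.
    apply: cabs_csum_sub => // n; apply: le_trans (hN n); apply: ler_sum => i _.
    apply: le_trans (U2 _) _; rewrite /b ler_wpM2l ?mulr_ge0//.
    rewrite /powR gt_eqF ?mu_gt0// ler_expR !mulNr lerN2 ler_wpM2r//.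
    by rewrite ln_ge0//; apply: mu_ge1.
  have hd : cabs (\sum_(i < N) U i) <= m / 8.
    apply: le_trans (ltW eD); apply: le_trans (cabs_sum _ _ _) _.
    rewrite /D mulr_sumr; apply: ler_sum => i _.
    rewrite /U 2!cabsM cabs_cpow_mu// [cabs (f i) * _]mulrC -mulrA; apply: ler_pM.
    + exact: cabs_ge0.
    + by rewrite mulr_ge0 ?cabs_ge0 ?powR_ge0.
    + exact: ht.
    apply: ler_pM; rewrite ?cabs_ge0 ?powR_ge0//.
    rewrite /powR gt_eqF ?mu_gt0//.
    have [l0|l0] := leP 0 (ln (mu i)).
      apply: ler_wpDr; first exact: expR_ge0.
      by rewrite ler_expR !mulNr lerN2 ler_wpM2r.
    apply: ler_wpDl; first exact: expR_ge0.
    by rewrite ler_expR !mulNr lerN2 ler_wnM2r// ltW.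
  rewrite -[X in cabs X](subrK (\sum_(i < N) U i)).
  by apply: le_trans (cabsD _ _) _; slra.
exists (y + u); have [y1 _] := Rey y (ltW yr); rewrite Reu; split => //; first slra.
have := le_trans (absIm_le_cabs _) (ltW yr); rewrite ImB ler_norml => /andP[h1 _].
rewrite ImD /=; slra.
Qed.

(** The variables are pushed to the unit circle one at a time by [zero_on_circle], the others being
    frozen into the coefficients. *)
Lemma zeros_of_polydisc_zero f C (n0 N : nat) (v : 'I_N -> nat -> nat) (z : 'I_N -> R[i]) s :
  (forall m, cabs (f m) <= C) -> (forall m, (m < n0)%N -> f m = 0) -> f n0 != 0 ->
  (forall j, additive_on_relations (v j)) -> (forall j, v j n0 = 0%N) ->
  (forall j, cabs (z j) <= 1) -> 1 < complex.Re s ->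
  dsum alpha (fun m => f m * \prod_j z j ^+ v j m) s = 0 ->
  forall T : R, exists s', [/\ 1 < complex.Re s', T <= complex.Im s' & dsum alpha f s' = 0].
Proof.
move=> fC f0 fn0 va vn0 z1 s1 Zs.
have bnd (y : 'I_N -> R[i]) (P : pred 'I_N) m : (forall j, cabs (y j) <= 1) ->
    cabs (\prod_(j | P j) y j ^+ v j m) <= 1.
  move=> y1; rewrite cabs_prod; apply: prodr_ile1 => j _.
  by rewrite cabs_ge0 cabsX exprn_ile1 ?cabs_ge0.
have fbnd y (P : pred 'I_N) m : (forall j, cabs (y j) <= 1) ->
    cabs (f m * \prod_(j | P j) y j ^+ v j m) <= C.
  move=> y1; rewrite cabsM; apply: le_trans (fC m).
  by rewrite ler_piMr ?cabs_ge0// bnd.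
have step k : (k <= N)%N -> exists (z : 'I_N -> R[i]) s, [/\ forall j, cabs (z j) <= 1,
    forall j : 'I_N, (j < k)%N -> cabs (z j) = 1, 1 < complex.Re s &
    dsum alpha (fun m => f m * \prod_j z j ^+ v j m) s = 0].
  elim: k => [|k IH] kN; first by exists z, s.
  have [y [w [y1 yk w1 Zw]]] := IH (ltnW kN).
  pose k' := Ordinal kN.
  pose c m := f m * \prod_(j | j != k') y j ^+ v j m.
  have cE x w' : dsum alpha (fun m => c m * x ^+ v k' m) w' =
      dsum alpha (fun m => f m * \prod_j (if j == k' then x else y j) ^+ v j m) w'.
    apply: eq_csum => m; rewrite /dterm /c [in RHS](bigD1 k') //= eqxx -!mulrA; congr (_ * _).
    rewrite [RHS]mulrA [X in _ = X * _]mulrC -mulrA; congr (_ * _).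
    by apply: eq_bigr => j /negbTE ->.
  have [||||||| w' [x [w'1 x1 Zx _]]] := @zero_on_circle R alpha alpha_gt0 c (v k') C n0 w (y k').
  - by move=> m; exact: fbnd.
  - by move=> m mn; rewrite /c f0// mul0r.
  - rewrite mulf_neq0// -cabs_eq0 cabs_prod big1 ?oner_eq0// => j _.
    by rewrite vn0 expr0 cabs1.
  - exact: vn0.
  - exact: w1.
  - exact: y1.
  - rewrite cE; rewrite -[RHS]Zw; apply: eq_csum => m; rewrite /dterm; congr (_ * _ * _).
    by apply: eq_bigr => j _; case: eqP => // ->.
  exists (fun j => if j == k' then x else y j), w'; split => //.
  - by move=> j; case: eqP => _; rewrite ?x1.
  - move=> j; rewrite ltnS leq_eqVlt => /orP[/eqP jk|jk].
      by have -> : j == k' by apply/eqP/val_inj.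
    by case: eqP => _ //; exact: yk.
  - by rewrite -cE.
have [y [w [y1 yk w1 Zw]]] := step N (leqnn N).
have y11 j : cabs (y j) = 1 by exact: yk.
pose phi m := \prod_j y j ^+ v j m.
have phi1 m : cabs (phi m) = 1.
  by rewrite /phi cabs_prod big1// => j _; rewrite cabsX y11 expr1n.
have phir : respects_relations phi.
  move=> s2 s3 E; rewrite /phi exchange_big [RHS]exchange_big /=; apply: eq_bigr => j _.
  by rewrite !prodrXr (va j _ _ E).
(* With all exponents [0] this last use leaves the twist unchanged and only makes the zero the
   rightmost one on its horizontal line, as [zeros_of_twist] demands. *)
have [||||||| w' [x [w'1 x1 Zx nZ]]] := @zero_on_circle R alpha alpha_gt0 (fun m => f m * phi m) (fun=> 0%N) C n0 w 1.
- by move=> m; exact: fbnd.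
- by move=> m mn; rewrite f0// mul0r.
- by rewrite mulf_neq0// -cabs_eq0 phi1 oner_eq0.
- by [].
- exact: w1.
- by rewrite cabs1.
- by rewrite -[RHS]Zw; apply: eq_csum => m; rewrite /dterm expr0 mulr1.
apply: (zeros_of_twist fC phi1 phir w'1).
  by rewrite -[RHS]Zx; apply: eq_csum => m; rewrite /dterm expr0 mulr1.
move=> t /nZ; apply: contra_neq => E; rewrite -[RHS]E.
by apply: eq_csum => m; rewrite /dterm expr0 mulr1.
Qed.

End Kronecker.

(** * Zeros forced by many terms that can be aligned *)

Section RootsOfUnity.
Variable R : realType.

Definition unity_root (e : nat) : R[i] := cis (2 * pi / e%:R).

Lemma unity_root_exp e : (0 < e)%N -> unity_root e ^+ e = 1.
Proof.
move=> e0; rewrite -cisMn -[_ *+ e]mulr_natr divfK ?pnatr_eq0 -?lt0n//.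
by rewrite mulr_natl /cis /cexp /= expR0 mul1r cos2pi sin2pi.
Qed.

Lemma unity_root_prim e k : (k < e)%N -> unity_root e ^+ k = 1 -> k = 0%N.
Proof.
move=> ke; have e0 : (0 < e)%N by apply: leq_ltn_trans ke.
have e0' : 0 < e%:R :> R by rewrite ltr0n.
have p0 := pi_gt0 R.
rewrite -cisMn -[_ *+ k]mulr_natr /cis /cexp /= expR0 mul1r => -[c1 _].
set th := 2 * pi / e%:R * k%:R in c1.
have th0 : 0 <= th by rewrite mulr_ge0// divr_ge0// mulr_ge0// ltW.
have th2 : th < 2 * pi.
  by rewrite /th mulrAC ltr_pdivrMr// ltr_pM2l ?mulr_gt0// ltr_nat.
suff : th = 0.
  move/eqP; rewrite /th mulf_eq0 pnatr_eq0 gt_eqF ?divr_gt0 ?mulr_gt0//= => /eqP ->//.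
have [le|lt] := leP th pi.
  have : cos th = cos 0 by rewrite c1 cos0.
  by move/cos_inj; rewrite !in_itv /= th0 le lexx ltW// => /(_ isT isT).
have : cos (2 * pi - th) = cos 0.
  by rewrite cosB mulr_natl cos2pi sin2pi mul1r mul0r addr0 c1 cos0.
move/cos_inj; rewrite !in_itv /= lexx (ltW p0) subr_ge0 (ltW th2) /= => h.
have : 2 * pi - th = 0 by apply: h => //; lra.
lra.
Qed.

Lemma unity_root_neq0 e : unity_root e != 0.
Proof. exact: cis_neq0. Qed.

Lemma cabs_unity_root e : cabs (unity_root e) = 1.
Proof. exact: cabs_cis. Qed.

Lemma sum_unity_root e k : (0 < e)%N -> (forall x : R[i], x = unity_root e ^+ k ->
  \sum_(l < e) x ^+ l = if x == 1 then e%:R else 0).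
Proof.
move=> e0 x xE; case: eqVneq => [->|x1].
  by under eq_bigr do rewrite expr1n; rewrite sumr_const card_ord.
have : (x - 1) * \sum_(l < e) x ^+ l = 0.
  by rewrite -subrX1 xE exprAC unity_root_exp// expr1n subrr.
by move/eqP; rewrite mulf_eq0 subr_eq0 (negbTE x1) => /eqP.
Qed.

Lemma unity_root_inv e k : (k <= e)%N -> (0 < e)%N -> (unity_root e ^+ k)^-1 = unity_root e ^+ (e - k).
Proof.
move=> ke e0; apply: (mulfI (expf_neq0 k (unity_root_neq0 e))).
by rewrite divff ?expf_neq0 ?unity_root_neq0// -exprD subnKC// unity_root_exp.
Qed.

(* Averaging over independent [e]-th roots of unity detects exponents that agree modulo [e]. *)
Lemma mean_unity_root e N (a b : 'I_N -> nat) : (0 < e)%N ->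
  (forall j, (b j <= e)%N) ->
  \sum_(l : {ffun 'I_N -> 'I_e}) \prod_j (unity_root e ^+ a j / unity_root e ^+ b j) ^+ l j =
  if [forall j, unity_root e ^+ a j == unity_root e ^+ b j] then (e ^ N)%:R else 0.
Proof.
move=> e0 be; rewrite -(bigA_distr_bigA (fun j l => (unity_root e ^+ a j / unity_root e ^+ b j) ^+ val l)) /=.
have E j : \sum_(l < e) (unity_root e ^+ a j / unity_root e ^+ b j) ^+ l =
    if unity_root e ^+ a j == unity_root e ^+ b j then e%:R else 0.
  rewrite (@sum_unity_root e (a j + (e - b j))%N)//; last by rewrite exprD -unity_root_inv.
  congr (if _ then _ else _).
  by rewrite -(inj_eq (mulIf (expf_neq0 (b j) (unity_root_neq0 e)))) mul1r divfK ?expf_neq0 ?unity_root_neq0.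
under eq_bigr do rewrite E.
case: forallP => [h|/forallP].
  under eq_bigr do rewrite h.
  by rewrite prodr_const card_ord natrX.
by rewrite negb_forall => /existsP[j nj]; rewrite (bigD1 j) //= (negbTE nj) mul0r.
Qed.

End RootsOfUnity.

Section SpecialTerms.
Variables (R : realType) (alpha : R).
Hypothesis alpha_gt0 : 0 < alpha.
Local Notation mu := (mu alpha).

(* The terms with index in the range of [nn] can be aligned while the remaining
   ones of degree [< e] in [xi] stay bounded in mean square; on [|xi| = r] the
   aligned terms then dominate, which forces a zero in the disc. *)

Lemma zeros_of_special_terms (f : nat -> R[i]) (C : R) (n0 N e : nat) (f0 : R[i])
  (nn : 'I_N -> nat) (v : 'I_N -> nat -> nat) (sg B M r : R) :
  (forall m, cabs (f m) <= C) -> (forall m, (m < n0)%N -> f m = 0) -> f n0 != 0 ->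
  (forall j, additive_on_relations alpha (v j)) -> (forall j, v j n0 = 0%N) ->
  (0 < e)%N -> (forall i j, v j (nn i) = if i == j then e else 0%N) ->
  f0 != 0 -> (forall j, f (nn j) = f0) -> 1 < sg ->
  (forall n, \sum_(m < n) cabs (f m) ^+ 2 * (mu m `^ (- sg)) ^+ 2 <= B) ->
  (forall n, \sum_(m < n | (e < \sum_j v j m)%N) cabs (f m) * mu m `^ (- sg) <= M) ->
  0 < r -> r < 1 -> 4 * r * M <= cabs f0 * \sum_j mu (nn j) `^ (- sg) ->
  2 + (8 * B + 4 * e%:R + 9) / r ^+ e <= cabs f0 * \sum_j mu (nn j) `^ (- sg) ->
  forall T : R, exists s', [/\ 1 < complex.Re s', T <= complex.Im s' & dsum alpha f s' = 0].
Proof.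
move=> fC fz fn0 va vn0 e0 vnn f00 fnn sg1 BB MM r0 r1.
set a := cabs f0 * _ => Ma Ba.
have C0 : 0 <= C by apply: le_trans (cabs_ge0 _) (fC 0%N).
have B0 : 0 <= B by apply: le_trans (BB 0%N); rewrite big_ord0.
have M0 : 0 <= M by apply: le_trans (MM 0%N); rewrite big_ord0.
have re0 : 0 < r ^+ e by rewrite exprn_gt0.
pose h m := (\sum_j v j m)%N.
pose p m := mu m `^ (- sg).
have p0 m : 0 <= p m by exact: powR_ge0.
have eR : e%:R != 0 :> R by rewrite pnatr_eq0 -lt0n.
have nninj : injective nn.
  by move=> i j E; apply/eqP; have := vnn i j; rewrite E vnn eqxx; case: eqP => // _ e0'; rewrite e0' in e0.
have [N1 hN1] := bounded_sum_tail (b := fun m => C * p m) (fun m => mulr_ge0 C0 (p0 m))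
  (fun n => ltac:(rewrite -mulr_sumr; exact: (ler_wpM2l C0 (sum_mu_le alpha_gt0 n sg1)))) (@ltr01 R).
(* Beyond [N0] the series contributes at most [1], and all special indices lie below it. *)
pose N0 := (N1 + (\max_j nn j).+1)%N.
have tailN n : \sum_(i < n) C * p (N0 + i)%N <= 1 by apply: hN1; rewrite leq_addr.
have nnN j : (nn j < N0)%N.
  by rewrite /N0 ltn_addl// ltnS; exact: leq_bigmax.
(* The frequency left to the term [m] once the variables carry the phases [t * ln (mu (nn j)) / e];
   it vanishes at the special indices. Each variable may still be multiplied by an [e]-th root of
   unity, which is the finite parameter [l]. *)
pose la m : R := ln (mu m) - \sum_j (v j m)%:R / e%:R * ln (mu (nn j)).
pose Z := {ffun 'I_N -> 'I_e}.
pose ze (l : Z) m : R[i] := \prod_j (unity_root R e ^+ v j m) ^+ l j.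
have ze1 l m : cabs (ze l m) = 1.
  by rewrite cabs_prod big1// => j _; rewrite !cabsX cabs_unity_root !expr1n.
have zeJ l m : ((ze l m)^*)%R = (ze l m)^-1.
  apply: (mulfI (_ : ze l m != 0)); first by rewrite -cabs_gt0 ze1.
  by rewrite divff -?cabs_gt0 ?ze1// -sqr_cabsJ ze1 expr1n.
pose u := (f0^* / (cabs f0)%:C)%R.
have u1 : cabs u = 1 by rewrite cabsM cabsV cabsR cabsJ ger0_norm ?cabs_ge0// divff// cabs_eq0.
have uf : u * f0 = (cabs f0)%:C.
  rewrite /u mulrAC [_ * f0]mulrC -sqr_cabsJ expr2 rmorphM /= mulfK//.
  by rewrite -cabs_eq0 cabsR normr_eq0 cabs_eq0.
(* The weight in [D] of the penalty on lower degrees; the factor [r ^ (- e)] cancels when [key]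
   multiplies by [r ^ e]. *)
have [ka kaE ka0] : exists2 ka : R, ka = 4 / r ^+ e & 0 < ka by exists (4 / r ^+ e); rewrite ?divr_gt0.
pose I := ('I_N0 * option 'I_N0)%type.
(* [D t l] equals [Re (u * A e) - ka * sum_(k < e) |A k| ^ 2], see [DE]. Here it is expanded into
   exponentials in [t]: indices [(m, None)] give the linear part and [(m, Some m')] the quadratic
   one. *)
pose c0 (i : I) : R[i] := if i.2 is Some m' then
    if (h i.1 == h m') && (h m' < e)%N then - ka%:C * (f i.1 * (f m')^* * (p i.1 * p m')%:C) else 0
  else if h i.1 == e then u * f i.1 * (p i.1)%:C else 0.
pose zz (l : Z) (i : I) := if i.2 is Some m' then ze l i.1 / ze l m' else ze l i.1.
pose L (i : I) : R := if i.2 is Some m' then la m' - la i.1 else - la i.1.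
pose D t l := complex.Re (\sum_(i : I) c0 i * zz l i * cis (t * L i)).
have vh m j : (v j m <= h m)%N by rewrite /h (bigD1 j) //= leq_addr.
have zle k : (k <= e)%N -> unity_root R e ^+ k = 1 -> k = 0%N \/ k = e.
  by rewrite leq_eqVlt => /orP[/eqP ->|ke /(unity_root_prim ke)]; [right | left].
(* Averaged over [t] and all roots of unity, only [m = nn j] survives in the linear part and
   [m = m'] in the quadratic one: the roots of unity fix the exponents [v j m], after which the
   vanishing frequency fixes [mu m]. *)
have [t _ [l hD]] : exists2 t : R, true & exists l, a - ka * B - 1 <= D t l.
  have [t _ ht] := @mean_value R I (fun i => \sum_(l : Z) c0 i * zz l i) L 0 (e ^ N)%:R
     ltac:(by rewrite ltr0n expn_gt0 e0).
  exists t => //; apply: contrapT => H.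
  have lt l : D t l < a - ka * B - 1.
    by rewrite ltNge; apply/negP => hl; apply: H; exists l.
  have : \sum_(l : Z) D t l < \sum_(l : Z) (a - ka * B - 1).
    apply: ltr_sum => //; apply/hasP; exists [ffun=> Ordinal e0]; first exact: mem_index_enum.
    by [].
  rewrite -Re_sum exchange_big /= sumr_const card_ffun !card_ord.
  have -> : \sum_(i : I) \sum_(l : Z) c0 i * zz l i * cis (t * L i) =
     \sum_(i : I) (\sum_(l : Z) c0 i * zz l i) * cis (t * L i).
    by apply: eq_bigr => i _; rewrite mulr_suml.
  apply/negP; rewrite -leNgt; apply: le_trans ht.
  rewrite big_mkcond -(pair_bigA _ (fun m o => if L (m, o) == 0 then \sum_(l : Z) c0 (m, o) * zz l (m, o) else 0)) /=.
  have osum (F : option 'I_N0 -> R[i]) : \sum_o F o = F None + \sum_m F (Some m).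
    rewrite (bigD1 None) //=; congr (_ + _).
    rewrite (reindex_omap Some id) //=; last by case.
    by apply: eq_bigl => i; rewrite eqxx.
  under eq_bigr do rewrite osum.
  rewrite big_split /= ReD.
  have eN : (e ^ N)%:R = (e ^ N)%:R%:C :> R[i] by rewrite rmorph_nat.
  have -> : \sum_(m < N0) (if L (m, None) == 0 then \sum_(l : Z) c0 (m, None) * zz l (m, None) else 0) =
     (a * (e ^ N)%:R)%:C.
    have T0 (m : 'I_N0) : (if L (m, None) == 0 then \sum_(l : Z) c0 (m, None) * zz l (m, None) else 0) =
       if [exists j, nn j == m] then u * f0 * (p m)%:C * (e ^ N)%:R else 0.
      rewrite /c0 /L /zz /=.
      have zE : \sum_(l : Z) ze l m = if [forall j, unity_root R e ^+ v j m == 1] then (e ^ N)%:R else 0.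
        have := @mean_unity_root R e N (fun j => v j m) (fun=> 0%N) e0 (fun _ => leq0n _).
        by under eq_bigr do under eq_bigr do rewrite expr0 divr1; move=> ->.
      case: existsP => [[j /eqP jm]|nj].
        have hm : h m = e.
          by rewrite /h (bigD1 j) //= -jm vnn eqxx big1 ?addn0// => i /negbTE ij; rewrite vnn eq_sym ij.
        have lm : la m = 0.
          rewrite /la (bigD1 j) //= big1 ?addr0 => [|i /negbTE ij]; last by rewrite -jm vnn eq_sym ij !mul0r.
          by rewrite -jm vnn eqxx divff// mul1r subrr.
        rewrite hm lm oppr0 !eqxx -mulr_sumr zE -jm fnn.
        rewrite (_ : [forall i, _] = true)//; apply/forallP => i; rewrite vnn.
        by case: ifP => _; rewrite ?unity_root_exp ?expr0.
      case: eqP => // /eqP; rewrite oppr_eq0 => /eqP lm.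
      case: ifP => [/eqP hm|_]; last by rewrite big1// => l _; rewrite mul0r.
      rewrite -mulr_sumr zE; case: forallP => [al|]; last by rewrite mulr0.
      exfalso; apply: nj.
      have vj j : v j m = 0%N \/ v j m = e.
        by apply: zle; [rewrite -hm; exact: vh | apply/eqP; exact: al].
      have [j vje] : exists j, v j m = e.
        apply: contrapT => nv; move: hm; rewrite /h big1 => [E|j _]; first by rewrite -E in e0.
        by case: (vj j) => // vje; case: nv; exists j.
      have vi i : i != j -> v i m = 0%N.
        move=> ij; case: (vj i) => // vie; move: hm; rewrite /h (bigD1 j) //= vje (bigD1 i) //= vie.
        by move=> /eqP; rewrite -[X in _ == X]addn0 eqn_add2l addn_eq0 => /andP[/eqP E _]; rewrite E in e0.
      exists j; apply/eqP/esym; apply: (@mu_inj R alpha); apply: ln_inj; rewrite ?posrE ?mu_gt0//.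
      apply/eqP; rewrite -subr_eq0; apply/eqP; rewrite -[RHS]lm /la (bigD1 j) //= big1 ?addr0 => [|i /vi ->]; last by rewrite !mul0r.
      by rewrite vje divff// mul1r.
    under eq_bigr do rewrite T0.
    rewrite -big_mkcond /= uf.
    rewrite (reindex_omap (fun j => Ordinal (nnN j)) (fun m : 'I_N0 => [pick j | nn j == m])) /=; last first.
      move=> m /existsP[j jm]; case: pickP => [j' /eqP j'm|/(_ j)]; last by rewrite jm.
      by rewrite /=; congr Some; apply: val_inj.
    rewrite (eq_bigl xpredT) => [|j]; last first.
      have -> : [exists j0, nn j0 == nn j] by apply/existsP; exists j.
      by case: pickP => [j' /eqP /nninj ->|/(_ j)]; rewrite eqxx.
    rewrite -!mulr_suml -mulr_sumr /a !rmorphM /= rmorph_nat; congr (_ * _ * _).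
    by rewrite rmorph_sum.
  have -> : \sum_(m < N0) \sum_(m' < N0)
     (if L (m, Some m') == 0 then \sum_(l : Z) c0 (m, Some m') * zz l (m, Some m') else 0) =
     - (ka * \sum_(m < N0 | (h m < e)%N) cabs (f m) ^+ 2 * p m ^+ 2 * (e ^ N)%:R)%:C.
    have T1 (m m' : 'I_N0) : (if L (m, Some m') == 0 then \sum_(l : Z) c0 (m, Some m') * zz l (m, Some m') else 0) =
       if (m == m') && (h m < e)%N then - ka%:C * (cabs (f m) ^+ 2 * p m ^+ 2 * (e ^ N)%:R)%:C else 0.
      rewrite /c0 /L /zz /=.
      have [<-|mm] /= := eqVneq m m'.
        rewrite subrr !eqxx /=; case: ifP => he; last by rewrite big1// => l _; rewrite mul0r.
        under eq_bigr do rewrite divff -?cabs_gt0 ?ze1// mulr1.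
        rewrite sumr_const card_ffun !card_ord -[_ *+ (e ^ N)]mulr_natr.
        have -> : f m * (f m)^* = (cabs (f m) ^+ 2)%:C := esym (sqr_cabsJ _).
        have -> : (cabs (f m) ^+ 2 * p m ^+ 2 * (e ^ N)%:R)%:C =
            (cabs (f m) ^+ 2)%:C * (p m * p m)%:C * (e ^ N)%:R :> R[i].
          by rewrite [X in _ = _ * X]eN -!(rmorphM (real_complex R)) /= -expr2.
        by ring.
      case: eqP => // lm; case: ifP => [/andP[/eqP hh he]|_]; last by rewrite big1// => l _; rewrite mul0r.
      rewrite -mulr_sumr.
      have -> : \sum_(l : Z) ze l m / ze l m' =
         if [forall j, unity_root R e ^+ v j m == unity_root R e ^+ v j m'] then (e ^ N)%:R else 0.
        rewrite -mean_unity_root//; last by move=> j; apply: leq_trans (vh _ _) (ltnW he).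
        by apply: eq_bigr => l _; rewrite /ze -prodf_div; apply: eq_bigr => j _; rewrite expr_div_n.
      case: forallP => [al|]; last by rewrite mulr0.
      have vv j : v j m = v j m'.
        have wl (x y : nat) : (x <= y)%N -> (y < e)%N -> unity_root R e ^+ x = unity_root R e ^+ y -> x = y.
          move=> xy ye E; have := @unity_root_prim R e (y - x).
          rewrite (leq_ltn_trans (leq_subr _ _) ye) => /(_ isT); rewrite expfB_cond; last by rewrite (negbTE (unity_root_neq0 R e)) add0n.
          rewrite E divff ?expf_neq0 ?unity_root_neq0// => /(_ erefl) /eqP; rewrite subn_eq0 => yx.
          by apply/eqP; rewrite eqn_leq xy.
        have vlt m1 : (h m1 < e)%N -> (v j m1 < e)%N by exact: leq_ltn_trans (vh _ _).
        case: (leqP (v j m) (v j m')) => [le|/ltnW le].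
          by apply: wl le (vlt _ he) _; apply/eqP; exact: al.
        by apply/esym; apply: wl le _ _; [apply: vlt; rewrite hh | apply/esym/eqP; exact: al].
      case/eqP: mm; apply: val_inj; apply: (@mu_inj R alpha); apply: ln_inj; rewrite ?posrE ?mu_gt0//.
      move: lm; rewrite /la; under eq_bigr do rewrite -vv.
      by move=> /eqP; rewrite opprB addrA subrK subr_eq0 => /eqP.
    under eq_bigr do under eq_bigr do rewrite T1.
    rewrite mulr_sumr (rmorph_sum (real_complex R)) /= -sumrN [RHS]big_mkcond /=.
    have kM (x : R) : - (ka * x)%:C = - ka%:C * x%:C by rewrite rmorphM mulNr.
    apply: eq_bigr => m _; rewrite kM (bigD1 m) //= eqxx /= [X in _ + X]big1 ?addr0//.
    by move=> m' /negbTE; rewrite eq_sym => ->.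
  have -> (x : R) : complex.Re (- x%:C) = - x by [].
  have -> (x : R) : complex.Re x%:C = x by [].
  rewrite -mulr_suml -[(a - ka * B - 1) *+ _]mulr_natr.
  have E1 : (0 : R) < (e ^ N)%:R by rewrite ltr0n expn_gt0 e0.
  have BL : \sum_(m < N0 | (h m < e)%N) cabs (f m) ^+ 2 * p m ^+ 2 <= B.
    apply: le_trans (BB N0); rewrite [leLHS]big_mkcond; apply: ler_sum => m _.
    by case: ifP => // _; rewrite mulr_ge0 ?sqr_ge0.
  rewrite mulrA -mulrBl -[X in _ <= _ - X]mul1r -mulrBl ler_pM2r//.
  by rewrite lerD2r lerD2l lerN2 ler_pM2l.
pose om j : R[i] := cis (t * ln (mu (nn j)) / e%:R) * unity_root R e ^+ l j.
have om1 j : cabs (om j) = 1 by rewrite cabsM cabs_cis cabsX cabs_unity_root expr1n mulr1.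
pose s : R[i] := sg +i* t.
pose U m := f m * (ze l m * cis (- t * la m)) * (p m)%:C.
have UE m : f m * \prod_j om j ^+ v j m * cpow (mu m) (- s) = U m.
  have -> : cpow (mu m) (- s) = cis (- t * ln (mu m)) * (p m)%:C.
    have -> : - s = 0 +i* (- t) + (- sg)%:C.
      by apply/eqP; rewrite eq_complex /= add0r addr0 !eqxx.
    rewrite cpowD cpow_cis; congr (_ * _).
    rewrite /cpow -rmorphM /= /p /powR gt_eqF ?mu_gt0//.
    by rewrite /cexp /= cos0 sin0 mulr1.
  have -> : \prod_j om j ^+ v j m = ze l m * cis (t * \sum_j (v j m)%:R / e%:R * ln (mu (nn j))).
    rewrite mulr_sumr cis_sum -big_split /=; apply: eq_bigr => j _.
    rewrite exprMn mulrC; congr (_ * _); first by rewrite exprAC.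
    by rewrite -cisMn; congr cis; rewrite -mulr_natl; ring.
  have laE : cis (- t * la m) = cis (t * \sum_j (v j m)%:R / e%:R * ln (mu (nn j))) * cis (- t * ln (mu m)).
    by rewrite -cisD; congr cis; rewrite /la; ring.
  by rewrite /U laE; ring.
have Up m : cabs (U m) = cabs (f m) * p m.
  by rewrite /U cabsM cabsM cabsM ze1 cabs_cis cabsR ger0_norm// !mulr1.
pose A k := \sum_(m < N0 | h m == k) U m.
have JM (x y : R[i]) : ((x * y)^*)%R = (x^* * y^*)%R by exact: rmorphM.
have JR (x : R) : ((x%:C)^*)%R = x%:C :> R[i] by exact: conjc_real.
have cJ (x : R) : ((cis x)^*)%R = cis (- x) by exact: cisJ.
have DE : D t l = complex.Re (u * A e) - ka * \sum_(k < e) cabs (A k) ^+ 2.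
  rewrite /D -(pair_bigA _ (fun m o => c0 (m, o) * zz l (m, o) * cis (t * L (m, o)))) /=.
  have osum (F : option 'I_N0 -> R[i]) : \sum_o F o = F None + \sum_m F (Some m).
    rewrite (bigD1 None) //=; congr (_ + _).
    rewrite (reindex_omap Some id) //=; last by case.
    by apply: eq_bigl => i; rewrite eqxx.
  under eq_bigr do rewrite osum.
  rewrite big_split /= ReD; congr (_ + _).
    congr complex.Re; rewrite mulr_sumr [RHS]big_mkcond /=; apply: eq_bigr => m _.
    rewrite /c0 /zz /L /U /=; case: ifP => _; last by rewrite !mul0r.
    by rewrite mulrN -mulNr; ring.
  rewrite -[RHS]/(complex.Re (- (ka * \sum_(k < e) cabs (A k) ^+ 2)%:C)); congr complex.Re.
  rewrite rmorphM /= -mulNr rmorph_sum /= mulr_sumr.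
  have AE (k : 'I_e) : - ka%:C * (cabs (A k) ^+ 2)%:C = \sum_(m < N0) \sum_(m' < N0)
     if (h m == k) && (h m' == k) then - ka%:C * (U m * (U m')^*) else 0.
    rewrite sqr_cabsJ /A rmorph_sum /= big_distrlr /= mulr_sumr big_mkcond /=; apply: eq_bigr => m _.
    case: ifP => hm /=; last by rewrite big1.
    by rewrite mulr_sumr big_mkcond.
  under [RHS]eq_bigr do rewrite AE.
  rewrite [RHS]exchange_big /=; apply: eq_bigr => m _.
  rewrite [RHS]exchange_big /=; apply: eq_bigr => m' _.
  rewrite /c0 /zz /L /=; case: ifP => [/andP[/eqP hh he]|nh].
    rewrite (bigD1 (Ordinal he)) //= hh !eqxx /= big1 ?addr0 => [|k nk]; last first.
      by case: eqP => //= hk; case/eqP: nk; apply: val_inj.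
    have UJ : ((U m')^*)%R = (f m')^* * (ze l m')^-1 * cis (t * la m') * (p m')%:C.
      rewrite /U (JM _ (p m')%:C) (JM (f m')) (JM (ze l m')) JR zeJ cJ mulNr opprK; ring.
    have -> : cis (t * (la m' - la m)) = cis (t * la m') * cis (- t * la m).
      by rewrite -cisD; congr cis; ring.
    rewrite UJ /U (rmorphM (real_complex R)); ring.
  rewrite !mul0r big1// => k _; case: eqP => //= hk; case: eqP => //= hk'.
  by move: nh; rewrite hk hk' eqxx ltn_ord.
rewrite DE in hD.
pose S1 := \sum_(k < e) cabs (A k); pose S2 := \sum_(k < e) cabs (A k) ^+ 2.
have S12 : 2 * S1 <= e%:R + S2.
  rewrite /S1 /S2 mulr_sumr.
  have -> : e%:R = \sum_(k < e) 1 :> R by rewrite sumr_const card_ord.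
  rewrite -big_split /=.
  by apply: ler_sum => k _; have := sqr_ge0 (cabs (A k) - 1); rewrite sqrrB1; slra.
pose y := cabs (A e).
have yA : complex.Re (u * A e) <= y by apply: le_trans (Re_le_cabs _) _; rewrite cabsM u1 mul1r.
have S20 : 0 <= S2 by apply: sumr_ge0 => k _; exact: sqr_ge0.
(* On [|xi| = r] the part of degree [e] has modulus [y * r ^ e]. By this inequality it exceeds the
   lower degrees, the higher ones and the tail by more than [S1 + 1], a bound for the value at
   [xi = 0]; so [min_principle] applies. *)
have key : 2 * S1 + 2 < y * r ^+ e - r ^+ e.+1 * M.
  have q0 : 0 < (r ^+ e)^-1 by rewrite invr_gt0.
  have y1 : ka * S2 + (a - ka * B - 1) <= y by rewrite /S2; slra.
  have rq : r ^+ e * (r ^+ e)^-1 = 1 by rewrite divff// gt_eqF.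
  rewrite exprS; move: Ba y1; rewrite kaE; move: q0 rq re0.
  move: (r ^+ e) ((r ^+ e)^-1) => x q q0 rq x0 Ba y1.
  have e1 : 1 <= e%:R :> R by rewrite ler1n.
  have h1 : q * B <= q * (8 * B + 4 * e%:R + 9) / 8 by rewrite ler_pdivlMr// -mulrA ler_pM2l//; slra.
  have h2 : r * M * x <= (a / 4) * x by rewrite ler_pM2r//; slra.
  have h3 : x * (4 * q * S2 + (a - 4 * q * B - 1)) <= x * y by rewrite ler_pM2l.
  have h4 : x * (4 * q * S2 + (a - 4 * q * B - 1)) = 4 * S2 * (x * q) + a * x - 4 * B * (x * q) - x by ring.
  have h5 : x * (2 + (8 * B + 4 * e%:R + 9) * q) <= x * a by rewrite ler_pM2l.
  have h6 : x * (2 + (8 * B + 4 * e%:R + 9) * q) = 2 * x + (8 * B + 4 * e%:R + 9) * (x * q) by ring.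
  rewrite h4 rq in h3; rewrite h6 rq in h5.
  slra.
have dom xi : cabs xi <= 1 -> forall m, cabs (f m * \prod_j (xi * om j) ^+ v j m) <= C.
  move=> x1 m; apply: le_trans (fC m); rewrite cabsM ler_piMr ?cabs_ge0// cabs_prod.
  apply: prodr_ile1 => j _; rewrite cabs_ge0 /= cabsX cabsM om1 mulr1.
  by rewrite exprn_ile1 ?cabs_ge0.
have prodE xi m : f m * \prod_j (xi * om j) ^+ v j m * cpow (mu m) (- s) = U m * xi ^+ h m.
  have -> : \prod_j (xi * om j) ^+ v j m = \prod_j om j ^+ v j m * xi ^+ h m.
    by rewrite /h -prodrXr -big_split /=; apply: eq_bigr => j _; rewrite exprMn mulrC.
  by rewrite -UE; ring.
have sU : csummable U.
  apply: (csummable_dom (b := fun m => C * p m) (B := C * mu_bound alpha sg)) => [m|n].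
    by rewrite Up ler_wpM2r.
  by rewrite -mulr_sumr ler_wpM2l// sum_mu_le.
have s1 : 1 < complex.Re s by [].
pose G xi := csum (fun m => U m * xi ^+ h m).
have Gsplit xi : cabs xi <= r -> cabs (G xi - (\sum_(k < e) A k * xi ^+ k + A e * xi ^+ e)) <= 
     cabs xi ^+ e.+1 * M + 1.
  move=> xr; have x1 : cabs xi <= 1 by slra.
  have tl : cabs (G xi - \sum_(m < N0) U m * xi ^+ h m) <= 1.
    apply: cabs_csum_sub.
      have [K hK] := sU; exists K => n; apply: le_trans (hK n); apply: ler_sum => i _.
      by rewrite cabsM cabsX ler_piMr ?cabs_ge0// exprn_ile1 ?cabs_ge0.
    move=> n; apply: le_trans (tailN n); apply: ler_sum => i _.
    rewrite cabsM Up cabsX; apply: le_trans (_ : C * p (N0 + i)%N * 1 <= _); last by rewrite mulr1.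
    by apply: ler_pM; rewrite ?mulr_ge0 ?exprn_ge0 ?cabs_ge0// ?ler_wpM2r// exprn_ile1 ?cabs_ge0.
  have E : \sum_(m < N0) U m * xi ^+ h m = \sum_(k < e) A k * xi ^+ k + A e * xi ^+ e +
      \sum_(m < N0 | (e < h m)%N) U m * xi ^+ h m.
    rewrite -(big_ord_recr e (fun k => A k * xi ^+ k)) /=.
    have -> : \sum_(k < e.+1) A k * xi ^+ k = \sum_(m < N0 | (h m <= e)%N) U m * xi ^+ h m.
      have AE (k : 'I_e.+1) : A k * xi ^+ k = \sum_(m < N0 | h m == k) U m * xi ^+ h m.
        by rewrite mulr_suml; apply: eq_bigr => m /eqP ->.
      under eq_bigr do rewrite AE.
      rewrite (exchange_big_dep xpredT) //= [RHS]big_mkcond /=; apply: eq_bigr => m _.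
      case: leqP => he; last by rewrite big1// => k /eqP hk; move: (ltn_ord k); rewrite -hk ltnS leqNgt he.
      rewrite (big_pred1 (Ordinal (he : (h m < e.+1)%N))) => [|k]; first by [].
      by apply/idP/idP => [/eqP hk|/eqP -> /=]; rewrite ?eqxx//; apply/eqP/val_inj.
    rewrite (bigID (fun m : 'I_N0 => (h m <= e)%N)) /=; congr (_ + _).
    by apply: eq_bigl => m; rewrite ltnNge.
  have rs : cabs (\sum_(m < N0 | (e < h m)%N) U m * xi ^+ h m) <= cabs xi ^+ e.+1 * M.
    apply: le_trans (cabs_sum _ _ _) _.
    apply: le_trans (_ : \sum_(m < N0 | (e < h m)%N) cabs xi ^+ e.+1 * (cabs (f m) * p m) <= _).
      apply: ler_sum => m hm; rewrite cabsM Up cabsX mulrC ler_wpM2r ?mulr_ge0 ?cabs_ge0//.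
      by apply: ler_wiXn2l; rewrite ?cabs_ge0.
    by rewrite -mulr_sumr ler_wpM2l ?exprn_ge0 ?cabs_ge0//; exact: MM.
  move: tl; rewrite E; set X := \sum_(k < e) _ + _; set Y := \sum_(m < N0 | _) _ in rs *.
  move=> tl; have -> : G xi - X = (G xi - (X + Y)) + Y by ring.
  by apply: le_trans (cabsD _ _) _; slra.
have Glow xi : cabs xi = r -> cabs (\sum_(k < e) A k * xi ^+ k) <= S1.
  move=> xr; apply: le_trans (cabs_sum _ _ _) _; apply: ler_sum => k _.
  by rewrite cabsM cabsX xr ler_piMr ?cabs_ge0// exprn_ile1// ltW.
have [||xi xir Gxi] := @min_principle R G 0 r r0.
- by move=> w; rewrite subr0 => wr; apply: ana_csum_exp => //; slra.
- move=> w; rewrite subr0 => wr.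
  have := Gsplit w; rewrite wr lexx => /(_ isT) h1; have h2 := Glow _ wr.
  have h3 : cabs (G 0) <= S1 + 1.
    have := Gsplit 0; rewrite cabs0 (ltW r0) => /(_ isT); rewrite exprS !mul0r add0r.
    have -> : A e * 0 ^+ e = 0 by rewrite expr0n gtn_eqF// mulr0.
    rewrite addr0; set X := \sum_(k < e) _ => h4.
    have : cabs X <= S1.
      apply: le_trans (cabs_sum _ _ _) _; apply: ler_sum => k _.
      by rewrite cabsM cabsX cabs0 ler_piMr ?cabs_ge0// exprn_ile1.
    by have := cabsD (G 0 - X) X; rewrite subrK; slra.
  have h5 : cabs (A e * w ^+ e) = y * r ^+ e by rewrite cabsM cabsX wr.
  move: h1 h2 h5; set X := \sum_(k < e) _; set Y := A e * _ => h1 h2 h5.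
  have tri : cabs Y <= cabs (G w) + cabs (G w - (X + Y)) + cabs X.
    have E : Y = G w - (G w - (X + Y)) - X by ring.
    rewrite {1}E; apply: le_trans (cabsD _ _) _; rewrite cabsN lerD2r.
    by apply: le_trans (cabsD _ _) _; rewrite cabsN.
  move: key h1 h2 h3 h5 tri; clear.
  move: (cabs Y) (cabs (G w - _)) (cabs X) (cabs (G 0)) (cabs (G w)) (y * _) (_ * M) S1 => *; slra.
rewrite subr0 in xir.
apply: (@zeros_of_polydisc_zero R alpha alpha_gt0 f C n0 N v (fun j => xi * om j) s) => //.
- by move=> j; rewrite cabsM om1 mulr1; slra.
- by rewrite -Gxi; apply: eq_csum => m; rewrite /dterm prodE.
Qed.

End SpecialTerms.

(** * Transcendental parameter *)

Section Transcendental.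
Variables (R : realType) (alpha : R).
Hypotheses (alpha_gt0 : 0 < alpha) (alpha_le1 : alpha <= 1).
Local Notation mu := (mu alpha).

Lemma harmonic_ge_ln n : ln (n.+1%:R : R) <= \sum_(i < n) i.+1%:R^-1.
Proof.
elim: n => [|n IH]; first by rewrite big_ord0 ln1.
rewrite big_ord_recr /=; apply: le_trans (lerD IH (lexx _)).
have n0 : (0 : R) < n.+1%:R by rewrite ltr0n.
have -> : n.+2%:R = n.+1%:R * (1 + n.+1%:R^-1) :> R.
  by rewrite mulrDr mulr1 divff ?gt_eqF// [in LHS]mulrS addrC.
have i0 : (0 : R) < n.+1%:R^-1 by rewrite invr_gt0.
have i1 : (0 : R) < 1 + n.+1%:R^-1 by rewrite ltr_wpDl.
rewrite lnM ?posrE//.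
by rewrite lerD2l; apply: le_ln1Dx; apply: lt_trans i0; rewrite ltrN10.
Qed.

(** The bound is uniform as [sg] tends to [1]. The index [0] is treated apart because [mu 0 = alpha]
    may be below [1]. *)
Lemma mean_square_bound (f : nat -> R[i]) C (sg : R) n : (forall m, cabs (f m) <= C) -> 1 < sg -> sg <= 2 ->
  \sum_(m < n) cabs (f m) ^+ 2 * (mu m `^ (- sg)) ^+ 2 <=
    C ^+ 2 * (alpha `^ (- 4) + mu_bound alpha 2).
Proof.
move=> fC s1 s2; have C0 : 0 <= C := le_trans (cabs_ge0 _) (fC 0%N).
apply: le_trans (_ : \sum_(m < n) C ^+ 2 * ((m == 0%N :> nat)%:R * alpha `^ (- 4) + mu m `^ (- 2)) <= _).
  apply: ler_sum => m _; apply: ler_pM; rewrite ?sqr_ge0//.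
    by rewrite ler_sqr ?nnegrE ?cabs_ge0.
  have -> : (mu m `^ (- sg)) ^+ 2 = mu m `^ (- (2 * sg)).
    by rewrite -powR_mulrn ?powR_ge0// -powRrM; congr (_ `^ _); rewrite mulNr mulrC.
  case: m => [[|m] mn] /=.
    rewrite mul1r /mu add0r; apply: ler_wpDr; first exact: powR_ge0.
    by rewrite /powR gt_eqF// ler_expR; have := ln_le0 alpha_le1; nra.
  rewrite mul0r add0r; apply: ler_powR; last by lra.
  exact: mu_ge1.
rewrite -mulr_sumr ler_wpM2l ?sqr_ge0// big_split /=; apply: lerD; last by apply: sum_mu_le => //; lra.
case: n => [|n]; first by rewrite big_ord0 powR_ge0.
by rewrite big_ord_recl /= mul1r big1 ?addr0// => i _; rewrite mul0r.
Qed.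

(** At the exponent [1 + 1 / L] only a constant factor is lost against [1 / x], as long as [ln x] is
    at most a fixed multiple of [L]. *)
Lemma powR_near1 (x K L : R) : 0 < x -> 0 < L -> ln x <= K * L ->
  expR (- K) / x <= x `^ (- (1 + L^-1)).
Proof.
move=> x0 L0 xK; rewrite opprD powRD; last by rewrite (gt_eqF x0) implybT.
rewrite powR_inv1 ?(ltW x0)// mulrC ler_pM2l ?invr_gt0//.
rewrite /powR gt_eqF// ler_expR mulNr lerN2 mulrC ler_pdivrMr//.
Qed.

Definition transcendental := forall Q : {poly int}, (map_poly intr Q).[alpha] = 0 -> Q = 0.

(** A relation is a polynomial equation for [alpha], so it holds identically, and comparing roots
    makes the two lists permutations of each other. *)
Lemma transcendental_additive n : transcendental ->
  additive_on_relations alpha (fun m => (m == n)%N : nat).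
Proof.
move=> tr s s' ss.
pose P (s : seq nat) : {poly int} := \prod_(x <- [seq - m%:Z | m <- s]) ('X - x%:P).
have mapP t : map_poly intr (P t) = \prod_(x <- [seq - m%:R : R | m <- t]) ('X - x%:P).
  rewrite /P rmorph_prod /= !big_map; apply: eq_bigr => m _.
  by rewrite rmorphB /= map_polyX map_polyC /= rmorphN.
have PE t : (map_poly intr (P t)).[alpha] = \prod_(m <- t) mu m.
  rewrite mapP horner_prod big_map; apply: eq_bigr => m _.
  by rewrite !hornerE opprK addrC.
have /eqP : P s - P s' = 0 by apply: tr; rewrite rmorphB /= hornerD hornerN !PE ss subrr.
rewrite subr_eq0 => /eqP PP.
have pe : perm_eq [seq - m%:R : R | m <- s] [seq - m%:R | m <- s'].
  by apply: prod_XsubC_eq; rewrite -!mapP PP.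
have inj : injective (fun m : nat => - m%:R : R) by move=> a b /oppr_inj /eqP; rewrite eqr_nat => /eqP.
have /(perm_map_inj inj) pss := pe.
by rewrite (perm_big _ pss).
Qed.

(** Finitely many indices congruent to [n0] modulo [q] get one variable each, with [e = 1]. No term
    has degree above [1], so [M = 0], and the divergence of the harmonic series makes the aligned
    terms heavy enough. *)
Lemma zeros_transcendental f C (n0 q : nat) : transcendental ->
  (forall m, cabs (f m) <= C) -> (forall m, (m < n0)%N -> f m = 0) -> f n0 != 0 ->
  (0 < q)%N -> (forall m, f (m + q)%N = f m) ->
  forall T : R, exists s', [/\ 1 < complex.Re s', T <= complex.Im s' & dsum alpha f s' = 0].
Proof.
move=> tr fC f0 fn0 q0 fper.
have fperX i m : f (m + i * q)%N = f m.
  by elim: i => [|i IH]; rewrite ?mul0n ?addn0// mulSn addnCA addnC fper.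
pose B := C ^+ 2 * (alpha `^ (- 4) + mu_bound alpha 2).
pose c := cabs (f n0) * expR (- 1) / (n0 + q).+1%:R.
have c0 : 0 < c by rewrite !mulr_gt0 ?cabs_gt0 ?expR_gt0 ?invr_gt0.
have [X hX] : exists X : nat, 2 + (8 * B + 4 * 1%:R + 9) / (2^-1) ^+ 1 <= c * ln X.+1%:R.
  set K := 2 + _.
  exists (Num.truncn (expR (K / c))).
  rewrite mulrC -ler_pdivrMr// -[leLHS]expRK ler_ln ?posrE ?expR_gt0//.
  by apply: ltW; apply: truncnS_gt.
have X0 : (0 < X)%N.
  case: X hX => // hX; move: hX; rewrite ln1 mulr0 expr1 invrK.
  have : 0 <= B by rewrite mulr_ge0 ?sqr_ge0// addr_ge0 ?powR_ge0// mu_bound_ge0//; lra.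
  lra.
pose nn (j : 'I_X) := (n0 + j.+1 * q)%N.
pose W : R := ((n0 + q).+1 * X)%:R + 2.
have W2 : 2 <= W by rewrite lerDr.
have lW0 : 0 < ln W by apply: ln_gt0; lra.
pose L := ln W + 1.
pose sg : R := 1 + L^-1.
have L0 : 0 < L by rewrite addr_gt0.
have sg1 : 1 < sg by rewrite ltrDl invr_gt0.
have sg2 : sg <= 2.
  have : L^-1 <= 1 by rewrite invf_le1// lerDr ltW.
  by rewrite /sg; lra.
have muW (j : 'I_X) : mu (nn j) <= (n0 + q).+1%:R * j.+1%:R.
  rewrite /mu /nn; apply: le_trans (lerD (lexx _) alpha_le1) _.
  rewrite -natrM natr1 ler_nat; nia.
have key : c * ln X.+1%:R <= cabs (f n0) * \sum_j mu (nn j) `^ (- sg).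
  apply: le_trans (_ : c * \sum_(i < X) i.+1%:R^-1 <= _); first by rewrite ler_pM2l// harmonic_ge_ln.
  rewrite !mulr_sumr; apply: ler_sum => j _.
  have m0 : 0 < mu (nn j) by exact: mu_gt0.
  rewrite /c -!mulrA ler_wpM2l ?cabs_ge0//.
  apply: le_trans (_ : expR (- 1) / mu (nn j) <= _).
    by rewrite ler_pM2l ?expR_gt0// -invfM lef_pV2 ?posrE ?mulr_gt0 ?ltr0n.
  apply: powR_near1 => //; rewrite mul1r; apply: le_trans (_ : ln W <= _); last by rewrite lerDl.
  rewrite ler_ln ?posrE//; last by lra.
  apply: le_trans (muW j) _; rewrite -natrM /W; apply: ler_wpDr => //.
  by rewrite ler_nat leq_mul2l ltn_ord orbT.
have nninj : injective nn.
  move=> i j /eqP; rewrite eqn_add2l eqn_pmul2r// eqSS => /eqP ij; exact: val_inj.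
apply: (@zeros_of_special_terms R alpha alpha_gt0 f C n0 X 1 (f n0) nn (fun j m => (m == nn j)%N : nat) sg B 0 2^-1) => //.
- by move=> j; apply: transcendental_additive.
- move=> j; rewrite /nn -[X in X == _]addn0 eqn_add2l; by rewrite ltn_eqF// muln_gt0 q0.
- by move=> i j; rewrite (inj_eq nninj); case: eqP.
- by move=> j; rewrite fperX.
- by move=> n; apply: mean_square_bound.
- move=> n; rewrite big_pred0// => m; apply/negbTE; rewrite -leqNgt.
  case: (pickP (fun j => val m == nn j)) => [j /eqP mj|no].
    rewrite (bigD1 j) //= mj eqxx big1// => i ij; rewrite (inj_eq nninj) eq_sym (negbTE ij)//.
  by rewrite big1// => i _; rewrite no.
- by rewrite invf_lt1// ltr1n.
- by rewrite mulr0 mulr_ge0 ?cabs_ge0// sumr_ge0// => j _; exact: powR_ge0.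
- exact: le_trans hX key.
Qed.

End Transcendental.

(** * Chebyshev's and Mertens's estimates with explicit constants *)

Section PrimeSums.
Variable R : realType.
Implicit Types n p K : nat.

Lemma ln_nat_ge0 n : 0 <= ln (n%:R : R).
Proof. by case: n => [|n]; [rewrite ln0|apply: ln_ge0; rewrite ler1n]. Qed.

Lemma ln_nat_mono m n : (0 < m)%N -> (m <= n)%N -> ln (m%:R : R) <= ln n%:R.
Proof. by move=> m0 mn; rewrite ler_ln ?posrE ?ltr0n ?ler_nat// (leq_trans m0). Qed.

Lemma ln_primes n K : (0 < n)%N -> (n < K)%N ->
  ln (n%:R : R) = \sum_(p < K | prime p) (logn p n)%:R * ln p%:R.
Proof.
move=> n0; case: K => // K nK.
rewrite -[in LHS](partnT n0) (widen_partn _ (nK : (n <= K)%N)) natr_prod big_mkord.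
pose F (p : nat) : R := if prime p then (p ^ logn p n)%:R else 1.
have F0 (p : 'I_K.+1) : 0 < F p.
  by rewrite /F; case: ifP => // pp; rewrite ltr0n expn_gt0 prime_gt0.
rewrite (eq_bigr (fun p : 'I_K.+1 => F p)) => [|p _]; last first.
  by rewrite /F lognE; case: (prime p).
rewrite ln_prod// [RHS]big_mkcond /=; apply: eq_bigr => p _; rewrite /F.
case: ifP => pp; last by rewrite ln1.
by rewrite natrX lnXn ?ltr0n ?prime_gt0// mulr_natl.
Qed.

Lemma sum_logn_le n K : (0 < n)%N ->
  \sum_(p < K | prime p) (logn p n)%:R * ln p%:R <= ln (n%:R : R).
Proof.
move=> n0; rewrite (@ln_primes n (maxn K n.+1))//; last by rewrite leq_max ltnSn orbT.
rewrite [leLHS](big_ord_widen_cond _ prime (fun p => (logn p n)%:R * ln p%:R) (leq_maxl K n.+1)).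
rewrite [leRHS](bigID (fun p : 'I__ => (p < K)%N)) /= lerDl sumr_ge0// => p _.
by rewrite mulr_ge0 ?ln_nat_ge0.
Qed.

Lemma sum_ord_le (P : pred nat) (F : nat -> R) m n : (forall i, 0 <= F i) -> (m <= n)%N ->
  \sum_(i < m | P i) F i <= \sum_(i < n | P i) F i.
Proof.
move=> F0 mn; rewrite (big_ord_widen_cond _ P F mn).
by rewrite [leRHS](bigID (fun p : 'I__ => (p < m)%N)) /= lerDl sumr_ge0.
Qed.

Lemma prime_dvd_fact p n : prime p -> (p %| n`!)%N -> (p <= n)%N.
Proof.
move=> pp; elim: n => [|n IH]; first by rewrite dvdn1 => /eqP p1; rewrite p1 in pp.
by rewrite factS Euclid_dvdM// => /orP[/dvdn_leq -> //|/IH /leqW].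
Qed.

(** The primes in [(n, 2 n]] divide the central binomial coefficient, which is at most
    [2 ^ (2 n)]. *)
Lemma theta_double n : \sum_(p < (n + n).+1 | prime p) ln (p%:R : R) <=
  \sum_(p < n.+1 | prime p) ln (p%:R : R) + (n + n)%:R * ln 2.
Proof.
have [->|n0] := posnP n; first by rewrite addn0 mul0r addr0.
have b0 : (0 < 'C(n + n, n))%N by rewrite bin_gt0 leq_addr.
have b1 : ln ('C(n + n, n)%:R : R) <= (n + n)%:R * ln 2.
  rewrite mulr_natl -lnXn// -natrX; apply: ln_nat_mono => //.
  rewrite -[2%N]/(1 + 1)%N expnDn.
  rewrite (bigD1 (Ordinal (leq_addr n n : (n < (n + n).+1)%N))) //=.
  by rewrite !exp1n !muln1 leq_addr.
apply: le_trans (lerD (lexx _) b1); apply: le_trans (lerD (lexx _) (sum_logn_le (n + n).+1 b0)).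
have nn : (n.+1 <= (n + n).+1)%N by rewrite ltnS leq_addr.
rewrite [X in _ <= X + _](big_ord_widen_cond _ prime (fun p => ln (p%:R : R)) nn).
rewrite [X in _ <= X + _]big_mkcondr /= -big_split /=; apply: ler_sum => p pp.
case: ltnP => pn; first by rewrite lerDl mulr_ge0 ?ln_nat_ge0.
rewrite add0r ler_peMl ?ln_nat_ge0// ler1n logn_gt0 mem_primes pp b0 /=.
have p2 : (p <= n + n)%N by rewrite -ltnS.
have : (p %| (n + n)`!)%N by rewrite dvdn_fact// prime_gt0.
rewrite -(bin_fact (leq_addr n n)) addnK !Euclid_dvdM// orbb => /orP[//|].
by move=> /(prime_dvd_fact pp); rewrite leqNgt pn.
Qed.

Lemma ln2_le1 : ln (2 : R) <= 1.
Proof. by have := @le_ln1Dx R 1; apply; lra. Qed.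

Lemma theta_le n : \sum_(p < n.+1 | prime p) ln (p%:R : R) <= 4 * n%:R.
Proof.
have l2 := ln2_le1; have l0 : 0 <= ln (2 : R) by apply: ln_ge0; lra.
elim: n {-2}n (leqnn n) => [|N IH] n nN.
  move: nN; rewrite leqn0 => /eqP ->; rewrite mulr0 big1// => p pp.
  by case: p pp => [[|p]].
have [n1|n1] := leqP n 1.
  rewrite big1 ?mulr_ge0// => p pp; move: (prime_gt1 pp) (ltn_ord p); rewrite ltnS => p1 pn.
  by have := leq_trans p1 (leq_trans pn n1).
pose h := uphalf n.
have hn : (h < n)%N by rewrite /h uphalf_half; move: (odd_double_half n) n1; rewrite -addnn; case: (odd n) => /=; lia.
have nh : (n <= h + h <= n.+1)%N.
  by rewrite /h uphalf_half; move: (odd_double_half n) n1; rewrite -addnn; case: (odd n) => /=; lia.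
case/andP: nh => nh1 nh2.
apply: le_trans (_ : \sum_(p < (h + h).+1 | prime p) ln (p%:R : R) <= _).
  by apply: (@sum_ord_le prime (fun p => ln (p%:R : R))) => [i|]; [exact: ln_nat_ge0|rewrite ltnS].
apply: le_trans (theta_double h) _.
have := IH h (leq_trans hn nN); set S := \sum_(_ < _ | _) _.
have h1 : (h + h)%:R <= n%:R + 1 :> R by rewrite natr1 ler_nat.
have h2 : (h + h)%:R * ln 2 <= (n%:R + 1) * 1 :> R by apply: ler_pM.
have [n2|n3] := leqP n 2.
  have [E1 E2] : n = 2%N /\ h = 1%N by split; lia.
  by rewrite E1 E2 in h1 h2 *; lra.
have : 3 <= n%:R :> R by rewrite (ler_nat R 3).
by move: h1 h2; rewrite natrD; lra.
Qed.

Lemma ln_fact_ge n : n%:R * ln n%:R - n%:R <= ln (n`!%:R : R).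
Proof.
elim: n => [|n IH]; first by rewrite mul0r subr0 ln1.
rewrite factS natrM lnM ?posrE ?ltr0n ?fact_gt0//.
apply: le_trans (lerD (lexx _) IH).
suff : n%:R * (ln n.+1%:R - ln n%:R) <= 1 :> R by rewrite -natr1; lra.
case: n {IH} => [|n]; first by rewrite mul0r.
have n0 : (0 : R) < n.+1%:R by rewrite ltr0n.
have i0 : (0 : R) < n.+1%:R^-1 by rewrite invr_gt0.
rewrite mulrC -ler_pdivlMr// div1r -ln_div ?posrE ?ltr0n//.
have -> : n.+2%:R / n.+1%:R = 1 + n.+1%:R^-1 :> R.
  by rewrite -natr1 mulrDl divff ?gt_eqF// div1r.
by apply: le_ln1Dx; move: (n.+1%:R^-1) i0 => y; lra.
Qed.

Lemma ln_fact_le n : ln (n`!%:R : R) <= n%:R * ln n%:R.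
Proof.
elim: n => [|n IH]; first by rewrite mul0r ln1.
rewrite factS natrM lnM ?posrE ?ltr0n ?fact_gt0//.
rewrite -[X in _ <= X * _]natr1 mulrDl mul1r addrC lerD2r; apply: le_trans IH _.
rewrite ler_wpM2l//; case: n => [|n]; first by rewrite ln0 ?ln_nat_ge0.
exact: ln_nat_mono.
Qed.

(** A prime [p] divides [n!] at least [n / p - 1] times; the loss of one [ln p] for each prime is
    bounded by [theta_le]. *)
Lemma mertens_upper n : (0 < n)%N ->
  \sum_(p < n.+1 | prime p) ln (p%:R : R) / p%:R <= ln n%:R + 4.
Proof.
move=> n0; have n0' : (0 : R) < n%:R by rewrite ltr0n.
rewrite -(ler_pM2l n0') mulrDr.
apply: le_trans (lerD (ln_fact_le n) (lexx _)).
apply: le_trans (lerD (sum_logn_le n.+1 (fact_gt0 n)) (lexx _)).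
rewrite [n%:R * 4]mulrC; apply: le_trans (lerD (lexx _) (theta_le n)).
rewrite mulr_sumr -big_split /=; apply: ler_sum => p pp.
have p0 : (0 : R) < p%:R by rewrite ltr0n prime_gt0.
rewrite mulrCA mulrC -[X in _ <= _ + X]mul1r -mulrDl ler_wpM2r ?ln_nat_ge0//.
rewrite ler_pdivrMr// natr1 -natrM ler_nat.
apply: leq_trans (_ : (n %/ p).+1 * p <= _)%N; first by apply: ltnW; rewrite -ltn_divLR// prime_gt0.
rewrite leq_mul2r ltnS logn_fact// big_add1 /= big_mkord; apply/orP; right.
case: n n0 p {n0' p0} pp => // n _ p pp.
by rewrite big_ord_recl expn1 leq_addr.
Qed.

Lemma geometric_le (x : R) K : 0 <= x -> x <= 2^-1 -> \sum_(k < K) x ^+ k.+1 <= x + 2 * x ^+ 2.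
Proof.
move=> x0 x1; case: K => [|K]; first by rewrite big_ord0 addr_ge0// mulr_ge0// sqr_ge0.
apply: le_trans (_ : x + 2 * x ^+ 2 - 2 * x ^+ K.+2 <= _); last first.
  by rewrite lerBlDr lerDl mulr_ge0// exprn_ge0.
elim: K => [|K IH]; first by rewrite big_ord_recl big_ord0 expr1; lra.
rewrite big_ord_recr /=; apply: le_trans (lerD IH (lexx _)) _.
have : x * x ^+ K.+2 <= 2^-1 * x ^+ K.+2 by rewrite ler_wpM2r// exprn_ge0.
by rewrite [x ^+ K.+3]exprS; lra.
Qed.

(** From [ln p <= 2 * sqrt p] and the bound [3] for the sum of the [n ^ (- 3/2)]. *)
Lemma sum_ln_sqr K : \sum_(p < K | prime p) ln (p%:R : R) / p%:R ^+ 2 <= 6.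
Proof.
apply: le_trans (_ : \sum_(p < K.+1 | prime p) ln (p%:R : R) / p%:R ^+ 2 <= _).
  apply: (@sum_ord_le prime (fun p => ln (p%:R : R) / p%:R ^+ 2)) => // i.
  by rewrite mulr_ge0 ?ln_nat_ge0 ?invr_ge0 ?exprn_ge0.
rewrite big_mkcond big_ord_recl /= add0r.
apply: le_trans (_ : 2 * \sum_(i < K) (i.+1%:R : R) `^ (- (3 / 2)) <= _); last first.
  have := @sum_powR_le R (3 / 2) K; have -> : (3 / 2 - 1)^-1 = 2 :> R.
    by have -> : 3 / 2 - 1 = 2^-1 :> R; [lra|rewrite invrK].
  by move=> h; have := h ltac:(lra); lra.
rewrite mulr_sumr; apply: ler_sum => i _; rewrite /bump /= add1n.
have i0 : (0 : R) < i.+1%:R by rewrite ltr0n.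
case: ifP => _; last by rewrite mulr_ge0 ?powR_ge0.
have -> : ln (i.+1%:R : R) = 2 * ln (i.+1%:R `^ 2^-1) by rewrite ln_powR mulrA divff// mul1r.
apply: le_trans (_ : 2 * (i.+1%:R `^ 2^-1) / i.+1%:R ^+ 2 <= _).
  rewrite ler_pM2r ?invr_gt0 ?exprn_gt0// ler_pM2l//.
  have : 0 < i.+1%:R `^ 2^-1 :> R by rewrite powR_gt0.
  move: (i.+1%:R `^ 2^-1) => y y0; have := @le_ln1Dx R (y - 1); rewrite addrCA subrr addr0.
  by move=> h; have := h ltac:(lra); lra.
rewrite -mulrA ler_pM2l// -powR_mulrn ?(ltW i0)// -powRN -powRD ?(gt_eqF i0) ?implybT//.
by rewrite le_eqVlt; apply/orP; left; apply/eqP; congr (_ `^ _); lra.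
Qed.

(** Here [13 = 1 + 12]: the [1] is the error in [ln_fact_ge], and [12] bounds the higher prime
    powers through [sum_ln_sqr]. *)
Lemma mertens_lower n : (0 < n)%N ->
  ln n%:R - 13 <= \sum_(p < n.+1 | prime p) ln (p%:R : R) / p%:R.
Proof.
move=> n0; have n0' : (0 : R) < n%:R by rewrite ltr0n.
rewrite -(ler_pM2l n0').
suff : ln (n`!%:R : R) <= n%:R * (\sum_(p < n.+1 | prime p) ln (p%:R : R) / p%:R + 12).
  by have := ln_fact_ge n; rewrite mulrDr mulrBr; lra.
have nf : (n`! < maxn n.+1 n`!.+1)%N by rewrite leq_max ltnSn orbT.
rewrite (ln_primes (fact_gt0 n) nf).
have -> : \sum_(p < maxn n.+1 n`!.+1 | prime p) (logn p n`!)%:R * ln (p%:R : R) =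
   \sum_(p < n.+1 | prime p) (logn p n`!)%:R * ln p%:R.
  rewrite [RHS](big_ord_widen_cond _ prime (fun p => (logn p n`!)%:R * ln (p%:R : R)) (leq_maxl n.+1 n`!.+1)).
  rewrite [RHS]big_mkcondr; apply: eq_bigr => p pp; case: ltnP => // np.
  rewrite (_ : logn p n`! = 0%N) ?mul0r//; apply/eqP; rewrite -leqn0 leqNgt logn_gt0 mem_primes pp fact_gt0 /=.
  by apply/negP => /(prime_dvd_fact pp); rewrite leqNgt np.
have := sum_ln_sqr n.+1; move=> h6.
apply: le_trans (_ : n%:R * (\sum_(p < n.+1 | prime p) (ln (p%:R : R) / p%:R + 2 * (ln p%:R / p%:R ^+ 2))) <= _); last first.
  by rewrite ler_pM2l// big_split /= lerD2l -mulr_sumr; lra.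
rewrite mulr_sumr; apply: ler_sum => p pp.
have p0 : (0 : R) < p%:R by rewrite ltr0n prime_gt0.
have -> : ln (p%:R : R) / p%:R + 2 * (ln p%:R / p%:R ^+ 2) = (p%:R^-1 + 2 * p%:R^-1 ^+ 2) * ln p%:R.
  by rewrite exprVn; ring.
rewrite mulrA ler_wpM2r ?ln_nat_ge0//.
apply: le_trans (_ : n%:R * \sum_(k < n) (p%:R^-1 : R) ^+ k.+1 <= _); last first.
  rewrite ler_pM2l//; apply: geometric_le; first by rewrite invr_ge0 ltW.
  by rewrite lef_pV2 ?posrE// (ler_nat R 2) prime_gt1.
rewrite logn_fact// big_add1 /= big_mkord natr_sum mulr_sumr; apply: ler_sum => k _.
rewrite exprVn -natrX ler_pdivlMr ?ltr0n ?expn_gt0 ?prime_gt0// -natrM ler_nat.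
exact: leq_divM.
Qed.

End PrimeSums.

Local Close Scope classical_set_scope.

(** * Large prime factors of polynomial values *)

Section IntegerPolynomials.
Local Notation dvz m z := ((m%:Z %| z%R)%Z).

Lemma horner_taylor2 (P : {poly int}) (a b : int) :
  exists h, P.[a] - P.[b] = (a - b) * (P^`().[b] + (a - b) * h).
Proof.
elim/poly_ind: P => [|P c [h hP]]; first by exists 0; rewrite deriv0 !horner0; ring.
exists (P^`().[b] + h * a).
rewrite derivD derivM derivX derivC addr0 mulr1 !hornerE.
have -> : P.[a] = P.[b] + (a - b) * (P^`().[b] + (a - b) * h) by rewrite -hP; ring.
by ring.
Qed.

Lemma horner_sub_dvd (P : {poly int}) (m a b : int) : (m %| a - b)%Z -> (m %| P.[a] - P.[b])%Z.
Proof. by move=> mab; have [h ->] := horner_taylor2 P a b; exact: dvdz_mulr. Qed.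

Lemma coprimez_prime (p i : nat) (z : int) : prime p -> ~~ dvz p z -> coprimez (p ^ i)%N z.
Proof. by move=> pp; rewrite dvdzE coprimezE /= => pz; rewrite coprimeXl// prime_coprime. Qed.

(** By [horner_taylor2] the difference of values is [a - b] times a number prime to [p]. *)
Lemma hensel_unique (P : {poly int}) (p i : nat) (a b : int) : prime p ->
  (p %| a - b)%Z -> ~~ (p %| P^`().[b])%Z ->
  dvz (p ^ i)%N (P.[a] - P.[b]) -> dvz (p ^ i)%N (a - b).
Proof.
move=> pp pab pP; have [h ->] := horner_taylor2 P a b; rewrite Gauss_dvdzl//.
apply: coprimez_prime => //.
by rewrite addrC rpredDl ?dvdz_mulr.
Qed.

Lemma sum_block (m : nat) (z : int) : (0 < m)%N -> (\sum_(i < m) dvz m (i%:Z + z) = 1)%N.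
Proof.
move=> m0; have m0' : (m%:Z != 0) by rewrite eqz_nat -lt0n.
have key (i : int) : dvz m (i + z) = ((i %% m)%Z == (- z %% m)%Z) by rewrite eqz_mod_dvd opprK.
pose t := `|(- z %% m)%Z|%N.
have te : t%:Z = (- z %% m)%Z by rewrite gez0_abs ?modz_ge0.
have tm : (t < m)%N by rewrite -ltz_nat te ltz_pmod.
rewrite (bigD1 (Ordinal tm)) //= key te modz_mod eqxx big1 => [|i it]; first by rewrite addn0.
rewrite key modz_small ?ltz_nat ?ltn_ord// -te eqz_nat.
by case: eqP => // E; case/eqP: it; apply: val_inj.
Qed.

Lemma sumn_ord_le (F : nat -> nat) (m n : nat) : (m <= n)%N ->
  (\sum_(i < m) F i <= \sum_(i < n) F i)%N.
Proof.
move=> mn; rewrite (big_ord_widen _ F mn).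
by rewrite [leqRHS](bigID (fun i : 'I_n => (i < m)%N)) /= leq_addr.
Qed.

Lemma sum_blocks (m k : nat) (z : int) : (0 < m)%N -> (\sum_(i < m * k) dvz m (i%:Z + z) = k)%N.
Proof.
move=> m0; elim: k z => [|k IH] z; first by rewrite muln0 big_ord0.
rewrite mulnS (@sum_nat_shift nat (fun i : nat => nat_of_bool (dvz m (i%:Z + z)))) sum_block// -[RHS]add1n; congr (_ + _)%N.
rewrite -[RHS](IH z); apply: eq_bigr => i _; rewrite PoszD -addrA.
by rewrite rpredDl ?dvdzz.
Qed.

Lemma progression_count_ge (m n : nat) (z : int) : (0 < m)%N ->
  (n %/ m <= \sum_(i < n) dvz m (i%:Z + z))%N.
Proof.
move=> m0; rewrite -[leqLHS](sum_blocks _ z m0).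
have h : (m * (n %/ m) <= n)%N by rewrite mulnC leq_divM.
exact: (sumn_ord_le (fun i : nat => nat_of_bool (dvz m (i%:Z + z)))).
Qed.

Lemma progression_count_le (m n : nat) (z : int) : (0 < m)%N ->
  (\sum_(i < n) dvz m (i%:Z + z) <= (n %/ m).+1)%N.
Proof.
move=> m0; rewrite -[leqRHS](sum_blocks _ z m0).
have h : (n <= m * (n %/ m).+1)%N by rewrite mulnC ltnW// -ltn_divLR.
exact: (sumn_ord_le (fun i : nat => nat_of_bool (dvz m (i%:Z + z)))).
Qed.

End IntegerPolynomials.

Section PolynomialPrimes.
Local Notation dvz m z := ((m%:Z %| z%R)%Z).
Variables (R : realType) (Q : {poly int}) (d : nat).
Hypothesis sizeQ : size Q = d.+1.
Hypothesis d_gt0 : (0 < d)%N.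
(** The binary form [b ^ d * Q (a / b)]. *)
Definition homog_form (a b : int) := \sum_(i < d.+1) Q`_i * a ^+ i * b ^+ (d - i).
Hypothesis form_neq0 : forall a b : int, b != 0 -> homog_form a b != 0.
Hypothesis simple_roots : forall (p : nat) (x : int), prime p ->
  (p %| Q.[x])%Z -> ~~ (p %| Q^`().[x])%Z.

Definition rootmod p (r : 'I_p) := (p %| Q.[r%:Z])%Z.
Definition rho p := #|[pred r : 'I_p | rootmod r]|.
Definition rhosum Y : R := \sum_(p < Y.+1 | prime p) (rho p)%:R * (ln p%:R / p%:R).

Lemma rho_le p : prime p -> (rho p <= d)%N.
Proof.
move=> pp; have chp := pchar_Fp pp.
pose q := map_poly intr Q : {poly 'F_p}.
have qE (x : int) : (p %| Q.[x])%Z = root q x%:~R.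
  by rewrite /root /q horner_map /= (dvdz_pcharf chp).
have q0 : q != 0.
  (* If [Q] vanished modulo [p], then [0] would be a root with vanishing derivative. *)
  apply/eqP => q0; have := simple_roots (p := p) (x := 0) pp.
  rewrite qE q0 root0 => /(_ isT); rewrite (dvdz_pcharf chp) -(horner_map intr) /= -deriv_map -/q q0.
  by rewrite deriv0 horner0 eqxx.
pose rs : seq 'F_p := [seq ((val r)%:Z)%:~R | r <- enum [pred r : 'I_p | rootmod r]].
have rsz : size rs = rho p by rewrite size_map -cardE.
have : (size rs < size q)%N.
  apply: max_poly_roots => //.
    by apply/allP => x /mapP[r]; rewrite mem_enum inE /rootmod qE => rr ->.
  rewrite map_inj_uniq ?enum_uniq// => r s rsE; apply: val_inj.
  have : (p %| r%:Z - s%:Z)%Z by rewrite (dvdz_pcharf chp) rmorphB /= rsE subrr.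
  by rewrite -eqz_mod_dvd !modz_small ?ltz_nat ?ltn_ord// => /eqP [].
rewrite rsz => h; rewrite -ltnS; apply: leq_trans h _.
by rewrite -sizeQ; exact: size_poly.
Qed.

(** The trivial estimate, from [rho p <= d]; [17 = 4 + 13] adds the two errors of Mertens's
    estimates. *)
Lemma rhosum_diff m n : (0 < m)%N -> (m <= n)%N ->
  rhosum n - rhosum m <= d%:R * (ln n%:R - ln m%:R + 17).
Proof.
move=> m0 mn; have n0 := leq_trans m0 mn.
pose F (p : nat) : R := if prime p then (d%:R - (rho p)%:R) * (ln p%:R / p%:R) else 0.
have F0 p : 0 <= F p.
  rewrite /F; case: ifP => // pp; rewrite mulr_ge0 ?subr_ge0 ?ler_nat ?rho_le//.
  by rewrite mulr_ge0 ?invr_ge0 ?ln_nat_ge0.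
have FE Y : \sum_(p < Y.+1 | prime p) F p =
    d%:R * (\sum_(p < Y.+1 | prime p) ln (p%:R : R) / p%:R) - rhosum Y.
  rewrite /rhosum mulr_sumr -sumrB; apply: eq_bigr => p pp.
  by rewrite /F pp mulrBl.
have := @sum_ord_le R prime F _ _ F0 (mn : (m < n.+1)%N); rewrite !FE.
have := @mertens_upper R _ n0; have := @mertens_lower R _ m0.
move: (\sum_(_ < m.+1 | _) _) (\sum_(_ < n.+1 | _) _) => x y xm yn.
have : d%:R * (y - x) <= d%:R * (ln n%:R - ln m%:R + 17) by rewrite ler_wpM2l//; lra.
by lra.
Qed.

Lemma form_horner a b : homog_form a b = (\poly_(i < d.+1) (Q`_i * b ^+ (d - i))).[a].
Proof. by rewrite horner_poly; apply: eq_bigr => i _; rewrite mulrAC. Qed.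

Lemma form_homog b r : homog_form (b * r) b = b ^+ d * Q.[r].
Proof.
rewrite /homog_form horner_coef sizeQ mulr_sumr; apply: eq_bigr => i _.
have <- : b ^+ (d - i) * b ^+ i = b ^+ d by rewrite -exprD subnK// -ltnS.
by rewrite exprMn; ring.
Qed.

Lemma form_dvd (p : nat) (a b r : int) : (p %| Q.[r])%Z -> (p %| a - b * r)%Z -> (p %| homog_form a b)%Z.
Proof.
move=> pr pab; have := horner_sub_dvd (\poly_(i < d.+1) (Q`_i * b ^+ (d - i))) pab.
by rewrite -!form_horner form_homog rpredBr// dvdz_mull.
Qed.

Lemma logn_form_ge (p : nat) (a b : int) : prime p -> b != 0 ->
  (\sum_(r < p | rootmod r) (~~ dvz p b && dvz p (a - b * r%:Z)) <= logn p `|homog_form a b|)%N.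
Proof.
move=> pp b0.
case: (pickP (fun r : 'I_p => [&& rootmod r, ~~ (p %| b)%Z & (p %| a - b * r%:Z)%Z])) => [r|no]; last first.
  by rewrite big1// => r rr; have := no r; rewrite rr /= => ->.
case/and3P => rr pb pab.
apply: leq_trans (_ : 1 <= _)%N; last first.
  rewrite logn_gt0 mem_primes pp absz_gt0 form_neq0//=.
  by have := form_dvd rr pab; rewrite dvdzE.
rewrite (bigD1 r) //= big1 ?addn0 ?leq_b1// => s /andP[ss sr].
rewrite pb /=; case E: (_ %| _)%Z => //; case/eqP: sr; apply: val_inj.
have : (p %| b * (r%:Z - s%:Z))%Z.
  have -> : b * (r%:Z - s%:Z) = (a - b * s%:Z) - (a - b * r%:Z) by ring.
  by rewrite rpredB.
rewrite Gauss_dvdzr; last by rewrite -[p]expn1; exact: coprimez_prime.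
by rewrite -eqz_mod_dvd !modz_small ?ltz_nat ?ltn_ord// => /eqP [].
Qed.

Section Box.
Variable B : nat.
Hypothesis B_gt0 : (0 < B)%N.

(* The points [(a, b)] of the box [-B <= a < B], [1 <= b <= B] with [p] prime to
   [b] and [a = b r] modulo [p], that is where the root [r] of [Q] modulo [p]
   makes [p] divide the homogenized form of [Q]. *)
Definition box_hit p (r : nat) (z : 'I_(B + B) * 'I_B) :=
  ~~ (p %| z.2.+1)%N && (p %| z.1%:Z - B%:Z - z.2.+1%:Z * r%:Z)%Z.
Definition box_count p r := #|[set z | box_hit p r z]|.

(* Pigeonhole on [a - b r] modulo [p] in the box of side [B], then differences. *)
Lemma box_count_large p (r : 'I_p) : prime p -> (B < p)%N -> (B * B <= p * (box_count p r).+1)%N.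
Proof.
move=> pp Bp; have p0 := prime_gt0 pp.
pose cl (z : 'I_B * 'I_B) : int := z.1%:Z - z.2%:Z * r%:Z.
pose C (c : 'I_p) := [set z | (p %| cl z - c%:Z)%Z].
have [c hc] : exists c, (B * B <= p * #|C c|)%N.
  apply/existsP; rewrite -[X in is_true X]negbK negb_exists; apply/negP => /forallP no.
  have s1 : (\sum_(c : 'I_p) #|C c| = B * B)%N.
    have -> : (\sum_(c : 'I_p) #|C c| = \sum_(c : 'I_p) \sum_(z : 'I_B * 'I_B) dvz p (cl z - c%:Z))%N.
      apply: eq_bigr => c _; rewrite -sum1_card big_mkcond /=; apply: eq_bigr => z _.
      by rewrite inE; case: (_ %| _)%Z.
    rewrite exchange_big /=; transitivity (\sum_(z : 'I_B * 'I_B) 1)%N; last first.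
      by rewrite sum1_card card_prod !card_ord.
    apply: eq_bigr => z _; rewrite -(sum_block (- cl z) p0); apply: eq_bigr => c _.
    by rewrite -[in RHS]rpredN opprD opprK addrC.
  have : (\sum_(c : 'I_p) p * #|C c| < \sum_(c : 'I_p) B * B)%N.
    rewrite (bigD1 (Ordinal p0)) //= [ltnRHS](bigD1 (Ordinal p0)) //= -addSn.
    by rewrite leq_add ?ltnNge ?no// leq_sum// => i _; rewrite ltnW// ltnNge.
  by rewrite -big_distrr /= s1 sum_nat_const card_ord ltnn.
have [z0 z0C] : exists z0, z0 \in C c.
  apply/set0Pn; rewrite -card_gt0; case: (#|C c|) hc => //; rewrite muln0 leqn0 muln_eq0 orbb => /eqP E.
  by have := B_gt0; rewrite E.
(* With the element of smallest second entry as origin, all differences have [b > 0]. Elements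
   sharing a second entry coincide because [B < p]. *)
pose zm := [arg min_(z < z0 in C c) (val z.2)].
have [zmC zmin] : zm \in C c /\ forall z, z \in C c -> (zm.2 <= z.2)%N.
  by rewrite /zm; case: arg_minnP.
have dC z : z \in C c -> (p %| cl z - cl zm)%Z.
  move: zmC; rewrite !inE => h1 h2; have -> : cl z - cl zm = (cl z - c%:Z) - (cl zm - c%:Z) by ring.
  by rewrite rpredB.
have lt2 z : z \in C c -> z != zm -> (zm.2 < z.2)%N.
  move=> zC zzm; rewrite ltn_neqAle zmin// andbT; apply/eqP => E2.
  case/eqP: zzm; have := dC z zC; rewrite /cl -E2.
  have -> : z.1%:Z - zm.2%:Z * r%:Z - (zm.1%:Z - zm.2%:Z * r%:Z) = z.1%:Z - zm.1%:Z by ring.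
  rewrite -eqz_mod_dvd !modz_small ?ltz_nat ?(ltn_trans (ltn_ord _) Bp)// => /eqP [E1].
  by move: E1 E2; case: z {zC} => [z1 z2]; case: (zm) => [y1 y2] /= E1 E2; congr pair; apply: val_inj.
have BB : (0 < B + B)%N by rewrite addn_gt0 B_gt0.
(* Indices in the box stand for [a + B] and [b - 1], hence the shift by [B] and the predecessor. *)
pose g (z : 'I_B * 'I_B) := (insubd (Ordinal BB) (z.1 + B - zm.1)%N, insubd (Ordinal B_gt0) (z.2 - zm.2).-1).
have g1 z : val (g z).1 = (z.1 + B - zm.1)%N.
  rewrite /g /= val_insubd ifT//; apply: leq_ltn_trans (leq_subr _ _) _.
  by rewrite ltn_add2r ltn_ord.
have g2 z : z \in C c -> z != zm -> (val (g z).2).+1 = (z.2 - zm.2)%N.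
  move=> zC zzm; have lt := lt2 z zC zzm; rewrite /g /= val_insubd ifT; first by rewrite prednK// subn_gt0.
  by rewrite prednK ?subn_gt0// (leq_trans (leq_subr _ _))// ltnW.
have ginj : {in C c :\ zm &, injective g}.
  move=> z y; rewrite !in_setD1 => /andP[zm1 zC] /andP[ym1 yC] gg.
  have e1 := congr1 (fun t => val t.1) gg; have e2 := congr1 (fun t => (val t.2).+1) gg.
  rewrite !g1 in e1; rewrite !g2// in e2.
  have l1 := lt2 z zC zm1; have l2 := lt2 y yC ym1.
  have := ltn_ord zm.1; have := ltn_ord z.1; have := ltn_ord y.1 => h1 h2 h3.
  have E1 : z.1 = y.1 by apply: val_inj => /=; move: e1 h1 h2 h3; clear; move: (val z.1) (val y.1) (val zm.1) => /=; lia.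
  have E2 : z.2 = y.2 by apply: val_inj => /=; move: e2 l1 l2; clear; move: (val z.2) (val y.2) (val zm.2) => /=; lia.
  by move: E1 E2; case: (z) (y) => [z1 z2] [y1 y2] /= -> ->.
apply: leq_trans hc _; rewrite leq_mul2l (cardsD1 zm) zmC add1n ltnS -(card_in_imset ginj).
apply/orP; right; rewrite /box_count; apply: subset_leq_card; apply/fintype.subsetP => w /imsetP[z].
rewrite finset.in_setD1 => /andP[zzm zC] ->; rewrite finset.in_set /box_hit.
have E2 := g2 z zC zzm; rewrite -[X in (_ %| X.+1)%N]/(val (g z).2) E2; apply/andP; split.
  apply/negP => /dvdn_leq; rewrite subn_gt0 lt2// => /(_ isT).
  by apply/negP; rewrite -ltnNge (leq_ltn_trans (leq_subr _ _))// (ltn_trans (ltn_ord _) Bp).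
rewrite -[X in (_ %| X%:Z - _ - _)%Z]/(val (g z).1) g1.
have -> : (z.1 + B - zm.1)%N%:Z = z.1%:Z + B%:Z - zm.1%:Z.
  by rewrite -subzn ?PoszD// (leq_trans (ltnW (ltn_ord zm.1)))// leq_addl.
rewrite -subzn ?(ltnW (lt2 _ zC zzm))//.
have := dC z zC; rewrite /cl.
by congr (_ %| _)%Z; ring.
Qed.

(** For each [b] prime to [p] the interval of length [2 B] meets a full progression of values of
    [a]. This gives about [2 B ^ 2 / p] points, twice what pigeonhole yields, and the surplus
    produces the term [rhosum B] in [rhosum_square]. *)
Lemma box_count_small p (r : nat) : prime p -> (p <= B)%N ->
  2 * (B%:R ^+ 2 / p%:R) - 2 * (B%:R ^+ 2 / p%:R ^+ 2) - 2 * B%:R <= (box_count p r)%:R :> R.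
Proof.
move=> pp pB; have p0 := prime_gt0 pp.
have p0' : (0 : R) < p%:R by rewrite ltr0n.
have E : box_count p r = (\sum_(w < B) (~~ (p %| w.+1)%N) * \sum_(u < B + B) dvz p (u%:Z + (- B%:Z - w.+1%:Z * r%:Z)))%N.
  transitivity (\sum_z box_hit p r z)%N.
    rewrite /box_count -sum1_card big_mkcond /=; apply: eq_bigr => z _; rewrite finset.in_set.
    by case: box_hit.
  rewrite (eq_bigr (fun z => nat_of_bool (box_hit p r (z.1, z.2)))) => [|[u w]//].
  rewrite -(pair_bigA _ (fun u w => nat_of_bool (box_hit p r (u, w)))) /=.
  rewrite exchange_big /=; apply: eq_bigr => w _; rewrite big_distrr /=; apply: eq_bigr => u _.
  by rewrite /box_hit /= addrA; case: (_ %| _)%N => //=; case: (_ \in _).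
pose W := (\sum_(w < B) ~~ (p %| w.+1)%N)%N.
have W1 : ((B + B) %/ p * W <= box_count p r)%N.
  rewrite E /W big_distrr /=; apply: leq_sum => w _; rewrite mulnC leq_mul2l.
  by rewrite progression_count_ge ?orbT.
have W2 : (B <= W + (B %/ p).+1)%N.
  have : (\sum_(w < B) dvz p (w%:Z + 1) <= (B %/ p).+1)%N by exact: progression_count_le.
  rewrite -(leq_add2l W); apply: leq_trans; rewrite -big_split /= -[leqLHS]card_ord -sum1_card.
  apply: leq_sum => w _; have -> : (p %| w%:Z + 1)%Z = (p %| w.+1)%N by rewrite -PoszD addn1.
  by case: (_ %| _)%N.
have W2' : B%:R - B%:R / p%:R - 1 <= W%:R :> R.
  have : B%:R <= W%:R + (B %/ p)%:R + 1 :> R by rewrite -addrA natr1 -natrD ler_nat.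
  have : (B %/ p)%:R <= B%:R / p%:R :> R by rewrite ler_pdivlMr// -natrM ler_nat leq_divM.
  by lra.
have K1 : 2 * (B%:R / p%:R) - 1 <= ((B + B) %/ p)%:R :> R.
  rewrite lerBlDr mulrA natr1 ler_pdivrMr// -natrM -natrM ler_nat mul2n -addnn.
  by apply: ltnW; rewrite -ltn_divLR.
have K0 : 1 <= B%:R / p%:R :> R by rewrite ler_pdivlMr// mul1r ler_nat.
apply: le_trans (_ : ((B + B) %/ p * W)%:R <= _); last by rewrite ler_nat.
rewrite natrM; apply: le_trans (_ : (2 * (B%:R / p%:R) - 1) * W%:R <= _); last by rewrite ler_wpM2r.
apply: le_trans (_ : (2 * (B%:R / p%:R) - 1) * (B%:R - B%:R / p%:R - 1) <= _); last first.
  by rewrite ler_wpM2l//; lra.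
have -> : B%:R ^+ 2 / p%:R = B%:R * (B%:R / p%:R) :> R by rewrite expr2 mulrA.
have -> : B%:R ^+ 2 / p%:R ^+ 2 = (B%:R / p%:R) ^+ 2 :> R by rewrite exprMn exprVn.
have B1 : 1 <= B%:R :> R by rewrite ler1n.
have : B%:R / p%:R <= B%:R :> R by rewrite ler_pdivrMr// ler_peMr// ler1n.
by move: K0; move: (B%:R / p%:R) => x; nra.
Qed.

End Box.

Definition height : nat := (\sum_(i < d.+1) absz (Q`_i)%R)%N.

Lemma height_gt0 : (0 < height)%N.
Proof.
rewrite /height (bigD1 ord_max) //= addn_gt0 absz_gt0.
by have := lead_coef_eq0 Q; rewrite lead_coefE sizeQ /= => ->; rewrite -size_poly_gt0 sizeQ.
Qed.

Lemma abs_sum_le (n : nat) (F : 'I_n -> int) : (`|(\sum_(i < n) F i)%R| <= \sum_(i < n) `|F i|)%N.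
Proof.
elim/big_ind2: _ => // x m y n' h1 h2; apply: leq_trans (_ : `|m| + `|n'| <= _)%N; last exact: leq_add.
by rewrite -lez_nat PoszD !abszE ler_normD.
Qed.

Lemma form_bound (B : nat) (a b : int) : (`|a| <= B)%N -> (`|b| <= B)%N ->
  (`|homog_form a b| <= height * B ^ d)%N.
Proof.
move=> aB bB; apply: leq_trans (abs_sum_le _) _; rewrite /height big_distrl /=.
apply: leq_sum => i _; rewrite !abszM !abszX -mulnA leq_mul2l.
have -> : (B ^ d = B ^ i * B ^ (d - i))%N by rewrite -expnD subnKC// -ltnS.
have ex k (x y : nat) : (x <= y)%N -> (x ^ k <= y ^ k)%N by case: k => // k; rewrite leq_exp2r.
by rewrite leq_mul ?ex ?orbT.
Qed.

Lemma horner_bound (x X : nat) : (x <= X)%N -> (0 < X)%N -> (`|Q.[x%:Z]| <= height * X ^ d)%N.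
Proof.
move=> xX X0; have := form_homog 1 x%:Z; rewrite mul1r expr1n mul1r => <-.
exact: form_bound.
Qed.

Lemma horner_neq0 (x : int) : Q.[x] != 0.
Proof. by have := form_homog 1 x; rewrite mul1r expr1n mul1r => <-; exact: form_neq0. Qed.

(* Every prime [p] up to [B ^ 2] contributes to the product of the form over the
   box, whose size is at most [(height * B ^ d) ^ (2 B ^ 2)]. *)
Lemma rhosum_square B : (0 < B)%N ->
  rhosum (B * B) + rhosum B <= 2 * d%:R * ln B%:R + 2 * ln height%:R + 24 * d%:R.
Proof.
move=> B0; have B0' : (0 : R) < B%:R by rewrite ltr0n.
have BB : (B.+1 <= (B * B).+1)%N by rewrite ltnS leq_pmulr.
pose F (z : 'I_(B + B) * 'I_B) := homog_form (z.1%:Z - B%:Z) z.2.+1%:Z.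
have F0 z : (0 < `|F z|)%N by rewrite absz_gt0 form_neq0.
have up : \sum_z \sum_(p < (B * B).+1 | prime p) (logn p `|F z|)%:R * ln (p%:R : R) <=
    2 * B%:R ^+ 2 * (d%:R * ln B%:R + ln height%:R).
  apply: le_trans (_ : \sum_(z : 'I_(B + B) * 'I_B) (d%:R * ln (B%:R : R) + ln height%:R) <= _).
    apply: ler_sum => z _; apply: le_trans (sum_logn_le _ _ (F0 z)) _.
    apply: le_trans (_ : ln ((height * B ^ d)%:R) <= _).
      apply: ln_nat_mono => //; apply: form_bound; last exact: ltn_ord.
      by have := ltn_ord z.1; move: (nat_of_ord z.1) => u hu; lia.
    by rewrite natrM natrX lnM ?posrE ?exprn_gt0 ?ltr0n ?height_gt0// lnXn// addrC mulr_natl.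
  rewrite sumr_const card_prod !card_ord -[_ *+ _]mulr_natl natrM natrD.
  by rewrite le_eqVlt; apply/orP; left; apply/eqP; ring.
have low : \sum_(p < (B * B).+1 | prime p) ln (p%:R : R) * \sum_(r < p | rootmod r) (box_count B p r)%:R <=
    \sum_z \sum_(p < (B * B).+1 | prime p) (logn p `|F z|)%:R * ln (p%:R : R).
  rewrite exchange_big /=; apply: ler_sum => p pp.
  rewrite -mulr_suml mulrC ler_wpM2r ?ln_nat_ge0//.
  rewrite -!natr_sum ler_nat.
  have -> : (\sum_(r < p | rootmod r) box_count B p r = \sum_(r < p | rootmod r) \sum_(z : 'I_(B + B) * 'I_B) box_hit p r z)%N.
    apply: eq_bigr => r _; rewrite /box_count -sum1_card big_mkcond /=; apply: eq_bigr => z _; rewrite finset.in_set.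
    by case: box_hit.
  rewrite exchange_big /=; apply: leq_sum => z _; apply: leq_trans (logn_form_ge _ pp _) => //.
have t1 (p : nat) : prime p -> (p <= B * B)%N ->
    (rho p)%:R * ln p%:R * (B%:R ^+ 2 / p%:R - 1 +
      (if (p <= B)%N then B%:R ^+ 2 / p%:R - 2 * (B%:R ^+ 2 / p%:R ^+ 2) - 2 * B%:R else 0))
    <= ln (p%:R : R) * \sum_(r < p | rootmod r) (box_count B p r)%:R.
  move=> pp pBB; have p0 : (0 : R) < p%:R by rewrite ltr0n prime_gt0.
  rewrite [(rho p)%:R * _]mulrC -mulrA ler_wpM2l ?ln_nat_ge0//.
  rewrite /rho -sum1_card natr_sum mulr_suml; apply: ler_sum => r _; rewrite mul1r.
  case: leqP => pB; first by have := @box_count_small B B0 p r pp pB; lra.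
  rewrite addr0 lerBlDr natr1 ler_pdivrMr// -natrX -natrM ler_nat mulnC -mulnn.
  exact: box_count_large.
(* In units of [d * B ^ 2] the losses are [4] from the [- 1] of each prime, [12] from the squares of
   primes and [8] from the term [2 B]; they make up the [24] of the statement. *)
have low2 : B%:R ^+ 2 * rhosum (B * B) - d%:R * (4 * B%:R ^+ 2) +
    (B%:R ^+ 2 * rhosum B - d%:R * (12 * B%:R ^+ 2) - d%:R * (8 * B%:R ^+ 2)) <=
   \sum_(p < (B * B).+1 | prime p) ln (p%:R : R) * \sum_(r < p | rootmod r) (box_count B p r)%:R.
  apply: le_trans (_ : \sum_(p < (B * B).+1 | prime p) (rho p)%:R * ln p%:R * (B%:R ^+ 2 / p%:R - 1 +
      (if (p <= B)%N then B%:R ^+ 2 / p%:R - 2 * (B%:R ^+ 2 / p%:R ^+ 2) - 2 * B%:R else 0)) <= _); last first.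
    by apply: ler_sum => p pp; apply: t1 => //; rewrite -ltnS.
  under eq_bigr do rewrite mulrDr; rewrite big_split /=; apply: lerD.
    have -> : \sum_(p < (B * B).+1 | prime p) (rho p)%:R * ln p%:R * (B%:R ^+ 2 / p%:R - 1) =
       B%:R ^+ 2 * rhosum (B * B) - \sum_(p < (B * B).+1 | prime p) (rho p)%:R * ln (p%:R : R).
      rewrite /rhosum mulr_sumr -sumrB; apply: eq_bigr => p _; ring.
    rewrite lerD2l lerN2; apply: le_trans (_ : \sum_(p < (B * B).+1 | prime p) d%:R * ln (p%:R : R) <= _).
      by apply: ler_sum => p pp; rewrite ler_wpM2r ?ln_nat_ge0// ler_nat rho_le.
    by rewrite -mulr_sumr ler_wpM2l//; apply: le_trans (theta_le _ _) _; rewrite natrM expr2.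
  have -> : \sum_(p < (B * B).+1 | prime p) (rho p)%:R * ln p%:R *
      (if (p <= B)%N then B%:R ^+ 2 / p%:R - 2 * (B%:R ^+ 2 / p%:R ^+ 2) - 2 * B%:R else 0) =
      \sum_(p < B.+1 | prime p) (rho p)%:R * ln (p%:R : R) * (B%:R ^+ 2 / p%:R - 2 * (B%:R ^+ 2 / p%:R ^+ 2) - 2 * B%:R).
    rewrite [RHS](big_ord_widen_cond _ prime (fun p => (rho p)%:R * ln (p%:R : R) * (B%:R ^+ 2 / p%:R - 2 * (B%:R ^+ 2 / p%:R ^+ 2) - 2 * B%:R)) BB).
    rewrite [RHS]big_mkcondr; apply: eq_bigr => p _; rewrite ltnS; case: ifP => //; by rewrite mulr0.
  have -> : \sum_(p < B.+1 | prime p) (rho p)%:R * ln (p%:R : R) * (B%:R ^+ 2 / p%:R - 2 * (B%:R ^+ 2 / p%:R ^+ 2) - 2 * B%:R) =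
     B%:R ^+ 2 * rhosum B - \sum_(p < B.+1 | prime p) (rho p)%:R * (2 * B%:R ^+ 2 * (ln (p%:R : R) / p%:R ^+ 2))
      - \sum_(p < B.+1 | prime p) (rho p)%:R * (2 * B%:R * ln (p%:R : R)).
    rewrite /rhosum mulr_sumr -!sumrB; apply: eq_bigr => p _; ring.
  apply: lerB.
    rewrite lerD2l lerN2; apply: le_trans (_ : \sum_(p < B.+1 | prime p) d%:R * (2 * B%:R ^+ 2 * (ln (p%:R : R) / p%:R ^+ 2)) <= _).
      apply: ler_sum => p pp; rewrite ler_wpM2r ?ler_nat ?rho_le//.
      by rewrite !mulr_ge0 ?sqr_ge0 ?invr_ge0 ?ln_nat_ge0 ?exprn_ge0.
    rewrite -!mulr_sumr ler_wpM2l//.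
    have := @sum_ln_sqr R B.+1; set S := \sum_(_ < _ | _) _ => hS.
    have := @ler_wpM2l R (2 * B%:R ^+ 2) ltac:(by rewrite mulr_ge0 ?sqr_ge0) _ _ hS; lra.
  apply: le_trans (_ : \sum_(p < B.+1 | prime p) d%:R * (2 * B%:R * ln (p%:R : R)) <= _).
    apply: ler_sum => p pp; rewrite ler_wpM2r ?ler_nat ?rho_le//.
    by rewrite !mulr_ge0 ?ln_nat_ge0.
  rewrite -!mulr_sumr ler_wpM2l//.
  have := @theta_le R B; set S := \sum_(_ < _ | _) _ => hS.
  have := @ler_wpM2l R (2 * B%:R) ltac:(by rewrite mulr_ge0) _ _ hS; rewrite expr2; lra.
have B2 : 0 < B%:R ^+ 2 :> R by rewrite exprn_gt0.
rewrite -(ler_pM2l B2); have := le_trans low2 (le_trans low up).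
move: (rhosum _) (rhosum _) (B%:R ^+ 2) => x y w; lra.
Qed.

(** Averaging [rhosum_square] with [rhosum_diff] eliminates [rhosum B]. For [Y = B ^ 2] the main
    term is [3/4 * d * ln Y]. *)
Lemma rhosum_square_le B : (0 < B)%N ->
  rhosum (B * B) <= 3 / 2 * d%:R * ln B%:R + (ln height%:R + 21 * d%:R).
Proof.
move=> B0; have := rhosum_square B0; have BB : (B <= B * B)%N by rewrite leq_pmulr.
have := rhosum_diff B0 BB; rewrite natrM lnM ?posrE ?ltr0n//.
move: (rhosum _) (rhosum _) => x y.
have -> : ln (B%:R : R) + ln B%:R - ln B%:R + 17 = ln B%:R + 17 by ring.
have : 0 <= d%:R :> R by [].
move: (d%:R : R) (ln (B%:R : R)) => t l; lra.
Qed.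

(** Each root modulo [p] has at most one lift modulo [p ^ (i + 1)], hence accounts for a single
    residue class of [x]. *)
Lemma hensel_count p i X : prime p ->
  (\sum_(x < X) dvz (p ^ i.+1)%N Q.[x%:Z] <= rho p * (X %/ p ^ i.+1).+1)%N.
Proof.
move=> pp; have p0 := prime_gt0 pp.
pose m := (p ^ i.+1)%N; have m0 : (0 < m)%N by rewrite expn_gt0 p0.
have pm : dvz p m%:Z by rewrite /m dvdzE /= dvdn_exp.
apply: leq_trans (_ : \sum_(r < p | rootmod r) \sum_(x < X) (dvz m Q.[x%:Z] && (x %% p == r)%N) <= _)%N.
  rewrite exchange_big /=; apply: leq_sum => x _; case hx: (_ \in _) => //.
  have xr : (x %% p < p)%N by rewrite ltn_mod.
  have rx : rootmod (Ordinal xr).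
    rewrite /rootmod /=; have h : dvz p ((x %% p)%N%:Z - x%:Z).
      by rewrite -modz_nat -eqz_mod_dvd modz_mod.
    have := horner_sub_dvd Q h; rewrite rpredBr//.
    exact: dvdz_trans pm hx.
  by rewrite (bigD1 (Ordinal xr)) //= eqxx leq_addr.
rewrite /rho -sum1_card big_distrl /=; apply: leq_sum => r rr; rewrite mul1n.
case: (pickP (fun x : 'I_X => dvz m Q.[x%:Z] && (x %% p == r)%N)) => [x0 /andP[hx0 /eqP r0]|no]; last first.
  by rewrite big1// => x _; rewrite no.
apply: leq_trans (progression_count_le X (- x0%:Z) m0); apply: leq_sum => x _.
case: andP => //= -[hx /eqP rx]; suff -> : dvz m (x%:Z - x0%:Z) by [].
have px : dvz p (x%:Z - x0%:Z) by rewrite -eqz_mod_dvd !modz_nat rx r0.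
apply: (hensel_unique (P := Q)) => //; last by rewrite rpredB.
by apply: simple_roots => //; exact: dvdz_trans pm hx0.
Qed.

(** Squares and higher powers of primes cost [12 d] for each [x]. The last term collects the [+ 1]
    of the progression counts, over at most [ln V / ln p] exponents for each prime, where [V] bounds
    the values of [Q]. *)
Lemma small_prime_part Y X : (0 < X)%N ->
  \sum_(x < X) \sum_(p < Y.+1 | prime p) (logn p `|Q.[x%:Z]|)%:R * ln (p%:R : R) <=
  X%:R * (rhosum Y + 12 * d%:R) +
  d%:R * (\sum_(p < Y.+1 | prime p) 1) * ln ((height * X ^ d)%:R : R).
Proof.
move=> X0; pose V := (height * X ^ d)%N.
have V0 : (0 < V)%N by rewrite muln_gt0 height_gt0 expn_gt0 X0.
rewrite exchange_big /=.
have t1 (p : nat) : prime p -> \sum_(x < X) (logn p `|Q.[x%:Z]|)%:R * ln (p%:R : R) <=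
   X%:R * ((rho p)%:R * (ln p%:R / p%:R) + 2 * d%:R * (ln p%:R / p%:R ^+ 2)) + d%:R * ln (V%:R : R).
  move=> pp; have p0 := prime_gt0 pp; have p1 := prime_gt1 pp; have p0' : (0 : R) < p%:R by rewrite ltr0n.
  pose t := trunc_log p V.
  have lt (x : 'I_X) : (logn p `|Q.[x%:Z]| <= \sum_(i < t) dvz (p ^ i.+1)%N Q.[x%:Z])%N.
    have Q0 : (0 < `|Q.[x%:Z]|)%N by rewrite absz_gt0 horner_neq0.
    have lv : (logn p `|Q.[x%:Z]| <= t)%N.
      apply: trunc_log_max => //; apply: leq_trans (dvdn_leq Q0 (pfactor_dvdnn _ _)) _.
      by apply: horner_bound => //; exact: ltnW.
    apply: leq_trans (_ : \sum_(i < logn p `|Q.[x%:Z]|) dvz (p ^ i.+1)%N Q.[x%:Z] <= _)%N; last first.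
      exact: (sumn_ord_le (fun i => nat_of_bool (dvz (p ^ i.+1)%N Q.[x%:Z]))).
    rewrite -[leqLHS]card_ord -sum1_card; apply: leq_sum => i _.
    by rewrite dvdzE /= pfactor_dvdn// ltn_ord.
  have st : (\sum_(x < X) logn p `|Q.[x%:Z]| <= \sum_(i < t) rho p * (X %/ p ^ i.+1).+1)%N.
    apply: leq_trans (_ : \sum_(x < X) \sum_(i < t) dvz (p ^ i.+1)%N Q.[x%:Z] <= _)%N.
      by apply: leq_sum => x _; exact: lt.
    by rewrite exchange_big /=; apply: leq_sum => i _; exact: hensel_count.
  have tl : t%:R * ln p%:R <= ln (V%:R : R).
    rewrite mulr_natl -lnXn// -natrX; apply: ln_nat_mono; first by rewrite expn_gt0 p0.
    exact: trunc_logP.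
  rewrite -mulr_suml -natr_sum.
  apply: le_trans (_ : (rho p)%:R * (X%:R * (p%:R^-1 + 2 * p%:R^-1 ^+ 2) + t%:R) * ln (p%:R : R) <= _).
    rewrite ler_wpM2r ?ln_nat_ge0//; apply: le_trans (_ : (\sum_(i < t) rho p * (X %/ p ^ i.+1).+1)%N%:R <= _).
      by rewrite ler_nat.
    rewrite -big_distrr natrM ler_wpM2l// natr_sum.
    apply: le_trans (_ : X%:R * (\sum_(i < t) (p%:R^-1 : R) ^+ i.+1) + t%:R <= _); last first.
      rewrite lerD2r ler_wpM2l//; apply: geometric_le; first by rewrite invr_ge0 ltW.
      by rewrite lef_pV2 ?posrE// (ler_nat R 2).
    rewrite -[X in _ + X%:R]card_ord -sum1_card natr_sum mulr_sumr -big_split /=; apply: ler_sum => i _.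
    rewrite -natr1 lerD2r exprVn ler_pdivlMr ?exprn_gt0// -natrX -natrM ler_nat.
    exact: leq_divM.
  have rd : (rho p)%:R <= d%:R :> R by rewrite ler_nat rho_le.
  have rl : (rho p)%:R * (t%:R * ln p%:R) <= d%:R * ln (V%:R : R).
    by apply: ler_pM => //; rewrite mulr_ge0 ?ln_nat_ge0.
  have r2 : (rho p)%:R * (2 * X%:R * (ln p%:R / p%:R ^+ 2)) <= d%:R * (2 * X%:R * (ln (p%:R : R) / p%:R ^+ 2)).
    by rewrite ler_wpM2r// !mulr_ge0 ?ln_nat_ge0 ?invr_ge0 ?exprn_ge0.
  rewrite exprVn; move: rl r2; set q1 := p%:R^-1; set q2 := (p%:R ^+ 2)^-1.
  by move=> *; lra.
apply: le_trans (_ : \sum_(p < Y.+1 | prime p) (X%:R * ((rho p)%:R * (ln p%:R / p%:R) + 2 * d%:R * (ln p%:R / p%:R ^+ 2)) + d%:R * ln (V%:R : R)) <= _).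
  by apply: ler_sum => p pp; exact: t1.
rewrite big_split /= -mulr_sumr big_split /=; apply: lerD.
  rewrite ler_wpM2l// lerD2l -mulr_sumr; have := @sum_ln_sqr R Y.+1; set S := \sum_(_ < _ | _) _ => hS.
  have := @ler_wpM2l R (2 * d%:R) ltac:(by rewrite mulr_ge0) _ _ hS; lra.
rewrite mulrAC [d%:R * _ * _]mulrC mulr_suml le_eqVlt; apply/orP; left; apply/eqP.
by apply: eq_bigr => p _; rewrite mul1r.
Qed.

(** Primes below [Z] number at most [Z]; each of the others weighs at least [ln Z] in [theta_le]. *)
Lemma prime_count_le Y Z : (1 < Z)%N ->
  (\sum_(p < Y.+1 | prime p) 1) * ln (Z%:R : R) <= Z%:R * ln Z%:R + 4 * Y%:R.
Proof.
move=> Z1; have lZ := ln_nat_ge0 R Z.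
apply: le_trans (_ : \sum_(p < Y.+1 | prime p) ((p < Z)%N%:R * ln Z%:R + ln (p%:R : R)) <= _).
  rewrite mulr_suml; apply: ler_sum => p pp; rewrite mul1r; case: ltnP => pZ.
    by rewrite mul1r lerDl ln_nat_ge0.
  by rewrite mul0r add0r; apply: ln_nat_mono => //; exact: ltnW.
rewrite big_split /=; apply: lerD; last exact: theta_le.
rewrite -mulr_suml ler_wpM2r//.
apply: le_trans (_ : \sum_(p < maxn Y.+1 Z) (p < Z)%N%:R <= _).
  apply: le_trans (@sum_ord_le R xpredT (fun p => (p < Z)%N%:R) _ _ _ (leq_maxl Y.+1 Z)) => //.
  by rewrite big_mkcond; apply: ler_sum => p _; case: ifP.
rewrite -natr_sum ler_nat.
have := @big_ord_widen _ 0%N addn Z (maxn Y.+1 Z) (fun=> 1%N) (leq_maxr Y.+1 Z).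
rewrite sum1_card card_ord big_mkcond => E; rewrite [leqRHS]E; apply: leq_sum => i _.
by case: ifP.
Qed.

Lemma sum_ln_ge n : n%:R * ln n%:R - 2 * n%:R <= \sum_(x < n) ln (x%:R : R).
Proof.
elim: n => [|n IH]; first by rewrite big_ord0 mul0r mulr0 subr0.
rewrite big_ord_recr /=; apply: le_trans (lerD IH (lexx _)).
case: n {IH} => [|n]; first by rewrite ln1 ln0//; lra.
have n0 : (0 : R) < n.+1%:R by rewrite ltr0n.
have i0 : (0 : R) < n.+1%:R^-1 by rewrite invr_gt0.
have : ln (n.+2%:R : R) - ln n.+1%:R <= n.+1%:R^-1.
  rewrite -ln_div ?posrE ?ltr0n//.
  have -> : n.+2%:R / n.+1%:R = 1 + n.+1%:R^-1 :> R.
    by rewrite -[n.+2%:R]natr1 mulrDl divff ?gt_eqF// div1r.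
  by apply: le_ln1Dx; move: (n.+1%:R^-1) i0 => y; lra.
rewrite -[n.+2%:R]natr1 => h.
have := @ler_wpM2l R (n.+1%:R + 1) ltac:(by rewrite addr_ge0) _ _ h.
have i1 : n.+1%:R * n.+1%:R^-1 = 1 :> R by rewrite divff// gt_eqF.
have i2 : n.+1%:R^-1 <= 1 :> R by rewrite invf_le1// ler1n.
move: i1 i2; move: (n.+1%:R : R) (n.+1%:R^-1) (ln _) (ln _) => a b l1 l2 i1 i2.
by rewrite [(a + 1) * b]mulrDl i1 mul1r; lra.
Qed.

(** Beyond [2 * height] the leading term is at least twice the sum of the others. For smaller [x]
    the left side is nonpositive, also at [x = 0] where [ln] takes the value [0]. *)
Lemma ln_horner_ge (x : nat) :
  d%:R * ln (x%:R : R) - d%:R * ln ((2 * height)%:R : R) <= ln (`|Q.[x%:Z]|%N%:R : R).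
Proof.
have h0 := height_gt0; have lQ := ln_nat_ge0 R `|Q.[x%:Z]|.
have d1 : 1 <= d%:R :> R by rewrite ler1n.
case: (leqP x (2 * height)) => xh.
  apply: le_trans lQ; rewrite subr_le0 ler_wpM2l//.
  by case: x xh => [|x] xh; [rewrite ln0// ln_nat_ge0|apply: ln_nat_mono].
have x0 : (0 < x)%N by lia.
have low : (x ^ d <= 2 * `|Q.[x%:Z]|)%N.
  have E : Q.[x%:Z] = \sum_(i < d) Q`_i * x%:Z ^+ i + Q`_d * x%:Z ^+ d.
    by rewrite horner_coef sizeQ big_ord_recr.
  have lc : (1 <= absz (Q`_d)%R)%N.
    rewrite absz_gt0; have := lead_coef_eq0 Q; rewrite lead_coefE sizeQ /= => ->.
    by rewrite -size_poly_gt0 sizeQ.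
  have b1 : (`|(\sum_(i < d) Q`_i * x%:Z ^+ i)%R| <= height * x ^ d.-1)%N.
    apply: leq_trans (abs_sum_le _) _.
    apply: leq_trans (_ : \sum_(i < d) absz (Q`_i)%R * x ^ d.-1 <= _)%N.
      apply: leq_sum => i _; rewrite abszM abszX /= leq_mul2l leq_pexp2l ?orbT//.
      by rewrite -ltnS prednK// ltn_ord.
    by rewrite -big_distrl /= leq_mul2r /height big_ord_recr /= leq_addr orbT.
  have b2 : (x ^ d <= `|(Q`_d * x%:Z ^+ d)%R|)%N by rewrite abszM abszX /= leq_pmull.
  have b3 : (2 * (height * x ^ d.-1) <= x ^ d)%N.
    by rewrite -[in leqRHS](prednK d_gt0) expnS mulnA leq_mul2r ltnW ?orbT.
  move: E b1 b2 b3; move: (\sum_(i < d) _) (Q`_d * _) (Q.[_]) (x ^ d)%N (height * _)%N => s u v w h.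
  by lia.
have lx : ln ((x ^ d)%:R : R) <= ln ((2 * `|Q.[x%:Z]|)%N%:R).
  by apply: ln_nat_mono => //; rewrite expn_gt0 x0.
rewrite natrX lnXn ?ltr0n// -[_ *+ d]mulr_natl in lx.
rewrite natrM lnM ?posrE ?ltr0n ?absz_gt0 ?horner_neq0// in lx.
rewrite lerBlDr; apply: le_trans lx _; rewrite addrC lerD2l.
apply: le_trans (_ : ln ((2 * height)%:R) <= _); first by apply: ln_nat_mono => //; rewrite leq_pmulr.
by rewrite ler_peMl ?ln_nat_ge0.
Qed.

Ltac keep_section H := first [constr_eq H sizeQ | constr_eq H d_gt0 | constr_eq H form_neq0].
Ltac plra := lra_keeping keep_section.
Ltac pnra := nra_keeping keep_section.

(* The primes up to [Y] make up, on average, a proportion of [ln |Q x|] that stays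
   away from [1], since [rhosum Y <= 3/4 d ln Y + O(1)]. *)
Lemma large_prime_factors : exists (eta : R) (Z0 : nat), 0 < eta /\
  forall Z, (Z0 <= Z)%N -> exists Y : nat, eta * Z%:R ^+ 2 * ln Z%:R <= Y%:R /\
    Z%:R ^+ 2 / 32 <= (\sum_(x < Z * Z) has (ltn Y) (primes `|Q.[x%:Z]|))%N%:R :> R.
Proof.
pose D : R := d%:R; have D1 : 1 <= D by rewrite ler1n.
(* This constant keeps the number of primes up to [Y] below [X / (16 D)], so that the counting
   errors in [small_prime_part] take at most [ln V / 16] on average. *)
pose e1 : R := (80 * D)^-1; have e10 : 0 < e1 by rewrite invr_gt0; plra.
have e1D : D * e1 = 80^-1 by rewrite /e1 invfM mulrCA divff ?mulr1//; apply: lt0r_neq0; plra.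
pose lc : R := ln height%:R; have lc0 : 0 <= lc := ln_nat_ge0 R _.
pose l2 : R := ln (2 * height)%:R; have l20 : 0 <= l2 := ln_nat_ge0 R _.
pose La := 280 + 8 * l2 + 16 * lc + 80 * D.
exists (e1 / 4), (Num.truncn (expR La)).+1; split; first by rewrite divr_gt0.
move=> Z ZZ; have Z0 : (0 < Z)%N by apply: leq_trans ZZ.
have Z0' : (0 : R) < Z%:R by rewrite ltr0n.
pose L : R := ln Z%:R.
have LLa : La <= L.
  rewrite -[La]expRK ler_ln ?posrE ?expR_gt0//; apply: ltW.
  by apply: lt_le_trans (truncnS_gt _) _; rewrite ler_nat.
have ZL : L <= Z%:R.
  have := @le_ln1Dx R (Z%:R - 1); rewrite addrCA subrr addr0 => h.
  by have := h ltac:(plra); rewrite -/L; plra.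
have Z1 : (1 < Z)%N by rewrite -(ltr_nat R); rewrite /La in LLa; plra.
have e1L : 1 <= e1 * L.
  have : e1 * (80 * D) <= e1 * L by rewrite ler_pM2l//; rewrite /La in LLa; plra.
  by apply: le_trans; rewrite mulVf//; apply: lt0r_neq0; plra.
pose y := Num.sqrt (e1 * L).
have y2 : y ^+ 2 = e1 * L by rewrite sqr_sqrtr//; plra.
have y1 : 1 <= y by rewrite -sqrtr1 ler_sqrt//; plra.
pose k := Num.truncn y.
have ky : k%:R <= y by rewrite truncn_le; plra.
have yk : y < k%:R + 1 by rewrite natr1; exact: truncnS_gt.
have k0 : (0 < k)%N by rewrite -(ltr_nat R); plra.
have k1 : 1 <= k%:R :> R by rewrite ler1n.
have k2 : k%:R ^+ 2 <= e1 * L by rewrite -y2 ler_sqr ?nnegrE//; plra.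
have k4 : e1 * L <= 4 * k%:R ^+ 2 by rewrite -y2; pnra.
(* A perfect square, as [rhosum_square_le] requires, of the order of [e1 * Z ^ 2 * ln Z]. *)
pose Y := ((Z * k) * (Z * k))%N.
have YE : Y%:R = Z%:R ^+ 2 * k%:R ^+ 2 :> R by rewrite !natrM; ring.
have Z2 : 0 < Z%:R ^+ 2 :> R by rewrite exprn_gt0.
exists Y; split.
  rewrite YE -/L; have -> : e1 / 4 * Z%:R ^+ 2 * L = Z%:R ^+ 2 * (e1 * L / 4) by ring.
  by rewrite ler_pM2l//; plra.
have e11 : e1 <= 1 by rewrite invf_le1; plra.
have L280 : 280 <= L by rewrite /La in LLa; plra.
have yL : y <= L / 12.
  have : e1 * L <= L by rewrite ler_piMl//; plra.
  by rewrite -y2; pnra.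
have lk : ln (k%:R : R) <= L / 12.
  apply: le_trans yL; apply: le_trans ky.
  have := @le_ln1Dx R (k%:R - 1); rewrite addrCA subrr addr0 => h.
  by have := h ltac:(plra); plra.
have hA : rhosum Y <= 13 / 8 * D * L + lc + 21 * D.
  have := @rhosum_square_le (Z * k)%N ltac:(by rewrite muln_gt0 Z0).
  rewrite -/Y natrM lnM ?posrE ?ltr0n// -/D -/L -/lc.
  have : D * ln k%:R <= D * (L / 12) by rewrite ler_wpM2l//; plra.
  by plra.
pose X := (Z * Z)%N.
have XE : X%:R = Z%:R ^+ 2 :> R by rewrite natrM expr2.
have X0 : (0 < X)%N by rewrite muln_gt0 Z0.
pose pi1 : R := \sum_(p < Y.+1 | prime p) 1.
have hpi : pi1 <= 5 * e1 * X%:R.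
  have L0 : 0 < L by plra.
  rewrite -(ler_pM2r L0); apply: le_trans (prime_count_le Y Z1) _; rewrite -/L YE XE.
  have h1 : Z%:R ^+ 2 * k%:R ^+ 2 <= Z%:R ^+ 2 * (e1 * L) by rewrite ler_pM2l.
  have h2 : Z%:R * L <= Z%:R * (Z%:R * e1) * L.
    rewrite ler_pM2r// ler_peMr// mulrC.
    have : e1 * L <= e1 * Z%:R by rewrite ler_pM2l.
    plra.
  by rewrite expr2 in h1 *; plra.
pose V := (height * X ^ d)%N.
have lV : ln (V%:R : R) = lc + 2 * D * L.
  rewrite natrM natrX lnM ?posrE ?exprn_gt0 ?ltr0n ?height_gt0// lnXn ?ltr0n//.
  by rewrite natrM lnM ?posrE ?ltr0n// -/L -/lc -[_ *+ d]mulr_natl -/D; ring.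
pose n x := `|Q.[x%:Z]|%N.
pose sm x : R := \sum_(p < Y.+1 | prime p) (logn p (n x))%:R * ln (p%:R : R).
have hS : \sum_(x < X) sm x <= X%:R * (7 / 4 * D * L + 33 * D + 2 * lc).
  apply: le_trans (small_prime_part Y X0) _; rewrite -/V -/D -/pi1 lV.
  have h1 : D * pi1 * (lc + 2 * D * L) <= D * (5 * e1 * X%:R) * (lc + 2 * D * L).
    by apply: ler_wpM2r; [rewrite addr_ge0 ?mulr_ge0//; plra|rewrite ler_wpM2l//; plra].
  have h2 : D * (5 * e1 * X%:R) * (lc + 2 * D * L) = X%:R * ((lc + 2 * D * L) / 16).
    have -> : D * (5 * e1 * X%:R) = X%:R / 16 by transitivity (5 * X%:R * (D * e1)); [ring|rewrite e1D; plra].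
    by ring.
  have h3 : X%:R * (rhosum Y + 12 * D) + X%:R * ((lc + 2 * D * L) / 16) <= X%:R * (7 / 4 * D * L + 33 * D + 2 * lc).
    by rewrite -mulrDr ler_wpM2l//; plra.
  by rewrite h2 in h1; move: h1 h3; plra.
have hT : X%:R * (2 * D * L - 2 * D - D * l2) <= \sum_(x < X) ln ((n x)%:R : R).
  apply: le_trans (_ : \sum_(x < X) (D * ln (x%:R : R) - D * l2) <= _); last first.
    by apply: ler_sum => x _; exact: ln_horner_ge.
  rewrite sumrB sumr_const card_ord -mulr_sumr -[D * l2 *+ X]mulr_natl.
  have lX : ln (X%:R : R) = 2 * L by rewrite natrM lnM ?posrE// -/L; ring.
  have := sum_ln_ge X; rewrite lX => h.
  have := @ler_wpM2l R D ltac:(plra) _ _ h.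
  by plra.
have good x : ln ((n x)%:R : R) - sm x <= (has (ltn Y) (primes (n x)))%:R * ln (n x)%:R.
  have n0 : (0 < n x)%N by rewrite absz_gt0 horner_neq0.
  case: hasP => [_|no].
    rewrite mul1r gerBl sumr_ge0// => p _.
    by rewrite mulr_ge0 ?ln_nat_ge0.
  rewrite mul0r subr_le0 (@ln_primes R (n x) (maxn Y.+1 (n x).+1))//; last by rewrite leq_max ltnSn orbT.
  rewrite [leRHS](big_ord_widen_cond _ prime (fun p => (logn p (n x))%:R * ln (p%:R : R)) (leq_maxl Y.+1 (n x).+1)).
  rewrite [leRHS]big_mkcondr; apply: ler_sum => p pp; case: ltnP => // Yp.
  rewrite (_ : logn p (n x) = 0%N) ?mul0r//; apply/eqP; rewrite -leqn0 leqNgt logn_gt0.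
  by apply/negP => h; apply: no; exists (val p).
pose G : R := (\sum_(x < X) has (ltn Y) (primes (n x)))%N%:R.
(* Of [ln |Q x|] the primes up to [Y] leave at least [D * L / 8] on average, and no value exceeds
   [3 * D * L]. So at least one [x] in [24] has a larger prime factor. *)
have hG : X%:R * (D * L / 8) <= G * (3 * D * L).
  apply: le_trans (_ : \sum_(x < X) (ln ((n x)%:R : R) - sm x) <= _).
    rewrite sumrB; apply: le_trans (lerB hT hS); rewrite -mulrBr ler_wpM2l//.
    have hh : 280 + 8 * l2 + 16 * lc <= L by rewrite /La in LLa; plra.
    have := @ler_wpM2l R D ltac:(plra) _ _ hh.
    have : lc <= D * lc by rewrite ler_peMl.
    by plra.
  rewrite /G natr_sum mulr_suml; apply: ler_sum => x _; apply: le_trans (good x) _.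
  rewrite ler_wpM2l//; apply: le_trans (_ : ln (V%:R : R) <= _).
    by apply: ln_nat_mono; [rewrite absz_gt0 horner_neq0|apply: horner_bound => //; exact: ltnW].
  rewrite lV; have : lc <= L by rewrite /La in LLa; plra.
  have : L <= D * L by rewrite ler_peMl//; plra.
  by plra.
have DL : 0 < D * L by rewrite mulr_gt0//; plra.
rewrite -/G -XE.
have : X%:R / 8 * (D * L) <= (3 * G) * (D * L) by move: hG; plra.
rewrite ler_pM2r//.
have : 0 <= X%:R :> R by [].
by plra.
Qed.

End PolynomialPrimes.

(** * Valuations of the numbers [m + alpha] for algebraic [alpha] *)

Section HenselRoots.
Local Notation dvz m z := ((m%:Z %| z%R)%Z).

(** Newton's iteration, with an inverse of the derivative modulo [p] from Bezout's identity. *)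
Lemma hensel_root (P : {poly int}) (p : nat) (a : int) K : prime p ->
  dvz p P.[a] -> ~~ dvz p P^`().[a] -> exists r : int, dvz p (r - a) /\ dvz (p ^ K.+1)%N P.[r].
Proof.
move=> pp pa pa'; elim: K => [|K [r [ra /dvdzP[w hw]]]]; first by exists a; rewrite subrr dvdz0 expn1.
pose m : int := (p ^ K.+1)%N%:Z.
have pr : ~~ dvz p P^`().[r].
  by apply: contra pa' => h; have := horner_sub_dvd P^`() ra; rewrite rpredBl.
have [u [v uv]] := Bezoutz p%:Z P^`().[r].
have g1 : gcdz p%:Z P^`().[r] = 1 by apply/eqP; have := coprimez_prime 1 pp pr; rewrite expn1.
rewrite g1 in uv.
have [h hE] := horner_taylor2 P (r + (- w * v) * m) r.
rewrite addrAC subrr add0r in hE.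
have pm : dvz p m by rewrite dvdzE /= dvdn_exp.
exists (r + (- w * v) * m); split.
  have -> : r + - w * v * m - a = (r - a) + - w * v * m by ring.
  by rewrite rpredD// dvdz_mull.
have -> : P.[r + - w * v * m] = P.[r] + - w * v * m * (P^`().[r] + - w * v * m * h) by rewrite -hE; ring.
have E1 : v * P^`().[r] = 1 - u * p%:Z by rewrite -uv; ring.
have -> : P.[r] + - w * v * m * (P^`().[r] + - w * v * m * h) =
   (p%:Z * m) * (w * u) + (w * v) ^+ 2 * h * (m * m).
  rewrite hw -/m; transitivity (w * m * (1 - v * P^`().[r]) + (w * v) ^+ 2 * h * (m * m)); first by ring.
  by rewrite E1; ring.
have -> : ((p ^ K.+2)%N%:Z) = p%:Z * m by rewrite /m -PoszM expnS.
by apply: rpredD; [exact/dvdz_mulr/dvdzz|apply: dvdz_mull; exact: dvdz_mul (dvdzz _)].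
Qed.

(** The ultrametric inequality. Equality is a separate alternative because [logn p 0 = 0]. *)
Lemma logn_sub_eq (p : nat) (a b : int) : prime p -> a != 0 -> b != 0 ->
  a = b \/ (logn p `|a| < logn p `|a - b| /\ logn p `|b| < logn p `|a - b|)%N ->
  logn p `|a| = logn p `|b|.
Proof.
move=> pp a0 b0 [->//|[h1 h2]].
have [->//|ab] := eqVneq a b.
have dz (z : int) i : z != 0 -> dvz (p ^ i)%N z = (i <= logn p `|z|)%N.
  by move=> z0; rewrite dvdzE /= pfactor_dvdn// absz_gt0.
have ab0 : a - b != 0 by rewrite subr_eq0.
apply/eqP; rewrite eqn_leq; apply/andP; split; rewrite -dz//.
  have -> : b = a - (a - b) by ring.
  by rewrite rpredB// dz// ltnW.
have -> : a = b + (a - b) by ring.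
by rewrite rpredD// dz// ltnW.
Qed.

End HenselRoots.

Section MinimalPolynomial.
Variables (R : realType) (alpha : R).
Local Notation dvz m z := ((m%:Z %| z%R)%Z).
Implicit Types G H P : {poly int}.

Definition ev (x : R) G : R := (map_poly intr G).[x].

Lemma evM x G H : ev x (G * H) = ev x G * ev x H.
Proof. by rewrite /ev rmorphM hornerM. Qed.
Lemma evD x G H : ev x (G + H) = ev x G + ev x H.
Proof. by rewrite /ev rmorphD hornerD. Qed.
Lemma evB x G H : ev x (G - H) = ev x G - ev x H.
Proof. by rewrite /ev rmorphB hornerD hornerN. Qed.
Lemma evZ x (c : int) G : ev x (c *: G) = c%:~R * ev x G.
Proof. by rewrite /ev map_polyZ hornerZ. Qed.
Lemma evC x (c : int) : ev x c%:P = c%:~R.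
Proof. by rewrite /ev map_polyC hornerC. Qed.
Lemma evX x : ev x 'X = x.
Proof. by rewrite /ev map_polyX hornerX. Qed.

(** Of least degree, but neither monic nor primitive: divisibility will hold up to an integer
    factor. *)
Definition minimal_poly P := [/\ P != 0, ev alpha P = 0 &
  forall G, G != 0 -> ev alpha G = 0 -> (size P <= size G)%N].

Lemma minimal_poly_exists : ~ transcendental alpha -> exists P, minimal_poly P.
Proof.
move=> ntr.
have [G0 [G00 evG0]] : exists G, G != 0 /\ ev alpha G = 0.
  apply: contrapT => no; apply: ntr => G evG; apply: contrapT => /eqP G0.
  by apply: no; exists G.
pose pr n := `[< exists G, [/\ G != 0, ev alpha G = 0 & size G = n] >].
have ex : exists n, pr n by exists (size G0); apply/asboolP; exists G0.
case: (ex_minnP ex) => n /asboolP[P [P0 evP <-]] mn.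
by exists P; split => // G G1 evG; apply: mn; apply/asboolP; exists G.
Qed.

Section Fixed.
Variable P : {poly int}.
Hypothesis minP : minimal_poly P.
Hypothesis irr : forall a b : int, b != 0 -> b%:~R * alpha <> a%:~R.

Let P_neq0 : P != 0. Proof. by case: minP. Qed.
Let evP : ev alpha P = 0. Proof. by case: minP. Qed.
Let P_min G : G != 0 -> ev alpha G = 0 -> (size P <= size G)%N. Proof. by case: minP => _ _; apply. Qed.

Lemma minimal_poly_dvd G : ev alpha G = 0 -> exists c H, c != 0 /\ c *: G = H * P.
Proof.
move=> evG; exists (lead_coef P ^+ scalp G P), (G %/ P).
split; first by rewrite expf_neq0// lead_coef_eq0.
have E := Pdiv.Idomain.divp_eq G P.
suff -> : lead_coef P ^+ scalp G P *: G = G %/ P * P + 0 by rewrite addr0.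
rewrite E; congr (_ + _); apply/eqP; apply: contraT => m0.
have : (size (G %% P)%R < size P)%N by rewrite ltn_modp.
rewrite ltnNge P_min//; have := congr1 (ev alpha) E.
by rewrite evZ evD evM evG evP !mulr0 add0r.
Qed.

Lemma size_minimal_poly : (2 < size P)%N.
Proof.
case E: (size P) => [|[|[|n]]] //.
- by move: P_neq0; rewrite -size_poly_eq0 E.
- have PE := size1_polyC (eq_leq E).
  have p0 : P`_0 = 0 by have := evP; rewrite {1}PE evC => /eqP; rewrite intr_eq0 => /eqP.
  by have := P_neq0; rewrite PE p0 polyC0 eqxx.
- have PE : P = P`_1 *: 'X + (P`_0)%:P.
    apply/polyP => i; rewrite !coefE; case: i => [|[|i]] /=; rewrite ?mulr0 ?mulr1 ?add0r ?addr0//.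
    by rewrite nth_default// E.
  have p1 : P`_1 != 0 by have := lead_coef_eq0 P; rewrite lead_coefE E /= => ->.
  have := evP; rewrite {1}PE evD evZ evC evX => h.
  case: (@irr (- P`_0) P`_1 p1); rewrite rmorphN /=; move: h => /eqP; rewrite addr_eq0 => /eqP //.
Qed.

Lemma minimal_poly_no_root (u w : int) : w != 0 -> ev (u%:~R / w%:~R) P != 0.
Proof.
move=> w0; apply/eqP => ev0; pose l : {poly int} := w *: 'X - u%:P.
have w0' : w%:~R != 0 :> R by rewrite intr_eq0.
have evl x : ev x l = w%:~R * x - u%:~R by rewrite /l evB evZ evX evC.
have sl : size l = 2.
  rewrite /l size_polyDl; first by rewrite size_scale// size_polyX.
  by rewrite size_polyN size_scale// size_polyX (leq_ltn_trans (size_polyC_leq1 _)).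
have l0 : l != 0 by rewrite -size_poly_eq0 sl.
have E := Pdiv.Idomain.divp_eq P l.
have : (size (P %% l)%R < size l)%N by rewrite ltn_modp.
rewrite sl ltnS => s1; have mE := size1_polyC s1.
have m0 : P %% l = 0.
  have evl0 : ev (u%:~R / w%:~R) l = 0 by rewrite evl mulrC divfK// subrr.
  have := congr1 (ev (u%:~R / w%:~R)) E; rewrite evZ evD evM ev0 evl0 !mulr0 add0r.
  by rewrite mE evC => /esym /eqP; rewrite intr_eq0 => /eqP ->.
have c0 : lead_coef l ^+ scalp P l != 0 by rewrite expf_neq0// lead_coef_eq0.
rewrite m0 addr0 in E.
have h0 : P %/ l != 0.
  by apply/eqP => h; move: E; rewrite h mul0r => /eqP; rewrite -mul_polyC mulf_eq0 polyC_eq0 (negbTE c0) (negbTE P_neq0).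
have evh : ev alpha (P %/ l) = 0.
  have := congr1 (ev alpha) E; rewrite evZ evM evP mulr0 => /esym /eqP.
  by rewrite mulf_eq0 evl subr_eq0 => /orP[/eqP//|/eqP h]; case: (irr w0 h).
have := P_min h0 evh; have := congr1 (fun p : {poly int} => size p) E.
rewrite /= size_scale// size_mul// sl addn2 /= => ->.
by rewrite ltnn.
Qed.

(** [D] is the resultant of [P] and [P']. If it vanished, a common factor or its cofactor would
    annihilate [alpha] in smaller degree. *)
Lemma minimal_poly_bezout : exists D : int, D != 0 /\
  forall x : int, exists u v, u * P.[x] + v * P^`().[x] = D.
Proof.
have s2 := size_minimal_poly.
have sP' : size P^`() = (size P).-1.
  apply/eqP; rewrite eqn_leq -ltnS prednK ?lt_size_deriv ?size_poly_gt0//=.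
  case E: (size P) s2 => [|[|n]] // _ /=; rewrite ltnNge; apply/negP => h.
  have := coef_deriv P n; rewrite nth_default// => /esym/eqP.
  by rewrite mulrn_eq0 /=; have := lead_coef_eq0 P; rewrite lead_coefE E /= => ->; rewrite (negbTE P_neq0).
have s2' : (1 < size P^`())%N by rewrite sP'; case: (size P) s2 => [|[|[|n]]].
have [[u v] /= _ uv] := resultant_in_ideal (ltnW s2) s2'.
exists (resultant P P^`()); split; last first.
  by move=> x; exists u.[x], v.[x]; rewrite -!hornerM -hornerD -uv hornerC.
rewrite resultant_eq0 -leqNgt leqNgt; apply/negP => sg.
set g := gcdp P P^`() in sg.
have g0 : g != 0 by rewrite -size_poly_gt0 (ltn_trans _ sg).
have P'0 : P^`() != 0 by rewrite -size_poly_gt0 (ltn_trans _ s2').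
have E := Pdiv.Idomain.divp_eq P g.
have /eqP m0 : P %% g == 0 by have := dvdp_gcdl P P^`(); rewrite /dvdp.
have c0 : lead_coef g ^+ scalp P g != 0 by rewrite expf_neq0// lead_coef_eq0.
rewrite m0 addr0 in E.
have h0 : P %/ g != 0.
  by apply/eqP => h; move: E; rewrite h mul0r => /eqP; rewrite -mul_polyC mulf_eq0 polyC_eq0 (negbTE c0) (negbTE P_neq0).
have := congr1 (ev alpha) E; rewrite evZ evM evP mulr0 => /esym /eqP; rewrite mulf_eq0 => /orP[]/eqP ev0.
  have := P_min h0 ev0; have := congr1 (fun p : {poly int} => size p) E.
  rewrite /= size_scale// size_mul//; move: sg; clear; move: (size g) (size P) (size (P %/ g)) => a b c; lia.
have := P_min g0 ev0; have := dvdp_leq P'0 (dvdp_gcdr P P^`()); rewrite -/g sP'.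
by move: s2; clear; move: (size g) (size P) => a b; lia.
Qed.

(** At a simple root [- n] of [P] modulo [p], this is the valuation of [m + alpha] at the
    corresponding prime of degree one above [p], where [alpha] reduces to [- n]. *)
Definition prime_val (p n m : nat) : nat :=
  if dvz p (m%:Z - n%:Z) then logn p `|P.[- m%:Z]| else 0.

Lemma minimal_poly_int_neq0 (x : int) : P.[x] != 0.
Proof.
have := @minimal_poly_no_root x 1 isT; rewrite divr1 /ev horner_map /= intr_eq0.
by [].
Qed.

(* Hensel lifts [-n] to a root [r] of [P] modulo a high power of [p], and [alpha |-> r]
   turns relations between the [m + alpha] into relations between the [m + r]. *)
Lemma prime_val_additive (p n : nat) : prime p -> dvz p P.[- n%:Z] -> ~~ dvz p P^`().[- n%:Z] ->
  additive_on_relations alpha (prime_val p n).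
Proof.
move=> pp pn pn' s s' ss.
pose Pi (t : seq nat) : {poly int} := \prod_(m <- t) ('X + m%:Z%:P).
have evPi t : ev alpha (Pi t) = \prod_(m <- t) mu alpha m.
  rewrite /Pi; elim: t => [|m t IH]; first by rewrite !big_nil -[1]/(1%:P) evC.
  by rewrite !big_cons evM IH evD evX evC /mu addrC.
have [c [H [c0 cE]]] : exists c H, c != 0 /\ c *: (Pi s - Pi s') = H * P.
  by apply: minimal_poly_dvd; rewrite evB !evPi ss subrr.
pose S := (\sum_(m <- s ++ s') logn p `|P.[- m%:Z]|)%N.
(* A precision that exceeds the valuations of both products even after multiplication by [c]. *)
pose K := (logn p `|c| + S)%N.
have [r [rn rK]] := hensel_root K pp pn pn'; rewrite opprK in rn.
have dz (z : int) i : z != 0 -> dvz (p ^ i)%N z = (i <= logn p `|z|)%N.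
  by move=> z0; rewrite dvdzE /= pfactor_dvdn// absz_gt0.
have lS m : m \in s ++ s' -> (logn p `|P.[- m%:Z]| <= S)%N.
  by move=> ms; rewrite /S (big_rem m ms) /= leq_addr.
have dK i : (i <= K.+1)%N -> dvz (p ^ i)%N P.[r].
  by move=> iK; apply: dvdz_trans rK; rewrite dvdzE /= dvdn_exp2l.
(* For [m = n] modulo [p], the powers of [p] up to [p ^ (K + 1)] divide [r + m] and [P (- m)] alike,
   because [r] is the only root in its class. *)
have rm m : m \in s ++ s' -> r + m%:Z != 0 /\ logn p `|r + m%:Z| = prime_val p n m.
  move=> ms; have Pm := minimal_poly_int_neq0 (- m%:Z).
  have rm0 : r + m%:Z != 0.
    apply/eqP => r0; have rE : r = - m%:Z by apply/eqP; rewrite -addr_eq0 r0.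
    by move: rK; rewrite rE dz// ltnNge (leq_trans (lS _ ms))// leq_addl.
  split => //; rewrite /prime_val.
  have prm : dvz p (r + m%:Z) = dvz p (m%:Z - n%:Z).
    have -> : m%:Z - n%:Z = (r + m%:Z) - (r + n%:Z) by ring.
    by rewrite rpredBr.
  case: ifP => pmn; last first.
    apply/eqP; rewrite -leqn0 leqNgt logn_gt0 mem_primes pp absz_gt0 rm0 /=.
    by move: prm; rewrite pmn dvdzE /= => ->.
  have pm' : ~~ dvz p P^`().[- m%:Z].
    apply: contra pn' => h; have := @horner_sub_dvd P^`() p%:Z (- m%:Z) (- n%:Z).
    have -> : - m%:Z - - n%:Z = - (m%:Z - n%:Z) by ring.
    by rewrite rpredN => /(_ pmn); rewrite rpredBl.
  have iff i : (i <= K.+1)%N -> dvz (p ^ i)%N (r + m%:Z) = dvz (p ^ i)%N P.[- m%:Z].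
    move=> iK; apply/idP/idP => h.
      have := @horner_sub_dvd P (p ^ i)%N r (- m%:Z); rewrite opprK => /(_ h).
      by rewrite rpredBl ?dK.
    have := @hensel_unique P p i r (- m%:Z) pp; rewrite opprK prm => /(_ pmn pm'); apply.
    by rewrite rpredB// dK.
  have lK : (logn p `|P.[- m%:Z]| <= K)%N by rewrite (leq_trans (lS _ ms))// leq_addl.
  apply/eqP; rewrite eqn_leq; apply/andP; split; last by rewrite -dz// iff ?dz// ltnW.
  rewrite leqNgt -dz// iff; last by rewrite ltnS.
  by rewrite dz// ltnn.
have prodE t : {subset t <= s ++ s'} -> \prod_(m <- t) (r + m%:Z) != 0 /\
    logn p `|\prod_(m <- t) (r + m%:Z)| = (\sum_(m <- t) prime_val p n m)%N.
  elim: t => [|m t IH] st; first by rewrite !big_nil logn1.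
  have [|t0 tl] := IH; first by move=> x xt; apply: st; rewrite inE xt orbT.
  have [m0 ml] := rm m (st m (mem_head _ _)).
  rewrite !big_cons mulf_neq0//; split => //.
  by rewrite abszM lognM ?absz_gt0// tl ml.
have [a0 al] := prodE s ltac:(by move=> x xs; rewrite mem_cat xs).
have [b0 bl] := prodE s' ltac:(by move=> x xs; rewrite mem_cat xs orbT).
set a := \prod_(m <- s) (r + m%:Z) in a0 al; set b := \prod_(m <- s') (r + m%:Z) in b0 bl.
have bS : ((\sum_(m <- s) prime_val p n m <= S) /\ (\sum_(m <- s') prime_val p n m <= S))%N.
  have vl m : (prime_val p n m <= logn p `|P.[- m%:Z]|)%N by rewrite /prime_val; case: ifP.
  rewrite /S big_cat /=; split.
    by apply: leq_trans (_ : _ <= \sum_(m <- s) logn p `|P.[- m%:Z]|)%N _; [exact: leq_sum|exact: leq_addr].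
  by apply: leq_trans (_ : _ <= \sum_(m <- s') logn p `|P.[- m%:Z]|)%N _; [exact: leq_sum|exact: leq_addl].
rewrite -al -bl; apply: logn_sub_eq => //.
have [->|ab] := eqVneq a b; [by left|right].
have PiE t : (Pi t).[r] = \prod_(m <- t) (r + m%:Z).
  by rewrite /Pi horner_prod; apply: eq_bigr => m _; rewrite !hornerE.
have ab0 : a - b != 0 by rewrite subr_eq0.
have : dvz (p ^ K.+1)%N (c * (a - b)).
  have := congr1 (fun q : {poly int} => q.[r]) cE; rewrite /= hornerZ hornerD hornerN !PiE -/a -/b hornerM => ->.
  exact: dvdz_mull.
rewrite dz ?mulf_neq0// abszM lognM ?absz_gt0// /K -addnS leq_add2l => SS.
by split; [rewrite al|rewrite bl]; apply: leq_ltn_trans SS; case: bS.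
Qed.

Lemma comp_linear (G : {poly int}) (a b : int) :
  exists H, G \Po (a%:P + b *: 'X) = G.[a]%:P + b *: ('X * H).
Proof.
elim/poly_ind: G => [|G c [H hG]]; first by exists 0; rewrite comp_poly0 horner0 mulr0 scaler0 addr0.
exists (G.[a]%:P + H * (a%:P + b *: 'X)).
rewrite comp_polyD comp_polyM comp_polyX comp_polyC hG hornerMXaddC polyCD polyCM -!mul_polyC.
by ring.
Qed.

(** [Q x = P (- n0 - q' x) / P (- n0)], with [q'] so divisible that [Q] is [1] modulo [q], [D] and
    [P (- n0)]. A prime dividing a value of [Q] avoids all of these, so its roots are simple and its
    valuation will vanish at the index [n0]. *)
Lemma shifted_poly (n0 q : nat) : (0 < q)%N -> exists (q' : nat) (Q : {poly int}),
  [/\ (0 < q')%N, (q %| q')%N, size Q = size P,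
   forall a b : int, b != 0 -> homog_form Q (size P).-1 a b != 0 &
   (forall (p : nat) (x : int), prime p -> dvz p Q.[x] ->
     [/\ ~~ dvz p Q^`().[x], ~~ (p %| q')%N, ~~ dvz p P.[- n0%:Z] &
       dvz p P.[- n0%:Z - q'%:Z * x] /\ ~~ dvz p P^`().[- n0%:Z - q'%:Z * x]])].
Proof.
move=> q0; have [D [D0 bez]] := minimal_poly_bezout.
pose m0 := P.[- n0%:Z]; have m00 : m0 != 0 := minimal_poly_int_neq0 _.
(* One factor [m0] is divided out in [Q], the other stays in [E]. *)
pose q' := (q * `|D| * `|m0| ^ 2)%N.
have q'0 : (0 < q')%N by rewrite !muln_gt0 q0 !absz_gt0 D0 m00.
pose E : int := m0 * (q * `|D|)%N%:Z.
have qE : q'%:Z = m0 * E.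
  rewrite /q' /E PoszM [(_ ^ 2)%N%:Z](_ : _ = m0 * m0); first by ring.
  by rewrite -mulnn PoszM !abszE -normrM ger0_norm// -expr2 sqr_ge0.
have [H hH] := comp_linear P (- n0%:Z) (- q'%:Z).
pose Q : {poly int} := 1 - E *: ('X * H).
set L : {poly int} := (- n0%:Z)%:P + (- q'%:Z) *: 'X in hH.
have QE : m0 *: Q = P \Po L.
  by rewrite hH -/m0 qE /Q scalerBr scalerA scaleNr -[1]/(1%:P) -mul_polyC -polyCM mulr1.
have sL : size L = 2%N.
  rewrite /L addrC size_polyDl; first by rewrite size_scale ?size_polyX// oppr_eq0 eqz_nat -lt0n.
  by rewrite size_scale ?size_polyX ?oppr_eq0 ?eqz_nat -?lt0n// (leq_ltn_trans (size_polyC_leq1 _)).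
have sQ : size Q = size P by rewrite -(size_comp_poly2 P sL) -QE size_scale.
have hornL x : L.[x] = - n0%:Z - q'%:Z * x by rewrite /L !hornerE mulNr.
have QxE x : m0 * Q.[x] = P.[- n0%:Z - q'%:Z * x].
  by rewrite -hornerZ QE horner_comp hornL.
exists q', Q; split => //.
- by rewrite /q' -mulnA dvdn_mulr.
- have [d1 sPd] : exists d1, size P = d1.+1 by exists (size P).-1; rewrite prednK ?size_poly_gt0.
  rewrite sPd /= => a b b0; apply/eqP => f0.
  have b0' : b%:~R != 0 :> R by rewrite intr_eq0.
  have evQ : ev (a%:~R / b%:~R) Q = 0.
    have : b%:~R ^+ d1 * ev (a%:~R / b%:~R) Q = (homog_form Q d1 a b)%:~R.
      rewrite /ev horner_coef size_map_poly_id0; last by rewrite intr_eq0 lead_coef_eq0 -size_poly_gt0 sQ size_poly_gt0.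
      rewrite /homog_form rmorph_sum /= mulr_sumr sQ sPd.
      apply: eq_bigr => i _; rewrite coef_map /= !rmorphM /= !rmorphXn /= expr_div_n.
      have -> : b%:~R ^+ d1 = b%:~R ^+ (d1 - i) * b%:~R ^+ i :> R.
        by rewrite -exprD subnK// -ltnS.
      by field; rewrite expf_neq0.
    by rewrite f0 => /eqP; rewrite mulf_eq0 expf_eq0 (negbTE b0') andbF /= => /eqP.
  have : ev ((- n0%:Z * b - q'%:Z * a)%:~R / b%:~R) P = m0%:~R * ev (a%:~R / b%:~R) Q.
    rewrite -evZ QE /ev map_comp_poly horner_comp; congr (_.[_]).
    rewrite -[RHS]/(ev (a%:~R / b%:~R) L) /L evD evC evZ evX.
    by rewrite rmorphB /= !rmorphM /= rmorphN /=; field.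
  by rewrite evQ mulr0; apply/eqP; exact: minimal_poly_no_root.
- move=> p x pp px.
  have pE : ~~ dvz p E.
    apply/negP => pE; move: px; rewrite /Q hornerD hornerN hornerZ hornerC rpredBr; last exact: dvdz_mulr.
    by rewrite dvdzE /= dvdn1 => /eqP p1; rewrite p1 in pp.
  have pm : ~~ dvz p m0 by apply: contra pE => h; rewrite /E dvdz_mulr.
  have zM (a b : int) : dvz p (a * b) = dvz p a || dvz p b.
    by rewrite !dvdzE /= abszM Euclid_dvdM.
  have pq : ~~ dvz p q'%:Z by rewrite qE zM negb_or pm.
  have pP : dvz p P.[- n0%:Z - q'%:Z * x] by rewrite -QxE dvdz_mull.
  have pP' : ~~ dvz p P^`().[- n0%:Z - q'%:Z * x].
    apply/negP => h; have [u [v uv]] := bez (- n0%:Z - q'%:Z * x).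
    have : dvz p D by rewrite -uv rpredD// dvdz_mull.
    move=> pD; move/negP: pE; apply; apply: dvdz_mull; rewrite PoszM; apply: dvdz_mull.
    by move: pD; rewrite !dvdzE.
  split => //.
  have dE : m0 * Q^`().[x] = - (q'%:Z * P^`().[- n0%:Z - q'%:Z * x]).
    rewrite -hornerZ -derivZ QE deriv_comp hornerM horner_comp hornL /L derivD derivC add0r derivZ derivX.
    by rewrite hornerZ hornerC mulr1 mulrN mulrC.
  by apply/negP => h; have := dvdz_mull m0 h; rewrite dE rpredN zM (negbTE pq) (negbTE pP').
Qed.

End Fixed.
End MinimalPolynomial.

(** * Algebraic irrational parameter *)

Section AlgebraicIrrational.
Variables (R : realType) (alpha : R).
Hypotheses (alpha_gt0 : 0 < alpha) (alpha_le1 : alpha <= 1).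
Local Notation mu := (mu alpha).
Local Notation dvz m z := ((m%:Z %| z%R)%Z).

Lemma progression_sum (p a n : nat) (sg : R) : (0 < p)%N -> 1 < sg ->
  \sum_(m < n | (a < m)%N && (p %| m - a)%N) mu m `^ (- sg) <= p%:R `^ (- sg) * (1 + (sg - 1)^-1).
Proof.
move=> p0 s1.
apply: le_trans (_ : p%:R `^ (- sg) * \sum_(k < n) k.+1%:R `^ (- sg) <= _); last first.
  by rewrite ler_wpM2l ?powR_ge0// sum_powR_le.
have t0 (k : nat) : 0 <= (k.+1 * p)%:R `^ (- sg) :> R by exact: powR_ge0.
apply: le_trans (_ : \sum_(m < n) \sum_(k < n | val m == (a + k.+1 * p)%N) (k.+1 * p)%:R `^ (- sg) <= _).
  rewrite big_mkcond; apply: ler_sum => m _; case: ifP => [/andP[am /dvdnP[k hk]]|_]; last first.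
    by apply: sumr_ge0.
  case: k hk => [|k] hk; first by move: am; rewrite -subn_gt0 hk.
  have mE : val m = (a + k.+1 * p)%N by rewrite -hk subnKC// ltnW.
  have kn : (k < n)%N.
    apply: leq_ltn_trans (ltn_ord m); rewrite mE; apply: leq_trans (leq_addl _ _).
    by apply: leq_trans (leq_pmulr _ p0) => //.
  rewrite (bigD1 (Ordinal kn)) /=; last by rewrite mE.
  apply: ler_wpDr; first by apply: sumr_ge0.
  apply: powR_antitone; rewrite ?ltr0n ?muln_gt0//; last by lra.
  by rewrite /mu mE natrD -addrA addrCA lerDl addr_ge0// ltW.
rewrite (exchange_big_dep xpredT) //= mulr_sumr; apply: ler_sum => k _.
have -> : p%:R `^ (- sg) * k.+1%:R `^ (- sg) = (k.+1 * p)%:R `^ (- sg) by rewrite natrM powRM// mulrC.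
case: (ltnP (a + k.+1 * p) n) => kn.
  by rewrite (big_pred1 (Ordinal kn)) // => m; rewrite -val_eqE /=.
rewrite big_pred0// => m; apply/negbTE/eqP => mE.
by have := ltn_ord m; rewrite mE ltnNge kn.
Qed.

Definition large_factor (Q : {poly int}) (t : R) (x : nat) :=
  has (fun p : nat => t * x.+1%:R < p%:R) (primes `|Q.[x%:Z]|).

(** The window from [N ^ 2] to [(64 N) ^ 2] holds at least [(4096 / 32 - 1) * N ^ 2] suitable [x],
    each weighing at least [1 / (4096 * N ^ 2)]: together [127 / 4096 >= 1 / 64]. The number [I] of
    windows is free, which makes the sum large. *)
Lemma window_sum (Q : {poly int}) (eta : R) (Z0 : nat) : 0 < eta ->
  (forall Z, (Z0 <= Z)%N -> exists Y : nat, eta * Z%:R ^+ 2 * ln Z%:R <= Y%:R /\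
    Z%:R ^+ 2 / 32 <= (\sum_(x < Z * Z) has (ltn Y) (primes `|Q.[x%:Z]|))%N%:R :> R) ->
  forall I Z, (Z0 <= Z)%N -> (0 < Z)%N -> I%:R / 64 <=
   \sum_(x < (64 ^ I * Z) * (64 ^ I * Z) | (Z * Z <= x)%N && large_factor Q (eta * ln Z%:R) x) x.+1%:R^-1 :> R.
Proof.
move=> eta0 big I Z ZZ Zpos; elim: I => [|I IH]; first by rewrite mul0r sumr_ge0.
set N := (64 ^ I * Z)%N in IH; have -> : (64 ^ I.+1 * Z = 64 * N)%N by rewrite /N expnS mulnA.
set N' := (64 * N)%N; pose c x := (Z * Z <= x)%N && large_factor Q (eta * ln Z%:R) x.
have ZN : (Z <= N)%N by rewrite /N leq_pmull// expn_gt0.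
have N0 : (0 < N)%N by apply: leq_trans ZN.
have NN' : (N <= N')%N by rewrite /N' leq_pmull.
have NN2 : (N * N <= N' * N')%N by rewrite leq_mul.
rewrite (bigID (fun x : 'I_(N' * N') => (x < N * N)%N)) /= -natr1 mulrDl; apply: lerD.
  by rewrite -(big_ord_widen_cond _ c (fun x => x.+1%:R^-1 : R) NN2).
have [Y [Y1 Y2]] := big N' (leq_trans ZZ (leq_trans ZN NN')).
have n0 : (0 : R) < N'%:R ^+ 2 by rewrite exprn_gt0// ltr0n (leq_trans N0).
pose g (x : nat) := has (ltn Y) (primes `|Q.[x%:Z]|).
apply: le_trans (_ : \sum_(x < N' * N' | (N * N <= x)%N && g x) (N'%:R ^+ 2)^-1 <= _); last first.
  rewrite big_mkcond [leRHS]big_mkcond; apply: ler_sum => x _.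
  case: ifP => [/andP[Nx /hasP[p pp Yp]]|_]; last by case: ifP.
  have -> : c x && ~~ (x < N * N)%N.
    rewrite -leqNgt Nx andbT /c (leq_trans _ Nx) ?leq_mul//=; apply/hasP; exists p => //.
    apply: le_lt_trans (_ : Y%:R < _); last by rewrite ltr_nat.
    apply: le_trans Y1; have -> : eta * ln Z%:R * x.+1%:R = eta * (x.+1%:R * ln Z%:R) by ring.
    rewrite -mulrA ler_pM2l//; apply: ler_pM; rewrite ?ln_nat_ge0//.
      by rewrite -natrX ler_nat -mulnn ltn_ord.
    by apply: ln_nat_mono => //; exact: leq_trans NN'.
  by rewrite lef_pV2 ?posrE// ?ltr0n// -natrX ler_nat -mulnn ltn_ord.
rewrite sumr_const -[(N'%:R ^+ 2)^-1 *+ _]mulr_natl ler_pdivlMr//.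
have cnt : (\sum_(x < N' * N') g x <= N * N + #|[pred x : 'I_(N' * N') | (N * N <= x)%N && g x]|)%N.
  have := @big_ord_widen _ 0%N addn (N * N) (N' * N') (fun=> 1%N) NN2; rewrite sum1_card card_ord => E.
  rewrite -sum1_card [X in (_ <= X + _)%N]E [X in (_ <= X + _)%N]big_mkcond [X in (_ <= _ + X)%N]big_mkcond /= -big_split /=.
  by apply: leq_sum => x _; rewrite inE; case: ltnP => _; case: (g x).
have cnt' : (\sum_(x < N' * N') g x)%N%:R <= N%:R ^+ 2 + #|[pred x : 'I_(N' * N') | (N * N <= x)%N && g x]|%:R :> R.
  by rewrite -natrX -natrD ler_nat -mulnn.
have N'E : N'%:R ^+ 2 = 4096 * N%:R ^+ 2 :> R by rewrite /N' natrM; ring.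
have N2 : 0 <= N%:R ^+ 2 :> R by rewrite exprn_ge0.
move: Y2 cnt'; rewrite /g N'E; lra.
Qed.

Lemma shift_bound (a b x : nat) : ((a * x + b).+1 <= (a + b).+1 * x.+1)%N.
Proof. by nia. Qed.


(** The special indices are [n x = q' x + n0] where [Q x] has a large prime factor. The valuations
    lie between [1] and [d], so pigeonhole gives a common value [e] with enough mass. Any other term
    met by [v j] lies beyond [nn j] in its progression modulo [p]; the mass [O (ln Z / p)] of that
    progression is [O (1 / x)] by the size of [p]. *)
Lemma zeros_algebraic f C (n0 q : nat) : ~ transcendental alpha ->
  (forall a b : int, b != 0 -> b%:~R * alpha <> a%:~R) ->
  (forall m, cabs (f m) <= C) -> (forall m, (m < n0)%N -> f m = 0) -> f n0 != 0 ->
  (0 < q)%N -> (forall m, f (m + q)%N = f m) ->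
  forall T : R, exists s', [/\ 1 < complex.Re s', T <= complex.Im s' & dsum alpha f s' = 0].
Proof.
move=> ntr irr fC f0 fn0 q0 fper.
have fperX i m : f (m + i * q)%N = f m.
  by elim: i => [|i IH]; rewrite ?mul0n ?addn0// mulSn addnCA addnC fper.
have [P minP] := minimal_poly_exists ntr.
have [d sPd] : exists d, size P = d.+1.
  by exists (size P).-1; rewrite prednK// size_poly_gt0; case: minP.
have d1 : (1 < d)%N by have := size_minimal_poly minP irr; rewrite sPd.
have d0 := ltnW d1.
have [q' [Q [q'0 /dvdnP[q2 qq'] sQ formQ simQ]]] := shifted_poly minP irr n0 q0.
rewrite sPd /= in sQ formQ.
have [eta [Z0 [eta0 bigp]]] := large_prime_factors R sQ d0 formQ
  (fun p x pp px => let: And4 h _ _ _ := simQ p x pp px in h).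
pose hP := height P d.
pose nq := (q' + n0).+1; have nq0 : (0 : R) < nq%:R by rewrite ltr0n.
have Cf : cabs (f n0) <= C by []; have f00 : 0 < cabs (f n0) by rewrite cabs_gt0.
have C0 : 0 < C by slra.
pose c1 := cabs (f n0) * expR (- 3) / nq%:R.
have c10 : 0 < c1 by rewrite !mulr_gt0 ?expR_gt0 ?invr_gt0.
pose B := C ^+ 2 * (alpha `^ (- 4) + mu_bound alpha 2).
have B0 : 0 <= B by rewrite mulr_ge0 ?sqr_ge0// addr_ge0 ?powR_ge0// mu_bound_ge0//; slra.
have ce : 0 < c1 * eta by rewrite mulr_gt0.
(* By [rC] this choice gives [4 * r * Mm <= c1 * T1]; the second summand of the denominator keeps
   [r < 1]. *)
pose r := c1 * eta / (8 * C + 2 * (c1 * eta)).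
have rden : 0 < 8 * C + 2 * (c1 * eta) by slra.
have r0 : 0 < r by rewrite divr_gt0.
have r1 : r < 1 by rewrite ltr_pdivrMr//; slra.
have rC : r * (8 * C) <= c1 * eta.
  by rewrite /r mulrAC ler_pdivrMr// ler_pM2l//; slra.
pose K0 := 2 + (8 * B + 4 * d%:R + 9) / r ^+ d.
have dR : (0 : R) < d%:R by rewrite ltr0n.
have [I hI] : exists I : nat, K0 <= c1 * (I%:R / 64 / d%:R).
  exists (Num.truncn (64 * d%:R * K0 / c1)).+1.
  have : 64 * d%:R * K0 / c1 <= (Num.truncn (64 * d%:R * K0 / c1)).+1%:R by apply/ltW/truncnS_gt.
  rewrite ler_pdivrMr// => h.
  by rewrite mulrA mulrA ler_pdivlMr// ler_pdivlMr//; slra.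
pose W := (64 ^ I * 64 ^ I)%N.
have W0 : (0 < W)%N by rewrite muln_gt0 !expn_gt0.
(* In turn, the first three terms make [px x] exceed the whole range [M0], make it exceed [hP + 1]
   times a bound for [n x], and keep the special [mu] below [Z ^ 3]. *)
pose La := W%:R / eta + nq%:R * hP.+1%:R / eta + nq%:R * W%:R + 3.
have [Z [ZZ0 Zpos LLa]] : exists Z : nat, [/\ (Z0 <= Z)%N, (0 < Z)%N & La <= ln Z%:R].
  exists (maxn Z0 (Num.truncn (expR La)).+1); rewrite leq_maxl; split => //.
    by rewrite (leq_trans _ (leq_maxr _ _)).
  rewrite -[leLHS]expRK ler_ln ?posrE ?expR_gt0// ?ltr0n ?(leq_trans _ (leq_maxr _ _))//; apply: ltW.
  by apply: lt_le_trans (truncnS_gt _) _; rewrite ler_nat leq_maxr.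
pose L : R := ln Z%:R; rewrite -/L in LLa.
have Zpos' : (0 : R) < Z%:R by rewrite ltr0n.
have ZL : L <= Z%:R.
  have := @le_ln1Dx R (Z%:R - 1); rewrite addrCA subrr addr0 => h.
  by have := h ltac:(slra); rewrite -/L; slra.
have w1 : 0 <= W%:R / eta by rewrite divr_ge0 ?ler0n ?(ltW eta0).
have w2 : 0 <= nq%:R * hP.+1%:R / eta by rewrite divr_ge0 ?mulr_ge0 ?ler0n ?(ltW eta0).
have w3 : 0 <= nq%:R * W%:R :> R by rewrite mulr_ge0.
have L3 : 3 <= L by rewrite /La in LLa; slra.
have LW : W%:R <= eta * L by rewrite mulrC -ler_pdivrMr//; rewrite /La in LLa; slra.
have Lh : nq%:R * hP.+1%:R <= eta * L by rewrite mulrC -[leRHS]mulrC -ler_pdivrMr//; rewrite mulrC; rewrite /La in LLa; slra.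
have LN : nq%:R * W%:R <= Z%:R :> R by rewrite /La in LLa; slra.
pose t := eta * L.
have t0 : 0 < t by rewrite mulr_gt0//; slra.
pose M0 := ((64 ^ I * Z) * (64 ^ I * Z))%N.
have M0E : M0 = (W * (Z * Z))%N by rewrite /M0 mulnACA.
pose c x := (Z * Z <= x)%N && large_factor Q t x.
pose n x := (q' * x + n0)%N.
pose px x := nth 0%N (primes `|Q.[x%:Z]|) (find (fun p : nat => t * x.+1%:R < p%:R) (primes `|Q.[x%:Z]|)).
have cP x : c x -> [/\ prime (px x), dvz (px x) Q.[x%:Z], t * x.+1%:R < (px x)%:R & (Z * Z <= x)%N].
  case/andP => Zx hs; have hn := nth_find 0%N hs.
  have : px x \in primes `|Q.[x%:Z]| by rewrite mem_nth// -has_find.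
  by rewrite mem_primes => /and3P[pp _ pd]; split => //; rewrite dvdzE.
have nE (x : nat) : - n0%:Z - q'%:Z * x%:Z = - (n x)%:Z by rewrite /n PoszD PoszM; ring.
have cQ x : c x -> [/\ ~~ (px x %| q')%N, ~~ dvz (px x) P.[- n0%:Z],
    dvz (px x) P.[- (n x)%:Z] & ~~ dvz (px x) P^`().[- (n x)%:Z]].
  by move=> /cP[pp pQ _ _]; have [_ h1 h2 []] := simQ _ _ pp pQ; rewrite nE.
have pW x : c x -> (W * (Z * Z) < px x)%N.
  case/cP => _ _ tp Zx; rewrite -(ltr_nat R); apply: le_lt_trans tp.
  by rewrite natrM; apply: ler_pM => //; rewrite ler_nat ltnW// ltnS.
have ph x : c x -> (nq * hP.+1 * x.+1 < px x)%N.
  case/cP => _ _ tp Zx; rewrite -(ltr_nat R); apply: le_lt_trans tp.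
  by rewrite natrM ler_pM// natrM.
have nle x : ((n x).+1 <= nq * x.+1)%N by exact: shift_bound.
have pn x : c x -> (n x < px x)%N.
  move=> cx; apply: leq_trans (nle x) _; apply: leq_trans (ltnW (ph x cx)).
  by rewrite leq_mul2r; apply/orP; right; rewrite leq_pmulr.
pose ee x := logn (px x) `|P.[- (n x)%:Z]|.
have ee1 x : c x -> (0 < ee x)%N.
  move=> cx; have [pp _ _ _] := cP x cx; have [_ _ pP _] := cQ x cx.
  rewrite logn_gt0 mem_primes pp absz_gt0 (minimal_poly_int_neq0 minP irr) /=.
  by move: pP; rewrite dvdzE.
(* The power [p ^ (d + 1)] exceeds [hP * p ^ d], which bounds [|P (- n x)|]. *)
have eed x : c x -> (ee x <= d)%N.
  move=> cx; have [pp _ _ _] := cP x cx; rewrite -ltnS -(ltn_exp2l _ _ (prime_gt1 pp)).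
  apply: leq_ltn_trans (_ : `|P.[- (n x)%:Z]| < _)%N.
    by rewrite dvdn_leq ?pfactor_dvdnn// absz_gt0 (minimal_poly_int_neq0 minP irr).
  apply: leq_ltn_trans (_ : hP * (n x).+1 ^ d < _)%N.
    have := form_homog sPd 1 (- (n x)%:Z); rewrite mul1r expr1n mul1r => <-.
    by apply: form_bound; rewrite ?abszN//= ltnW.
  have p1 : ((n x).+1 <= px x)%N by exact: pn.
  apply: leq_ltn_trans (_ : hP * px x ^ d < _)%N; first by rewrite leq_mul2l leq_exp2r ?p1 ?orbT.
  rewrite expnS ltn_pmul2r ?expn_gt0 ?prime_gt0//.
  apply: ltn_trans (ph x cx); apply: leq_trans (_ : hP.+1 <= _)%N => //.
  by rewrite mulnAC leq_pmull// muln_gt0.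
have [e [e0 ed he]] : exists e, [/\ (0 < e)%N, (e <= d)%N &
    I%:R / 64 / d%:R <= \sum_(x < M0 | c x && (ee x == e)) x.+1%:R^-1 :> R].
  apply: contrapT => no.
  have lt (e : 'I_d) : \sum_(x < M0 | c x && (ee x == e.+1)) x.+1%:R^-1 < I%:R / 64 / d%:R :> R.
    by rewrite ltNge; apply/negP => h; apply: no; exists e.+1; split => //; exact: ltn_ord.
  have := window_sum eta0 bigp I ZZ0 Zpos; rewrite -/M0 -/L -/t.
  have -> : \sum_(x < M0 | (Z * Z <= x)%N && large_factor Q t x) x.+1%:R^-1 =
     \sum_(e < d) \sum_(x < M0 | c x && (ee x == e.+1)) x.+1%:R^-1 :> R.
    rewrite [RHS](exchange_big_dep (fun x : 'I_M0 => c x)) /=; last by move=> i x _ /andP[].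
    apply: eq_bigr => x cx; have e1 : ((ee x).-1 < d)%N by rewrite prednK ?ee1// eed.
    rewrite (big_pred1 (Ordinal e1)) // => i; rewrite (cx : c x = true) /= -val_eqE /=.
    by rewrite -{1}(prednK (ee1 x cx)) eqSS eq_sym.
  apply/negP; rewrite -ltNge; apply: lt_le_trans (_ : \sum_(e < d) I%:R / 64 / d%:R <= _).
    by apply: ltr_sum => [|i _]; [apply/hasP; exists (Ordinal d0); rewrite ?mem_index_enum|exact: lt].
  by rewrite sumr_const card_ord -[_ *+ d]mulr_natr divfK// gt_eqF.
pose S : {set 'I_M0} := [set x : 'I_M0 | c x && (ee x == e)].
pose xj (j : 'I_#|S|) : nat := enum_val j.
have xjP j : c (xj j) /\ ee (xj j) = e.
  by have := enum_valP j; rewrite finset.in_set => /andP[h /eqP].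
have xjinj : injective xj by move=> i j /val_inj /enum_val_inj.
have xjM j : (xj j < M0)%N by rewrite /xj ltn_ord.
pose T1 : R := \sum_j (xj j).+1%:R^-1.
have T1E : I%:R / 64 / d%:R <= T1.
  apply: le_trans he _; rewrite /T1 /xj -(big_enum_val (fun x : 'I_M0 => x.+1%:R^-1 : R)).
  rewrite le_eqVlt; apply/orP; left; apply/eqP; apply: eq_bigl => x.
  by rewrite finset.in_set.
pose nn j := n (xj j).
pose v j := prime_val P (px (xj j)) (nn j).
pose sg : R := 1 + L^-1.
have L0 : 0 < L by slra.
have sg1 : 1 < sg by rewrite ltrDl invr_gt0.
have sg2 : sg <= 2.
  have : L^-1 <= 1 by rewrite invf_le1//; slra.
  by rewrite /sg; slra.
have sgL : (sg - 1)^-1 = L by rewrite /sg addrAC subrr add0r invrK.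
have low j : c1 * (xj j).+1%:R^-1 <= cabs (f n0) * mu (nn j) `^ (- sg).
  have x0 : (0 : R) < (xj j).+1%:R by rewrite ltr0n.
  have mle : mu (nn j) <= nq%:R * (xj j).+1%:R.
    rewrite /mu; apply: le_trans (lerD (lexx _) alpha_le1) _.
    by rewrite natr1 -natrM ler_nat nle.
  rewrite /c1 -!mulrA ler_pM2l//.
  apply: le_trans (_ : expR (- 3) / mu (nn j) <= _).
    by rewrite ler_pM2l ?expR_gt0// -invfM lef_pV2 ?posrE ?mulr_gt0 ?mu_gt0.
  apply: powR_near1; rewrite ?mu_gt0//.
  apply: le_trans (_ : ln (Z%:R ^+ 3) <= _); last by rewrite lnXn// -/L mulr_natl.
  rewrite ler_ln ?posrE ?exprn_gt0 ?mu_gt0//; apply: le_trans mle _.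
  apply: le_trans (_ : nq%:R * W%:R * Z%:R ^+ 2 <= _).
    rewrite -mulrA ler_pM2l// -natrX -natrM ler_nat -mulnn -M0E; exact: xjM.
  by rewrite [Z%:R ^+ 3]exprS ler_pM2r ?exprn_gt0.
have lowS : c1 * T1 <= cabs (f n0) * \sum_j mu (nn j) `^ (- sg).
  by rewrite !mulr_sumr; apply: ler_sum => j _; exact: low.
have vnn i j : v j (nn i) = if i == j then e else 0%N.
  rewrite /v /prime_val; have [cj ej] := xjP j; have [ci _] := xjP i.
  case: eqP => [->|ij]; first by rewrite subrr dvdz0 -/(ee (xj j)) ej.
  case: ifP => // pd; case: ij; apply: xjinj.
  have [pp _ _ _] := cP _ cj; have [pq _ _ _] := cQ _ cj.
  have : dvz (px (xj j)) (q'%:Z * ((xj i)%:Z - (xj j)%:Z)).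
    by move: pd; rewrite /nn /n !PoszD !PoszM; congr (_ %| _)%Z; ring.
  rewrite dvdzE /= abszM Euclid_dvdM// (negbTE pq) /= => pdx.
  apply/eqP; apply: contraT => xij.
  have : (0 < `|((xj i)%:Z - (xj j)%:Z)%R|)%N by rewrite absz_gt0 subr_eq0 eqz_nat.
  move=> /dvdn_leq /(_ pdx); have := pW _ cj; rewrite -M0E.
  by move: (xjM i) (xjM j); move: (px (xj j)) (xj i) (xj j) (M0); clear => p0 a b m0; lia.
pose h m := (\sum_j v j m)%N.
pose Mm := 2 * C / eta * T1.
apply: (@zeros_of_special_terms R alpha alpha_gt0 f C n0 #|S| e (f n0) nn v sg B Mm r) => //.
- by move=> j; have [cj _] := xjP j; have [_ _ h1 h2] := cQ _ cj; have [pp _ _ _] := cP _ cj; exact: prime_val_additive.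
- move=> j; have [cj _] := xjP j; have [_ h1 _ _] := cQ _ cj; have [pp _ _ _] := cP _ cj.
  rewrite /v /prime_val; case: ifP => // _; apply/eqP; rewrite -leqn0 leqNgt logn_gt0 mem_primes pp.
  by move: h1; rewrite dvdzE /= => /negbTE ->; rewrite andbF.
- by move=> j; rewrite /nn /n qq' mulnAC addnC fperX.
- by move=> k; apply: mean_square_bound.
- move=> k.
  have key (m : 'I_k) : (e < h m)%N -> exists j, (nn j < m)%N && (px (xj j) %| m - nn j)%N.
    move=> ehm; have [j vj] : exists j, (0 < v j m)%N.
      apply/existsP; rewrite -[X in is_true X]negbK negb_exists; apply/negP => /forallP no.
      by move: ehm; rewrite /h big1// => j _; apply/eqP; rewrite -leqn0 leqNgt no.
    exists j; have [cj _] := xjP j.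
    move: vj; rewrite /v /prime_val; case: ifP => // pd _.
    have mn : val m != nn j.
      apply/eqP => mE; move: ehm; rewrite /h mE (bigD1 j) //= vnn eqxx big1 ?addn0 ?ltnn// => i ij.
      by rewrite vnn eq_sym (negbTE ij).
    have pnj := pn _ cj; rewrite -/(nn j) in pnj.
    have nm : (nn j < m)%N.
      rewrite ltn_neqAle eq_sym mn /= leqNgt; apply/negP => lt.
      move: pd; rewrite -rpredN opprB subzn ?(ltnW lt)// dvdzE /= => /dvdn_leq.
      rewrite subn_gt0 lt => /(_ isT); apply/negP; rewrite -ltnNge.
      exact: leq_ltn_trans (leq_subr _ _) pnj.
    by rewrite nm /=; move: pd; rewrite subzn ?(ltnW nm)// dvdzE.
  apply: le_trans (_ : \sum_(m < k) \sum_(j | (nn j < m)%N && (px (xj j) %| m - nn j)%N) C * mu m `^ (- sg) <= _).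
    rewrite big_mkcond; apply: ler_sum => m _; case: ifP => [/key[j hj]|_]; last first.
      by apply: sumr_ge0 => j _; rewrite mulr_ge0 ?powR_ge0// ltW.
    rewrite (bigD1 j) //= ler_wpDr//; last by rewrite ler_wpM2r ?powR_ge0.
    by apply: sumr_ge0 => i _; rewrite mulr_ge0 ?powR_ge0// ltW.
  rewrite (exchange_big_dep xpredT) //= /Mm /T1 mulr_sumr; apply: ler_sum => j _.
  rewrite -mulr_sumr; have [cj _] := xjP j; have [pp _ tp _] := cP _ cj.
  have p0 : (0 : R) < (px (xj j))%:R by rewrite ltr0n prime_gt0.
  have p1 : 1 <= (px (xj j))%:R :> R by rewrite ler1n prime_gt0.
  have -> : 2 * C / eta / (xj j).+1%:R = C * (2 / (eta * (xj j).+1%:R)) by rewrite invfM; ring.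
  rewrite ler_pM2l//; apply: le_trans (progression_sum _ _ (prime_gt0 pp) sg1) _; rewrite sgL.
  apply: le_trans (_ : (px (xj j))%:R^-1 * (2 * L) <= _).
    apply: ler_pM; rewrite ?powR_ge0 ?addr_ge0 ?(ltW L0)//; last by slra.
    by rewrite -[leRHS]powR_inv1 ?(ltW p0)//; apply: ler_powR => //; slra.
  rewrite mulrC ler_pdivrMr// mulrAC ler_pdivlMr ?mulr_gt0 ?ltr0n//.
  by move: tp; rewrite /t; slra.
- rewrite /Mm; apply: le_trans lowS.
  have T10 : 0 <= T1 by rewrite sumr_ge0.
  have -> : 4 * r * (2 * C / eta * T1) = r * (8 * C) / eta * T1 by ring.
  by rewrite ler_wpM2r// ler_pdivrMr.
- apply: le_trans lowS; apply: le_trans (_ : K0 <= _).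
    rewrite /K0 lerD2l; apply: ler_pM.
    + by have := ler0n R e; slra.
    + by rewrite invr_ge0 exprn_ge0// ltW.
    + by rewrite lerD2r lerD2l ler_pM2l// ler_nat.
    + by rewrite lef_pV2 ?posrE ?exprn_gt0//; apply: ler_wiXn2l => //; apply: ltW.
  by apply: le_trans hI _; rewrite ler_pM2l.
Qed.

End AlgebraicIrrational.

(** * Rational parameter: ordinary Dirichlet series and finite Euler products *)

Section OrdinaryDirichletSeries.
Variable R : realType.
Implicit Types (u : nat -> R[i]) (s z : R[i]).

Lemma csummable_shift u (a : nat) : csummable u -> csummable (fun i => u (a + i)%N).
Proof.
move=> [B hB]; exists B => n; apply: le_trans (hB (a + n)%N).
by rewrite (sum_nat_shift (fun i => cabs (u i))) lerDr sumr_ge0// => i _; exact: cabs_ge0.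
Qed.

Lemma csum_shift u (a : nat) : csummable u ->
  csum u = \sum_(i < a) u i + csum (fun i => u (a + i)%N).
Proof.
move=> su; apply: is_csum_unique => e e0.
have [N hN] := csummable_csum (csummable_shift a su) e0.
exists (a + N)%N => n aNn; have an : (a <= n)%N := leq_trans (leq_addr _ _) aNn.
rewrite -(subnKC an) sum_nat_shift opprD addrACA subrr add0r.
by apply: hN; rewrite leq_subRL.
Qed.

Lemma sum_multiples_le (F : nat -> R) (p N : nat) : (0 < p)%N -> (forall i, 0 <= F i) ->
  \sum_(n < N | (p %| n)%N) F (n %/ p)%N <= \sum_(m < N) F m.
Proof.
move=> p0 F0.
apply: le_trans (_ : \sum_(n < N) \sum_(m < N | val n == (p * m)%N) F m <= _).
  rewrite big_mkcond; apply: ler_sum => n _; case: ifP => [/dvdnP[m nE]|_]; last exact: sumr_ge0.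
  have mN : (m < N)%N by apply: leq_ltn_trans (ltn_ord n); rewrite nE leq_pmulr.
  rewrite (bigD1 (Ordinal mN)) /=; last by rewrite nE mulnC.
  by rewrite nE mulnK// lerDl sumr_ge0.
rewrite (exchange_big_dep xpredT) //=; apply: ler_sum => m _.
case: (ltnP (p * m) N) => pm.
  by rewrite (big_pred1 (Ordinal pm)) // => n; rewrite -val_eqE /=.
rewrite big_pred0// => n; apply/negbTE/eqP => nE.
by have := ltn_ord n; rewrite nE ltnNge pm.
Qed.

Lemma csum_progression u (a b : nat) : (0 < b)%N -> csummable u ->
  csum (fun n => if (a <= n)%N && (b %| n - a)%N then u ((n - a) %/ b)%N else 0) = csum u.
Proof.
move=> b0 su; rewrite (csum_shift a); last first.
  have [B hB] := su; exists B => n; apply: le_trans (hB n).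
  pose F i : R := cabs (u i).
  apply: le_trans (_ : \sum_(m < n | (b %| m)%N) F (m %/ b)%N <= _); last first.
    by apply: sum_multiples_le => // i; exact: cabs_ge0.
  pose G i := if (b %| i)%N then F (i %/ b)%N else 0.
  have G0 i : 0 <= G i by rewrite /G; case: ifP => // _; exact: cabs_ge0.
  have -> : \sum_(m < n | (b %| m)%N) F (m %/ b)%N = \sum_(m < n) G m by rewrite big_mkcond.
  apply: le_trans (_ : \sum_(i < n) (if (a <= i)%N then G (i - a)%N else 0) <= _).
    apply: ler_sum => i _; rewrite /G; case: (leqP a i) => ai /=; last by rewrite cabs0.
    by case: ifP => _; rewrite ?cabs0.
  case: (leqP a n) => an; last first.
    rewrite [leLHS]big1 ?sumr_ge0// => i _.
    by rewrite leqNgt (ltn_trans (ltn_ord i) an).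
  rewrite -(subnKC an); move: (n - a)%N => n'.
  rewrite (sum_nat_shift (fun i => if (a <= i)%N then G (i - a)%N else 0)).
  rewrite big1 ?add0r => [|i _]; last by rewrite leqNgt ltn_ord.
  under eq_bigr do rewrite leq_addr addKn.
  by apply: (@sum_ord_le R xpredT G) => //; rewrite leq_addl.
rewrite big1 ?add0r => [|i _]; last by rewrite leqNgt ltn_ord.
rewrite -[RHS](csum_mul b0 su); apply: eq_csum => i.
by rewrite leq_addr addKn.
Qed.

Definition dsr u s : R[i] := csum (fun n => u n * cpow n%:R (- s)).

Lemma cabs_cpow_nat n s : (0 < n)%N -> cabs (cpow n%:R (- s)) = n%:R `^ (- complex.Re s).
Proof. by move=> n0; rewrite cabs_cpow_powR ?ltr0n// ReN. Qed.

Lemma sum_nat_powR (sg : R) n : 1 < sg -> \sum_(i < n) (i != 0%N :> nat)%:R * i%:R `^ (- sg) <= 1 + (sg - 1)^-1 :> R.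
Proof.
move=> s1; case: n => [|n]; first by rewrite big_ord0 addr_ge0// invr_ge0 subr_ge0 ltW.
rewrite big_ord_recl /= mul0r add0r; apply: le_trans (sum_powR_le n s1).
by apply: ler_sum => i _; rewrite /bump /= add1n mul1r.
Qed.

Lemma dsr_summable u (C : R) s : u 0%N = 0 -> (forall n, cabs (u n) <= C) -> 1 < complex.Re s ->
  csummable (fun n => u n * cpow n%:R (- s)).
Proof.
move=> u0 uC s1; apply: (csummable_dom (b := fun n => C * ((n != 0%N)%:R * n%:R `^ (- complex.Re s)))
   (B := C * (1 + (complex.Re s - 1)^-1))).
  move=> [|n]; first by rewrite u0 mul0r cabs0 mul0r mulr0.
  by rewrite cabsM cabs_cpow_nat// mul1r ler_wpM2r ?powR_ge0.
move=> n; rewrite -mulr_sumr ler_wpM2l ?sum_nat_powR//.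
exact: le_trans (cabs_ge0 _) (uC 0%N).
Qed.

Lemma dsr_mul u p s : (0 < p)%N -> u 0%N = 0 -> csummable (fun n => u n * cpow n%:R (- s)) ->
  csum (fun n => (if (p %| n)%N then u (n %/ p)%N else 0) * cpow n%:R (- s)) = cpow p%:R (- s) * dsr u s.
Proof.
move=> p0 u0 su; rewrite /dsr -csumZ// -[RHS](csum_mul p0 (csummableZ _ su)).
apply: eq_csum => n; case: ifP => [/dvdnP[m ->]|_]; last by rewrite mul0r.
rewrite mulnK//; case: m => [|m]; first by rewrite u0 !mul0r mulr0.
by rewrite natrM cpowM ?ltr0n//; ring.
Qed.

(** Since [m + a / b = (b m + a) / b], the sum runs over a progression; [a <= b] ensures that it
    contains every positive [n] congruent to [a]. *)
Lemma dsum_rational (a b : nat) (f g w : nat -> R[i]) (C : R) s : (0 < a)%N -> (0 < b)%N ->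
  (forall m, g (b * m + a)%N = f m) -> (forall n, (n %% b != a %% b)%N -> g n = 0) -> (a <= b)%N ->
  (forall m, cabs (f m * w (b * m + a)%N) <= C) -> 1 < complex.Re s ->
  dsum (a%:R / b%:R) (fun m => f m * w (b * m + a)%N) s =
  cpow b%:R s * dsr (fun n => if n == 0%N then 0 else g n * w n) s.
Proof.
move=> a0 b0 gf g0 ab fC s1; have a0' : (0 : R) < a%:R by rewrite ltr0n.
have b0' : (0 : R) < b%:R by rewrite ltr0n.
have al0 : 0 < a%:R / b%:R :> R by rewrite divr_gt0.
pose u m := f m * w (b * m + a)%N * cpow (b * m + a)%N%:R (- s).
have muE m : mu (a%:R / b%:R) m = (b * m + a)%N%:R / b%:R :> R.
  by rewrite /mu natrD natrM mulrDl mulrAC divff ?gt_eqF// mul1r.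
have uE m : dterm (a%:R / b%:R) (fun m => f m * w (b * m + a)%N) s m = cpow b%:R s * u m.
  rewrite /dterm muE cpowM ?invr_gt0// ?ltr0n ?addn_gt0 ?a0 ?orbT//.
  have -> : cpow (b%:R^-1) (- s) = cpow b%:R s.
    by rewrite /cpow lnV ?posrE// rmorphN /= mulrN mulNr opprK.
  by rewrite /u; ring.
have su' := dterm_summable al0 fC s1.
have su : csummable u.
  have := csummableZ (cpow b%:R s)^-1 su'; rewrite /csummable => -[B hB]; exists B => n.
  apply: le_trans (hB n); apply: ler_sum => i _; rewrite uE mulrA mulVf ?mul1r//; exact: cpow_neq0.
rewrite /dsum (eq_csum uE) csumZ//; congr (_ * _).
rewrite -(csum_progression a b0 su) /dsr; apply: eq_csum => n.
case: ifP => [/andP[an /dvdnP[m nE]]|no].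
  have nE' : n = (b * m + a)%N by rewrite mulnC -nE subnK.
  rewrite nE mulnK// /u -nE' gtn_eqF ?(leq_trans a0 an)//.
  by rewrite [in g n]nE' gf.
case: n no => [|n] no; first by rewrite mul0r.
rewrite /= g0 ?mul0r//; apply: contraFN no => /eqP nE.
have an : (a <= n.+1)%N.
  rewrite leqNgt; apply/negP => na.
  have nb : (n.+1 < b)%N := leq_trans na ab.
  move: nE; rewrite modn_small//; move: ab; rewrite leq_eqVlt => /orP[/eqP ->|ab']; first by rewrite modnn.
  by rewrite modn_small// => nE; rewrite nE ltnn in na.
by rewrite an /= -eqn_mod_dvd// nE eqxx.
Qed.

Definition smooth (k n : nat) := (0 < n)%N && all (fun p => (p <= k)%N) (primes n).

(** A finite Euler product, one prime at a time: with [x = p ^ (- 1/2)] the enlarged sum [S]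
    satisfies [S <= B + x * S]. The exponent [1/2] leaves room to the left of the line
    [Re s = 1]. *)
Lemma smooth_sum k : exists B : R, forall N, \sum_(n < N) (smooth k n)%:R * n%:R `^ (- 2^-1) <= B.
Proof.
have h0 n : 0 <= n%:R `^ (- 2^-1) :> R by exact: powR_ge0.
elim: k => [|k [B hB]].
  exists 1 => N; apply: le_trans (_ : \sum_(n < N) (val n == 1%N)%:R <= _); last first.
    rewrite -natr_sum (ler_nat R _ 1); case: (ltnP 1 N) => N1.
      rewrite (bigD1 (Ordinal N1)) //= big1 ?addn0// => i i1.
      by rewrite -val_eqE /= in i1; rewrite (negbTE i1).
    by rewrite big1// => i _; rewrite ltn_eqF// (leq_trans (ltn_ord i)).
  apply: ler_sum => n _; case: (boolP (smooth 0 n)) => [/andP[n0 /allP sm]|_]; last by rewrite mul0r; case: eqP.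
  have nE : n = 1%N :> nat.
    apply/eqP; rewrite eqn_leq n0 andbT leqNgt; apply/negP => n1.
    have := sm (pdiv n); rewrite mem_primes pdiv_prime// n0 pdiv_dvd => /(_ isT).
    by rewrite leqn0 => /eqP E; have := pdiv_prime n1; rewrite E.
  by case: n nE {n0 sm} => n nN /= ->; rewrite mul1r powR1.
have [pk|npk] := boolP (prime k.+1); last first.
  exists B => N; apply: le_trans (hB N); apply: ler_sum => n _; rewrite ler_wpM2r// ler_nat.
  case: (boolP (smooth k.+1 n)) => // /andP[n0 /allP sm]; rewrite /smooth n0 (_ : all _ _)//.
  apply/allP => p pn; have := sm p pn; rewrite leq_eqVlt => /orP[/eqP pE|//].
  by move: pn; rewrite mem_primes pE (negbTE npk).
set p := k.+1 in pk *; have p0 := prime_gt0 pk.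
pose x : R := p%:R `^ (- 2^-1).
have x1 : x < 1.
  have lp : 0 < ln (p%:R : R) by rewrite ln_gt0// ltr1n prime_gt1.
  rewrite /x /powR gt_eqF ?ltr0n// -[ltRHS]expR0 ltr_expR mulNr oppr_lt0.
  by rewrite mulr_gt0.
have x0 : 0 <= x by exact: powR_ge0.
exists (B / (1 - x)) => N; rewrite ler_pdivlMr ?subr_gt0//.
pose F n : R := (smooth p n)%:R * n%:R `^ (- 2^-1).
have F0 n : 0 <= F n by rewrite mulr_ge0.
suff : \sum_(n < N) F n <= B + x * \sum_(n < N) F n by rewrite -/F; lra.
apply: le_trans (lerD (hB N) (ler_wpM2l x0 (sum_multiples_le N p0 F0))).
rewrite mulr_sumr [X in _ <= _ + X]big_mkcond -big_split /=; apply: ler_sum => n _.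
case: (boolP (smooth p n)) => [/andP[n0 /allP sm]|nsm]; last first.
  rewrite /F (negbTE nsm) mul0r addr_ge0 ?mulr_ge0//; case: ifP => // _.
  by rewrite !mulr_ge0.
case: ifP => pn.
  apply: ler_wpDl; first by rewrite mulr_ge0.
  case/dvdnP: pn => m nE; rewrite nE mulnK//.
  have m0 : (0 < m)%N by move: n0; rewrite nE muln_gt0 => /andP[].
  have sm' : smooth p m.
    rewrite /smooth m0; apply/allP => r; rewrite mem_primes => /and3P[rp _ rm].
    by apply: sm; rewrite mem_primes rp n0 nE dvdn_mulr.
  rewrite /F sm' !mul1r natrM powRM// mulrC -/x.
  by rewrite [leRHS]mulrC ler_piMr ?mulr_ge0//; case: smooth.
have sk : smooth k n; last by rewrite addr0 ler_wpM2r// ler_nat sk leq_b1.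
rewrite /smooth n0 /=; apply/allP => r rn; have := sm r rn; rewrite leq_eqVlt => /orP[/eqP rE|//].
by move: rn; rewrite rE mem_primes pn !andbF.
Qed.

(** In the product of the two series the lowest frequency [ln n1 + ln n2] occurs only once. The mean
    value of the product, rotated to that frequency, is therefore [u1 n1 * u2 n2]. *)
Lemma common_nonzero (u1 u2 : nat -> R[i]) (n1 n2 : nat) : csummable u1 -> csummable u2 ->
  u1 0%N = 0 -> u2 0%N = 0 ->
  (forall n, (n < n1)%N -> u1 n = 0) -> (forall n, (n < n2)%N -> u2 n = 0) ->
  u1 n1 != 0 -> u2 n2 != 0 ->
  exists t : R, csum (fun n => u1 n * cis (- t * ln n%:R)) != 0 /\
    csum (fun n => u2 n * cis (- t * ln n%:R)) != 0.
Proof.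
move=> su1 su2 u10 u20 un1 un2 u1n u2n.
have n10 : (0 < n1)%N by case: n1 un1 u1n => //; rewrite u10 eqxx.
have n20 : (0 < n2)%N by case: n2 un2 u2n => //; rewrite u20 eqxx.
pose c0 := u1 n1 * u2 n2; have c00 : 0 < cabs c0 by rewrite cabs_gt0 mulf_neq0.
have [B1 hB1] := su1; have [B2 hB2] := su2.
pose Bd := B1 + B2.
have B10 : 0 <= B1 by have := hB1 0%N; rewrite big_ord0.
have B20 : 0 <= B2 by have := hB2 0%N; rewrite big_ord0.
pose ep := cabs c0 / (4 * (Bd + 1)).
have Bd0 : 0 <= Bd by rewrite /Bd; lra.
have ep0 : 0 < ep by rewrite divr_gt0// mulr_gt0//; lra.
have [N1 hN1] := cabs_csum_tail (fun i => cabs_ge0 (u1 i)) hB1 ep0.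
have [N2 hN2] := cabs_csum_tail (fun i => cabs_ge0 (u2 i)) hB2 ep0.
pose N := (n1 + n2 + N1 + N2).+1.
have lt1 : (n1 < N)%N by rewrite /N; lia.
have lt2 : (n2 < N)%N by rewrite /N; lia.
have leN1 : (N1 <= N)%N by rewrite /N; lia.
have leN2 : (N2 <= N)%N by rewrite /N; lia.
pose v : R[i] := (c0^* / (cabs c0)%:C)%R.
have v1 : cabs v = 1 by rewrite cabsM cabsV cabsR ger0_norm ?cabs_ge0// cabsJ divff// gt_eqF.
have vc0 : v * c0 = (cabs c0)%:C.
  have E : (cabs c0 ^+ 2)%:C = c0 * c0^* := sqr_cabsJ c0.
  have nz : (cabs c0)%:C != 0 :> R[i] by rewrite -cabs_gt0 cabsR ger0_norm ?cabs_ge0.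
  rewrite /v mulrAC [_ * c0]mulrC; apply: (canLR (mulfK nz)).
  by rewrite -(rmorphM (real_complex R)) /= -expr2; exact: esym E.
pose c (nm : 'I_N * 'I_N) := v * (u1 nm.1 * u2 nm.2).
pose L (nm : 'I_N * 'I_N) : R := (ln n1%:R - ln nm.1%:R) + (ln n2%:R - ln nm.2%:R).
have e2 : 0 < cabs c0 / 2 by rewrite divr_gt0.
have [t _ ht] := mean_value c L 0 e2.
exists t.
pose w1 n := u1 n * cis (- t * ln n%:R); pose w2 n := u2 n * cis (- t * ln n%:R).
have cw1 n : cabs (w1 n) <= cabs (u1 n) by rewrite cabsM cabs_cis mulr1.
have cw2 n : cabs (w2 n) <= cabs (u2 n) by rewrite cabsM cabs_cis mulr1.
have t1 := hN1 w1 cw1 N leN1.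
have t2 := hN2 w2 cw2 N leN2.
pose X1 := \sum_(i < N) w1 i; pose X2 := \sum_(i < N) w2 i.
have bX1 : cabs X1 <= Bd.
  apply: le_trans (cabs_sum _ _ _) _; apply: le_trans (_ : B1 <= _); last by rewrite /Bd; lra.
  by apply: le_trans (hB1 N); apply: ler_sum => i _; exact: cw1.
have bX2 : cabs X2 <= Bd.
  apply: le_trans (cabs_sum _ _ _) _; apply: le_trans (_ : B2 <= _); last by rewrite /Bd; lra.
  by apply: le_trans (hB2 N); apply: ler_sum => i _; exact: cw2.
have mainE : \sum_(i | L i == 0) c i = (cabs c0)%:C.
  rewrite (bigD1 (Ordinal lt1, Ordinal lt2)) /=; last by rewrite /L /= !subrr addr0.
  rewrite {1}/c /= vc0 big1 ?addr0// => -[n m] /= /andP[/eqP L0 nm].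
  rewrite /c /=; case: (ltnP n n1) => nn1; first by rewrite un1// mul0r mulr0.
  case: (ltnP m n2) => mn2; first by rewrite un2// !mulr0.
  have l1 : ln (n1%:R : R) <= ln n%:R by exact: ln_nat_mono.
  have l2 : ln (n2%:R : R) <= ln m%:R by exact: ln_nat_mono.
  rewrite /L /= in L0.
  have E1 : ln (n1%:R : R) = ln n%:R by lra.
  have E2 : ln (n2%:R : R) = ln m%:R by lra.
  have inj (x y : nat) : (0 < x)%N -> (x <= y)%N -> ln (x%:R : R) = ln y%:R -> x = y.
    move=> x0 xy /ln_inj; rewrite !posrE !ltr0n x0 (leq_trans x0 xy) => /(_ isT isT) /eqP.
    by rewrite eqr_nat => /eqP.
  case/eqP: nm; congr pair; apply: val_inj => /=; apply/esym; exact: inj.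
have prodE : complex.Re (\sum_i c i * cis (t * L i)) <= cabs X1 * cabs X2.
  pose v' := v * cis (t * (ln n1%:R + ln n2%:R)).
  have -> : \sum_i c i * cis (t * L i) = v' * (X1 * X2).
    rewrite /X1 /X2 big_distrlr /= mulr_sumr.
    rewrite -(pair_bigA _ (fun n m => c (n, m) * cis (t * L (n, m)))) /=; apply: eq_bigr => n _.
    rewrite mulr_sumr; apply: eq_bigr => m _; rewrite /c /L /w1 /w2 /v' /=.
    have -> : cis (t * (ln n1%:R - ln n%:R + (ln n2%:R - ln m%:R))) =
        cis (t * (ln n1%:R + ln n2%:R)) * (cis (- t * ln n%:R) * cis (- t * ln m%:R)).
      by rewrite -!cisD; congr cis; ring.
    by ring.
  by apply: le_trans (Re_le_cabs _) _; rewrite cabsM /v' [cabs (v * _)]cabsM v1 cabs_cis mul1r mul1r [cabs (X1 * _)]cabsM.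
rewrite mainE -[complex.Re _]/(cabs c0) in ht.
have epE : ep * (4 * (Bd + 1)) = cabs c0 by rewrite /ep divfK// gt_eqF// mulr_gt0//; lra.
have tail0 X Y : cabs (X - Y) <= ep -> X = 0 -> cabs Y <= ep by move=> + X0; rewrite X0 sub0r cabsN.
split; apply/eqP => X0.
  have := tail0 _ _ t1 X0; rewrite -/X1 => h.
  have : cabs X1 * cabs X2 <= ep * Bd by apply: ler_pM; rewrite ?cabs_ge0.
  by move: prodE ht ep0 epE; nra.
have := tail0 _ _ t2 X0; rewrite -/X2 => h.
have : cabs X1 * cabs X2 <= Bd * ep by apply: ler_pM; rewrite ?cabs_ge0.
by move: prodE ht ep0 epE; nra.
Qed.

End OrdinaryDirichletSeries.

Section EulerProducts.
Variables (R : realType) (k : nat).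
Implicit Types (n p : nat) (Q : seq nat) (z : nat -> R[i]).

Definition outer Q p := [&& prime p, (k < p)%N & p \notin Q].
Definition hout Q n := (\sum_(p < n.+1 | outer Q p) logn p n)%N.
(** The twist by [z p] at the primes of [Q] and by [0] at all other primes beyond [k], the latter
    gathered in the single exponent [hout]. As [0 ^ 0 = 1], numbers without such primes survive. *)
Definition eweight Q z n : R[i] := 0 ^+ hout Q n * \prod_(p <- Q) z p ^+ logn p n.

Lemma hout_widen Q n N : (0 < n)%N -> (n < N)%N ->
  hout Q n = (\sum_(p < N | outer Q p) logn p n)%N.
Proof.
move=> n0 nN; rewrite /hout (big_ord_widen_cond _ (outer Q) (logn^~ n) nN).
rewrite big_mkcondr; apply: eq_bigr => p /andP[pp _]; case: ltnP => // np; apply/esym/eqP.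
rewrite -leqn0 leqNgt logn_gt0 mem_primes pp n0 /=; apply/negP => /(dvdn_leq n0).
by rewrite leqNgt np.
Qed.

Lemma houtM Q m n : (0 < m)%N -> (0 < n)%N -> hout Q (m * n) = (hout Q m + hout Q n)%N.
Proof.
move=> m0 n0; have mn0 : (0 < m * n)%N by rewrite muln_gt0 m0.
rewrite !(@hout_widen _ _ (m * n).+1)//; last first.
- by rewrite ltnS leq_pmulr.
- by rewrite ltnS leq_pmull.
by rewrite -big_split /=; apply: eq_bigr => p _; rewrite lognM.
Qed.

Lemma hout_small Q n : (n <= k)%N -> hout Q n = 0%N.
Proof.
move=> nk; rewrite /hout big_pred0// => p; apply/negbTE; rewrite /outer !negb_and -leqNgt.
by rewrite (leq_trans _ nk) ?orbT// -ltnS.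
Qed.

Lemma hout_cons p Q n : prime p -> (k < p)%N -> p \notin Q -> (0 < n)%N ->
  hout Q n = (hout (p :: Q) n + logn p n)%N.
Proof.
move=> pp kp pQ n0; have nN : (n < n + p.+1)%N by rewrite addnS ltnS leq_addr.
have pN : (p < n + p.+1)%N by rewrite addnS ltnS leq_addl.
rewrite !(hout_widen _ n0 nN) (bigD1 (Ordinal pN)) /=; last by rewrite /outer pp kp.
rewrite addnC; congr (_ + _)%N; apply: eq_bigl => r; rewrite /outer inE negb_or -val_eqE /=.
by rewrite -!andbA; congr (_ && (_ && _)); rewrite andbC.
Qed.

Lemma hout_nil_smooth n : (0 < n)%N -> (hout [::] n == 0%N) = smooth k n.
Proof.
move=> n0; rewrite /smooth n0 /=; apply/eqP/allP => [h p pn|sm].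
  rewrite leqNgt; apply/negP => kp; move: (pn); rewrite mem_primes => /and3P[pp _ pd].
  have pN : (p < n.+1)%N by rewrite ltnS dvdn_leq.
  move: h; rewrite /hout (bigD1 (Ordinal pN)) /=; last by rewrite /outer pp kp.
  by move=> /eqP; rewrite addn_eq0 eqn0Ngt logn_gt0 pn.
rewrite /hout big1// => p /and3P[pp kp _]; apply/eqP; rewrite -leqn0 leqNgt logn_gt0.
by apply/negP => /sm; rewrite leqNgt kp.
Qed.

Lemma eweight_cons p Q z n : prime p -> (k < p)%N -> p \notin Q -> (0 < n)%N ->
  eweight (p :: Q) z n = eweight Q z n +
    (if (p %| n)%N then z p * eweight (p :: Q) z (n %/ p) else 0).
Proof.
move=> pp kp pQ n0; rewrite /eweight big_cons (hout_cons pp kp pQ n0).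
case: ifP => pn; last first.
  have -> : logn p n = 0%N by apply/eqP; rewrite -leqn0 leqNgt logn_gt0 mem_primes pp n0 pn.
  by rewrite expr0 mul1r addn0 addr0.
have l0 : (0 < logn p n)%N by rewrite logn_gt0 mem_primes pp n0.
rewrite [X in _ = X + _](_ : _ = 0); last first.
  by rewrite exprD [0 ^+ logn p n]expr0n gtn_eqF// mulr0 mul0r.
case/dvdnP: (pn) => m nE; have m0 : (0 < m)%N by move: n0; rewrite nE muln_gt0 => /andP[].
have p0 := prime_gt0 pp.
have hp : hout (p :: Q) p = 0%N.
  rewrite /hout big1// => r /and3P[rp _]; rewrite inE negb_or => /andP[rnp _].
  by rewrite (logn_prime _ pp) (negbTE rnp).
rewrite add0r nE mulnK// big_cons houtM// hp addn0 lognM// (logn_prime p pp) eqxx addn1 exprS.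
rewrite -!mulrA mulrCA; congr (_ * _); congr (_ * _); congr (_ * _).
rewrite big_seq [RHS]big_seq; apply: eq_bigr => r rQ; rewrite lognM// (logn_prime r pp).
have -> : (r == p) = false by apply/negbTE; apply: contraNneq pQ => <-.
by rewrite addn0.
Qed.

Lemma cabs_eweight Q z n : (forall p, p \in Q -> cabs (z p) <= 1) -> cabs (eweight Q z n) <= 1.
Proof.
move=> z1; rewrite cabsM cabsX cabs0 cabs_prod; apply: mulr_ile1.
- by rewrite exprn_ge0.
- by rewrite prodr_ge0// => p _; exact: cabs_ge0.
- by rewrite expr0n; case: eqP.
rewrite big_seq; apply: prodr_ile1 => p pQ; rewrite cabs_ge0 cabsX.
by rewrite exprn_ile1 ?cabs_ge0// z1.
Qed.

(* [n = 0] is a junk index, since [cpow 0] is meaningless. *)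
Definition ecoef (g : nat -> R[i]) Q z n := if n == 0%N then 0 else g n * eweight Q z n.

(** Adjoining [p] to [Q] replaces its twist [0] by [z p]. By [eweight_cons] the enlarged series is
    the former one plus [chi * z p * p ^ (- s)] times itself. *)
Lemma euler_product (g : nat -> R[i]) (C : R) (chi : R[i]) Q z s : uniq Q ->
  (forall n, cabs (g n) <= C) ->
  (forall p, p \in Q -> [/\ prime p, (k < p)%N, cabs (z p) <= 1 & forall n, g (p * n)%N = chi * g n]) ->
  1 < complex.Re s ->
  dsr (ecoef g Q z) s * \prod_(p <- Q) (1 - chi * z p * cpow p%:R (- s)) = dsr (ecoef g [::] z) s.
Proof.
move=> + gC + s1; elim: Q => [|p Q IH] /=; first by rewrite big_nil mulr1.
case/andP => pQ uQ hQ; have [pp kp zp gp] := hQ p (mem_head _ _).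
have hQ' r : r \in Q -> [/\ prime r, (k < r)%N, cabs (z r) <= 1 & forall n, g (r * n)%N = chi * g n].
  by move=> rQ; apply: hQ; rewrite inE rQ orbT.
rewrite big_cons mulrA -(IH uQ hQ'); congr (_ * _).
have eC Q' n : (forall r, r \in Q' -> cabs (z r) <= 1) -> cabs (ecoef g Q' z n) <= C.
  move=> z1; rewrite /ecoef; case: eqP => _; first by rewrite cabs0 (le_trans (cabs_ge0 (g 0%N))).
  rewrite cabsM; apply: le_trans (gC n); rewrite ler_piMr ?cabs_ge0// cabs_eweight//.
have s1' : csummable (fun n => ecoef g (p :: Q) z n * cpow n%:R (- s)).
  by apply: (@dsr_summable _ _ C) => // n; apply: eC => r /hQ[].
have s2' : csummable (fun n => ecoef g Q z n * cpow n%:R (- s)).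
  by apply: (@dsr_summable _ _ C) => // n; apply: eC => r /hQ'[].
have p0 := prime_gt0 pp.
have := dsr_mul p0 (erefl : ecoef g (p :: Q) z 0 = 0) s1' => mE.
have E n : ecoef g Q z n * cpow n%:R (- s) = ecoef g (p :: Q) z n * cpow n%:R (- s) -
   chi * z p * ((if (p %| n)%N then ecoef g (p :: Q) z (n %/ p) else 0) * cpow n%:R (- s)).
  rewrite mulrA -mulrBl; congr (_ * _); rewrite /ecoef; case: n => [|n].
    by rewrite /= dvdn0 div0n /= mulr0 subr0.
  rewrite /= (eweight_cons z pp kp pQ (ltn0Sn n)); case: ifP => [/dvdnP[m nE]|_]; last by rewrite mulr0 subr0 addr0.
  have m0 : (0 < m)%N by case: m nE.
  by rewrite nE mulnK// gtn_eqF// mulnC gp; ring.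
rewrite /dsr (eq_csum E).
have s3 : csummable (fun n => (if (p %| n)%N then ecoef g (p :: Q) z (n %/ p) else 0) * cpow n%:R (- s)).
  apply: (@dsr_summable _ _ C) => // [|n]; first by rewrite dvdn0 div0n.
  by case: ifP => _; [apply: eC => r /hQ[]|rewrite cabs0 (le_trans (cabs_ge0 (g 0%N)))].
rewrite csumB//; last exact: csummableZ.
by rewrite csumZ// mE /dsr mulrBr mulr1; ring.
Qed.

(** After clearing denominators, [V b = 0] makes the powers of [b] invisible. *)
Lemma additive_of_multiplicative (a b : nat) (V : nat -> nat) : (0 < a)%N -> (0 < b)%N ->
  (forall m n, (0 < m)%N -> (0 < n)%N -> V (m * n)%N = (V m + V n)%N) -> V b = 0%N ->
  additive_on_relations (a%:R / b%:R : R) (fun m => V (b * m + a)%N).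
Proof.
move=> a0 b0 VM Vb t t'.
have b0' : (0 : R) < b%:R by rewrite ltr0n.
have V1 : V 1%N = 0%N by have := VM 1%N 1%N isT isT; rewrite muln1; lia.
have pos m : (0 < b * m + a)%N by rewrite addn_gt0 a0 orbT.
have prodE (u : seq nat) : \prod_(m <- u) mu (a%:R / b%:R : R) m = (\prod_(m <- u) (b * m + a))%N%:R / b%:R ^+ size u.
  elim: u => [|m u IH]; first by rewrite !big_nil divr1.
  rewrite !big_cons IH natrM /= exprS /mu natrD natrM; field.
  by rewrite expf_neq0 ?gt_eqF.
have prod0 (u : seq nat) : (0 < \prod_(m <- u) (b * m + a))%N by rewrite prodn_gt0.
have VP (u : seq nat) : V (\prod_(m <- u) (b * m + a))%N = (\sum_(m <- u) V (b * m + a))%N.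
  by elim: u => [|m u IH]; rewrite ?big_nil// !big_cons VM// IH.
have VX n : V (b ^ n)%N = 0%N by elim: n => // n IH; rewrite expnS VM ?expn_gt0 ?b0// Vb IH.
rewrite !prodE => /eqP; rewrite eqr_div ?expf_neq0 ?(gt_eqF b0')//.
rewrite -!natrX -!natrM eqr_nat => /eqP E; have := congr1 V E.
by rewrite !VM ?prod0 ?expn_gt0 ?b0// !VX !addn0 !VP.
Qed.

End EulerProducts.

(** * Zeros of exponential sums, and residue classes without an eigenvalue *)

Section ExponentialPolynomials.
Variable R : realType.
Implicit Types (z w x y : R[i]) (t : R).

Lemma cisE t : cis t = cos t +i* sin t.
Proof. by rewrite /cis /cexp /= expR0 mul1r. Qed.

Lemma cis_surj z : cabs z = 1 -> exists t, cis t = z.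
Proof.
case: z => x y h1; have h2 : x ^+ 2 + y ^+ 2 = 1 by rewrite -(sqr_cabs (x +i* y)) h1 expr1n.
have xx : -1 <= x <= 1 by apply/andP; split; nra.
have cx : cos (acos x) = x by apply: acosK; rewrite in_itv.
have sx : sin (acos x) = `|y|.
  by rewrite sin_acos// -sqrtr_sqr; congr Num.sqrt; lra.
have [y0|y0] := leP 0 y.
  by exists (acos x); rewrite cisE cx sx ger0_norm.
by exists (- acos x); rewrite cisE cosN sinN cx sx ltr0_norm// opprK.
Qed.

Lemma cexp_surj z : z != 0 -> exists w, cexp w = z.
Proof.
move=> z0; have c0 : 0 < cabs z by rewrite cabs_gt0.
have [t tE] : exists t, cis t = (cabs z)%:C^-1 * z.
  by apply: cis_surj; rewrite cabsM cabsV cabsR ger0_norm ?cabs_ge0// mulVf// gt_eqF.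
exists ((ln (cabs z))%:C + 0 +i* t); rewrite cexpD -/(cis t) tE.
have -> : cexp (ln (cabs z))%:C = (cabs z)%:C.
  by rewrite /cexp /= cos0 sin0 lnK ?posrE// mulr1.
by rewrite mulrA mulfV ?mul1r// -cabs_gt0 cabsR normr_gt0 gt_eqF.
Qed.

Lemma cis_sub (a b : R) : cis a - cis b = cis ((a + b) / 2) * ('i * (2 * sin ((a - b) / 2))%:C).
Proof.
have -> : cis a = cis ((a + b) / 2) * cis ((a - b) / 2) by rewrite -cisD; congr cis; lra.
have -> : cis b = cis ((a + b) / 2) * cis (- ((a - b) / 2)) by rewrite -cisD; congr cis; lra.
rewrite -mulrBr; congr (_ * _); rewrite !cisE cosN sinN.
by apply/eqP; rewrite eq_complex /=; apply/andP; split; apply/eqP; ring.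
Qed.

(** A point met after [a] and [b] on the circle lies to the left of the chord from [a] to [b]. *)
Lemma chord_ratio (a b c : R) : a < b -> b < c -> c < a + 2 * pi ->
  cis b - cis a != 0 /\ 0 < complex.Im ((cis c - cis a) / (cis b - cis a)).
Proof.
move=> ab bc ca.
have s1 : 0 < sin ((b - a) / 2) by apply: sin_gt0_pi; lra.
have s2 : 0 < sin ((c - a) / 2) by apply: sin_gt0_pi; lra.
have s3 : 0 < sin ((c - b) / 2) by apply: sin_gt0_pi; lra.
have i0 : 'i != 0 :> R[i] by rewrite -cabs_gt0 cabs_gt0 neq0Ci.
have n1 : ((2 * sin ((b - a) / 2))%:C : R[i]) != 0.
  by rewrite -cabs_gt0 cabsR normr_gt0 mulf_neq0 ?gt_eqF.
have d0 : cis b - cis a != 0 by rewrite cis_sub mulf_neq0 ?cis_neq0// mulf_neq0.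
split=> //.
have -> : (cis c - cis a) / (cis b - cis a) = (sin ((c - a) / 2) / sin ((b - a) / 2))%:C * cis ((c - b) / 2).
  apply: (canLR (mulfK d0)); rewrite !cis_sub.
  have -> : cis ((c + a) / 2) = cis ((c - b) / 2) * cis ((b + a) / 2) by rewrite -cisD; congr cis; lra.
  have -> : (2 * sin ((c - a) / 2))%:C = (sin ((c - a) / 2) / sin ((b - a) / 2))%:C * (2 * sin ((b - a) / 2))%:C :> R[i].
    by rewrite -(rmorphM (real_complex R)) /=; congr (_%:C); rewrite mulrCA divfK// gt_eqF.
  by ring.
by rewrite Im_realM cisE /= mulr_gt0// divr_gt0.
Qed.

Lemma expR_half_le2 : expR (2^-1 : R) <= 2.
Proof.
have h : 1 + - 2^-1 <= expR (- 2^-1 : R) by exact: expR_ge1Dx.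
have e0 : 0 < expR (2^-1 : R) by exact: expR_gt0.
have : expR (2^-1 : R) * expR (- 2^-1) = 1 by rewrite -expRD subrr expR0.
nra.
Qed.

Lemma cexp_sub1 y : cabs y <= 2^-1 -> cabs (cexp y - (1 + y)) <= cabs y ^+ 2.
Proof.
move=> y2; have := cexp_taylor 2 y.
rewrite big_ord_recl big_ord1 /= /bump /= fact0 !divr1 expr0 expr1 => h.
apply: le_trans h _; rewrite [leRHS](_ : _ = cabs y ^+ 2 / 2 * 2); last by lra.
have f2 : (2`!)%:R = 2 :> R by [].
rewrite f2; apply: ler_pM; rewrite ?expR_ge0 ?divr_ge0 ?sqr_ge0//.
by apply: le_trans expR_half_le2; rewrite ler_expR.
Qed.

(** Factor by factor, [(1 - x) ^ -1] and [exp x] differ by at most [3 * |x| ^ 2]. *)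
Lemma prod_inv_exp (Q : seq nat) (x : nat -> R[i]) : (forall p, p \in Q -> cabs (x p) <= 2^-1) ->
  cabs (\prod_(p <- Q) (1 - x p)^-1 - cexp (\sum_(p <- Q) x p)) <=
  3 * expR (2 * \sum_(p <- Q) cabs (x p)) * \sum_(p <- Q) cabs (x p) ^+ 2.
Proof.
elim: Q => [|p Q IH] hx; first by rewrite !big_nil cexp0 subrr cabs0 mulr0.
have xp : cabs (x p) <= 2^-1 by apply: hx; rewrite mem_head.
have {}IH := IH (fun r rQ => hx r (mem_behead (s := p :: Q) rQ)).
have S0 : 0 <= \sum_(r <- Q) cabs (x r) by apply: sumr_ge0 => r _; exact: cabs_ge0.
have bB : cabs (cexp (\sum_(r <- Q) x r)) <= expR (2 * \sum_(r <- Q) cabs (x r)).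
  rewrite cabs_cexp ler_expR; apply: le_trans (Re_le_cabs _) _; apply: le_trans (cabs_sum _ _ _) _.
  by lra.
rewrite !big_cons cexpD; move: IH bB S0.
set A := \prod_(r <- Q) _; set B := cexp _; set S := \sum_(r <- Q) cabs (x r); set S2 := \sum_(r <- Q) _.
move=> IH bB S0; have S20 : 0 <= S2 by apply: sumr_ge0 => r _; exact: sqr_ge0.
set y := x p in xp *; set u := cabs y; have u0 : 0 <= u := cabs_ge0 y.
have u1 : u <= 2^-1 := xp.
have dy : 1 - u <= cabs (1 - y) by have := cabs_subl 1 y; rewrite cabs1.
have d0 : 0 < cabs (1 - y) by lra.
have ny : 1 - y != 0 by rewrite -cabs_gt0.
have e2 : 1 + 2 * u <= expR (2 * u) by exact: expR_ge1Dx.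
have bi : cabs (1 - y)^-1 <= expR (2 * u).
  rewrite cabsV; apply: le_trans (_ : (1 - u)^-1 <= _); first by rewrite lef_pV2 ?posrE//; lra.
  rewrite -[leLHS]div1r ler_pdivrMr; last by lra.
  have : (1 + 2 * u) * (1 - u) <= expR (2 * u) * (1 - u) by rewrite ler_wpM2r//; lra.
  nra.
have da : cabs ((1 - y)^-1 - cexp y) <= 3 * u ^+ 2.
  have h1 : cabs ((1 - y)^-1 - (1 + y)) <= 2 * u ^+ 2.
    have -> : (1 - y)^-1 - (1 + y) = y ^+ 2 / (1 - y) by field.
    rewrite cabsM cabsX cabsV -/u mulrC ler_wpM2r ?sqr_ge0//.
    by rewrite -[2]invrK lef_pV2 ?posrE ?invr_gt0//; lra.
  have h2 := cexp_sub1 xp.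
  have -> : (1 - y)^-1 - cexp y = ((1 - y)^-1 - (1 + y)) - (cexp y - (1 + y)) by ring.
  by apply: le_trans (cabsD _ _) _; rewrite cabsN; rewrite -/u in h2; lra.
have -> : (1 - y)^-1 * A - cexp y * B = (1 - y)^-1 * (A - B) + ((1 - y)^-1 - cexp y) * B by ring.
apply: le_trans (cabsD _ _) _; rewrite [cabs (_ * (A - B))]cabsM [cabs (_ * B)]cabsM.
have E2 : expR (2 * (u + S)) = expR (2 * u) * expR (2 * S) by rewrite mulrDr expRD.
have k1 : cabs (1 - y)^-1 * cabs (A - B) <= expR (2 * u) * (3 * expR (2 * S) * S2).
  by apply: ler_pM; rewrite ?cabs_ge0.
have k2 : cabs ((1 - y)^-1 - cexp y) * cabs B <= 3 * u ^+ 2 * (expR (2 * u) * expR (2 * S)).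
  apply: ler_pM; rewrite ?cabs_ge0//; apply: le_trans bB _.
  by rewrite ler_peMl ?expR_ge0//; lra.
rewrite E2; move: k1 k2; move: (expR (2 * u)) (expR (2 * S)) (_ * cabs (A - B)) (_ * cabs B) (u ^+ 2) => a b c d v.
lra.
Qed.

(* [be j1 e^{z1 w} + be j2 e^{z2 w}] has zeros along a line on which the terms with
   [j > j2] are exponentially small compared with these two. *)
Lemma exp_sum_zero (e : nat) (be : nat -> R[i]) (j1 j2 : nat) : (j1 < j2)%N -> (j2 < e)%N ->
  be j1 != 0 -> be j2 != 0 -> (forall j, (j < j2)%N -> j != j1 -> be j = 0) ->
  exists (gg : R[i] -> R[i]) w0 (rho m : R), [/\ 0 < rho, 0 < m, gg w0 = 0,
    forall w, cabs (w - w0) = rho -> 4 * m < cabs (gg w) &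
    forall w, cabs (w - w0) <= rho ->
      cabs (\sum_(j < e) be j * cexp (unity_root R e ^+ j * w) - gg w) <= m / 2].
Proof.
move=> j12 j2e b1 b2 b0; have e0 : (0 < e)%N by apply: leq_trans j2e.
have e0' : (0 : R) < e%:R by rewrite ltr0n.
pose th (j : nat) : R := 2 * pi / e%:R *+ j.
have zE j : unity_root R e ^+ j = cis (th j) by rewrite /unity_root -cisMn.
have pe : 0 < 2 * pi / e%:R :> R by rewrite divr_gt0 ?mulr_gt0 ?pi_gt0.
have thl i j : (i < j)%N -> th i < th j by move=> ij; rewrite /th ltr_pMn2l.
have the j : (j < e)%N -> th j < th 0%N + 2 * pi.
  by move=> je; rewrite /th mulr0n add0r -mulr_natr mulrAC ltr_pdivrMr// ltr_pM2l ?mulr_gt0 ?pi_gt0// ltr_nat.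
have th0 j : th 0%N <= th j by rewrite /th ler_pMn2l.
set z := fun j => cis (th j).
pose de := z j2 - z j1.
have th21 : th j1 < th j2 by exact: thl.
have dne : de != 0.
  have c2 : th j2 < th j1 + 2 * pi by have := the _ j2e; have := th0 j1; lra.
  pose cc := (th j2 + (th j1 + 2 * pi)) / 2.
  by have [] := @chord_ratio (th j1) (th j2) cc th21 ltac:(rewrite /cc; lra) ltac:(rewrite /cc; lra).
have dp : 0 < cabs de by rewrite cabs_gt0.
have [w' hw'] : exists w', cexp w' = - be j1 / be j2.
  by apply: cexp_surj; rewrite mulf_neq0 ?invr_eq0 ?oppr_eq0.
(* Then [z j = z j1 + q j * de], and [chord_ratio] gives [Im (q j) > 0] for [j > j2]. *)
pose q j := (z j - z j1) / de.
have qpos (j : nat) : (j2 < j)%N -> (j < e)%N -> 0 < complex.Im (q j).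
  move=> jj je; have [] := @chord_ratio (th j1) (th j2) (th j) th21 (thl _ _ jj) _ => //.
  by have := the _ je; have := th0 j1; lra.
pose rho := (2 * cabs de)^-1.
have rho0 : 0 < rho by rewrite invr_gt0 mulr_gt0.
have drho : cabs de * rho = 2^-1 by rewrite /rho invfM mulrCA divff ?mulr1// gt_eqF.
pose et := expR (- (2 * rho)) * cabs (be j1) / 40.
have et0 : 0 < et by rewrite divr_gt0// mulr_gt0 ?expR_gt0 ?cabs_gt0.
pose D (j : nat) : R := cabs (q j) * (cabs w' + 2^-1).
(* How many periods make the term [j] fall below [et / e], from [y <= exp y]. *)
pose lj (j : nat) := (Num.truncn (cabs (be j) * expR (D j) * e%:R / (et * complex.Im (q j)))).+1.
pose l := (\sum_(j < e) lj j)%N.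
have lle (j : 'I_e) : (lj j <= l)%N by rewrite /l (bigD1 j) //= leq_addr.
have small (j : 'I_e) : (j2 < j)%N -> cabs (be j) * expR (D j - l%:R * complex.Im (q j) * (2 * pi)) <= et / e%:R.
  move=> jj; have qj := qpos j jj (ltn_ord j).
  have h1 : cabs (be j) * expR (D j) * e%:R / (et * complex.Im (q j)) <= l%:R.
    by apply: le_trans (_ : (lj j)%:R <= _); [apply/ltW/truncnS_gt|rewrite ler_nat].
  rewrite (ler_pdivrMr _ _ (mulr_gt0 et0 qj)) in h1.
  have pi1 : 1 <= 2 * pi :> R by have := pi_ge2 R; lra.
  have lq : 0 <= l%:R * complex.Im (q j) by rewrite mulr_ge0// ltW.
  have h2 : l%:R * complex.Im (q j) <= expR (l%:R * complex.Im (q j) * (2 * pi)).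
    apply: le_trans (_ : l%:R * complex.Im (q j) * (2 * pi) <= _); first by rewrite ler_peMr.
    by apply: le_trans (expR_ge1Dx _); rewrite lerDr.
  rewrite expRD expRN mulrA ler_pdivrMr ?expR_gt0// mulrAC ler_pdivlMr//.
  by apply: le_trans h1 _; rewrite mulrCA (ler_pM2l et0).
(* A zero of the two-term sum, moved by [l] periods of [exp (de * w)]; relative to the first term
   this multiplies the modulus of the term [j] by [exp (- 2 pi l Im (q j))]. *)
pose w0 := (w' + 0 +i* (2 * pi *+ l)) / de.
have dw0 : de * w0 = w' + 0 +i* (2 * pi *+ l) by rewrite /w0 mulrCA divff ?mulr1.
have cis2 : cis (2 * pi *+ l) = 1 :> R[i].
  by rewrite cisMn (_ : cis (2 * pi) = 1) ?expr1n// cisE mulr_natl cos2pi sin2pi.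
have ew0 : cexp (de * w0) = - be j1 / be j2 by rewrite dw0 cexpD hw' -/(cis _) cis2 mulr1.
pose gg w := cexp (z j1 * w) * (be j1 + be j2 * cexp (de * w)).
pose X := complex.Re (z j1 * w0).
(* On the circle [|gg| >= 5 m], and the remaining terms amount to at most
   [expR (X + rho) * et = m / 2]. *)
pose m := expR (X - rho) * cabs (be j1) / 20.
have m0 : 0 < m by rewrite divr_gt0// mulr_gt0 ?expR_gt0 ?cabs_gt0.
have zw w : cabs (w - w0) <= rho -> `|complex.Re (z j1 * w) - X| <= rho.
  move=> h; rewrite /X -ReB -mulrBr; apply: le_trans (absRe_le_cabs _) _.
  by rewrite cabsM cabs_cis mul1r.
have ggE w : gg w = cexp (z j1 * w) * (be j1 * (1 - cexp (de * (w - w0)))).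
  rewrite /gg; congr (_ * _).
  have -> : cexp (de * w) = cexp (de * w0) * cexp (de * (w - w0)) by rewrite -cexpD; congr cexp; ring.
  by rewrite ew0; field.
exists gg, w0, rho, m; split => //.
- by rewrite ggE subrr mulr0 cexp0 subrr !mulr0.
- move=> w wr; rewrite ggE [cabs (_ * _)]cabsM [cabs (be j1 * _)]cabsM cabs_cexp.
  have yE : cabs (de * (w - w0)) = 2^-1 by rewrite cabsM wr.
  have := @cexp_sub1 (de * (w - w0)); rewrite yE lexx => /(_ isT) hy.
  have h4 : 4^-1 <= cabs (1 - cexp (de * (w - w0))).
    have -> : 1 - cexp (de * (w - w0)) = - (de * (w - w0)) - (cexp (de * (w - w0)) - (1 + de * (w - w0))) by ring.
    apply: le_trans (cabs_subl _ _); rewrite cabsN yE.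
    have -> : 2^-1 - cabs (cexp (de * (w - w0)) - (1 + de * (w - w0))) >= 4^-1.
      have -> : 4^-1 = 2^-1 - 2^-1 ^+ 2 :> R by lra.
      by rewrite lerD2l lerN2.
    by [].
  have hx : expR (X - rho) <= expR (complex.Re (z j1 * w)).
    by rewrite ler_expR; have := zw w ltac:(by rewrite wr); rewrite ler_norml => /andP[]; lra.
  have b1p : 0 < cabs (be j1) by rewrite cabs_gt0.
  apply: lt_le_trans (_ : expR (X - rho) * (cabs (be j1) * 4^-1) <= _).
    have : 0 < expR (X - rho) * cabs (be j1) by rewrite mulr_gt0 ?expR_gt0.
    by rewrite mulrA /m; move: (expR (X - rho) * cabs (be j1)) => y0; lra.
  by apply: ler_pM; rewrite ?expR_ge0 ?mulr_ge0 ?cabs_ge0// ler_wpM2l ?cabs_ge0.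
- move=> w wr.
  pose o1 : 'I_e := Ordinal (ltn_trans j12 j2e); pose o2 : 'I_e := Ordinal j2e.
  have pe0 : 0 <= expR (X + rho) * (et / e%:R).
    by apply: mulr_ge0; [exact: expR_ge0|apply: divr_ge0; [exact: ltW|exact: ler0n]].
  have o21 : o2 != o1 by rewrite -val_eqE /= gtn_eqF.
  have -> : \sum_(j < e) be j * cexp (unity_root R e ^+ j * w) - gg w =
      \sum_(j < e | (j != o1) && (j != o2)) be j * cexp (z j * w).
    under eq_bigr do rewrite zE -/(z _).
    rewrite (bigD1 o1) //= (bigD1 o2) //= /gg.
    have -> : cexp (z j2 * w) = cexp (z j1 * w) * cexp (de * w) by rewrite -cexpD; congr cexp; rewrite /de; ring.
    by set S := \sum_(_ < _ | _) _; ring.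
  apply: le_trans (cabs_sum _ _ _) _.
  apply: le_trans (_ : \sum_(j < e | (j != o1) && (j != o2)) expR (X + rho) * (et / e%:R) <= _).
    apply: ler_sum => j /andP[jo1 jo2]; rewrite cabsM cabs_cexp.
    case: (ltngtP j j2) => jj; [|have qj := small j jj|by case/eqP: jo2; apply: val_inj].
      by rewrite b0// cabs0 mul0r.
    have -> : z j * w = z j1 * w + q j * (de * w0) + q j * (de * (w - w0)).
      have -> : z j = z j1 + q j * de by rewrite /q divfK//; ring.
      by ring.
    have h1 := zw w wr; rewrite ler_norml in h1; case/andP: h1 => h1a h1b.
    have h2 : complex.Re (q j * (de * (w - w0))) <= cabs (q j) * 2^-1.
      apply: le_trans (Re_le_cabs _) _; rewrite [cabs (q j * _)]cabsM [cabs (de * _)]cabsM ler_wpM2l ?cabs_ge0//.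
      by rewrite -drho ler_wpM2l ?cabs_ge0.
    have h3 : complex.Re (q j * (de * w0)) <= cabs (q j) * cabs w' - l%:R * complex.Im (q j) * (2 * pi).
      rewrite dw0 mulrDr ReD; have -> : complex.Re (q j * (0 +i* (2 * pi *+ l))) = - (l%:R * complex.Im (q j) * (2 * pi)).
        by case: (q j) => qr qi /=; rewrite -[_ *+ l]mulr_natr; ring.
      rewrite lerD2r; apply: le_trans (Re_le_cabs _) _; by rewrite cabsM.
    apply: le_trans (_ : expR (X + rho) * (cabs (be j) * expR (D j - l%:R * complex.Im (q j) * (2 * pi))) <= _); last first.
      by rewrite ler_pM2l ?expR_gt0.
    rewrite [leRHS]mulrCA ler_wpM2l ?cabs_ge0// -expRD ler_expR !ReD /D.
    lra.
  rewrite sumr_const -[_ *+ _]mulr_natr.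
  apply: le_trans (_ : expR (X + rho) * (et / e%:R) * e%:R <= _).
    apply: ler_wpM2l => //; rewrite ler_nat.
    by rewrite -[leqRHS]card_ord max_card.
  rewrite mulrA divfK ?gt_eqF// /et /m.
  have -> : X + rho = (X - rho) + 2 * rho by lra.
  rewrite expRD expRN; have := expR_gt0 (2 * rho); move: (expR (2 * rho)) => y0 yp.
  rewrite le_eqVlt; apply/orP; left; apply/eqP; field.
  by rewrite gt_eqF.
Qed.

End ExponentialPolynomials.

Section Eigencomponents.
Variables (R : realType) (k c : nat) (g : nat -> R[i]).
Hypotheses (k_gt0 : (0 < k)%N) (ck : coprime c k).
Hypothesis g_per : forall n, g (n + k)%N = g n.

Lemma periodic_mod m n : m = n %[mod k] -> g m = g n.
Proof.
have gX i x : g (x + i * k)%N = g x.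
  by elim: i => [|i IH]; rewrite ?mul0n ?addn0// mulSn addnCA addnC g_per.
by move=> mn; rewrite (divn_eq m k) (divn_eq n k) addnC gX mn addnC gX.
Qed.

Let e := totient k.
Let z := unity_root R e.
Let e_gt0 : (0 < e)%N. Proof. by rewrite totient_gt0. Qed.

(** The projection of [g] onto the eigenspace of the dilation [n |-> c n] for the eigenvalue
    [z ^ j]; by Euler's theorem the [e]-th iterate of the dilation is trivial on periodic
    functions. *)
Definition eigencomp (j n : nat) : R[i] := e%:R^-1 * \sum_(l < e) (z ^+ j) ^- l * g (c ^ l * n)%N.

Lemma eigencomp_mod j m n : m = n %[mod k] -> eigencomp j m = eigencomp j n.
Proof.
move=> mn; congr (_ * _); apply: eq_bigr => l _; congr (_ * _); apply: periodic_mod.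
by rewrite -modnMmr mn modnMmr.
Qed.

Lemma eigencomp_eigen j n : eigencomp j (c * n) = z ^+ j * eigencomp j n.
Proof.
pose u l := (z ^+ j) ^- l * g (c ^ l * n)%N.
have zj : z ^+ j != 0 by rewrite expf_neq0// unity_root_neq0.
rewrite /eigencomp mulrCA; congr (_ * _); rewrite mulr_sumr.
transitivity (\sum_(l < e) z ^+ j * u l.+1).
  apply: eq_bigr => l _; rewrite /u exprS invfM !mulrA divff// mul1r; congr (_ * g _).
  by rewrite expnS; lia.
rewrite -!mulr_sumr; congr (_ * _).
have ue : u e = u 0%N.
  rewrite /u -exprM mulnC exprM unity_root_exp// expr1n expr0; congr (_ * _); apply: periodic_mod.
  by rewrite expn0 -modnMml cyclic.Euler_exp_totient// modnMml.
apply: (addrI (u 0%N)); rewrite -(big_ord_recl e (fun l => u l)).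
rewrite -[in RHS]ue addrC -(big_ord_recr e (fun l => u l)).
by [].
Qed.

Lemma eigencomp_sum n : \sum_(j < e) eigencomp j n = g n.
Proof.
rewrite -mulr_sumr exchange_big /=.
have key (l : 'I_e) : \sum_(j < e) (z ^+ j) ^- l * g (c ^ l * n)%N = if val l == 0%N then e%:R * g n else 0.
  rewrite -mulr_suml.
  have -> : \sum_(j < e) (z ^+ j) ^- l = \sum_(j < e) (z ^+ (e - l)) ^+ j.
    apply: eq_bigr => j _; rewrite -(unity_root_inv R (ltnW (ltn_ord l)) e_gt0) exprVn.
    by rewrite -!exprM mulnC.
  rewrite (sum_unity_root e_gt0 (erefl _)).
  rewrite -(unity_root_inv R (ltnW (ltn_ord l)) e_gt0) invr_eq1.
  case: (eqVneq (val l) 0%N) => [->|l0]; first by rewrite expr0 eqxx expn0 mul1n.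
  case: eqP => [zl|_]; last by rewrite mul0r.
  by case/eqP: l0; exact: (unity_root_prim (ltn_ord l) zl).
rewrite (eq_bigr _ (fun l _ => key l)) -big_mkcond (big_pred1 (Ordinal e_gt0)) //.
  by rewrite mulrA mulVf ?mul1r// pnatr_eq0 -lt0n.
Qed.

Lemma cabs_eigencomp (C : R) j n : (forall m, cabs (g m) <= C) -> cabs (eigencomp j n) <= C.
Proof.
move=> gC; rewrite cabsM cabsV cabs_nat mulrC ler_pdivrMr ?ltr0n//.
apply: le_trans (cabs_sum _ _ _) _; apply: le_trans (_ : \sum_(l < e) C <= _); last first.
  by rewrite sumr_const card_ord mulr_natr.
apply: ler_sum => l _; rewrite cabsM cabsV !cabsX cabs_unity_root !expr1n invr1 mul1r.
exact: gC.
Qed.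

End Eigencomponents.

Section SmoothSums.
Variables (R : realType) (k : nat).
Implicit Types (g : nat -> R[i]) (z : nat -> R[i]).

Lemma cabs_ecoef_nil g z (C : R) n : (forall n, cabs (g n) <= C) ->
  cabs (ecoef k g [::] z n) <= C * (smooth k n)%:R.
Proof.
move=> gC; rewrite /ecoef /eweight; case: n => [|n]; first by rewrite cabs0 mulr0.
rewrite /= big_nil mulr1 expr0n hout_nil_smooth//; case: smooth; last by rewrite mulr0 cabs0 mulr0.
by rewrite !mulr1.
Qed.

Lemma smooth_term_le g z (C : R) n (s : R[i]) : (forall n, cabs (g n) <= C) -> 1 <= complex.Re s ->
  cabs (ecoef k g [::] z n * cpow n%:R (- s)) <= C * ((smooth k n)%:R * n%:R `^ (- 2^-1)).
Proof.
move=> gC s1; case: n => [|n]; first by rewrite mul0r cabs0 mul0r mulr0.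
rewrite cabsM cabs_cpow_nat// mulrA; apply: ler_pM; rewrite ?cabs_ge0 ?powR_ge0//.
  exact: cabs_ecoef_nil.
by apply: ler_powR; [rewrite ler1n|lra].
Qed.

Lemma smooth_dsr_bound (C : R) : 0 <= C -> exists2 B : R, 0 <= B &
  forall g z s, (forall n, cabs (g n) <= C) -> 1 <= complex.Re s ->
    csummable (fun n => ecoef k g [::] z n * cpow n%:R (- s)) /\ cabs (dsr (ecoef k g [::] z) s) <= B.
Proof.
move=> C0; have [B hB] := smooth_sum R k.
have B0 : 0 <= B by have := hB 0%N; rewrite big_ord0.
exists (C * B); first exact: mulr_ge0.
move=> g z s gC s1.
have h n : \sum_(i < n) cabs (ecoef k g [::] z i * cpow i%:R (- s)) <= C * B.
  apply: le_trans (_ : \sum_(i < n) C * ((smooth k i)%:R * i%:R `^ (- 2^-1)) <= _).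
    by apply: ler_sum => i _; exact: smooth_term_le.
  by rewrite -mulr_sumr ler_wpM2l.
by split; [exists (C * B)|exact: cabs_csum].
Qed.

(** Series over smooth numbers converge on the line [Re s = 1] itself, and [d] is uniform in [g] and
    [tau]. *)
Lemma smooth_dsr_cont (C ep : R) : 0 <= C -> 0 < ep -> exists2 d : R, 0 < d &
  forall g z (tau x : R), (forall n, cabs (g n) <= C) -> 0 <= x -> x <= d ->
    cabs (dsr (ecoef k g [::] z) ((1 + x) +i* tau) - dsr (ecoef k g [::] z) (1 +i* tau)) <= ep.
Proof.
move=> C0 ep0; have [B hB] := smooth_sum R k.
have hB' n : \sum_(i < n) C * ((smooth k i)%:R * i%:R `^ (- 2^-1)) <= C * B.
  by rewrite -mulr_sumr ler_wpM2l.
have ep3 : 0 < ep / 3 by lra.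
have b0 i : 0 <= C * ((smooth k i)%:R * i%:R `^ (- 2^-1)) by rewrite !mulr_ge0 ?powR_ge0.
have [N hN] := cabs_csum_tail b0 hB' ep3.
pose S : R := \sum_(n < N) C * ln n%:R.
have S0 : 0 <= S by apply: sumr_ge0 => n _; rewrite mulr_ge0 ?ln_nat_ge0.
exists (ep / 3 / (S + 1)); first by rewrite divr_gt0//; lra.
move=> g z tau x gC x0 xd; set u := ecoef k g [::] z.
have t1 := hN _ (fun i => @smooth_term_le g z C i ((1 + x) +i* tau) gC ltac:(by rewrite /= lerDl)) N (leqnn N).
have t2 := hN _ (fun i => @smooth_term_le g z C i (1 +i* tau) gC (lexx _)) N (leqnn N).
have fin : cabs (\sum_(n < N) u n * cpow n%:R (- ((1 + x) +i* tau)) - \sum_(n < N) u n * cpow n%:R (- (1 +i* tau))) <= ep / 3.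
  apply: le_trans (_ : x * S <= _); last first.
    have : x * (S + 1) <= ep / 3 by rewrite -ler_pdivlMr//; lra.
    by nra.
  rewrite -sumrB; apply: le_trans (cabs_sum _ _ _) _; rewrite /S mulr_sumr; apply: ler_sum => -[[|n] nN] _ /=.
    by rewrite /u /ecoef /= !mul0r subr0 cabs0 !mulr_ge0 ?ln_nat_ge0.
  have -> : cpow n.+1%:R (- ((1 + x) +i* tau)) = cpow n.+1%:R (- (1 +i* tau)) * (expR (- (x * ln n.+1%:R)))%:C.
    have -> : - ((1 + x) +i* tau) = - (1 +i* tau) + (- x)%:C.
      by apply/eqP; rewrite eq_complex /= opprD addr0 !eqxx.
    by rewrite cpowD; congr (_ * _); rewrite /cpow -rmorphM /= /cexp /= cos0 sin0 mulr1 mulNr.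
  have y0 : 0 <= x * ln (n.+1%:R : R) by rewrite mulr_ge0 ?ln_nat_ge0.
  have -> : u n.+1 * (cpow n.+1%:R (- (1 +i* tau)) * (expR (- (x * ln n.+1%:R)))%:C) - u n.+1 * cpow n.+1%:R (- (1 +i* tau)) =
     u n.+1 * (cpow n.+1%:R (- (1 +i* tau)) * (expR (- (x * ln n.+1%:R)) - 1)%:C).
    by rewrite (rmorphB (real_complex R)) /=; ring.
  rewrite [cabs (u _ * _)]cabsM [cabs (cpow _ _ * _)]cabsM [leRHS]mulrCA cabsR; apply: ler_pM; rewrite ?cabs_ge0 ?mulr_ge0 ?cabs_ge0//.
    by apply: le_trans (cabs_ecoef_nil z _ gC) _; rewrite ler_piMr//; case: smooth.
  rewrite cabs_cpow_nat// -[leRHS]mul1r; apply: ler_pM; rewrite ?powR_ge0//.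
    by rewrite /= powR_inv1// invf_le1 ?ler1n ?ltr0n.
  have e1 : expR (- (x * ln (n.+1%:R : R))) <= 1 by rewrite -[leRHS]expR0 ler_expR oppr_le0.
  rewrite ler0_norm ?subr_le0//.
  by have := expR_ge1Dx (- (x * ln (n.+1%:R : R))); lra.
rewrite /dsr -/u.
move: t1 t2 fin; rewrite -/u; set X1 := csum _; set X2 := csum _; set Y1 := \sum_(n < N) _; set Y2 := \sum_(n < N) _.
move=> t1 t2 fin; have -> : X1 - X2 = (X1 - Y1) - (X2 - Y2) + (Y1 - Y2) by ring.
apply: le_trans (cabsD _ _) _; have := cabsD (X1 - Y1) (- (X2 - Y2)); rewrite cabsN.
lra.
Qed.

End SmoothSums.

Section RationalParameter.
Variable R : realType.
Variables (a b q n0 : nat) (f : nat -> R[i]) (C : R).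
Hypotheses (a_gt0 : (0 < a)%N) (ab : (a <= b)%N) (q_gt0 : (0 < q)%N).
Hypothesis f_per : forall m, f (m + q)%N = f m.
Hypothesis f_bound : forall m, cabs (f m) <= C.
Hypothesis f_first : forall m, (m < n0)%N -> f m = 0.
Hypothesis f_n0 : f n0 != 0.
Let k := (b * q)%N.
Let alpha : R := a%:R / b%:R.

(* [f] spread on the progression [b m + a]; adding [b q] keeps the subtraction from truncating. *)
Definition gfun (n : nat) : R[i] := if n == a %[mod b] then f ((n + b * q - a) %/ b)%N else 0.

Let b_gt0 : (0 < b)%N. Proof. exact: leq_trans ab. Qed.
Let k_gt0 : (0 < k)%N. Proof. by rewrite muln_gt0 b_gt0. Qed.
Let C_ge0 : 0 <= C. Proof. exact: le_trans (cabs_ge0 _) (f_bound 0%N). Qed.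

Lemma gfun_prog m : gfun (b * m + a) = f m.
Proof.
rewrite /gfun [(b * m)%N]mulnC modnMDl eqxx.
have -> : (m * b + a + b * q - a = (m + q) * b)%N by rewrite addnAC addnK mulnDl [(b * q)%N]mulnC.
by rewrite mulnK// f_per.
Qed.

Lemma gfun_out n : (n %% b != a %% b)%N -> gfun n = 0.
Proof. by rewrite /gfun => /negbTE ->. Qed.

Lemma gfun_per n : gfun (n + k) = gfun n.
Proof.
rewrite /gfun /k -{1}modnDmr modnMr addn0; case: ifP => // _.
have h : (a <= n + b * q)%N by apply: leq_trans ab _; rewrite (leq_trans (leq_pmulr b q_gt0))// leq_addl.
have -> : (n + b * q + b * q - a = q * b + (n + b * q - a))%N by rewrite addnC -addnBA// mulnC.
by rewrite divnMDl// addnC f_per.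
Qed.

Lemma cabs_gfun n : cabs (gfun n) <= C.
Proof. by rewrite /gfun; case: ifP => _; rewrite ?cabs0. Qed.

(** The first index lies within one period. Hence [b * n0 + a] has no prime factor beyond [k], and
    the exponents used in the twist vanish there. *)
Lemma first_small : (b * n0 + a <= k)%N.
Proof.
have n0q : (n0 < q)%N.
  rewrite ltnNge; apply/negP => qn; have : f (n0 - q)%N = 0 by rewrite f_first// ltn_subrL q_gt0 (leq_trans q_gt0 qn).
  by rewrite -f_per subnK// => /eqP; rewrite (negbTE f_n0).
rewrite /k; apply: leq_trans (_ : b * n0.+1 <= _)%N; last by rewrite leq_mul2l n0q orbT.
by rewrite mulnS addnC leq_add2r.
Qed.

Ltac keep_section H := first
  [constr_eq H a_gt0 | constr_eq H ab | constr_eq H q_gt0 | constr_eq H f_per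
  |constr_eq H f_bound | constr_eq H f_first | constr_eq H f_n0 | constr_eq H k
  |constr_eq H alpha | constr_eq H b_gt0 | constr_eq H k_gt0].
Ltac plra := lra_keeping keep_section.
Ltac pnra := nra_keeping keep_section.

(** Twisting primes [p = c] modulo [k] by [xi], the [j]-th eigencomponent contributes a series over
    smooth numbers times the product of the [(1 - ze ^ j * xi * p ^ (- sg)) ^ -1]. This product is
    close to [exp (ze ^ j * w)] with [w = xi * A]. As [A] can be made large, any bounded region of
    [w] is reached with small [xi], and [exp_sum_zero] provides a zero. *)
Lemma zeros_of_noneigen (c : nat) : coprime c k ->
  (forall A : R, exists Q : seq nat, [/\ uniq Q,
     forall p, p \in Q -> [/\ prime p, (k < p)%N & p = c %[mod k]] & A <= \sum_(p <- Q) p%:R^-1]) ->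
  ~ (exists chi, forall n, gfun (c * n) = chi * gfun n) ->
  forall T : R, exists s', [/\ 1 < complex.Re s', T <= complex.Im s' & dsum alpha f s' = 0].
Proof.
move=> ck hdiv noneig.
pose e := totient k; have e0 : (0 < e)%N by rewrite totient_gt0.
have e0' : (0 : R) < e%:R by rewrite ltr0n.
pose ze := unity_root R e.
pose co j := eigencomp k c gfun j.
have coC j n : cabs (co j n) <= C by apply: cabs_eigencomp => //; exact: cabs_gfun.
have coS n : \sum_(j < e) co j n = gfun n by exact: eigencomp_sum.
have coE j n : co j (c * n)%N = ze ^+ j * co j n by apply: eigencomp_eigen => //; exact: gfun_per.
have coM j m n : m = n %[mod k] -> co j m = co j n by move=> mn; apply: eigencomp_mod => //; exact: gfun_per.
(* A single nonzero component would make [gfun] an eigenfunction, so there are at least two; the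
   first two are taken. *)
have [j1 [j2 [j12 j2e nz1 nz2 others]]] : exists j1 j2, [/\ (j1 < j2)%N, (j2 < e)%N, exists n, co j1 n != 0,
     exists n, co j2 n != 0 & forall j, (j < j2)%N -> j != j1 -> forall n, co j n = 0].
  pose pr j := `[< (j < e)%N /\ exists n, co j n != 0 >].
  have npr j n : (j < e)%N -> ~~ pr j -> co j n = 0.
    by move=> je /asboolPn no; apply/eqP; apply: contraT => h; case: no; split => //; exists n.
  have ex1 : exists j, pr j.
    apply: contrapT => no; case/eqP: f_n0; rewrite -gfun_prog -coS big1// => j _.
    by apply: npr => //; apply/negP => h; apply: no; exists (val j).
  case: (ex_minnP ex1) => j1 pr1 min1; have [j1e nz1] := asboolP _ pr1.
  have ex2 : exists j, pr j && (j != j1).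
    apply: contrapT => no; apply: noneig; exists (ze ^+ j1) => n.
    have g1 m : gfun m = co j1 m.
      rewrite -coS (bigD1 (Ordinal j1e)) //= big1 ?addr0// => j jj.
      by apply: npr => //; apply/negP => h; apply: no; exists (val j); rewrite h.
    by rewrite !g1 coE.
  case: (ex_minnP ex2) => j2 /andP[pr2 j21] min2; have [j2e nz2] := asboolP _ pr2.
  exists j1, j2; split => //; first by rewrite ltn_neqAle eq_sym j21 min1.
  move=> j jj2 jj1 n; apply: npr; first exact: ltn_trans j2e.
  by apply/negP => h; have := min2 j; rewrite h jj1 => /(_ isT); rewrite leqNgt jj2.
pose z0 : nat -> R[i] := fun=> 0.
pose B0 j := ecoef k (co j) [::] z0.
have smallrep (j : nat) : (exists n, co j n != 0) -> exists n, B0 j n != 0.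
  move=> [n hn]; pose n' := if (n %% k == 0)%N then k else (n %% k)%N.
  have n'0 : (0 < n')%N by rewrite /n'; case: eqP => // /eqP; rewrite -lt0n.
  have n'k : (n' <= k)%N by rewrite /n'; case: ifP => // _; rewrite ltnW// ltn_mod.
  have n'n : n' = n %[mod k].
    by rewrite /n'; case: eqP => [->|_]; rewrite ?modnn// modn_mod.
  exists n'; rewrite /B0 /ecoef gtn_eqF// /eweight big_nil mulr1 hout_small// expr0 mulr1.
  by rewrite (coM _ _ _ n'n).
have [Bb Bb0 hBb] := smooth_dsr_bound k C_ge0.
have B0nz j : (exists n, co j n != 0) -> exists n1, [/\ forall n, (n < n1)%N -> B0 j n = 0 & B0 j n1 != 0].
  move/smallrep => ex; case: (ex_minnP ex) => n1 h1 min1; exists n1; split => // n nn1.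
  by apply/eqP; apply: contraT => /min1; rewrite leqNgt nn1.
have [n1 [n1a n1b]] := B0nz j1 nz1; have [n2 [n2a n2b]] := B0nz j2 nz2.
pose u j n := B0 j n * cpow n%:R (- (1 : R[i])).
have su j : csummable (u j) by have [] := hBb (co j) z0 1 (coC j) (lexx _).
(* A height on the line [Re s = 1] where the smooth parts of both components are nonzero. *)
have [tau [t1 t2]] : exists t : R, csum (fun n => u j1 n * cis (- t * ln n%:R)) != 0 /\
    csum (fun n => u j2 n * cis (- t * ln n%:R)) != 0.
  apply: (@common_nonzero R (u j1) (u j2) n1 n2) => //; rewrite /u ?mul0r//.
  - by move=> n /n1a ->; rewrite mul0r.
  - by move=> n /n2a ->; rewrite mul0r.
  - by rewrite mulf_neq0// cpow_neq0.
  - by rewrite mulf_neq0// cpow_neq0.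
pose be j := dsr (B0 j) (1 +i* tau).
have beE j : be j = csum (fun n => u j n * cis (- tau * ln n%:R)).
  apply: eq_csum => n; rewrite /u -mulrA; congr (_ * _).
  have -> : - (1 +i* tau) = - (1 : R[i]) + 0 +i* (- tau).
    by apply/eqP; rewrite eq_complex /= oppr0 addr0 add0r !eqxx.
  by rewrite cpowD cpow_cis.
have b1 : be j1 != 0 by rewrite beE.
have b2 : be j2 != 0 by rewrite beE.
have be0 j : (j < j2)%N -> j != j1 -> be j = 0.
  move=> jj jj1; rewrite /be /dsr (eq_csum (v := fun=> 0)) ?csum0// => n.
  by rewrite /B0 /ecoef; case: eqP => _; rewrite ?(others _ jj jj1) !mul0r.
have [gg [w0 [rho [m [rho0 m0 gw0 ggc ggd]]]]] := exp_sum_zero j12 j2e b1 b2 be0.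
pose Rad := cabs w0 + rho.
have Rad0 : 0 < Rad by rewrite ltr_wpDl ?cabs_ge0.
(* Large enough for [|xi| <= 1/2] in the relevant disc, and for the error of [prod_inv_exp], of
   order [Rad ^ 2 / A], to cost at most [m / (4 e)] in each component. *)
pose A0 := 2 * Rad + 2 + 12 * e%:R * Bb * expR (2 * Rad) * Rad ^+ 2 / m.
have A0' : 0 <= 12 * e%:R * Bb * expR (2 * Rad) * Rad ^+ 2 / m.
  by rewrite !mulr_ge0 ?invr_ge0 ?expR_ge0 ?sqr_ge0// ltW.
pose ep := m / (4 * e%:R * expR Rad).
have ep0 : 0 < ep by rewrite divr_gt0// !mulr_gt0 ?expR_gt0.
have [d d0 hd] := smooth_dsr_cont k C_ge0 ep0.
have [Q [uQ hQ sQ]] := hdiv (A0 + 1).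
pose Sl : R := \sum_(p <- Q) ln p%:R / p%:R.
have Sl0 : 0 <= Sl by apply: sumr_ge0 => p _; rewrite divr_ge0 ?ln_nat_ge0.
(* With [Q] fixed, [sg = 1 + x] is brought so close to [1] that the smooth parts hardly change and
   the sum of the [p ^ (- sg)] loses at most [1] against that of the [1 / p]. *)
have [x x0 [xd xS]] : exists2 x : R, 0 < x & x <= d /\ x * Sl <= 1.
  have [y [y0 y1 y2 y3 _]] := @small_factor R d 1 1 1 Sl 0 d0 ltr01 ltr01 ler01 Sl0 (lexx _).
  by exists y => //; split; [move: y2; rewrite mulr1 => /ltW|exact: ltW].
pose sg : R := 1 + x; pose s : R[i] := sg +i* tau.
have sg1 : 1 < sg by rewrite ltrDl.
have pQ p : p \in Q -> (0 : R) < p%:R by move=> /hQ[pp _ _]; rewrite ltr0n prime_gt0.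
pose A : R := \sum_(p <- Q) p%:R `^ (- sg).
have AA0 : A0 <= A.
  apply: le_trans (_ : \sum_(p <- Q) (p%:R^-1 - x * (ln p%:R / p%:R)) <= _).
    by rewrite sumrB -mulr_sumr -/Sl; plra.
  rewrite /A big_seq [leRHS]big_seq; apply: ler_sum => p pq; have p0 := pQ p pq.
  rewrite /sg opprD powRD; last by rewrite (gt_eqF p0) implybT.
  rewrite powR_inv1 ?(ltW p0)//.
  have -> : p%:R^-1 - x * (ln p%:R / p%:R) = p%:R^-1 * (1 + - x * ln p%:R) :> R by ring.
  by rewrite ler_pM2l ?invr_gt0// /powR gt_eqF// expR_ge1Dx.
have A2 : 2 * Rad + 2 <= A by rewrite /A0 in AA0; plra.
have Apos : 0 < A by plra.
have Anz : A%:C != 0 :> R[i] by rewrite -cabs_gt0 cabsR normr_gt0 gt_eqF.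
have cA : cabs A%:C = A by rewrite cabsR gtr0_norm.
(* The phase cancels [p ^ (- i tau)], leaving the positive numbers [p ^ (- sg)] in the Euler
   factors. *)
pose z (xi : R[i]) (p : nat) : R[i] := xi * cis (tau * ln p%:R).
pose Phi xi := dsr (ecoef k gfun Q (z xi)) s.
pose hq n := (\sum_(p <- Q) logn p n)%N.
have anaPhi xi : cabs xi < 1 -> ana Phi xi.
  move=> xi1; have -> : Phi = fun xi => csum (fun n => ecoef k gfun Q (z 1) n * cpow n%:R (- s) * xi ^+ hq n).
    apply/funext => y; apply: eq_csum => n; rewrite /ecoef; case: eqP => _; first by rewrite !mul0r.
    have -> : eweight k Q (z y) n = eweight k Q (z 1) n * y ^+ hq n.
      rewrite /eweight -mulrA; congr (_ * _); rewrite /hq -prodrXr -big_split /=; apply: eq_bigr => p _.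
      by rewrite /z exprMn mul1r mulrC.
    by ring.
  apply: ana_csum_exp => //; apply: (@dsr_summable _ _ C) => // n.
  rewrite /ecoef; case: eqP => _; first by rewrite cabs0.
  rewrite cabsM; apply: le_trans (_ : C * 1 <= _); last by rewrite mulr1.
  apply: ler_pM; rewrite ?cabs_ge0 ?cabs_gfun//; apply: cabs_eweight => p _.
  by rewrite /z mul1r cabs_cis.
pose px p : R := p%:R `^ (- sg).
have cpx (p : nat) : p \in Q -> cpow p%:R (- s) = cis (- (tau * ln p%:R)) * (px p)%:C.
  move=> pq; have -> : - s = 0 +i* (- tau) + (- sg)%:C.
    by apply/eqP; rewrite eq_complex /= add0r addr0 !eqxx.
  rewrite cpowD cpow_cis mulNr; congr (_ * _).
  by rewrite /cpow -rmorphM /= /px /powR gt_eqF ?pQ// /cexp /= cos0 sin0 mulr1.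
have PhiE xi : cabs xi <= 2^-1 -> Phi xi = \sum_(j < e) dsr (B0 j) s * \prod_(p <- Q) (1 - ze ^+ j * xi * (px p)%:C)^-1.
  move=> xi2; have z1 p : cabs (z xi p) <= 1 by rewrite /z cabsM cabs_cis mulr1; plra.
  transitivity (\sum_(j < e) dsr (ecoef k (co j) Q (z xi)) s).
    rewrite /dsr -csum_sum; last first.
      move=> j _; apply: (@dsr_summable _ _ C) => // n; rewrite /ecoef; case: eqP => _; first by rewrite cabs0.
      rewrite cabsM; apply: le_trans (_ : C * 1 <= _); last by rewrite mulr1.
      by apply: ler_pM; rewrite ?cabs_ge0 ?coC//; apply: cabs_eweight.
    apply: eq_csum => n; rewrite -mulr_suml; congr (_ * _); rewrite /ecoef; case: eqP => _; first by rewrite big1.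
    by rewrite -mulr_suml coS.
  apply: eq_bigr => j _.
  have hp p : p \in Q -> [/\ prime p, (k < p)%N, cabs (z xi p) <= 1 & forall n, co j (p * n)%N = ze ^+ j * co j n].
    move=> pq; have [pp kp pc] := hQ p pq; split => // n; rewrite -coE; apply: coM.
    by rewrite -modnMml pc modnMml.
  have := euler_product uQ (coC j) hp (s := s) sg1.
  have -> : dsr (ecoef k (co j) [::] (z xi)) s = dsr (B0 j) s.
    by apply: eq_csum => n; rewrite /B0 /ecoef /eweight !big_nil.
  move=> <-; rewrite -mulrA -[LHS]mulr1; congr (_ * _).
  rewrite -big_split /= big_seq big1// => p pq.
  have -> : ze ^+ j * z xi p * cpow p%:R (- s) = ze ^+ j * xi * (px p)%:C.
    rewrite (cpx p pq) /z cisN; have c0 : cis (tau * ln p%:R) != 0 by exact: cis_neq0.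
    by field.
  rewrite divff// -cabs_gt0.
  have : cabs (ze ^+ j * xi * (px p)%:C) <= 2^-1.
    rewrite 2!cabsM cabsX cabs_unity_root expr1n mul1r cabsR ger0_norm ?powR_ge0//.
    apply: le_trans (_ : 2^-1 * 1 <= _); last by rewrite mulr1.
    apply: ler_pM; rewrite ?cabs_ge0 ?powR_ge0//.
    have p1 : 1 <= p%:R :> R by rewrite ler1n; have [/prime_gt0] := hQ p pq.
    rewrite /px powRN invf_le1 ?powR_gt0 ?pQ//.
    by rewrite -[leLHS](powRr0 (p%:R : R)); apply: ler_powR => //; plra.
  by have := cabs_subl 1 (ze ^+ j * xi * (px p)%:C); rewrite cabs1; plra.
have close xi : cabs (xi * A%:C - w0) <= rho -> cabs (Phi xi - gg (xi * A%:C)) <= m.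
  move=> xw; pose w := xi * A%:C.
  have wR : cabs w <= Rad.
    rewrite /Rad; have := cabsD (w - w0) w0; rewrite subrK; rewrite -/w in xw; plra.
  have xiA : cabs xi * A = cabs w by rewrite /w cabsM cA.
  have xi2 : cabs xi <= 2^-1.
    have : cabs xi * (2 * Rad) <= Rad.
      apply: le_trans wR; rewrite -xiA ler_wpM2l ?cabs_ge0//; plra.
    by have := cabs_ge0 xi; pnra.
  rewrite PhiE//.
  have term (j : 'I_e) : cabs (dsr (B0 j) s * \prod_(p <- Q) (1 - ze ^+ j * xi * (px p)%:C)^-1 -
      be j * cexp (ze ^+ j * w)) <= m / 2 / e%:R.
    pose y p := ze ^+ j * xi * (px p)%:C.
    have ya p : cabs (y p) = cabs xi * px p.
      by rewrite /y 2!cabsM cabsX cabs_unity_root expr1n mul1r cabsR ger0_norm ?powR_ge0.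
    have px1 p : p \in Q -> px p <= 1.
      move=> pq; have p1 : 1 <= p%:R :> R by rewrite ler1n; have [/prime_gt0] := hQ p pq.
      rewrite /px powRN invf_le1 ?powR_gt0 ?pQ//.
      by rewrite -[leLHS](powRr0 (p%:R : R)); apply: ler_powR => //; plra.
    have y2 p : p \in Q -> cabs (y p) <= 2^-1.
      move=> pq; rewrite ya; apply: le_trans (_ : 2^-1 * 1 <= _); last by rewrite mulr1.
      by apply: ler_pM; rewrite ?cabs_ge0 ?powR_ge0// px1.
    have yS : \sum_(p <- Q) y p = ze ^+ j * w.
      rewrite /y -mulr_sumr /w mulrA; congr (_ * _); rewrite /A.
      by rewrite (rmorph_sum (real_complex R)).
    have ySa : \sum_(p <- Q) cabs (y p) = cabs w.
      by rewrite (eq_bigr (fun p => cabs xi * px p)) => [|p _]; rewrite ?ya// -mulr_sumr -/A xiA.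
    have ySq : \sum_(p <- Q) cabs (y p) ^+ 2 <= Rad ^+ 2 / A.
      apply: le_trans (_ : \sum_(p <- Q) cabs xi * cabs (y p) <= _).
        rewrite big_seq [leRHS]big_seq; apply: ler_sum => p pq; rewrite expr2 ler_wpM2r ?cabs_ge0//.
        by rewrite ya ler_piMr ?cabs_ge0// px1.
      rewrite -mulr_sumr ySa ler_pdivlMr// mulrAC xiA -expr2.
      by rewrite ler_sqr ?nnegrE ?cabs_ge0// ltW.
    have pe := prod_inv_exp y2; rewrite yS ySa in pe.
    have Bj : cabs (dsr (B0 j) s) <= Bb by have [] := hBb (co j) z0 s (coC j) (ltW sg1).
    have Bd : cabs (dsr (B0 j) s - be j) <= ep by apply: hd => //; exact: ltW.
    have eR : cabs (cexp (ze ^+ j * w)) <= expR Rad.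
      rewrite cabs_cexp ler_expR; apply: le_trans (Re_le_cabs _) _.
      by rewrite cabsM cabsX cabs_unity_root expr1n mul1r.
    set PQ := \prod_(p <- Q) _ in pe *; set EX := cexp _ in pe eR *.
    have -> : dsr (B0 j) s * PQ - be j * EX = dsr (B0 j) s * (PQ - EX) + (dsr (B0 j) s - be j) * EX by ring.
    apply: le_trans (cabsD _ _) _; rewrite [cabs (_ * (PQ - EX))]cabsM [cabs (_ * EX)]cabsM.
    have k1 : cabs (dsr (B0 j) s) * cabs (PQ - EX) <= Bb * (3 * expR (2 * Rad) * (Rad ^+ 2 / A)).
      apply: ler_pM; rewrite ?cabs_ge0//; apply: le_trans pe _.
      apply: ler_pM; rewrite ?mulr_ge0 ?expR_ge0//; first by apply: sumr_ge0 => p _; exact: sqr_ge0.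
      by rewrite ler_wpM2l// ler_expR ler_wpM2l.
    have k2 : cabs (dsr (B0 j) s - be j) * cabs EX <= ep * expR Rad by apply: ler_pM; rewrite ?cabs_ge0.
    have k3 : ep * expR Rad = m / 4 / e%:R.
      by rewrite /ep; field; rewrite !gt_eqF ?expR_gt0.
    have k4 : Bb * (3 * expR (2 * Rad) * (Rad ^+ 2 / A)) <= m / 4 / e%:R.
      have h : 12 * e%:R * Bb * expR (2 * Rad) * Rad ^+ 2 / m <= A by rewrite /A0 in AA0; plra.
      rewrite ler_pdivrMr// in h.
      have -> : Bb * (3 * expR (2 * Rad) * (Rad ^+ 2 / A)) = (Bb * 3 * expR (2 * Rad) * Rad ^+ 2) / A by ring.
      rewrite ler_pdivrMr// [leRHS]mulrAC ler_pdivlMr//; move: h.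
      by move: (expR (2 * Rad)) (Rad ^+ 2) (e%:R : R) => y1 y3 y4; plra.
    rewrite k3 in k2; apply: le_trans (lerD k1 k2) _; apply: le_trans (lerD k4 (lexx _)) _.
    by rewrite -mulrDl; rewrite ler_pM2r ?invr_gt0//; plra.
  have E1 : cabs (\sum_(j < e) dsr (B0 j) s * \prod_(p <- Q) (1 - ze ^+ j * xi * (px p)%:C)^-1 -
      \sum_(j < e) be j * cexp (ze ^+ j * w)) <= m / 2.
    rewrite -sumrB; apply: le_trans (cabs_sum _ _ _) _.
    apply: le_trans (_ : \sum_(j < e) m / 2 / e%:R <= _); first by apply: ler_sum => j _; exact: term.
    by rewrite sumr_const card_ord -[_ *+ e]mulr_natr divfK// gt_eqF.
  have E2 := ggd w xw.
  by apply: le_trans (cabs_dist _ _ (\sum_(j < e) be j * cexp (ze ^+ j * w))) _; plra.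
have scale xi : xi * A%:C - w0 = (xi - w0 / A%:C) * A%:C by rewrite mulrBl divfK.
have scalec xi : cabs (xi * A%:C - w0) = cabs (xi - w0 / A%:C) * A by rewrite scale cabsM cA.
have rA : 0 < rho / A by rewrite divr_gt0.
have [||||xi xir Pxi] := @zero_perturb R (fun xi => gg (xi * A%:C)) (w0 / A%:C) (rho / A) m Phi rA.
- move=> y yr; apply: anaPhi.
  have h1 : cabs y * A <= Rad.
    have -> : cabs y * A = cabs (y * A%:C) by rewrite cabsM cA.
    have := cabsD (y * A%:C - w0) w0; rewrite subrK scalec /Rad.
    by move: yr; rewrite ler_pdivlMr//; plra.
  have : cabs y * (2 * Rad) <= cabs y * A by rewrite ler_wpM2l ?cabs_ge0//; plra.
  by have := cabs_ge0 y; pnra.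
- by rewrite divfK// gw0 cabs0 ltW.
- move=> y yr; apply: lt_trans (ggc _ _); first by plra.
  by rewrite scalec yr divfK// gt_eqF.
- move=> y yr; apply: close; rewrite scalec; by rewrite -ler_pdivlMr.
have xi1 : cabs xi <= 1.
  have h1 : cabs xi * A <= Rad.
    have -> : cabs xi * A = cabs (xi * A%:C) by rewrite cabsM cA.
    have := cabsD (xi * A%:C - w0) w0; rewrite subrK scalec /Rad.
    by move: (ltW xir); rewrite ler_pdivlMr//; plra.
  have : cabs xi * (2 * Rad) <= cabs xi * A by rewrite ler_wpM2l ?cabs_ge0//; plra.
  by have := cabs_ge0 xi; pnra.
(* One exponent for each prime of [Q], and a last one, whose variable is [0], for all other primes
   beyond [k]. *)
pose vv (i : 'I_(size Q).+1) (m' : nat) := if (i < size Q)%N then logn (nth 0%N Q i) (b * m' + a) else hout k Q (b * m' + a).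
pose zz (i : 'I_(size Q).+1) : R[i] := if (i < size Q)%N then z xi (nth 0%N Q i) else 0.
have nk := first_small.
have pos0 : (0 < b * n0 + a)%N by rewrite addn_gt0 a_gt0 orbT.
have z1 p : cabs (z xi p) <= 1 by rewrite /z cabsM cabs_cis mulr1.
have al0 : 0 < alpha by rewrite divr_gt0 ?ltr0n.
apply: (@zeros_of_polydisc_zero R alpha al0 f C n0 (size Q).+1 vv zz s) => //.
- move=> i; have [iQ|iQ] := boolP (i < size Q)%N.
    have -> : vv i = fun m' => logn (nth 0%N Q i) (b * m' + a) by apply/funext => m'; rewrite /vv iQ.
    apply: (additive_of_multiplicative (V := logn (nth 0%N Q i))) => //; first exact: lognM.
    have [pp kp _] := hQ _ (mem_nth 0%N iQ); apply/eqP; rewrite -leqn0 leqNgt logn_gt0 mem_primes pp b_gt0 /=.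
    apply/negP => /(dvdn_leq b_gt0); rewrite leqNgt => /negP; apply.
    by apply: leq_ltn_trans kp; rewrite /k leq_pmulr.
  have -> : vv i = fun m' => hout k Q (b * m' + a) by apply/funext => m'; rewrite /vv (negbTE iQ).
  apply: (additive_of_multiplicative (V := hout k Q)) => //; first exact: houtM.
  by rewrite hout_small// /k leq_pmulr.
- move=> i; rewrite /vv; case: ifP => iQ; last by rewrite hout_small.
  have [pp kp _] := hQ _ (mem_nth 0%N iQ); apply/eqP; rewrite -leqn0 leqNgt logn_gt0 mem_primes pp pos0 /=.
  by apply/negP => /(dvdn_leq pos0); rewrite leqNgt (leq_ltn_trans nk kp).
- by move=> i; rewrite /zz; case: ifP => _; rewrite ?cabs0.
have E m' : f m' * \prod_i zz i ^+ vv i m' = f m' * eweight k Q (z xi) (b * m' + a)%N.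
  congr (_ * _); rewrite big_ord_recr /= /zz /vv /= ltnn mulrC /eweight; congr (_ * _).
  rewrite (big_nth 0%N) big_mkord; apply: eq_bigr => i _; by rewrite ltn_ord.
transitivity (dsum alpha (fun m' => f m' * eweight k Q (z xi) (b * m' + a)%N) s).
  by apply: eq_csum => m'; rewrite /dterm E.
rewrite /alpha (@dsum_rational R a b f gfun (eweight k Q (z xi)) C) //.
- by rewrite -[X in _ * X]/(Phi xi) Pxi mulr0.
- exact: gfun_prog.
- exact: gfun_out.
- move=> m'; rewrite cabsM; apply: le_trans (_ : C * 1 <= _); last by rewrite mulr1.
  by apply: ler_pM; rewrite ?cabs_ge0//; apply: cabs_eweight.
Qed.

End RationalParameter.

(** * From sparse bad primes to eigenvalues in every reduced class *)

Section ResidueClasses.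

Lemma prime_dvd_prod p (s : seq nat) : prime p -> (p %| \prod_(r <- s) r)%N -> exists2 r, r \in s & (p %| r)%N.
Proof.
move=> pp; elim: s => [|r s IH]; first by rewrite big_nil dvdn1 => /eqP p1; rewrite p1 in pp.
rewrite big_cons Euclid_dvdM// => /orP[pr|/IH[r' rs pr']]; first by exists r; rewrite ?mem_head.
by exists r'; rewrite // inE rs orbT.
Qed.

(** With [t] the product of the primes of [k] not dividing [x], each prime of [k] divides exactly
    one of [x] and [m * t]. *)
Lemma lift_coprime x m k : (0 < k)%N -> coprime x m ->
  exists v, v = x %[mod m] /\ coprime v k.
Proof.
move=> k0 xm; pose l := [seq p <- primes k | ~~ (p %| x)%N]; pose t := (\prod_(p <- l) p)%N.
have lP p : p \in l -> prime p by rewrite mem_filter mem_primes => /andP[_ /and3P[]].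
have t0 : (0 < t)%N by rewrite /t big_seq prodn_cond_gt0// => p /lP /prime_gt0.
exists (x + m * t)%N; split; first by rewrite mulnC addnC modnMDl.
have v0 : (0 < x + m * t)%N.
  rewrite addn_gt0 muln_gt0 t0 andbT; case: x xm {l t lP t0} => //=; case: m => //; by rewrite /coprime gcdn0.
rewrite coprime_has_primes//; apply/hasPn => p pk; apply/negP => /= pv.
move: (pk) (pv); rewrite !mem_primes => /and3P[pp _ pdk] /and3P[_ _ pdv].
have [px|px] := boolP (p %| x)%N.
  have : (p %| m * t)%N by rewrite -(dvdn_addr _ px).
  rewrite Euclid_dvdM// => /orP[pm|].
    have : (p %| gcdn x m)%N by rewrite dvdn_gcd px.
    by rewrite (eqP xm) dvdn1 => /eqP p1; rewrite p1 in pp.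
  move=> /(prime_dvd_prod pp)[r rl pr]; move: (rl); rewrite mem_filter => /andP[rx _].
  by move: pr; rewrite (dvdn_prime2 pp (lP r rl)) => /eqP pr; rewrite -pr px in rx.
have : (p %| m * t)%N.
  rewrite dvdn_mull//; apply: dvdn_trans (_ : p %| t)%N => //.
  rewrite /t (big_rem p) /= ?dvdn_mulr// mem_filter px mem_primes pp k0 pdk.
  by [].
by move=> pmt; move: pdv; rewrite dvdn_addl// (negbTE px).
Qed.

End ResidueClasses.

Section EigenAll.
Variable R : realType.
Variables (k : nat) (g : nat -> R[i]).
Hypothesis k_gt0 : (0 < k)%N.
Hypothesis g_per : forall n, g (n + k)%N = g n.

Definition eigen c := exists chi, forall n, g (c * n)%N = chi * g n.

Lemma eigen_mod c d : c = d %[mod k] -> eigen c -> eigen d.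
Proof.
move=> cd [chi h]; exists chi => n; rewrite -h; apply: (periodic_mod g_per).
by rewrite -modnMml -cd modnMml.
Qed.

Lemma eigenM c d : eigen c -> eigen d -> eigen (c * d)%N.
Proof. by move=> [x hx] [y hy]; exists (x * y) => n; rewrite -mulnA hx hy mulrA. Qed.

Lemma eigen_primes n : (0 < n)%N -> (forall p, prime p -> (p %| n)%N -> eigen p) -> eigen n.
Proof.
elim: n {-2}n (leqnn n) => [|N IH] n nN n0 hp; first by move: n0; rewrite ltnNge nN.
have [n1|n1] := leqP n 1.
  have -> : n = 1%N by apply/eqP; rewrite eqn_leq n1.
  by exists 1 => m; rewrite mul1n mul1r.
have pp := pdiv_prime n1; have p0 := prime_gt0 pp.
rewrite -(divnK (pdiv_dvd n)); apply: eigenM; last exact: hp (pdiv_dvd n).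
apply: IH.
- by rewrite -ltnS (leq_trans (ltn_Pdiv (prime_gt1 pp) n0)).
- by rewrite divn_gt0// dvdn_leq ?pdiv_dvd.
- by move=> p pr pd; apply: hp => //; apply: dvdn_trans pd _; apply/dvdnP; exists (pdiv n); rewrite mulnC divnK ?pdiv_dvd.
Qed.

Hypothesis converge : forall c, coprime c k -> ~ eigen c -> exists B : R, forall N,
  \sum_(p < N | [&& prime p, (k < p)%N & p == c %[mod k]]) p%:R^-1 <= B.

Let bad p := prime p && ~~ `[< eigen p >].

(** A prime beyond [k] is prime to [k] and its being bad depends on its class only, so finitely many
    convergent sums are added. *)
Lemma bad_sum : exists B : R, forall N, \sum_(p < N | bad p && (k < p)%N) p%:R^-1 <= B.
Proof.
have hB c : exists B : R, 0 <= B /\ forall N,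
    \sum_(p < N | [&& bad p, (k < p)%N & p == c %[mod k]]) p%:R^-1 <= B.
  have [[ck nc]|no] := pselect (coprime c k /\ ~ eigen c).
    have [B hB] := converge ck nc; exists B; split; first by have := hB 0%N; rewrite big_ord0.
    move=> N; apply: le_trans (hB N); rewrite big_mkcond [leRHS]big_mkcond; apply: ler_sum => p _.
    by rewrite /bad; case: (prime p) => //=; case: `[< _ >] => //=; case: ifP.
  exists 0; split => // N; rewrite big_pred0// => p; apply/negbTE/negP => /and3P[/andP[pp bp] kp /eqP pc].
  apply: no; split.
    rewrite -coprime_modl -pc coprime_modl prime_coprime//; apply/negP => /(dvdn_leq k_gt0).
    by rewrite leqNgt kp.
  by move=> ec; move/asboolPn: bp; apply; exact: eigen_mod (esym pc) ec.
have [Bf hBf] := choice hB.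
exists (\sum_(c < k) Bf c) => N.
apply: le_trans (_ : \sum_(c < k) \sum_(p < N | [&& bad p, (k < p)%N & p == c %[mod k]]) p%:R^-1 <= _); last first.
  by apply: ler_sum => c _; have [_] := hBf c; apply.
rewrite (exchange_big_dep (fun p : 'I_N => bad p && (k < p)%N)) /=; last first.
  by move=> c p _ /and3P[-> ->].
apply: ler_sum => p bp; have ck : (p %% k < k)%N by rewrite ltn_mod.
rewrite (bigD1 (Ordinal ck)) /=; last by case/andP: bp => -> ->; rewrite modn_mod eqxx.
by rewrite lerDl sumr_ge0.
Qed.

(* If [c] is not an eigenvalue class, every [x = c] modulo [k] has a bad prime factor.
   In a subclass avoiding the small bad primes such [x] are rare, by [bad_sum]. *)
Lemma all_eigen c : coprime c k -> eigen c.
Proof.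
move=> ck; apply: contrapT => nc.
have k1 : (1 < k)%N.
  rewrite ltnNge; apply/negP => k1; apply: nc; exists 1 => n; rewrite mul1r; apply: (periodic_mod g_per).
  have -> : k = 1%N by apply/eqP; rewrite eqn_leq k1.
  by rewrite !modn1.
have [BE hBE] := bad_sum.
pose bb p : R := if bad p && (k < p)%N then p%:R^-1 else 0.
have bb0 p : 0 <= bb p by rewrite /bb; case: ifP.
have hbb N : \sum_(p < N) bb p <= BE by rewrite -big_mkcond; exact: hBE.
have half : 0 < 2^-1 :> R by [].
have [Y0 hY0] := bounded_sum_tail bb0 hbb half.
pose Y := (Y0 + k.+1)%N.
pose l := [seq p <- iota 0 Y | bad p && coprime p k].
pose K := (\prod_(p <- l) p)%N.
have K0 : (0 < K)%N.
  rewrite /K big_seq prodn_cond_gt0// => p; rewrite mem_filter => /andP[/andP[/andP[pp _] _] _].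
  exact: prime_gt0.
pose k' := (k * K)%N; have k'0 : (0 < k')%N by rewrite muln_gt0 k_gt0.
(* A class modulo [k * K] inside the class of [c] and prime to [K]: its members have no bad prime
   factor below [Y]. *)
have [c' [cc' ck']] := lift_coprime k'0 ck.
pose cl (x : nat) := (k'%:Z %| x%:Z - c'%:Z)%Z.
have clE (x : nat) : cl x -> x = c' %[mod k'].
  by rewrite /cl -eqz_mod_dvd !modz_nat eqz_nat => /eqP.
have fact (x : nat) : cl x -> exists p, [/\ bad p, (Y <= p)%N, (k < p)%N, (p %| x)%N & (0 < x)%N].
  move=> /clE xc.
  have xk' : coprime x k' by rewrite -coprime_modl xc coprime_modl.
  have xk : x = c %[mod k].
    by rewrite -cc' -(modn_dvdm x (dvdn_mulr K (dvdnn k))) -/k' xc modn_dvdm// dvdn_mulr.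
  have x0 : (0 < x)%N.
    rewrite lt0n; apply/eqP => x0; move: xk'; rewrite x0 /coprime gcd0n /k' => /eqP E.
    by move: k1; rewrite ltnNge; have := leq_pmulr k K0; rewrite E => ->.
  have : ~ forall p, prime p -> (p %| x)%N -> eigen p.
    by move=> h; apply: nc; apply: eigen_mod xk _; exact: eigen_primes.
  move/existsNP => [p] /not_implyP[pp] /not_implyP[px np].
  have bp : bad p by rewrite /bad pp; apply/asboolPn.
  have pk' : coprime p k' by apply: coprime_dvdl px xk'.
  have Yp : (Y <= p)%N.
    rewrite leqNgt; apply/negP => pY.
    have pl : p \in l.
      rewrite mem_filter bp mem_iota pY /= andbT.
      by move: pk'; rewrite /k' coprimeMr => /andP[].
    have pK : (p %| k')%N by rewrite /k' dvdn_mull// /K (big_rem p) //= dvdn_mulr.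
    by move: pk'; rewrite prime_coprime// pK.
  by exists p; split => //; apply: leq_trans Yp; rewrite /Y leq_addl.
(* Each member of the class has a bad prime factor [p >= Y], and the members divisible by a given
   [p] form at most one class modulo [p * k']. *)
have count N : (N %/ k' <= \sum_(p < N | bad p && (Y <= p)%N && (k < p)%N) (N %/ (p * k')).+1)%N.
  apply: leq_trans (progression_count_ge N (- c'%:Z) k'0) _.
  apply: leq_trans (_ : \sum_(x < N) \sum_(p < N | bad p && (Y <= p)%N && (k < p)%N) (cl x && (p %| x)%N) <= _)%N.
    apply: leq_sum => x _; rewrite -/(cl x); case clx: (cl x) => //.
    have [p [bp Yp kp px x0]] := fact x clx.
    have pN : (p < N)%N by apply: leq_ltn_trans (ltn_ord x); exact: dvdn_leq.
    by rewrite (bigD1 (Ordinal pN)) /= ?bp ?Yp// px leq_addr.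
  rewrite exchange_big /=; apply: leq_sum => p /andP[/andP[/andP[pp _] Yp] kp].
  case: (pickP (fun x : 'I_N => cl x && (p %| x)%N)) => [x0 /andP[cx0 px0]|no]; last first.
    by rewrite big1// => x _; rewrite no.
  have pk' : coprime p k'.
    have x0k : coprime x0 k' by rewrite -coprime_modl (clE _ cx0) coprime_modl.
    exact: coprime_dvdl px0 x0k.
  apply: leq_trans (progression_count_le N (- x0%:Z) _); last by rewrite muln_gt0 prime_gt0.
  apply: leq_sum => x _; case: andP => // -[cx px] /=.
  suff -> : ((p * k')%N%:Z %| x%:Z - x0%:Z)%Z by [].
  have h1 : (p%:Z %| x%:Z - x0%:Z)%Z by rewrite rpredB.
  have h2 : (k'%:Z %| x%:Z - x0%:Z)%Z.
    have -> : x%:Z - x0%:Z = (x%:Z - c'%:Z) - (x0%:Z - c'%:Z) by ring.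
    by rewrite rpredB.
  by move: h1 h2; rewrite !dvdzE /= => h1 h2; rewrite Gauss_dvd// h1.
have k'R : (0 : R) < k'%:R by rewrite ltr0n.
have real N : N%:R / k'%:R - 1 <= N%:R / k'%:R / 2 + \sum_(p < N.+1 | prime p) 1 :> R.
  apply: le_trans (_ : (N %/ k')%:R <= _).
    by rewrite lerBlDr natr1 ler_pdivrMr// -natrM ler_nat ltnW// -ltn_divLR.
  apply: le_trans (_ : (\sum_(p < N | bad p && (Y <= p)%N && (k < p)%N) (N %/ (p * k')).+1)%N%:R <= _); first by rewrite ler_nat.
  rewrite natr_sum.
  apply: le_trans (_ : \sum_(p < N | bad p && (Y <= p)%N && (k < p)%N) (N%:R / k'%:R * p%:R^-1 + 1) <= _).
    apply: ler_sum => p /andP[/andP[/andP[pp _] _] _]; rewrite -natr1 lerD2r.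
    have p0 : (0 : R) < p%:R by rewrite ltr0n prime_gt0.
    rewrite -mulrA -invfM ler_pdivlMr ?mulr_gt0// -natrM -natrM ler_nat mulnC [(k' * p)%N]mulnC.
    by rewrite mulnC leq_divM.
  rewrite big_split /=; apply: lerD.
    rewrite -mulr_sumr ler_wpM2l ?divr_ge0//.
    apply: le_trans (_ : \sum_(i < N) bb (Y0 + i)%N <= _); last exact: hY0.
    apply: le_trans (_ : \sum_(p < Y0 + N) (if (Y0 <= p)%N then bb p else 0) <= _); last first.
      rewrite (sum_nat_shift (fun p => if (Y0 <= p)%N then bb p else 0)) big1 ?add0r => [|i _]; last by rewrite leqNgt ltn_ord.
      by apply: ler_sum => i _; rewrite leq_addr.
    apply: le_trans (_ : \sum_(p < N) (if (Y0 <= p)%N then bb p else 0) <= _).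
      rewrite big_mkcond; apply: ler_sum => p _; case: ifP => [/andP[/andP[bp Yp] kp]|_]; last by case: ifP.
      by rewrite (leq_trans _ Yp) ?leq_addr// /bb bp kp.
    apply: (@sum_ord_le R xpredT (fun p => if (Y0 <= p)%N then bb p else 0)) => [i|]; first by case: ifP.
    exact: leq_addl.
  apply: le_trans (_ : \sum_(p < N | prime p) 1 <= _); last exact: (@sum_ord_le R prime (fun=> 1)).
  rewrite big_mkcond [leRHS]big_mkcond; apply: ler_sum => p _.
  by rewrite /bad; case: (prime p) => /=; [case: ifP|].
(* The large bad primes cover at most half of the class up to the [+ 1] of each progression, so the
   number of primes up to [N] would be at least [N / (2 k') - 1 = 2 Z + 3]. The choice of [Z] bounds
   it by [2 Z + 2]. *)
pose Z := (Num.truncn (expR (16 * k'%:R : R))).+2.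
have lZ : 16 * k'%:R <= ln (Z%:R : R).
  rewrite -[leLHS]expRK ler_ln ?posrE ?expR_gt0// ?ltr0n//; apply: ltW.
  by apply: lt_le_trans (truncnS_gt _) _; rewrite ler_nat.
have lZ0 : 0 < ln (Z%:R : R) by lra.
pose N := (4 * k' * (Z + 2))%N.
have := real N; have := @prime_count_le R N Z isT.
set pi1 := \sum_(_ < _ | _) _ => h1 h2.
have NE : N%:R / k'%:R = 4 * (Z%:R + 2) :> R.
  have -> : N%:R = 4 * k'%:R * (Z%:R + 2) :> R by rewrite /N natrM natrD natrM.
  by rewrite mulrAC mulfK// gt_eqF.
have h3 : pi1 <= Z%:R + (Z%:R + 2).
  rewrite -(ler_pM2r lZ0); apply: le_trans h1 _; rewrite [leRHS]mulrDl lerD2l.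
  apply: le_trans (_ : (Z%:R + 2) * (16 * k'%:R) <= _); last by rewrite ler_pM2l//; rewrite ltr_wpDl.
  by rewrite /N !natrM natrD; lra.
by rewrite NE in h2; lra.
Qed.

End EigenAll.

(** * Simultaneous eigenfunctions as Dirichlet polynomials times L-functions *)

Section FiniteDirichletSums.
Variable R : realType.
Implicit Types P : R[i] -> R[i].

Definition dirichlet_sum (l : seq (nat * R[i])) (s : R[i]) : R[i] := \sum_(x <- l) x.2 * cpow x.1%:R (- s).
(** Repeated indices and zero coefficients are allowed, which makes sums and products immediate;
    [finite_dirichlet_polynomial] normalizes at the end. *)
Definition finite_dirichlet P := exists l : seq (nat * R[i]),
  (forall x, x \in l -> (0 < x.1)%N) /\ forall s, P s = dirichlet_sum l s.

Lemma finite_dirichlet_mono (n : nat) (c : R[i]) : (0 < n)%N ->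
  finite_dirichlet (fun s => c * cpow n%:R (- s)).
Proof.
move=> n0; exists [:: (n, c)]; split => [x|s]; first by rewrite inE => /eqP ->.
by rewrite /dirichlet_sum big_seq1.
Qed.

Lemma finite_dirichletM P1 P2 : finite_dirichlet P1 -> finite_dirichlet P2 ->
  finite_dirichlet (fun s => P1 s * P2 s).
Proof.
move=> [l1 [h1 e1]] [l2 [h2 e2]].
exists [seq ((x.1 * y.1)%N, x.2 * y.2) | x <- l1, y <- l2]; split.
  by move=> z /allpairsP[[x y] /= [/h1 x0 /h2 y0 ->]] /=; rewrite muln_gt0 x0.
move=> s; rewrite e1 e2 /dirichlet_sum big_allpairs_dep big_distrlr /= big_seq [RHS]big_seq.
apply: eq_bigr => x /h1 x0; rewrite big_seq [RHS]big_seq; apply: eq_bigr => y /h2 y0.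
by rewrite natrM cpowM ?ltr0n//; ring.
Qed.

Lemma finite_dirichletD P1 P2 : finite_dirichlet P1 -> finite_dirichlet P2 ->
  finite_dirichlet (fun s => P1 s + P2 s).
Proof.
move=> [l1 [h1 e1]] [l2 [h2 e2]]; exists (l1 ++ l2); split.
  by move=> x; rewrite mem_cat => /orP[/h1|/h2].
by move=> s; rewrite e1 e2 /dirichlet_sum big_cat.
Qed.

Lemma finite_dirichlet_sum (I : eqType) (r : seq I) (F : I -> R[i] -> R[i]) :
  (forall i, i \in r -> finite_dirichlet (F i)) -> finite_dirichlet (fun s => \sum_(i <- r) F i s).
Proof.
elim: r => [|i r IH] h.
  by exists [::]; split => // s; rewrite /dirichlet_sum !big_nil.
have [l [h1 e1]] := finite_dirichletD (h i (mem_head _ _)) (IH (fun j jr => h j (mem_behead (s := i :: r) jr))).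
by exists l; split => // s; rewrite big_cons e1.
Qed.

Lemma finite_dirichlet_prod (r : seq nat) (F : nat -> R[i] -> R[i]) :
  (forall i, i \in r -> finite_dirichlet (F i)) -> finite_dirichlet (fun s => \prod_(i <- r) F i s).
Proof.
elim: r => [|i r IH] h.
  have [l [h1 e1]] := finite_dirichlet_mono 1 (ltn0Sn 0).
  by exists l; split => // s; rewrite big_nil -e1 cpow1 mulr1.
have [l [h1 e1]] := finite_dirichletM (h i (mem_head _ _)) (IH (fun j jr => h j (mem_behead (s := i :: r) jr))).
by exists l; split => // s; rewrite big_cons e1.
Qed.

(** Terms are collected and zero coefficients dropped; a nonzero value ensures that some index
    remains. *)
Lemma finite_dirichlet_polynomial P : finite_dirichlet P -> (exists s, P s != 0) ->
  dirichlet_polynomial P.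
Proof.
move=> [l [l0 lE]] [s0 Ps0]; pose A n := \sum_(x <- l | x.1 == n) x.2.
pose u := undup [seq x.1 | x <- l].
pose v := [seq n <- u | A n != 0].
pose N : {fset nat} := [fset n in v]%fset.
have PE s : P s = \sum_(n <- N) A n * cpow n%:R (- s).
  rewrite (perm_big v) /=; last first.
    apply: uniq_perm; rewrite ?fset_uniq ?filter_uniq ?undup_uniq// => n.
    by rewrite in_fset.
  rewrite /v big_filter lE /dirichlet_sum.
  transitivity (\sum_(n <- u) A n * cpow n%:R (- s)); last first.
    rewrite [LHS](bigID (fun n => A n != 0)) /= [X in _ + X]big1 ?addr0// => n.
    by rewrite negbK => /eqP ->; rewrite mul0r.
  under [RHS]eq_bigr do rewrite mulr_suml.
  rewrite (exchange_big_dep xpredT) //= big_seq [RHS]big_seq; apply: eq_bigr => x xl.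
  have xu : x.1 \in u by rewrite mem_undup map_f.
  rewrite big_mkcond (bigD1_seq x.1) ?undup_uniq//= eqxx big1 ?addr0// => n.
  by rewrite eq_sym => /negbTE ->.
exists N, A; split => //.
- apply/eqP => N0; by case/eqP: Ps0; rewrite PE N0 big_seq_fset0.
- move=> n; rewrite in_fset mem_filter mem_undup => /andP[_ /mapP[x xl ->]]; exact: l0.
- by move=> n; rewrite in_fset mem_filter => /andP[].
Qed.

End FiniteDirichletSums.

Section CharacterForm.
Variable R : realType.
Variables (k : nat) (g : nat -> R[i]) (n1 : nat).
Hypothesis k_gt0 : (0 < k)%N.
Hypothesis g_per : forall n, g (n + k)%N = g n.
Hypothesis g_n1 : g n1 != 0.
Hypothesis g_eigen : forall c, coprime c k -> eigen g c.

Let gmod m n : m = n %[mod k] -> g m = g n := @periodic_mod R k g g_per m n.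

(** The eigenvalue is read off at [n1], where [g] does not vanish, and is therefore multiplicative
    and periodic; Euler's theorem makes it nonzero. *)
Lemma character_of_eigen : exists chi : nat -> R[i],
  [/\ forall c, coprime c k -> forall n, g (c * n)%N = chi c * g n,
      forall c d, coprime c k -> coprime d k -> chi (c * d)%N = chi c * chi d,
      forall c d, coprime c k -> c = d %[mod k] -> chi c = chi d,
      chi 1%N = 1 & forall c, coprime c k -> chi c != 0].
Proof.
have ex c : exists x : R[i], coprime c k -> forall n, g (c * n)%N = x * g n.
  have [ck|nck] := boolP (coprime c k); last by exists 0.
  by have [x hx] := g_eigen ck; exists x.
have [chi hchi] := choice ex; exists chi.
have inj x y : x * g n1 = y * g n1 -> x = y by exact: mulIf.
have cM c d : coprime c k -> coprime d k -> chi (c * d)%N = chi c * chi d.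
  move=> ck dk; apply: inj; rewrite -mulrA -!hchi ?mulnA//.
  by rewrite coprimeMl ck.
have cm c d : coprime c k -> c = d %[mod k] -> chi c = chi d.
  move=> ck cd; have dk : coprime d k by rewrite -coprime_modl -cd coprime_modl.
  by apply: inj; rewrite -!hchi//; apply: gmod; rewrite -modnMml cd modnMml.
have c1 : chi 1%N = 1 by apply: inj; rewrite -hchi ?coprime1n// mul1n mul1r.
split => // c ck; have ek : (0 < totient k)%N by rewrite totient_gt0.
have cX i : coprime (c ^ i) k by rewrite coprimeXl.
have : chi (c ^ totient k)%N = 1.
  by rewrite -c1; apply: cm => //; rewrite cyclic.Euler_exp_totient.
rewrite -(prednK ek) expnS cM// => h; apply/eqP => c0; move: h; rewrite c0 mul0r => /esym/eqP.
by rewrite oner_eq0.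
Qed.

Lemma minus_one_class n : g n != 0 -> g (k.-1 * n)%N != 0.
Proof.
have [chi [hchi _ _ _ nz]] := character_of_eigen.
have kk : coprime k.-1 k by rewrite -{2}(prednK k_gt0) coprimenS.
by move=> gn; rewrite hchi// mulf_neq0// nz.
Qed.

Variable chi : nat -> R[i].
Hypothesis chiE : forall c, coprime c k -> forall n, g (c * n)%N = chi c * g n.
Hypothesis chiM : forall c d, coprime c k -> coprime d k -> chi (c * d)%N = chi c * chi d.
Hypothesis chi_mod : forall c d, coprime c k -> c = d %[mod k] -> chi c = chi d.
Hypothesis chi1 : chi 1%N = 1.
Hypothesis chi_neq0 : forall c, coprime c k -> chi c != 0.

(** [chi] is induced from a character modulo [m]; the least such [m] is its conductor. *)
Definition factors_mod m := (m %| k)%N /\ forall v w, coprime v k -> coprime w k ->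
  v = w %[mod m] -> chi v = chi w.

(** By the Chinese remainder theorem some [x] is [v] modulo [m1] and [w] modulo [m2]. Lifted to [y]
    prime to [k], it gives [chi v = chi y = chi w]. *)
Lemma factors_gcd m1 m2 : factors_mod m1 -> factors_mod m2 -> factors_mod (gcdn m1 m2).
Proof.
move=> [m1k f1] [m2k f2]; split; first by apply: dvdn_trans m1k; exact: dvdn_gcdl.
move=> v w vk wk vw.
have m10 : (0 < m1)%N by exact: dvdn_gt0 m1k.
have m20 : (0 < m2)%N by exact: dvdn_gt0 m2k.
(* The multiple of [k] keeps the subtraction [w' - v] from truncating. *)
pose D := gcdn m1 m2; pose w' := (w + v * k)%N.
have vw' : (v <= w')%N by rewrite /w' (leq_trans (leq_pmulr v k_gt0))// leq_addl.
have Dk : (D %| k)%N by apply: dvdn_trans m1k; exact: dvdn_gcdl.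
have w'w m : (m %| k)%N -> w' = w %[mod m].
  by move=> mk; rewrite /w' -modnDmr -modnMmr (eqP (mk : k %% m == 0)%N) muln0 mod0n addn0.
have /dvdnP[e eE] : (D %| w' - v)%N by rewrite -eqn_mod_dvd// (w'w _ Dk) vw.
case: (Bezoutr m1 m20) => al _ hal; rewrite -/D in hal.
pose t := (m2.-1 * al * e)%N; pose x := (v + m1 * t)%N.
have x1 : x = v %[mod m1] by rewrite /x addnC mulnC modnMDl.
have x2 : x = w %[mod m2].
  rewrite -(w'w _ m2k) -(subnK vw') eE /x addnC; apply/eqP; rewrite eqn_modDr.
  have h : (m1 * t + (D + al * m1) * e)%N = ((m2 * (al * m1 * e)) + D * e + 0)%N.
    rewrite /t addn0 -[in RHS](prednK m20) mulSn mulnDl; ring.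
  have h1 : ((m1 * t + (D + al * m1) * e) %% m2 = (m1 * t) %% m2)%N.
    by rewrite -modnDmr -modnMml (eqP (hal : (D + al * m1) %% m2 == 0)%N) mul0n mod0n addn0.
  by rewrite -h1 h addn0 mulnC modnMDl [(D * e)%N]mulnC.
have xm1 : coprime x m1 by rewrite -coprime_modl x1 coprime_modl (coprime_dvdr m1k).
have xm2 : coprime x m2 by rewrite -coprime_modl x2 coprime_modl (coprime_dvdr m2k).
have xl : coprime x (lcmn m1 m2).
  have ml : (lcmn m1 m2 %| m1 * m2)%N by rewrite dvdn_lcm dvdn_mulr ?dvdn_mull.
  by apply: (coprime_dvdr ml); rewrite coprimeMr xm1.
have [y [yx yk]] := lift_coprime k_gt0 xl.
have yd m : (m %| lcmn m1 m2)%N -> y = x %[mod m] by move=> ml; rewrite -(modn_dvdm y ml) yx modn_dvdm.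
rewrite (f1 v y)//; last by rewrite yd ?dvdn_lcml.
by apply: f2 => //; rewrite yd ?dvdn_lcmr.
Qed.

Lemma minimal_modulus : exists K, [/\ (0 < K)%N, factors_mod K & forall m, factors_mod m -> (K %| m)%N].
Proof.
have fk : factors_mod k by split => // v w vk _; exact: chi_mod.
pose pr m := `[< factors_mod m >].
have ex : exists m, pr m by exists k; apply/asboolP.
case: (ex_minnP ex) => K /asboolP fK min; exists K.
have K0 : (0 < K)%N by have [Kk _] := fK; exact: dvdn_gt0 Kk.
split => // m fm; have := factors_gcd fK fm => /asboolP /min Kg.
have -> : K = gcdn K m by apply/eqP; rewrite eqn_leq Kg dvdn_leq// dvdn_gcdl.
exact: dvdn_gcdr.
Qed.

(** If [g d != 0], then [g (d * v)] depends on [v] modulo [k / d] only, so [chi] factors modulo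
    [k / d] and the conductor divides [k / d]. This is why [psi] gives the right value at every [m]
    prime to [k / d], even one that is not prime to [k]. *)
Lemma induced_character : exists (K : nat) (psi : nat -> R[i]), [/\ dirichlet_character K psi,
  forall d m, (d %| k)%N -> coprime m (k %/ d) -> g (d * m)%N = g d * psi m &
  forall m, cabs (psi m) <= 1].
Proof.
have [K [K0 [Kk fK] Kmin]] := minimal_modulus.
have ex n : exists v, coprime n K -> v = n %[mod K] /\ coprime v k.
  have [nK|nK] := boolP (coprime n K); last by exists 0%N.
  by have [v hv] := lift_coprime k_gt0 nK; exists v.
have [lf hlf] := choice ex.
pose psi n := if coprime n K then chi (lf n) else 0.
have psiE n v : coprime n K -> coprime v k -> v = n %[mod K] -> psi n = chi v.
  by move=> nK vk vn; rewrite /psi nK; have [l1 l2] := hlf n nK; apply: fK => //; rewrite l1 vn.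
exists K, psi; split.
- split => //.
  + by rewrite (psiE 1%N 1%N) ?coprime1n.
  + move=> m n; rewrite {1}/psi coprimeMl; have [mK|mK] /= := boolP (coprime m K); last by rewrite /psi (negbTE mK) mul0r.
    have [nK|nK] /= := boolP (coprime n K); last by rewrite /psi (negbTE nK) mulr0.
    have [lm1 lm2] := hlf m mK; have [ln1 ln2] := hlf n nK.
    have mnK : coprime (m * n) K by rewrite coprimeMl mK.
    have [l1 l2] := hlf _ mnK; rewrite /psi mK nK -chiM//; apply: fK => //; first by rewrite coprimeMl lm2.
    by rewrite l1 -modnMm -lm1 -ln1 modnMm.
  + move=> n; have E : coprime (n + K) K = coprime n K by rewrite -coprime_modl modnDr coprime_modl.
    have [nK|nK] := boolP (coprime n K); last by rewrite /psi E (negbTE nK).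
    have [l1 l2] := hlf n nK; rewrite (psiE (n + K)%N (lf n)) ?E// ?(psiE n (lf n))//.
    by rewrite l1 modnDr.
  + move=> n; rewrite /psi; case: ifP => nK; last by rewrite eqxx.
    by have [_ l2] := hlf n nK; rewrite chi_neq0.
- move=> d m dk mkd; have d0 : (0 < d)%N by exact: dvdn_gt0 dk.
  have [v [vm vk]] := lift_coprime k_gt0 mkd.
  have kE : k = (k %/ d * d)%N by rewrite divnK.
  have -> : g (d * m)%N = chi v * g d.
    rewrite -chiE//; apply: gmod; rewrite kE mulnC [(v * d)%N]mulnC [(d * v)%N]mulnC -!muln_modl ?vm//.
  have [->|gd] := eqVneq (g d) 0; first by rewrite mulr0 mul0r.
  rewrite mulrC; congr (_ * _).
  have Kd : (K %| k %/ d)%N.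
    apply: Kmin; split; first exact: dvdn_div.
    move=> v' w' vk' wk' vw'; apply: (mulIf gd); rewrite -!chiE//; apply: gmod.
    by rewrite kE -!muln_modl vw'.
  apply/esym; apply: psiE => //; first by apply: coprime_dvdr mkd.
  by rewrite -(modn_dvdm v Kd) vm modn_dvdm.
- move=> m; rewrite /psi; case: ifP => mK; last by rewrite cabs0.
  have [_ l2] := hlf m mK; have ek : (0 < totient k)%N by rewrite totient_gt0.
  have cX i : coprime (lf m ^ i) k by rewrite coprimeXl.
  have chX i : chi (lf m ^ i)%N = chi (lf m) ^+ i.
    by elim: i => [|i IH]; rewrite ?expn0// expnS chiM// IH exprS.
  have h : chi (lf m) ^+ totient k = 1.
    by rewrite -chX -chi1; apply: chi_mod => //; rewrite cyclic.Euler_exp_totient.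
  have := congr1 (@cabs R) h; rewrite cabsX cabs1 => /eqP.
  by rewrite pexpr_eq1 ?cabs_ge0// => /eqP ->.
Qed.

End CharacterForm.

Section CharacterSeries.
Variable R : realType.
Variable psi : nat -> R[i].
Hypothesis psiM : forall m n, psi (m * n)%N = psi m * psi n.
Hypothesis psi_le1 : forall m, cabs (psi m) <= 1.

(** The coefficients of the L-function of [psi] with the Euler factors at the primes of [l]
    removed. *)
Definition sifted (l : seq nat) (m : nat) : R[i] :=
  if (m != 0%N) && all (fun p => ~~ (p %| m)%N) l then psi m else 0.

Lemma cabs_sifted l m : cabs (sifted l m) <= 1.
Proof. by rewrite /sifted; case: ifP => _; rewrite ?cabs0. Qed.

Lemma sifted0 l : sifted l 0%N = 0. Proof. by []. Qed.

Lemma sifted_cons p l m : prime p -> p \notin l -> all prime l ->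
  sifted (p :: l) m = sifted l m - (if (p %| m)%N then psi p * sifted l (m %/ p)%N else 0).
Proof.
move=> pp pl lP; case: m => [|m]; first by rewrite dvdn0 div0n sifted0 mulr0 subr0.
case: (boolP (p %| m.+1)%N) => pm; last by rewrite subr0 {1}/sifted /= pm.
rewrite {1}/sifted /= pm /=; case/dvdnP: pm => m' ->; rewrite mulnK ?prime_gt0//.
case: m' => [|m']; first by rewrite mul0n sifted0 mulr0 subr0.
rewrite mulnC /sifted !muln_eq0 /= gtn_eqF ?prime_gt0//= psiM.
have -> : all (fun r => ~~ (r %| p * m'.+1)%N) l = all (fun r => ~~ (r %| m'.+1)%N) l.
  apply: eq_in_all => r rl; have rp := allP lP _ rl.
  rewrite Euclid_dvdM// (dvdn_prime2 rp pp); case: eqP => // rE.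
  by rewrite -rE rl in pl.
by case: ifP => _; rewrite ?mulr0 subrr.
Qed.

Lemma sifted_summable l d s : 1 < complex.Re s ->
  csummable (fun n => (if (d %| n)%N then sifted l (n %/ d) else 0) * cpow n%:R (- s)).
Proof.
move=> s1; apply: (@dsr_summable R (fun n => if (d %| n)%N then sifted l (n %/ d) else 0) 1) => //.
  by rewrite dvdn0 div0n.
by move=> n; case: ifP => _; rewrite ?cabs0 ?cabs_sifted.
Qed.

Lemma dsr_sifted l s : uniq l -> all prime l -> 1 < complex.Re s ->
  dsr (sifted l) s = dirichlet_L psi s * \prod_(p <- l) (1 - psi p * cpow p%:R (- s)).
Proof.
move=> + + s1; have su l' : csummable (fun n => sifted l' n * cpow n%:R (- s)).
  by apply: (@dsr_summable R (sifted l') 1) => // n; exact: cabs_sifted.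
elim: l => [_ _|p l IH /= /andP[pl ul] /andP[pp lP]].
  rewrite big_nil mulr1 /dsr (csum_shift 1 (su [::])) big_ord1 sifted0 mul0r add0r.
  by apply: eq_csum => n; rewrite add1n.
rewrite big_cons mulrCA -IH// mulrBl mul1r.
transitivity (csum (fun n => sifted l n * cpow n%:R (- s) -
    psi p * ((if (p %| n)%N then sifted l (n %/ p) else 0) * cpow n%:R (- s)))).
  apply: eq_csum => n; rewrite sifted_cons// mulrBl; congr (_ - _).
  by case: ifP => _; rewrite ?mul0r ?mulr0// mulrA.
have sp := sifted_summable l p s1.
rewrite csumB ?csumZ//; last exact: csummableZ.
by rewrite dsr_mul ?prime_gt0// mulrA.
Qed.

Variables (k : nat) (g : nat -> R[i]).
Hypothesis k_gt0 : (0 < k)%N.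
Hypothesis g_psi : forall d m, (d %| k)%N -> coprime m (k %/ d) -> g (d * m)%N = g d * psi m.

(** Only the divisor [d = gcd (n, k)] contributes: sieving by the primes of [k / d] tests whether
    [n / d] is prime to [k / d]. *)
Lemma gcd_decomposition n : (0 < n)%N ->
  g n = \sum_(d <- divisors k) g d * (if (d %| n)%N then sifted (primes (k %/ d)) (n %/ d) else 0).
Proof.
move=> n0; pose e := gcdn n k.
have ek : (e %| k)%N by exact: dvdn_gcdr.
have en : (e %| n)%N by exact: dvdn_gcdl.
have e0 : (0 < e)%N by exact: dvdn_gt0 ek.
have siftE d : (d %| k)%N -> (d %| n)%N -> sifted (primes (k %/ d)) (n %/ d) =
    if coprime (n %/ d) (k %/ d) then psi (n %/ d)%N else 0.
  move=> dk dn; have d0 : (0 < d)%N by exact: dvdn_gt0 dk.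
  have nd : (0 < n %/ d)%N by rewrite divn_gt0// dvdn_leq.
  have kd : (0 < k %/ d)%N by rewrite divn_gt0// dvdn_leq.
  rewrite /sifted -lt0n nd /= coprime_has_primes// -all_predC.
  congr (if _ then _ else _); apply: eq_in_all => p; rewrite mem_primes => /and3P[pp _ _] /=.
  by rewrite mem_primes pp nd.
have cd d : (d %| k)%N -> (d %| n)%N -> coprime (n %/ d) (k %/ d) -> d = e.
  move=> dk dn /eqP c; rewrite /e -(divnK dn) -(divnK dk) mulnC [(k %/ d * d)%N]mulnC.
  by rewrite -muln_gcdr c muln1.
have ce : coprime (n %/ e) (k %/ e).
  by rewrite /coprime -(eqn_pmul2r e0) muln_gcdl !divnK// mul1n.
rewrite (bigD1_seq e) ?divisors_uniq -?dvdn_divisors//= en siftE// ce.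
rewrite big_seq_cond big1 ?addr0 => [|d /andP[]].
  by rewrite -g_psi// mulnC divnK.
rewrite -dvdn_divisors// => dk de; case: ifP => dn; last by rewrite mulr0.
rewrite siftE//; case: ifP => c; last by rewrite mulr0.
by rewrite (cd d) ?eqxx in de.
Qed.

Definition euler_corrected s :=
  \sum_(d <- divisors k) g d * cpow d%:R (- s) * \prod_(p <- primes (k %/ d)) (1 - psi p * cpow p%:R (- s)).

Lemma dsr_character s : 1 < complex.Re s ->
  dsr (fun n => if n == 0%N then 0 else g n) s = euler_corrected s * dirichlet_L psi s.
Proof.
move=> s1; transitivity (csum (fun n => \sum_(d <- divisors k)
    g d * ((if (d %| n)%N then sifted (primes (k %/ d)) (n %/ d) else 0) * cpow n%:R (- s)))).
  apply: eq_csum => -[|n] /=.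
    by rewrite mul0r big1// => d _; rewrite dvdn0 div0n sifted0 mul0r mulr0.
  by rewrite {1}gcd_decomposition// mulr_suml; apply: eq_bigr => d _; rewrite mulrA.
rewrite csum_sum => [|d _]; last exact/csummableZ/sifted_summable.
rewrite /euler_corrected mulr_suml big_seq [RHS]big_seq; apply: eq_bigr => d.
rewrite -dvdn_divisors// => dk; have d0 : (0 < d)%N by exact: dvdn_gt0 dk.
rewrite csumZ; last exact: sifted_summable.
rewrite dsr_mul//; last first.
  by apply: (@dsr_summable R _ 1) => // n; exact: cabs_sifted.
rewrite dsr_sifted ?primes_uniq//; last by apply/allP => p; rewrite mem_primes => /and3P[].
by rewrite [dirichlet_L _ _ * _]mulrC !mulrA.
Qed.

Lemma finite_dirichlet_euler_corrected : finite_dirichlet euler_corrected.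
Proof.
apply: (@finite_dirichlet_sum R _ (divisors k) (fun d s => g d * cpow d%:R (- s) *
  \prod_(p <- primes (k %/ d)) (1 - psi p * cpow p%:R (- s)))) => d.
rewrite -dvdn_divisors// => dk; have d0 : (0 < d)%N by exact: dvdn_gt0 dk.
apply: (finite_dirichletM (finite_dirichlet_mono (g d) d0)).
apply: (@finite_dirichlet_prod R _ (fun p s => 1 - psi p * cpow p%:R (- s))) => p.
rewrite mem_primes => /and3P[/prime_gt0 p0 _ _].
have [l [h1 h2]] := finite_dirichletD (finite_dirichlet_mono (1 : R[i]) (ltn0Sn 0)) (finite_dirichlet_mono (- psi p) p0).
by exists l; split => // s; rewrite -h2 cpow1 mulr1 mulNr.
Qed.

End CharacterSeries.

(** * Rational parameter: conclusion *)

Section RationalCase.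
Variable R : realType.
Variables (a b q n0 : nat) (f : nat -> R[i]) (C : R).
Hypotheses (a_gt0 : (0 < a)%N) (ab : (a <= b)%N) (q_gt0 : (0 < q)%N).
Hypothesis f_per : forall m, f (m + q)%N = f m.
Hypothesis f_bound : forall m, cabs (f m) <= C.
Hypothesis f_first : forall m, (m < n0)%N -> f m = 0.
Hypothesis f_n0 : f n0 != 0.
Let k := (b * q)%N.
Let g := gfun a b q f.
Let alpha : R := a%:R / b%:R.

Let b_gt0 : (0 < b)%N. Proof. exact: leq_trans ab. Qed.
Let k_gt0 : (0 < k)%N. Proof. by rewrite muln_gt0 b_gt0. Qed.
Let alpha_gt0 : 0 < alpha. Proof. by rewrite divr_gt0 ?ltr0n. Qed.
Let g_per n : g (n + k)%N = g n. Proof. exact: gfun_per. Qed.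
Let g_n0 : g (b * n0 + a)%N != 0. Proof. by rewrite /g gfun_prog. Qed.

(** If zeros of large height are missing, [zeros_of_noneigen] bounds the sum of the [1 / p] over
    every class without an eigenvalue, and that is the hypothesis of [all_eigen]. *)
Lemma zeros_or_eigen :
  (forall T : R, exists s, [/\ 1 < complex.Re s, T <= complex.Im s & dsum alpha f s = 0]) \/
  (forall c, coprime c k -> eigen g c).
Proof.
have [Z|nZ] := pselect (forall T : R, exists s, [/\ 1 < complex.Re s, T <= complex.Im s & dsum alpha f s = 0]).
  by left.
right; apply: all_eigen => // c ck nc; apply: contrapT => nB; apply: nZ.
apply: (zeros_of_noneigen a_gt0 ab q_gt0 f_per f_bound f_first f_n0 ck) => // A.
have [N hN] : exists N, A <= \sum_(p < N | [&& prime p, (k < p)%N & p == c %[mod k]]) p%:R^-1.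
  apply: contrapT => nN; apply: nB; exists A => N; rewrite leNgt; apply/negP => /ltW h.
  by apply: nN; exists N.
exists [seq p <- index_iota 0 N | [&& prime p, (k < p)%N & p == c %[mod k]]]; split.
- by rewrite filter_uniq ?iota_uniq.
- by move=> p; rewrite mem_filter => /andP[/and3P[-> -> /eqP]].
- by rewrite big_filter big_mkord.
Qed.

(** Multiplication by [k - 1] preserves the support of [g], which is contained in the class of [a]
    modulo [b]; hence [- a = a] modulo [b], and [a <= b] leaves two quotients. *)
Lemma eigen_half : (forall c, coprime c k -> eigen g c) -> a = b \/ (2 * a)%N = b.
Proof.
move=> eg; have := minus_one_class k_gt0 g_per g_n0 eg g_n0.
have [h|h] := eqVneq ((k.-1 * (b * n0 + a)) %% b)%N (a %% b)%N; last by rewrite /g gfun_out ?eqxx.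
move=> _; have : (k.-1 * (b * n0 + a) + (b * n0 + a) = a + a %[mod b])%N.
  by rewrite -modnDm h [(b * n0)%N]mulnC modnMDl modnDm.
rewrite -[X in (_ + X)%N]mul1n -mulnDl addn1 prednK// /k -mulnA modnMr addnn => /esym/eqP bd.
have /dvdnP[x xE] : (b %| a.*2)%N by rewrite /dvdn bd.
have : (x <= 2)%N by rewrite -(leq_pmul2r b_gt0) -xE -mul2n leq_mul2l ab.
case: x xE => [|[|[|x]]] xE //= _.
- by move: xE a_gt0; rewrite mul0n; case: (a).
- by right; rewrite mul2n xE mul1n.
- by left; apply/eqP; rewrite -(eqn_pmul2l (isT : (0 < 2)%N)) mul2n xE.
Qed.

(** With [a = 1] the factor [b ^ s] of [dsum_rational] is [alpha ^ (- s)]. The polynomial has a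
    nonzero value because the series does not vanish far to the right. *)
Lemma eigen_PL : a = 1%N -> (forall c, coprime c k -> eigen g c) -> of_PL_form f alpha.
Proof.
move=> a1 eg; have [chi [c1 c2 c3 c4 c5]] := character_of_eigen k_gt0 g_per g_n0 eg.
have [K [psi [psiK gpsi psi1]]] := induced_character k_gt0 g_per c1 c2 c3 c4 c5.
have [_ _ psiM _ _] := psiK.
have HE s : periodic_hurwitz f alpha s = dsum alpha f s.
  by apply: eq_csum => n; rewrite /dterm cpowN.
have E s : 1 < complex.Re s -> periodic_hurwitz f alpha s =
    cpow alpha (- s) * euler_corrected psi k g s * dirichlet_L psi s.
  move=> s1; rewrite HE -mulrA -dsr_character//.
  have -> : cpow alpha (- s) = cpow b%:R s.
    by rewrite /alpha a1 mul1r /cpow lnV ?posrE ?ltr0n// rmorphN /= mulrN mulNr opprK.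
  have := @dsum_rational R a b f g (fun=> 1) C s a_gt0 b_gt0.
  rewrite /dsum /dterm /dsr => h.
  transitivity (csum (fun m => f m * 1 * cpow (mu alpha m) (- s))).
    by apply: eq_csum => n; rewrite mulr1.
  rewrite h//.
  - by congr (_ * _); apply: eq_csum => n; rewrite mulr1.
  - by move=> m; rewrite /g gfun_prog.
  - by move=> n; exact: gfun_out.
  - by move=> m; rewrite mulr1.
exists (euler_corrected psi k g), K, psi; split => //.
apply: finite_dirichlet_polynomial; first exact: finite_dirichlet_euler_corrected.
have C0 : 0 <= C by exact: le_trans (cabs_ge0 _) (f_bound 0%N).
have fp : 0 < cabs (f n0) by rewrite cabs_gt0.
have [sg hsg] := dsum_neq0 alpha_gt0 n0 C0 fp.
pose s : R[i] := (Num.max sg 2)%:C; exists s.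
have s1 : 1 < complex.Re s by rewrite /= lt_max ltr1n orbT.
have := hsg f f_bound f_first (lexx _) s; rewrite /= le_max lexx => /(_ isT).
rewrite -HE E// => nz; apply: contraNneq nz => ->; by rewrite mulr0 mul0r.
Qed.

End RationalCase.

Lemma infinite_of_unbounded_Im (R : realType) (S : set R[i]) :
  (forall T : R, exists s, S s /\ T <= complex.Im s) -> infinite_set S.
Proof.
move=> h /finite_seqP[l lE].
have [s [Ss sT]] := h (\sum_(x <- l) `|complex.Im x| + 1).
move: Ss; rewrite lE /= => sl; move: sT; rewrite leNgt => /negP; apply.
rewrite (big_rem s)//= ltr_pwDr// (le_trans (ler_norm _))// lerDl.
by apply: sumr_ge0 => x _.
Qed.

Lemma rational_parameter (R : realType) (alpha : R) (x y : int) : 0 < alpha -> alpha <= 1 ->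
  y != 0 -> y%:~R * alpha = x%:~R ->
  exists a b : nat, [/\ (0 < a)%N, (a <= b)%N & alpha = a%:R / b%:R].
Proof.
move=> al0 al1 y0 h; exists `|x|%N, `|y|%N.
have y1 : (0 : R) < `|y|%N%:R by rewrite ltr0n absz_gt0.
have E : `|y|%N%:R * alpha = `|x|%N%:R.
  by rewrite !natr_absz !intr_norm -h normrM (gtr0_norm al0).
split.
- by rewrite -(ltr0n R) -E mulr_gt0.
- by rewrite -(ler_nat R) -E ler_piMr// ltW.
- by rewrite -E mulrAC divff ?mul1r// gt_eqF.
Qed.

Local Open Scope classical_set_scope.

Theorem theorem1 (R : realType) (q : nat) (f : nat -> R[i]) (alpha : R)
  (q_ge1 : (1 <= q)%N)
  (f_periodic : forall n : nat, f (n + q)%N = f n)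
  (f_neq0 : exists n : nat, f n <> 0)
  (alpha_gt0 : 0 < alpha) (alpha_le1 : alpha <= 1)
  (hyp : ~ (alpha = 1 \/ alpha = 1 / 2) \/
         (alpha = 1 \/ alpha = 1 / 2) /\ ~ of_PL_form f alpha) :
  infinite_set
    [set s : R[i] | 1 < complex.Re s /\ periodic_hurwitz f alpha s = 0].
Proof.
pose C : R := \sum_(i < q) cabs (f i).
have f_bound m : cabs (f m) <= C.
  have -> : f m = f (m %% q)%N by apply: (periodic_mod f_periodic); rewrite modn_mod.
  have mq : (m %% q < q)%N by rewrite ltn_mod.
  rewrite /C (bigD1 (Ordinal mq)) //= lerDl; apply: sumr_ge0 => i _; exact: cabs_ge0.
have [n0 f_n0 f_first] : exists2 n0, f n0 != 0 & forall m, (m < n0)%N -> f m = 0.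
  have ex : exists n, f n != 0 by have [n /eqP fn] := f_neq0; exists n.
  case: (ex_minnP ex) => n0 fn0 min; exists n0 => // m mn0; apply/eqP/negPn/negP => /min.
  by rewrite leqNgt mn0.
have HE s : periodic_hurwitz f alpha s = dsum alpha f s.
  by apply: eq_csum => n; rewrite /dterm cpowN.
have fin : (forall T : R, exists s, [/\ 1 < complex.Re s, T <= complex.Im s & dsum alpha f s = 0]) ->
    infinite_set [set s : R[i] | 1 < complex.Re s /\ periodic_hurwitz f alpha s = 0].
  move=> Z; apply: infinite_of_unbounded_Im => T; have [s [s1 sT sz]] := Z T.
  by exists s; split => //; split => //; rewrite HE.
have [tr|ntr] := pselect (transcendental alpha).
  apply: fin; exact: (zeros_transcendental alpha_gt0 alpha_le1 tr f_bound f_first f_n0 q_ge1 f_periodic).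
have [irr|rat] := pselect (forall x y : int, y != 0 -> y%:~R * alpha <> x%:~R).
  apply: fin; exact: (zeros_algebraic alpha_gt0 alpha_le1 ntr irr f_bound f_first f_n0 q_ge1 f_periodic).
have [a [b [a0 ab aE]]] : exists a b : nat, [/\ (0 < a)%N, (a <= b)%N & alpha = a%:R / b%:R].
  apply: contrapT => no; apply: rat => x y y0 h; apply: no.
  exact: rational_parameter y0 h.
case: hyp => [nhalf|[half noPL]].
  apply: fin; rewrite aE; have [//|eg] := zeros_or_eigen a0 ab q_ge1 f_periodic f_bound f_first f_n0.
  have b0 : (0 : R) < b%:R by rewrite ltr0n (leq_trans a0).
  exfalso; apply: nhalf; have [E|E] := eigen_half a0 ab q_ge1 f_periodic f_n0 eg.
    by left; rewrite aE E divff// gt_eqF.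
  right; rewrite aE -E natrM; field.
  by rewrite pnatr_eq0 -lt0n.
(* Both exceptional values have numerator [1], as [eigen_PL] requires. *)
have [b' [b'0 b'E]] : exists b' : nat, (0 < b')%N /\ alpha = 1%:R / b'%:R.
  by case: half => ->; [exists 1%N; rewrite divr1|exists 2].
apply: fin; rewrite b'E; have [//|eg] := zeros_or_eigen (ltn0Sn 0) b'0 q_ge1 f_periodic f_bound f_first f_n0.
exfalso; apply: noPL; rewrite b'E.
exact: (eigen_PL (ltn0Sn 0) b'0 q_ge1 f_periodic f_bound f_first f_n0 erefl eg).
Qed.
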